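(* Let $K\subset \mathbb{H}^2$ be a compact set with smooth convex boundary $M=\partial K$ and let $p\geq 3$. Then $$\mathrm{Cap}_p(K)\leq \left(\int_0^\infty e^{\frac{p-2}{p-1}t}|M|^{\frac{p-2}{p-1}} \left(e^{2t}|M|^2+ \left(|M|^{p-2}T_p(0)\right)^{\frac{2}{p-1}}-|M|^2\right)^{-\frac{1}{2}}dt\right)^{1-p},$$ where $T_p(0)=\int_M \sigma_1^{p-1}\,d\mu$. Moreover, equality holds if and only if $K$ is a geodesic ball.
   Context: $\mathbb{H}^2$ is the hyperbolic plane of constant curvature $-1$, with area element $dv$. For a compact set $K\subset\mathbb{H}^2$ and $p\geq 1$, the $p$-capacity is $\mathrm{Cap}_p(K)=\inf\int_{\mathbb{H}^2}|\nabla f|^p\,dv$, the infimum being over all smooth functions $f$ on $\mathbb{H}^2$ with compact support satisfying $f=1$ on $K$. $K$ is understood to be a convex set with non-empty interior bounded by the smooth closed curve $M$; $|M|$ is the length of $M$, $d\mu$ its length element, and $\sigma_1$ is the (geodesic) curvature of $M$ with respect to the outward unit normal, with the sign making that of geodesic circles positive. *)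

(* Defs.v *)
(* The hyperbolic plane is the upper half-plane model
   {(x, y) : y > 0} with metric tensor (dx^2 + dy^2) / y^2 (constant
   curvature -1), over an arbitrary R : realType. *)
From HB Require Import structures.
From mathcomp Require Import all_boot all_order all_algebra.
From mathcomp Require Import all_classical all_reals all_analysis.
Set Implicit Arguments.
Unset Strict Implicit.
Unset Printing Implicit Defensive.
Import Order.TTheory GRing.Theory Num.Theory.
Import numFieldNormedType.Exports.
Local Open Scope classical_set_scope.
Local Open Scope ring_scope.

Definition hplane (R : realType) : set (R * R) := [set z | 0 < z.2].
Arguments hplane {R}.

(* Vectors at z are written in the coordinate frame (d/dx, d/dy). *)
Definition hmetric (R : realType) (z u v : R * R) : R :=
  (u.1 * v.1 + u.2 * v.2) / z.2 ^+ 2.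

Definition hnorm (R : realType) (z u : R * R) : R := Num.sqrt (hmetric z u u).

(* Christoffel symbols of the Levi-Civita connection: in coordinates (x, y),
   Gamma^x_xy = Gamma^x_yx = Gamma^y_yy = - 1 / y and Gamma^y_xx = 1 / y,
   the others being zero; [christoffel z u v] is Gamma_z(u, v). *)
Definition christoffel (R : realType) (z u v : R * R) : R * R :=
  (- (u.1 * v.2 + u.2 * v.1) / z.2, (u.1 * v.1 - u.2 * v.2) / z.2).

(* The density of dv is sqrt (det g) = y^-2. The values of F outside the
   half-plane are irrelevant. *)
Definition harea_integral (R : realType) (F : R * R -> R) : \bar R :=
  (\int[(@lebesgue_measure R \x @lebesgue_measure R)%E]_(z in hplane)
     (F z / z.2 ^+ 2)%:E)%E.

Definition d_dx (R : realType) (f : R * R -> R) (z : R * R) : R :=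
  'D_((1, 0) : R * R) f z.

Definition d_dy (R : realType) (f : R * R -> R) (z : R * R) : R :=
  'D_((0, 1) : R * R) f z.

(* f is of class C^n on the (open) half-plane. *)
Fixpoint hclass (R : realType) (n : nat) (f : R * R -> R) : Prop :=
  match n with
  | 0%N => forall z, hplane z -> {for z, continuous f}
  | m.+1 =>
      [/\ forall z, hplane z -> {for z, continuous f},
          forall z, hplane z -> derivable f z ((1, 0) : R * R)
            /\ derivable f z ((0, 1) : R * R),
          hclass m (d_dx f)
        & hclass m (d_dy f)]
  end.

Definition hsmooth (R : realType) (f : R * R -> R) : Prop :=
  forall n, hclass n f.

Definition hcompact_support (R : realType) (f : R * R -> R) : Prop :=
  exists C : set (R * R),
    [/\ compact C, C `<=` hplane & forall z, hplane z -> ~ C z -> f z = 0].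

(* The Riemannian gradient: hmetric z (hgrad f z) v = df_z(v). *)
Definition hgrad (R : realType) (f : R * R -> R) (z : R * R) : R * R :=
  (z.2 ^+ 2 * d_dx f z, z.2 ^+ 2 * d_dy f z).

Definition hcap (R : realType) (p : R) (K : set (R * R)) : \bar R :=
  ereal_inf [set harea_integral (fun z => hnorm z (hgrad f z) `^ p) |
    f in [set f : R * R -> R |
      [/\ hsmooth f, hcompact_support f & forall z, K z -> f z = 1]]].

Definition velocity (R : realType) (c : R -> R * R) (t : R) : R * R :=
  (derive1 (fst \o c) t, derive1 (snd \o c) t).

Definition hsmooth_curve (R : realType) (c : R -> R * R) : Prop :=
  (forall t, hplane (c t)) /\
  forall n t, derivable (derive1n n (fst \o c)) t 1
    /\ derivable (derive1n n (snd \o c)) t 1.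

(* The covariant derivative of the velocity of c along c. *)
Definition hacceleration (R : realType) (c : R -> R * R) (t : R) : R * R :=
  (derive1n 2 (fst \o c) t, derive1n 2 (snd \o c) t)
  + christoffel (c t) (velocity c t) (velocity c t).

(* The plane is complete: every geodesic segment extends to a geodesic
   parametrized by the whole line. *)
Definition hgeodesic (R : realType) (c : R -> R * R) : Prop :=
  hsmooth_curve c /\ forall t, hacceleration c t = 0.

Definition hconvex (R : realType) (K : set (R * R)) : Prop :=
  forall c, hgeodesic c -> K (c 0) -> K (c 1) ->
    forall t, 0 <= t <= 1 -> K (c t).

(* Integral over [0, 1] against the length element of c. *)
Definition length_integral (R : realType) (c : R -> R * R) (g : R -> R) : R :=
  \int[@lebesgue_measure R]_(t in `[0, 1]) (g t * hnorm (c t) (velocity c t)).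

Definition hlength (R : realType) (c : R -> R * R) : R :=
  length_integral c (fun=> 1).

Definition hdist (R : realType) (a b : R * R) : R :=
  inf [set hlength c | c in [set c : R -> R * R |
    [/\ hsmooth_curve c, c 0 = a & c 1 = b]]].

Definition hball (R : realType) (a : R * R) (r : R) : set (R * R) :=
  [set z | hplane z /\ hdist a z <= r].

Definition geodesic_ball (R : realType) (K : set (R * R)) : Prop :=
  exists a r, [/\ hplane a, 0 < r & K = hball a r].

(* [gamma] is a smooth regular parametrization, of period 1, of a simple
   closed curve equal to the boundary of K. *)
Definition boundary_param (R : realType) (K : set (R * R))
    (gamma : R -> R * R) : Prop :=
  [/\ hsmooth_curve gamma,
      forall t, gamma (t + 1) = gamma t,
      forall t, velocity gamma t != 0,
      {in `[0, 1[ &, injective gamma}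
    & [set gamma t | t in `[0, 1]] = closure K `\` K°].

(* No orientation of [gamma] is assumed; [nu t] is the unit normal at
   [gamma t] whose direction leaves K. *)
Definition outward_unit_normal (R : realType) (K : set (R * R))
    (gamma nu : R -> R * R) : Prop :=
  forall t,
    [/\ hmetric (gamma t) (nu t) (nu t) = 1,
        hmetric (gamma t) (nu t) (velocity gamma t) = 0
      & exists2 e : R, 0 < e &
          forall s, 0 < s < e -> ~ K (gamma t + s *: nu t)].

(* With this sign the curvature of a geodesic circle, with respect to its
   outward normal, is positive. *)
Definition hcurvature (R : realType) (gamma nu : R -> R * R) (t : R) : R :=
  - hmetric (gamma t) (hacceleration gamma t) (nu t)
  / hmetric (gamma t) (velocity gamma t) (velocity gamma t).

Definition curvature_energy (R : realType) (p : R) (gamma nu : R -> R * R) : R :=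
  length_integral gamma (fun t => hcurvature gamma nu t `^ (p - 1)).

(* Main.v *)
Require Import Defs.
From HB Require Import structures.
From mathcomp Require Import all_boot all_order all_algebra.
From mathcomp Require Import all_classical all_reals all_analysis.
From mathcomp Require Import measurable_realfun.
From mathcomp Require Import ring lra.
Import Order.TTheory GRing.Theory Num.Theory.
Import numFieldNormedType.Exports.
Local Open Scope classical_set_scope.
Local Open Scope ring_scope.
Set Implicit Arguments.
Unset Strict Implicit.
Unset Printing Implicit Defensive.

(** Write L for the length of M, Th for its total curvature, the integral of
    sigma_1, and ell s = L cosh s + Th sinh s for the length of the outer
    parallel curve of M at distance s.

    Upper bound. A function phi (d) of the distance d to K has energy
    int |phi' s|^p ell s ds. The best phi, with phi' proportional to
    ell^(-1/(p-1)), gives Cap_p (K) <= (int_0^oo ell^(-1/(p-1)))^(1-p). Since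
    ell'^2 = ell^2 + Th^2 - L^2, the substitution e^t = ell s / L turns this
    integral into the one of the theorem with Th^2 in the place of
    (L^(p-2) T)^(2/(p-1)) ([wcap_par], [upper_limit]). By Hoelder's inequality
    Th^(p-1) <= L^(p-2) T, with equality only if sigma_1 is constant
    ([Y_compare]), and the integral decreases in that term ([Icap_lt]). Hence
    the bound of the theorem holds and is strict unless sigma_1 is constant
    ([upper_bound]).

    The distance to K and the coarea formula are replaced as follows. At
    gamma t let q t z be sinh of the signed distance from z to the tangent
    geodesic and r t z the corresponding coordinate along the tangent. Convexity
    gives q t <= 0 on K ([support_line]) and q t z > 0 for some t when z is
    outside ([outside_pos]). A soft maximum u of finitely many functions
    arsinh (q t), which has |grad u| <= 1, stands for d. The energy of phi (u)
    is computed by integral geometry: seen from a point z outside K, r t z runs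
    through a neighbourhood of 0 while q t z > 0, with derivative
    - v (cosh d(gamma t, z) + sigma_1 q t z) by the Frenet equations
    ([frame_der], [crofton_point]). Averaging over r and exchanging the
    integrals over z and t leaves
    int H(q) (L + Th q / sqrt (1 + q^2)) dq = int H(sinh s) ell s ds
    ([crofton_total], [weight_total], [energy_upper]).

    Equality. If sigma_1 is constant then M has constant Euclidean curvature, so
    K is a disc in the half-plane, which is a geodesic ball ([const_curv_ball]).
    Conversely let K be a geodesic ball of radius s. Then sigma_1 = coth s, so
    the bound of the theorem is that with Th^2. Young's inequality along the
    rays from the centre bounds the energy of every admissible function from
    below ([ball_lower]); as L <= 2 pi sinh s ([ball_length_le]) this lower
    bound is at least the upper one ([ball_hcap_ge]). *)

(** * Derivatives and integrals over segments *)

Section Wrap.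
Variables (R : realType) (V : normedModType R).
Implicit Types (f g u : V -> R) (z v : V).

(** Reduces the rules for directional derivatives to those of one variable. *)
Lemma is_derive_lineP f z v d :
  is_derive z v f d <-> is_derive (0 : R) (1 : R) (fun h : R => f (h *: v + z)) d.
Proof.
have e : (fun h : R => h^-1 *: ((f \o shift z) (h *: v) - f z)) =
   (fun h : R => h^-1 *: (((fun h : R => f (h *: v + z)) \o shift 0) (h *: (1:R)) -
       f ((0:R) *: v + z))).
  by apply/funext => h /=; rewrite addr0 scale0r add0r [_ *: 1]mulr1.
have e1 : derivable f z v = derivable (fun h : R => f (h *: v + z)) 0 1.
  by rewrite /derivable e.
have e2 : 'D_v f z = 'D_1 (fun h : R => f (h *: v + z)) 0.
  by rewrite /derive e.
split => -[h1 h2]; apply: DeriveDef.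
- by rewrite -e1.
- by rewrite -e2.
- by rewrite e1.
- by rewrite e2.
Qed.

(** Lets the tactics below produce a derivative in whatever form the rules give,
    to be compared with the expected one afterwards. *)
Lemma deq f z v a b : is_derive z v f a -> a = b -> is_derive z v f b.
Proof. by move=> h <-. Qed.
Lemma dcst (c : R) z v : is_derive z v (fun=> c) 0.
Proof. exact: is_derive_cst. Qed.
Lemma dadd f g z v a b : is_derive z v f a -> is_derive z v g b ->
  is_derive z v (fun t => f t + g t) (a + b).
Proof. exact: is_deriveD. Qed.
Lemma dsub f g z v a b : is_derive z v f a -> is_derive z v g b ->
  is_derive z v (fun t => f t - g t) (a - b).
Proof. exact: is_deriveB. Qed.
Lemma dopp f z v a : is_derive z v f a -> is_derive z v (fun t => - f t) (- a).
Proof. exact: is_deriveN. Qed.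
Lemma dmul f g z v a b : is_derive z v f a -> is_derive z v g b ->
  is_derive z v (fun t => f t * g t) (f z * b + g z * a).
Proof. exact: is_deriveM. Qed.
Lemma dexp f n z v a : is_derive z v f a ->
  is_derive z v (fun t => f t ^+ n) (n%:R * f z ^+ n.-1 * a).
Proof.
move=> h; have := is_deriveX n h.
by congr (is_derive _ _ _ _); apply/funext => t; rewrite fctE.
Qed.
Lemma dinv f z v a : is_derive z v f a -> f z != 0 ->
  is_derive z v (fun t => (f t)^-1) (- (f z) ^- 2 * a).
Proof.
move=> [h <-] fz; apply: DeriveDef; first exact: derivableV.
by rewrite deriveV.
Qed.
Lemma dcomp (phi : R -> R) u z v dphi du :
  is_derive (u z) (1 : R) phi dphi -> is_derive z v u du ->
  is_derive z v (fun y => phi (u y)) (dphi * du).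
Proof.
move=> h1 /is_derive_lineP h2; apply/is_derive_lineP.
pose w := fun h : R => u (h *: v + z).
have h1' : is_derive (w 0) (1:R) phi dphi by rewrite /w scale0r add0r.
exact: (@is_derive1_comp _ phi w 0 _ _ h1' h2).
Qed.
Lemma dsum (I : finType) (h : I -> V -> R) (dh : I -> R) z v :
  (forall i, is_derive z v (h i) (dh i)) ->
  is_derive z v (fun t => \sum_i h i t) (\sum_i dh i).
Proof.
move=> H.
suff : forall s : seq I, is_derive z v (fun t => \sum_(i <- s) h i t) (\sum_(i <- s) dh i).
  exact.
elim => [|i s ih].
  rewrite big_nil (_ : (fun t => _) = fun=> 0); first exact: dcst.
  by apply/funext => t; rewrite big_nil.
rewrite big_cons (_ : (fun t => _) = fun t => h i t + \sum_(j <- s) h j t).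
  exact: dadd.
by apply/funext => t; rewrite big_cons.
Qed.

Lemma is_derive_continuous1 (f : R -> R) (x d : R) :
  is_derive x (1:R) f d -> {for x, continuous f}.
Proof.
by move=> [h _]; apply: differentiable_continuous; apply/derivable1_diffP.
Qed.

End Wrap.

Lemma did (R : realType) (x : R) : is_derive x (1:R) (fun t : R => t) 1.
Proof. exact: is_derive_id. Qed.
Lemma dexpR (R : realType) (x : R) : is_derive x (1:R) expR (expR x).
Proof. exact: is_derive_expR. Qed.
Lemma dln (R : realType) (x : R) : 0 < x -> is_derive x (1:R) (@ln R) x^-1.
Proof. exact: is_derive1_ln. Qed.

Lemma dsqrt (R : realType) (x : R) : 0 < x -> is_derive x (1:R) Num.sqrt (2 * Num.sqrt x)^-1.
Proof. exact: is_derive1_sqrt. Qed.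

(** Syntax-directed differentiation. Derivatives of subterms are looked up among
    the hypotheses; non-vanishing and positivity conditions are left as goals. *)
Ltac der1 := match goal with
  | |- is_derive _ _ (fun t => ?c) _ => exact (dcst _ _ _)
  | |- is_derive _ _ (fun t => @?f t + @?g t) _ => notypeclasses refine (dadd _ _)
  | |- is_derive _ _ (fun t => - @?f t) _ => notypeclasses refine (dopp _)
  | |- is_derive _ _ (fun t => @?f t * @?g t) _ => notypeclasses refine (dmul _ _)
  | |- is_derive _ _ (fun t => @?f t ^+ _) _ => notypeclasses refine (dexp _ _)
  | |- is_derive _ _ (fun t => (@?f t)^-1) _ => notypeclasses refine (dinv _ _)
  | |- is_derive _ _ (fun t => expR (@?f t)) _ => notypeclasses refine (dcomp (dexpR _) _)
  | |- is_derive _ _ (fun t => Num.sqrt (@?f t)) _ => notypeclasses refine (dcomp (dsqrt _) _)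
  | |- is_derive _ _ (fun t => ln (@?f t)) _ => notypeclasses refine (dcomp (dln _) _)
  | |- is_derive _ _ (fun t => t) _ => exact (did _)
  | |- is_derive _ _ ( *%R ?c) _ => exact (dmul (dcst c _ _) (did _))
  | |- is_derive _ _ ( +%R ?c) _ => exact (dadd (dcst c _ _) (did _))
  | |- is_derive _ _ -%R _ => exact (dopp (did _))
  | |- is_derive _ _ expR _ => exact (dexpR _)
  end.
Ltac der := repeat (first [match goal with
  | H : is_derive _ _ ?f _ |- is_derive _ _ ?f _ => exact H end | der1]).
Ltac dert := notypeclasses refine (deq _ _); [der | cbv beta].

Section Sint.
Variable R : realType.
Notation mu := (@lebesgue_measure R).
Implicit Types (f g F : R -> R) (a b c x y T M eta : R).

Definition sint a b f : R := \int[mu]_(x in `[a, b]) f x.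

Lemma continuous_integrable a b f : (forall x, a <= x <= b -> {for x, continuous f}) ->
  mu.-integrable `[a, b] (EFin \o f).
Proof.
move=> cf; apply: continuous_compact_integrable; first exact: segment_compact.
apply: continuous_in_subspaceT => x; rewrite inE/= in_itv /=; exact: cf.
Qed.

Lemma sint_FTC a b f F : a <= b ->
  (forall x, a <= x <= b -> {for x, continuous f}) ->
  (forall x, a <= x <= b -> is_derive x (1:R) F (f x)) ->
  sint a b f = F b - F a.
Proof.
rewrite le_eqVlt => /predU1P[<- _ _|ab cf dF].
  by rewrite /sint set_itv1 Rintegral_set1 subrr.
rewrite /sint /Rintegral (@continuous_FTC2 _ f F a b ab) //.
- apply: continuous_in_subspaceT => x; rewrite inE/= in_itv /=; exact: cf.
- have c x : a <= x <= b -> F y @[y --> x] --> F x.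
    by move=> /dF h; exact: (is_derive_continuous1 h).
  split.
  + move=> x; rewrite in_itv/= => /andP[h1 h2].
    by have [] : is_derive x (1:R) F (f x) by apply: dF; rewrite (ltW h1) (ltW h2).
  + by apply: cvg_at_right_filter; apply: c; rewrite lexx (ltW ab).
  + by apply: cvg_at_left_filter; apply: c; rewrite lexx (ltW ab).
- move=> x; rewrite in_itv/= => /andP[h1 h2].
  have [_ <-] : is_derive x (1:R) F (f x) by apply: dF; rewrite (ltW h1) (ltW h2).
  by rewrite derive1E.
Qed.

Lemma primitive_gt f a : continuous f ->
  forall x : R, a < x -> is_derive x (1:R) (fun y : R => sint a y f) (f x).
Proof.
move=> cf x ax.
have fi : mu.-integrable `[a, x + 1] (EFin \o f).
  by apply: continuous_integrable => y _; exact: cf.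
have x1 : x < x + 1 by rewrite ltrDl.
have [h1 h2] := continuous_FTC1_closed x1 fi ax (cf x).
by apply: DeriveDef h1 _; rewrite -derive1E.
Qed.

Lemma sint_cat a b c f : continuous f -> a <= b -> b <= c ->
  sint a c f = sint a b f + sint b c f.
Proof.
move=> cf ab bc.
have fi x y : mu.-integrable `[x, y] (EFin \o f).
  by apply: continuous_integrable => ? _; exact: cf.
have /= := @Rintegral_itvB _ f (BLeft a) (BRight c) b (fi _ _).
rewrite !bnd_simp => /(_ ab bc) h; rewrite /sint.
have <- : \int[mu]_(x in `]b, c]) f x = \int[mu]_(x in `[b, c]) f x.
  apply: Rintegral_itv_obnd_cbnd; apply: integrableS (fi b c) => //.
  exact: subset_itv_oc_cc.
by rewrite -h addrC subrK.
Qed.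

(** The integral from a fixed base point vanishes to the left of it, so the
    primitive is written with different integrals on the two half-lines. *)
Lemma primitive_ex f : continuous f -> exists F : R -> R, forall x : R, is_derive x (1:R) F (f x).
Proof.
move=> cf.
pose F x := if 0 <= x then sint (-1) x f - sint (-1) 0 f else - sint x 0 f.
exists F => x.
pose N : R := `|x| + 1.
have xN : - N < x by rewrite /N; have := ler_norm (- x); rewrite normrN; lra.
have N0 : 1 <= N by rewrite /N; have := normr_ge0 x; lra.
have E y : - N < y -> F y = sint (- N) y f - sint (- N) 0 f.
  move=> yN; rewrite /F; case: leP => y0.
    rewrite (@sint_cat (- N) (-1) y) //; [|lra|lra].
    by rewrite (@sint_cat (- N) (-1) 0) //; lra.
  by rewrite (@sint_cat (- N) y 0) //; lra.
have h : is_derive x (1:R) (fun y : R => sint (- N) y f - sint (- N) 0 f) (f x - 0).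
  exact: (dsub (primitive_gt cf xN) (dcst _ _ _)).
rewrite subr0 in h.
apply: near_eq_is_derive h.
have : \forall y \near x, - N < y by exact: lt_nbhsr.
by apply: filterS => y /E ->.
Qed.

Lemma sint_prim f : continuous f -> exists F : R -> R,
  (forall x : R, is_derive x (1:R) F (f x)) /\ forall a b, a <= b -> sint a b f = F b - F a.
Proof.
move=> cf; have [F hF] := primitive_ex cf; exists F; split => // a b ab.
by apply: sint_FTC => // x _; exact: cf.
Qed.

Lemma sint_le a b f g : (forall x, a <= x <= b -> {for x, continuous f}) ->
  (forall x, a <= x <= b -> {for x, continuous g}) ->
  (forall x, a <= x <= b -> f x <= g x) -> sint a b f <= sint a b g.
Proof.
move=> cf cg fg; apply: le_Rintegral => //; try exact: continuous_integrable.
Qed.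

Lemma eq_sint a b f g : (forall x, a <= x <= b -> f x = g x) -> sint a b f = sint a b g.
Proof.
move=> fg; apply: eq_Rintegral => x; rewrite inE/= in_itv/=; exact: fg.
Qed.

Lemma sintD a b f g : (forall x, a <= x <= b -> {for x, continuous f}) ->
  (forall x, a <= x <= b -> {for x, continuous g}) ->
  sint a b (fun x => f x + g x) = sint a b f + sint a b g.
Proof. by move=> cf cg; apply: RintegralD => //; exact: continuous_integrable. Qed.

Lemma sintZ a b c f : (forall x, a <= x <= b -> {for x, continuous f}) ->
  sint a b (fun x => c * f x) = c * sint a b f.
Proof. by move=> cf; apply: RintegralZl => //; exact: continuous_integrable. Qed.

Lemma sint_cst a b c : a <= b -> sint a b (fun=> c) = c * (b - a).
Proof.
move=> ab.
have h x : a <= x <= b -> is_derive x (1:R) (fun x : R => c * x) c.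
  by move=> _; dert; ring.
rewrite (sint_FTC ab _ h); first by ring.
by move=> x _; exact: cvg_cst.
Qed.

Lemma sint_ge0 a b f : (forall x, a <= x <= b -> 0 <= f x) -> 0 <= sint a b f.
Proof. by move=> f0; apply: Rintegral_ge0 => x; rewrite /= in_itv/=; exact: f0. Qed.

Lemma sint_EFin a b f : (forall x, a <= x <= b -> {for x, continuous f}) ->
  (\int[mu]_(x in `[a, b]) (f x)%:E = (sint a b f)%:E)%E.
Proof.
move=> cf; rewrite /sint /Rintegral fineK //.
by apply: integrable_fin_num => //; exact: continuous_integrable.
Qed.

Lemma sint_gt0 a b f x0 : a < b -> (forall x, a <= x <= b -> {for x, continuous f}) ->
  (forall x, a <= x <= b -> 0 <= f x) -> a <= x0 <= b -> 0 < f x0 -> 0 < sint a b f.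
Proof.
move=> ab cf f0 hx0 fx0.
have [] := (@cvgrPdist_lt _ R^o _ _ _ f (f x0)).1 (cf _ hx0) (f x0 / 2).
  by rewrite divr_gt0.
move=> d /= d0 hd.
pose a' := Num.max a (x0 - d / 2); pose b' := Num.min b (x0 + d / 2).
have ab' : a' < b'.
  rewrite /a' /b' lt_min !gt_max; case/andP: hx0 => h1 h2.
  by apply/andP; split; apply/andP; split; lra.
have h y : a' <= y <= b' -> f x0 / 2 <= f y.
  rewrite /a' /b' ge_max le_min => /andP[/andP[_ h1] /andP[_ h2]].
  have := hd y; rewrite /ball /= => /(_ _) h.
  have {}h : `|f x0 - f y| < f x0 / 2.
    by apply: h; rewrite ltr_norml; apply/andP; split; lra.
  have := ler_norm (f x0 - f y); lra.
have aa : a <= a' by rewrite /a' le_max lexx.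
have bb : b' <= b by rewrite /b' ge_min lexx.
have ms : measurable `[a', b'] by exact: measurable_itv.
apply: (@lt_le_trans _ _ (sint a' b' (fun=> f x0 / 2))).
  rewrite sint_cst ?(ltW ab')// mulr_gt0 ?divr_gt0 // subr_gt0 //.
have cf' y : a' <= y <= b' -> {for y, continuous f}.
  by move=> /andP[h1 h2]; apply: cf; rewrite (le_trans aa) // (le_trans h2).
apply: (@le_trans _ _ (sint a' b' f)).
  by apply: sint_le => // y _; exact: cvg_cst.
rewrite -lee_fin -!sint_EFin //.
apply: ge0_subset_integral => //.
- apply/measurable_EFinP.
  by have /integrableP[/measurable_EFinP] := continuous_integrable cf.
- by move=> y; rewrite /= !in_itv/= => /andP[h1 h2]; rewrite (le_trans aa h1) (le_trans h2).
Qed.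

Lemma sint_mono f : (forall x, 0 <= x -> {for x, continuous f}) ->
  (forall x, 0 <= x -> 0 <= f x) ->
  forall a b, 0 <= a -> a <= b -> sint 0 a f <= sint 0 b f.
Proof.
move=> cf f0 a b a0 ab; rewrite -lee_fin -!sint_EFin; last 2 first.
  by move=> x /andP[x0 _]; exact: cf.
  by move=> x /andP[x0 _]; exact: cf.
apply: ge0_subset_integral => //.
- apply/measurable_EFinP.
  suff /integrableP[/measurable_EFinP //] : mu.-integrable `[0, b] (EFin \o f).
  by apply: continuous_integrable => x /andP[x0 _]; exact: cf.
- by move=> y; rewrite /= in_itv/= ?lee_fin => /andP[h _]; exact: f0.
- by move=> y; rewrite /= !in_itv/= => /andP[-> h]; rewrite (le_trans h).
Qed.

(** Monotone convergence, in the form needed to pass between the improper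
    integrals of the theorem and integrals over segments. *)
Lemma sint_y f M : (forall x, 0 <= x -> {for x, continuous f}) ->
  (forall x, 0 <= x -> 0 <= f x) ->
  (forall T, 0 <= T -> sint 0 T f <= M) ->
  let Lam := \int[mu]_(x in `[0, +oo[) f x in
  (forall T, 0 <= T -> sint 0 T f <= Lam) /\
  (forall eta, 0 < eta -> exists2 T, 0 <= T & Lam - eta < sint 0 T f).
Proof.
move=> cf f0 fM Lam.
have cv : ((sint 0 k%:R f)%:E @[k --> \oo] --> \int[mu]_(x in `[0%R, +oo[) (f x)%:E)%E.
  have -> : `[0, +oo[%classic = \bigcup_k `[0, k%:R : R]%classic.
    rewrite (itv_bndy_bigcup_BRight true 0).
    by apply: eq_bigcup => // k _; rewrite add0r.
  have -> : (fun k => (sint 0 k%:R f)%:E) = (fun k : nat => \int[mu]_(x in `[0%R, k%:R]) (f x)%:E)%E.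
    apply/funext => k; rewrite sint_EFin // => x /andP[x0 _]; exact: cf.
  apply: ge0_nondecreasing_set_cvg_integral => //.
  - apply/nondecreasing_seqP => n; rewrite subsetEset => x /=.
    rewrite !in_itv/= => /andP[-> h]; rewrite (le_trans h) // ler_nat //.
  - move=> n; apply/measurable_EFinP.
    suff /integrableP[/measurable_EFinP //] : mu.-integrable `[0, n%:R] (EFin \o f).
    by apply: continuous_integrable => x /andP[x0 _]; exact: cf.
  - by move=> n x; rewrite /= in_itv/= ?lee_fin => /andP[x0 _]; exact: f0.
set I := (\int[mu]_(x in `[0%R, +oo[) (f x)%:E)%E in cv.
have Ige : (0 <= I)%E.
  by apply: integral_ge0 => x; rewrite /= in_itv/= andbT ?lee_fin; exact: f0.
have IM : (I <= M%:E)%E.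
  have <- := cvg_lim (@ereal_hausdorff R) cv.
  apply: lime_le; first by apply/cvg_ex; exists I.
  by near=> k; rewrite lee_fin; apply: fM.
have IE : I = Lam%:E.
  rewrite /Lam /Rintegral -/I fineK // ge0_fin_numE // (le_lt_trans IM) // ltry //.
split.
- move=> T T0; rewrite -lee_fin -IE.
  have <- := cvg_lim (@ereal_hausdorff R) cv.
  apply: lime_ge; first by apply/cvg_ex; exists I.
  near=> k; rewrite lee_fin; apply: (sint_mono cf f0) => //.
  by near: k; exact: nbhs_infty_ger.
- move=> eta eta0.
  rewrite IE in cv.
  have cv1 : sint 0 k%:R f @[k --> \oo] --> Lam by exact: (fine_cvg cv).
  have [N _ hN] := (@cvgrPdist_lt _ _ _ _ _ _ _).1 cv1 _ eta0.
  exists N%:R => //.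
  have := hN N (leqnn N) => /=.
  have := ler_norm (Lam - sint 0 N%:R f); lra.
Unshelve. all: by end_near. Qed.

(** The strict inequality survives the limit because the gap over [0, 1] is a part
    of the gap over every longer segment. *)
Lemma sint_y_lt f g M : (forall x, 0 <= x -> {for x, continuous f}) ->
  (forall x, 0 <= x -> {for x, continuous g}) ->
  (forall x, 0 <= x -> 0 < f x) -> (forall x, 0 <= x -> f x < g x) ->
  (forall T, 0 <= T -> sint 0 T g <= M) ->
  0 < \int[mu]_(x in `[0, +oo[) f x < M.
Proof.
move=> cf cg f0 fg gM.
have f0' x : 0 <= x -> 0 <= f x by move=> x0; exact: ltW (f0 x x0).
pose h x := g x + (-1) * f x.
have ch x : 0 <= x -> {for x, continuous h}.
  move=> x0; apply: cvgD; first exact: cg.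
  by apply: cvgM; [exact: cvg_cst | exact: cf].
have h0 x : 0 <= x -> 0 < h x by move=> x0; rewrite /h mulN1r subr_gt0 fg.
have h0' x : 0 <= x -> 0 <= h x by move=> x0; exact: ltW (h0 x x0).
have pos (u : R -> R) : (forall x, 0 <= x -> {for x, continuous u}) -> (forall x, 0 <= x -> 0 < u x) ->
    0 < sint 0 1 u.
  move=> cu u0; apply: (@sint_gt0 _ _ _ 0) => //; rewrite ?lexx ?ler01 //.
  - by move=> x /andP[x0 _]; exact: cu.
  - by move=> x /andP[x0 _]; exact: ltW (u0 x x0).
  - exact: u0.
pose d := sint 0 1 h; have d0 : 0 < d by exact: pos.
have big T : 0 <= T -> sint 0 T f <= M - d.
  move=> T0; pose T1 := Num.max T 1.
  have T1T : T <= T1 by rewrite le_max lexx.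
  have T11 : 1 <= T1 by rewrite le_max lexx orbT.
  have T10 : 0 <= T1 by exact: le_trans T1T.
  apply: (le_trans (sint_mono cf f0' T0 T1T)).
  have e : sint 0 T1 g = sint 0 T1 f + sint 0 T1 h.
    rewrite -sintD; [|by move=> x /andP[x0 _]; exact: cf|by move=> x /andP[x0 _]; exact: ch].
    by apply: eq_sint => x _; rewrite /h; ring.
  rewrite lerBrDr; apply: le_trans (gM T1 T10); rewrite e lerD2l.
  exact: (sint_mono ch h0' ler01 T11).
have [h1 h2] := sint_y cf f0' big.
set I := \int[mu]_(x in `[0, +oo[) f x in h1 h2 *; apply/andP; split.
  by apply: lt_le_trans (h1 1 ler01); exact: pos.
have [T T0 hT] := h2 (d / 2) (divr_gt0 d0 (ltr0Sn _ 1)).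
have := big T T0; clear -hT d0; lra.
Qed.

End Sint.

(** * Functions of class C^n *)

Section Cls.
Variables (R : realType) (V : normedModType R) (D : set V).
Implicit Types (O : set V) (f g : V -> R) (z v : V) (n m : nat).

(** Iterated directional derivatives, along an arbitrary set D of directions: the
    same lemmas then serve on the line and on the half-plane. *)
Fixpoint cls O n f : Prop :=
  (forall z, O z -> {for z, continuous f}) /\
  match n with
  | 0%N => True
  | m.+1 => forall v, D v -> (forall z, O z -> derivable f z v) /\ cls O m ('D_v f)
  end.

Lemma cls_cont O n f : cls O n f -> forall z, O z -> {for z, continuous f}.
Proof. by case: n => [|n] []. Qed.

Lemma cls_der O n f z v : cls O n.+1 f -> D v -> O z -> is_derive z v f ('D_v f z).
Proof. by move=> [_ /(_ v) h] /h [h1 _] /h1 ?; exact: derivableP. Qed.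

Lemma cls_weak O n f : cls O n.+1 f -> cls O n f.
Proof.
elim: n f => [|n ih] f [h1 h2]; first by split.
split => // v /h2 [h3 h4]; split => //; exact: ih.
Qed.

Lemma cls_sub O O' n f : O' `<=` O -> cls O n f -> cls O' n f.
Proof.
move=> s; elim: n f => [|n ih] f [h1 h2]; first by split => // z /s /h1.
split => [z /s /h1 //|v /h2 [h3 h4]]; split; last exact: ih.
by move=> z /s /h3.
Qed.

Lemma cls_ext O n f g : open O -> (forall z, O z -> f z = g z) -> cls O n f -> cls O n g.
Proof.
move=> oO; elim: n f g => [|n ih] f g fg [h1 h2].
all: have nfg z : O z -> {near z, f =1 g}
  by move=> Oz; exact: filterS (open_nbhs_nbhs (conj oO Oz)).
all: have cg z : O z -> {for z, continuous g}
  by move=> Oz; rewrite /prop_for /continuous_at -fg //; apply: cvg_trans (h1 _ Oz);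
     apply: near_eq_cvg; apply: filterS (nfg z Oz) => y ->.
- by split.
- split => // v Dv; have [h3 h4] := h2 _ Dv; split.
  + by move=> z Oz; apply: near_eq_derivable (h3 z Oz); exact: nfg.
  + by apply: ih h4 => z Oz; apply: near_eq_derive; exact: nfg.
Qed.

(** The induction step of the smoothness proofs: the derivatives may be given by
    formulas that are valid on O only. *)
Lemma cls_intro O n f (df : V -> V -> R) : open O ->
  (forall z, O z -> {for z, continuous f}) ->
  (forall z v, O z -> D v -> is_derive z v f (df v z)) ->
  (forall v, D v -> cls O n (df v)) -> cls O n.+1 f.
Proof.
move=> oO cf hf hdf; split => // v Dv; split; first by move=> z Oz; have [] := hf z v Oz Dv.
by apply: cls_ext (hdf v Dv) => // z Oz; have [_ ->] := hf z v Oz Dv.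
Qed.

Lemma cls_union O O' n f : cls O n f -> cls O' n f -> cls (O `|` O') n f.
Proof.
elim: n f => [|n ih] f [h1 h2] [h3 h4].
  by split => // z []; [exact: h1|exact: h3].
split=> [z []|v Dv]; [exact: h1|exact: h3|].
have [a1 a2] := h2 _ Dv; have [b1 b2] := h4 _ Dv; split; last exact: ih.
by move=> z []; [exact: a1|exact: b1].
Qed.

Lemma cls_cst O n (c : R) : open O -> cls O n (fun=> c).
Proof.
move=> oO; elim: n c => [|n ih] c; first by split => // z _; exact: cvg_cst.
apply: (@cls_intro _ _ _ (fun _ _ => 0)) => //; first by move=> z _; exact: cvg_cst.
Qed.

Lemma cls_add O n f g : open O -> cls O n f -> cls O n g -> cls O n (fun z => f z + g z).
Proof.
move=> oO; elim: n f g => [|n ih] f g hf hg.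
  by split => // z Oz; apply: cvgD; [exact: (cls_cont hf)|exact: (cls_cont hg)].
apply: (@cls_intro _ _ _ (fun v z => 'D_v f z + 'D_v g z)) => //.
- by move=> z Oz; apply: cvgD; [exact: (cls_cont hf)|exact: (cls_cont hg)].
- by move=> z v Oz Dv; exact: dadd (cls_der hf Dv Oz) (cls_der hg Dv Oz).
- move=> v Dv; apply: ih; first by case: hf => _ /(_ _ Dv) [].
  by case: hg => _ /(_ _ Dv) [].
Qed.

Lemma cls_mul O n f g : open O -> cls O n f -> cls O n g -> cls O n (fun z => f z * g z).
Proof.
move=> oO; elim: n f g => [|n ih] f g hf hg.
  by split => // z Oz; apply: cvgM; [exact: (cls_cont hf)|exact: (cls_cont hg)].
apply: (@cls_intro _ _ _ (fun v z => f z * 'D_v g z + g z * 'D_v f z)) => //.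
- by move=> z Oz; apply: cvgM; [exact: (cls_cont hf)|exact: (cls_cont hg)].
- by move=> z v Oz Dv; exact: dmul (cls_der hf Dv Oz) (cls_der hg Dv Oz).
- move=> v Dv; apply: cls_add => //; apply: ih; try exact: cls_weak.
    by case: hg => _ /(_ _ Dv) [].
  by case: hf => _ /(_ _ Dv) [].
Qed.

Lemma cls_sum (I : finType) O n (F : I -> V -> R) : open O ->
  (forall i, cls O n (F i)) -> cls O n (fun z => \sum_i F i z).
Proof.
move=> oO h.
suff : forall s : seq I, cls O n (fun z => \sum_(i <- s) F i z) by exact.
elim => [|i s ih].
  apply: (@cls_ext _ _ (fun=> 0)) => //; last exact: cls_cst.
  by move=> z _; rewrite big_nil.
apply: (@cls_ext _ _ (fun z => F i z + \sum_(j <- s) F j z)) => //.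
  by move=> z _; rewrite big_cons.
exact: cls_add.
Qed.

End Cls.

Section Cls1.
Variable R : realType.
Implicit Types (O : set R) (n : nat) (x : R).

Definition cls1 O n (f : R -> R) := cls [set (1:R)] O n f.

Lemma cls1_intro O n (f df : R -> R) : open O ->
  (forall x, O x -> is_derive x (1:R) f (df x)) -> cls1 O n df -> cls1 O n.+1 f.
Proof.
move=> oO h hd; apply: (@cls_intro _ _ _ _ _ _ (fun _ => df)) => //.
- by move=> x /h; exact: is_derive_continuous1.
- by move=> x v Ox ->; exact: h.
Qed.

Lemma cls1_intro0 O (f df : R -> R) :
  (forall x, O x -> is_derive x (1:R) f (df x)) -> cls1 O 0 f.
Proof. by move=> h; split => // x /h; exact: is_derive_continuous1. Qed.

Lemma cls1_der O n f x : cls1 O n.+1 f -> O x -> is_derive x (1:R) f ('D_1 f x).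
Proof. by move=> h Ox; exact: (cls_der h _ Ox). Qed.

Lemma cls1_id O n : open O -> cls1 O n (fun x => x).
Proof.
move=> oO; case: n => [|n]; first by apply: cls1_intro0 => x _; exact: did.
apply: (@cls1_intro _ _ _ (fun=> 1)) => //; last exact: cls_cst.
Qed.

Lemma cls1_expR n : cls1 setT n (@expR R).
Proof.
elim: n => [|n ih]; first by apply: cls1_intro0 => x _; exact: dexpR.
by apply: (cls1_intro openT) ih => x _; exact: dexpR.
Qed.

Lemma open_gt0 : open [set x : R | 0 < x].
Proof. exact: open_gt. Qed.

Lemma cls1_inv n : cls1 [set x : R | 0 < x] n (fun x => x^-1).
Proof.
have h x : 0 < x -> is_derive x (1:R) (fun x : R => x^-1) (- 1 * (x^-1 * x^-1)).
  move=> x0; notypeclasses refine (deq _ _); [der|]; first by rewrite gt_eqF.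
  by cbv beta; field; rewrite gt_eqF.
elim: n => [|n ih]; first by apply: cls1_intro0 => x; exact: h.
apply: (cls1_intro open_gt0 h).
apply: cls_mul; first exact: open_gt0.
  by apply: cls_cst; exact: open_gt0.
by apply: cls_mul => //; exact: open_gt0.
Qed.

Lemma cls1_ln n : cls1 [set x : R | 0 < x] n (@ln R).
Proof.
case: n => [|n]; first by apply: cls1_intro0 => x; exact: dln.
by apply: (cls1_intro open_gt0 (@dln R)); exact: cls1_inv.
Qed.

End Cls1.

Section ClsComp.
Variables (R : realType) (V : normedModType R) (D : set V).
Implicit Types (O : set V) (n : nat).

Lemma cls_comp O (P : set R) n (phi : R -> R) (u : V -> R) : open O ->
  (forall z, O z -> P (u z)) -> cls1 P n phi -> cls D O n u ->
  cls D O n (fun z => phi (u z)).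
Proof.
move=> oO uP; elim: n phi u uP => [|n ih] phi u uP hphi hu.
all: have c z : O z -> {for z, continuous (fun z => phi (u z))}
  by move=> Oz; apply: continuous_comp; [exact: (cls_cont hu)|exact: (cls_cont hphi (uP _ Oz))].
- by split.
- apply: (@cls_intro _ _ _ _ _ _ (fun v z => 'D_1 phi (u z) * 'D_v u z)) => //.
  + by move=> z v Oz Dv; exact: dcomp (cls1_der hphi (uP _ Oz)) (cls_der hu Dv Oz).
  + move=> v Dv; apply: cls_mul => //.
      apply: (ih ('D_1 phi) u) => //; last exact: cls_weak.
      by have [_ /(_ 1 erefl) [_ hd]] := hphi.
    by have [_ /(_ _ Dv) [_ hd]] := hu.
Qed.

End ClsComp.

Section HClass.
Variable R : realType.

Definition hdirs : set (R * R) := [set v | v = (1, 0) \/ v = (0, 1)].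

Lemma hclassE n (f : R * R -> R) : hclass n f <-> cls hdirs hplane n f.
Proof.
elim: n f => [|n ih] f /=; first by split => [|[]].
split=> [[h1 h2 h3 h4]|[h1 h2]].
  split; first exact: h1.
  move=> v [->|->]; split; [|exact/ih| |exact/ih] => z hz; first exact: (h2 z hz).1.
  exact: (h2 z hz).2.
have [h3 h4] := h2 _ (or_introl erefl); have [h5 h6] := h2 _ (or_intror erefl).
by split; [exact: h1|move=> z Oz; split; [exact: h3|exact: h5]|exact/ih|exact/ih].
Qed.

Lemma open_hplane : open (@hplane R).
Proof.
have -> : @hplane R = snd @^-1` [set y : R | 0 < y] by [].
apply: open_comp; last exact: open_gt.
by move=> z _; exact: cvg_snd.
Qed.

End HClass.

(** * Integration over the half-plane *)

Section Meas2.
Variable R : realType.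
Notation mu := (@lebesgue_measure R).

(** Open sets are countable unions of boxes with rational corners. *)
Lemma open_measurable2 (A : set (R * R)) : open A -> measurable A.
Proof.
move=> oA.
pose box (q : (rat * rat) * (rat * rat)) : set (R * R) :=
  `]ratr q.1.1, ratr q.1.2[%classic `*` `]ratr q.2.1, ratr q.2.2[%classic.
have -> : A = \bigcup_(q in [set q | box q `<=` A]) box q.
  apply/seteqP; split => [[x y] Axy|z [q /= qA /qA //]].
  have /nbhs_ballP [e /= e0 he] := open_nbhs_nbhs (conj oA Axy).
  have r1 (t : R) : t - e < t by rewrite ltrBlDr ltrDl.
  have r2 (t : R) : t < t + e by rewrite ltrDl.
  have [a /[!in_itv]/= /andP[a1 a2]] := rat_in_itvoo (r1 x).
  have [b /[!in_itv]/= /andP[b1 b2]] := rat_in_itvoo (r2 x).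
  have [c /[!in_itv]/= /andP[c1 c2]] := rat_in_itvoo (r1 y).
  have [d /[!in_itv]/= /andP[d1 d2]] := rat_in_itvoo (r2 y).
  exists ((a, b), (c, d)); last by split; rewrite /= in_itv/= ?a2 ?b1 ?c2 ?d1.
  move=> [x' y'] [] /=; rewrite !in_itv/= => /andP[h1 h2] /andP[h3 h4].
  apply: he; split; rewrite /ball/= ltr_norml; apply/andP; split; lra.
rewrite bigcup_mkcond; apply: countable_bigcupT_measurable; first exact: countableP.
move=> q; case: ifP => _; last exact: measurable0.
by apply: measurableX; exact: measurable_itv.
Qed.

Lemma continuous_on_measurable2 (O : set (R * R)) (f : R * R -> R) : open O ->
  (forall z, O z -> {for z, continuous f}) -> measurable_fun O f.
Proof.
move=> oO cf mO; apply: (measurability _ (RGenOpens.measurableE R)) => //.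
move=> _ [_ [a [b ->] <-]].
apply: open_measurable2.
rewrite openE => z [Oz /= fz]; apply: filterI; first exact: open_nbhs_nbhs.
have ho : open (`]a, b[%classic : set R) by exact: interval_open.
by have := cf z Oz; apply; exact: (open_nbhs_nbhs (conj ho fz)).
Qed.

Lemma hplane_tonelli (F : R * R -> R) :
  (forall z, hplane z -> {for z, continuous F}) -> (forall z, hplane z -> 0 <= F z) ->
  (\int[mu \x mu]_(z in hplane) (F z)%:E =
   \int[mu]_(y in [set y : R | (0 < y)%R]) \int[mu]_x (F (x, y))%:E)%E.
Proof.
move=> cF F0.
have mh : measurable (@hplane R) by apply: open_measurable2; exact: open_hplane.
have mF : measurable_fun hplane F.
  by apply: continuous_on_measurable2 => //; exact: open_hplane.
rewrite [LHS]integral_mkcond /= fubini_tonelli2 /=.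
- rewrite [RHS]integral_mkcond; apply: eq_integral => y _.
  rewrite /fubini_G patchE; case: ifPn => hy.
    apply: eq_integral => x _; rewrite patchE.
    have -> // : ((x, y) \in hplane) = true.
    by apply: mem_set; exact: (set_mem hy).
  rewrite (_ : (fun x => _) = cst 0%E) ?integral_cst ?mul0e //.
  apply/funext => x; rewrite patchE ifF //; apply/negP => /set_mem h.
  by case/negP: hy; exact: mem_set.
- apply/(measurable_restrictT _ mh); exact/measurable_EFinP.
- move=> z; rewrite patchE; case: ifPn => // ; rewrite inE => /F0; by rewrite lee_fin.
Qed.

(** Change of variables on the line, by exhaustion with the segments
    from - n to n. *)
Lemma subst_T (F f G : R -> R) :
  (forall x, is_derive x (1:R) F (f x)) -> continuous f -> (forall x, 0 < f x) ->
  (forall y, range F y -> {for y, continuous G}) -> (forall y, range F y -> 0 <= G y) ->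
  (\int[mu]_(y in range F) (G y)%:E = \int[mu]_x (G (F x) * f x)%:E)%E.
Proof.
move=> dF cf f0 cG G0.
have cF : continuous F by move=> x; exact: (is_derive_continuous1 (dF x)).
have incF : {homo F : x y / x < y}.
  move=> x y xy.
  have [c _ e] := MVT xy (fun c _ => dF c) (continuous_subspaceT cF).
  by rewrite -subr_gt0 e mulr_gt0 // subr_gt0.
have leF : {homo F : x y / x <= y} by exact: ltW_homo.
have F1 : derive1 F = f by apply/funext => x; rewrite derive1E; have [_ ->] := dF x.
pose n1 (n : nat) : R := n.+1%:R; pose m1 (n : nat) : R := - n1 n.
have n10 n : m1 n < n1 n by rewrite /m1 /n1 gtrN // ltr0n.
have n1S n : n1 n <= n1 n.+1 by rewrite ler_nat.
have n1x x : exists n, m1 n <= x <= n1 n.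
  exists (Num.truncn `|x|); have : `|x| < n1 (Num.truncn `|x|) by exact: truncnS_gt.
  by rewrite /m1 -ler_norml => /ltW.
have rF : range F = \bigcup_n `[F (m1 n), F (n1 n)]%classic.
  apply/seteqP; split => [_ [x _ <-]|y [n _]]; rewrite /=.
    have [n /andP[h1 h2]] := n1x x; exists n => //=.
    by rewrite in_itv/= !leF.
  rewrite in_itv/= => hy.
  have [||x _ <-] := @IVT _ F (m1 n) (n1 n) y (ltW (n10 n)).
  - exact: continuous_subspaceT.
  - have /andP[h1 h2] := hy.
    by rewrite /Num.min /Num.max incF ?n10 // h1 h2.
  - by exists x.
have rT : [set: R] = \bigcup_n `[m1 n, n1 n]%classic.
  by apply/seteqP; split => // x _; have [n h] := n1x x; exists n => //=; rewrite in_itv.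
have inF n y : F (m1 n) <= y <= F (n1 n) -> range F y.
  by move=> h; rewrite rF; exists n => //=; rewrite in_itv.
have cW n : {within `[F (m1 n), F (n1 n)], continuous G}.
  by apply: continuous_in_subspaceT => y; rewrite inE/= in_itv/= => /inF; exact: cG.
have cGF : continuous (fun x => G (F x) * f x).
  move=> x; apply: cvgM; last exact: cf.
  apply: continuous_comp; [exact: cF|apply: cG; by exists x].
have c1 : (\int[mu]_(y in `[F (m1 n), F (n1 n)]) (G y)%:E @[n --> \oo] -->
   \int[mu]_(y in range F) (G y)%:E)%E.
  rewrite rF; apply: ge0_nondecreasing_set_cvg_integral => //.
  - apply/nondecreasing_seqP => n; rewrite subsetEset => y /=.
    rewrite !in_itv/= => /andP[h1 h2]; apply/andP; split.
      by rewrite (le_trans _ h1) // leF // /m1 lerN2.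
    by rewrite (le_trans h2) // leF.
  - move=> n; apply/measurable_EFinP.
    have /integrableP[/measurable_EFinP //] :
      mu.-integrable `[F (m1 n), F (n1 n)] (EFin \o G).
    by apply: continuous_integrable => y /inF; exact: cG.
  - by move=> n y; rewrite /= in_itv/= => /inF; rewrite ?lee_fin; exact: G0.
have c2 : (\int[mu]_(x in `[m1 n, n1 n]) (G (F x) * f x)%:E @[n --> \oo] -->
   \int[mu]_(x in [set: R]) (G (F x) * f x)%:E)%E.
  rewrite rT; apply: ge0_nondecreasing_set_cvg_integral => //.
  - apply/nondecreasing_seqP => n; rewrite subsetEset => y /=.
    rewrite !in_itv/= => /andP[h1 h2]; apply/andP; split.
      by rewrite (le_trans _ h1) // /m1 lerN2.
    by rewrite (le_trans h2).
  - move=> n; apply/measurable_EFinP; apply: measurable_funTS.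
    exact: continuous_measurable_fun.
  - by move=> n y _; rewrite ?lee_fin mulr_ge0 ?(ltW (f0 _)) //; apply: G0; exists y.
have e n : (\int[mu]_(y in `[F (m1 n), F (n1 n)]) (G y)%:E =
   \int[mu]_(x in `[m1 n, n1 n]) (G (F x) * f x)%:E)%E.
  rewrite (integration_by_substitution_increasing (ltW (n10 n)) _ _ _ _ _ (cW n)).
  - by apply: eq_integral => x _; rewrite F1 fctE.
  - by move=> x y _ _; exact: incF.
  - by rewrite F1 => x _; exact: cf.
  - by rewrite F1; apply/cvg_ex; exists (f (m1 n)); apply: cvg_at_right_filter; exact: cf.
  - by rewrite F1; apply/cvg_ex; exists (f (n1 n)); apply: cvg_at_left_filter; exact: cf.
  - split; first by move=> x _; have [] := dF x.
      by apply: cvg_at_right_filter; exact: cF.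
    by apply: cvg_at_left_filter; exact: cF.
move: c1; rewrite (funext e) => c1.
exact: cvg_unique c1 c2.
Qed.

Lemma cvg_integral_symm (G : R -> R) : continuous G -> (forall y, 0 <= G y) ->
  (\int[mu]_(x in `[(- n.+1%:R)%R, n.+1%:R]) (G x)%:E @[n --> \oo] --> \int[mu]_x (G x)%:E)%E.
Proof.
move=> cG G0.
have -> : [set: R] = \bigcup_n `[(- n.+1%:R)%R, n.+1%:R]%classic.
  apply/seteqP; split => // x _.
  exists (Num.truncn `|x|) => //=; rewrite in_itv/= -ler_norml; apply: ltW.
  exact: truncnS_gt.
apply: ge0_nondecreasing_set_cvg_integral => //.
- apply/nondecreasing_seqP => n; rewrite subsetEset => y /=.
  rewrite !in_itv/= => /andP[h1 h2]; apply/andP; split.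
    by rewrite (le_trans _ h1) // lerN2 ler_nat.
  by rewrite (le_trans h2) // ler_nat.
- move=> n; apply/measurable_EFinP; apply: measurable_funTS.
  exact: continuous_measurable_fun.
- by move=> n y _; rewrite ?lee_fin.
Qed.

Lemma subst_opp (G : R -> R) : continuous G -> (forall y, 0 <= G y) ->
  (\int[mu]_y (G y)%:E = \int[mu]_y (G (- y)%R)%:E)%E.
Proof.
move=> cG G0.
have cG' : continuous (fun y => G (- y)).
  by move=> y; apply: continuous_comp; [exact: opp_continuous|exact: cG].
have h1 := cvg_integral_symm cG G0.
have h2 := cvg_integral_symm cG' (fun y => G0 (- y)).
have e n : (\int[mu]_(x in `[(- n.+1%:R)%R, n.+1%:R]) (G x)%:E =
    \int[mu]_(x in `[(- n.+1%:R)%R, n.+1%:R]) (G (- x)%R)%:E)%E.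
  have := @integration_by_substitution_oppr _ G (- n.+1%:R) n.+1%:R.
  rewrite opprK; apply; last exact: continuous_subspaceT.
  have : (0 : R) < n.+1%:R by rewrite ltr0n.
  by lra.
move: h1; rewrite (funext e) => h1.
exact: cvg_unique h1 h2.
Qed.

Lemma subst_affine (G : R -> R) (a b : R) : continuous G -> (forall y, 0 <= G y) -> a != 0 ->
  (\int[mu]_y (G y)%:E = \int[mu]_x (G (a * x + b)%R * `|a|)%:E)%E.
Proof.
move=> cG G0.
have pos (a' b' : R) (H : R -> R) : continuous H -> (forall y, 0 <= H y) -> 0 < a' ->
   (\int[mu]_y (H y)%:E = \int[mu]_x (H (a' * x + b')%R * a')%:E)%E.
  move=> cH H0 a0.
  have rT : range (fun x : R => a' * x + b') = [set: R].
    apply/seteqP; split => // y _; exists ((y - b') / a') => //.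
    by field; rewrite gt_eqF.
  have h (x : R) : is_derive x (1:R) (fun x : R => a' * x + b') a' by dert; ring.
  have := @subst_T (fun x : R => a' * x + b') (fun=> a') H h.
  rewrite rT; apply.
  - by move=> x; exact: cvg_cst.
  - by [].
  - by move=> y _; exact: cH.
  - by move=> y _; exact: H0.
have := ltrgt0P a; case=> [a0 _|a0 _|-> /eqP //].
  exact: pos.
rewrite subst_opp // (pos (- a) (- b) (fun y => G (- y))) ?oppr_gt0 //; last first.
  by move=> y; apply: continuous_comp; [exact: opp_continuous|exact: cG].
by apply: eq_integral => x _; rewrite mulNr -opprD opprK.
Qed.

End Meas2.

(** * Continuity of expressions *)

Section Cont.
Variables (T : topologicalType) (R : realType).
Implicit Types (f g : T -> R) (t : T).

Lemma ccst t (c : R) : {for t, continuous (fun _ : T => c)}.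
Proof. exact: cvg_cst. Qed.
Lemma cadd f g t : {for t, continuous f} -> {for t, continuous g} ->
  {for t, continuous (fun t => f t + g t)}.
Proof. exact: cvgD. Qed.
Lemma copp f t : {for t, continuous f} -> {for t, continuous (fun t => - f t)}.
Proof. exact: cvgN. Qed.
Lemma cmul f g t : {for t, continuous f} -> {for t, continuous g} ->
  {for t, continuous (fun t => f t * g t)}.
Proof. exact: cvgM. Qed.
Lemma cexp f n t : {for t, continuous f} -> {for t, continuous (fun t => f t ^+ n)}.
Proof.
move=> cf; elim: n => [|n ih]; first exact: ccst.
rewrite (_ : (fun t => f t ^+ n.+1) = (fun t => f t * f t ^+ n)); first exact: cmul.
by apply/funext => u; rewrite exprS.
Qed.
Lemma cinv f t : {for t, continuous f} -> f t != 0 -> {for t, continuous (fun t => (f t)^-1)}.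
Proof. by move=> cf f0; apply: cvgV. Qed.
Lemma ccomp (phi : R -> R) f t : {for f t, continuous phi} -> {for t, continuous f} ->
  {for t, continuous (fun t => phi (f t))}.
Proof. by move=> cphi cf; exact: (continuous_comp cf cphi). Qed.
Lemma cpair (f g : T -> R) t : {for t, continuous f} -> {for t, continuous g} ->
  {for t, continuous (fun t => (f t, g t))}.
Proof.
move=> cf cg.
by apply: (@cvg_pair _ _ _ (nbhs t) (nbhs (f t)) (nbhs (g t)) _ _ _ f g).
Qed.
Lemma ccomp2 (phi : R * R -> R) f g t : {for (f t, g t), continuous phi} ->
  {for t, continuous f} -> {for t, continuous g} ->
  {for t, continuous (fun t => phi (f t, g t))}.
Proof. move=> cphi cf cg; exact: (continuous_comp (cpair cf cg) cphi). Qed.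
Lemma csqrt f t : {for t, continuous f} -> {for t, continuous (fun t => Num.sqrt (f t))}.
Proof. by move=> cf; apply: ccomp => //; exact: sqrt_continuous. Qed.
Lemma cexpR f t : {for t, continuous f} -> {for t, continuous (fun t => expR (f t))}.
Proof. by move=> cf; apply: ccomp => //; exact: continuous_expR. Qed.
Lemma cln f t : {for t, continuous f} -> 0 < f t -> {for t, continuous (fun t => ln (f t))}.
Proof. by move=> cf ft; apply: ccomp => //; exact: continuous_ln. Qed.
Lemma cid (x : R) : {for x, continuous (fun x : R => x)}.
Proof. exact: cvg_id. Qed.
Lemma cfst (z : R * R) : {for z, continuous (fun z : R * R => z.1)}.
Proof. exact: cvg_fst. Qed.
Lemma csnd (z : R * R) : {for z, continuous (fun z : R * R => z.2)}.
Proof. exact: cvg_snd. Qed.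
End Cont.
Arguments ccst {T R} t c.
Arguments cid {R} x.
Arguments cfst {R} z.
Arguments csnd {R} z.
Arguments cadd {T R} f g t _ _.
Arguments copp {T R} f t _.
Arguments cmul {T R} f g t _ _.
Arguments cexp {T R} f n t _.
Arguments cinv {T R} f t _ _.
Arguments csqrt {T R} f t _.
Arguments cexpR {T R} f t _.
Arguments cln {T R} f t _ _.

(** A copy of the continuity predicate that exposes the function, so that the
    patterns of the tactic [cts] match its syntax. *)
Definition cts_at (T : topologicalType) (R : realType) (t : T) (f : T -> R) : Prop :=
  {for t, continuous f}.
Lemma cts_atW (T : topologicalType) (R : realType) (t : T) (f : T -> R) :
  cts_at t f -> {for t, continuous f}.
Proof. exact. Qed.

Ltac cts1 := match goal with
  | |- cts_at _ (fun t => ?c) => exact (ccst _ _)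
  | |- cts_at _ (fun t => t) => exact (cid _)
  | |- cts_at _ ( *%R ?c) => exact (cmul _ _ _ (ccst _ c) (cid _))
  | |- cts_at _ ( +%R ?c) => exact (cadd _ _ _ (ccst _ c) (cid _))
  | |- cts_at _ fst => exact (cfst _)
  | |- cts_at _ snd => exact (csnd _)
  | |- cts_at _ -%R => exact (copp _ _ (cid _))
  | |- cts_at ?x (fun t => @?f t + @?g t) => refine (cadd f g x (_ : cts_at x f) (_ : cts_at x g))
  | |- cts_at ?x (fun t => - @?f t) => refine (copp f x (_ : cts_at x f))
  | |- cts_at ?x (fun t => @?f t * @?g t) => refine (cmul f g x (_ : cts_at x f) (_ : cts_at x g))
  | |- cts_at ?x (fun t => @?f t ^+ ?n) => refine (cexp f n x (_ : cts_at x f))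
  | |- cts_at ?x (fun t => (@?f t)^-1) => refine (cinv f x (_ : cts_at x f) _)
  | |- cts_at ?x (fun t => Num.sqrt (@?f t)) => refine (csqrt f x (_ : cts_at x f))
  | |- cts_at ?x (fun t => expR (@?f t)) => refine (cexpR f x (_ : cts_at x f))
  | |- cts_at ?x (fun t => ln (@?f t)) => refine (cln f x (_ : cts_at x f) _)
  | |- cts_at _ (fun t => t.1) => exact (cfst _)
  | |- cts_at _ (fun t => t.2) => exact (csnd _)
  end.
Ltac cts := apply: cts_atW; repeat cts1.

(** [cts] with the leaves, and the non-vanishing of denominators, taken from the
    hypotheses. *)
Ltac ctsh := apply: cts_atW; repeat first [match goal with
  | H : {for ?x, continuous ?f} |- cts_at ?x ?f => exact H
  | H : {for ?x, continuous ?f} |- cts_at ?x (fun t => ?f t) => exact H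
  | |- cts_at ?x (fun t => @?f t + @?g t) => refine (cadd f g x (_ : cts_at x f) (_ : cts_at x g))
  | |- cts_at ?x (fun t => - @?f t) => refine (copp f x (_ : cts_at x f))
  | |- cts_at ?x (fun t => @?f t * @?g t) => refine (cmul f g x (_ : cts_at x f) (_ : cts_at x g))
  end | cts1].

(** * Coordinates centred at a point *)

Section Plane.
Variable R : realType.
Notation mu := (@lebesgue_measure R).
Implicit Types (a z : R * R) (x y : R).

Lemma hplane_tonelli_sym (F : R * R -> R) :
  (forall z, hplane z -> {for z, continuous F}) -> (forall z, hplane z -> 0 <= F z) ->
  (\int[mu]_(y in [set y : R | (0 < y)%R]) \int[mu]_x (F (x, y))%:E =
   \int[mu]_x \int[mu]_(y in [set y : R | (0 < y)%R]) (F (x, y))%:E)%E.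
Proof.
move=> cF F0; rewrite -hplane_tonelli //.
have mh : measurable (@hplane R) by apply: open_measurable2; exact: open_hplane.
have mF : measurable_fun hplane F.
  by apply: continuous_on_measurable2 => //; exact: open_hplane.
rewrite [LHS]integral_mkcond /= fubini_tonelli1 /=.
- apply: eq_integral => x _.
  rewrite /fubini_F [RHS]integral_mkcond; apply: eq_integral => y _.
  by rewrite !patchE.
- apply/(measurable_restrictT _ mh); exact/measurable_EFinP.
- move=> z; rewrite patchE; case: ifPn => // ; rewrite inE => /F0; by rewrite ?lee_fin.
Qed.

Lemma tonelli2 (F : R * R -> R) : continuous F -> (forall z, 0 <= F z) ->
  (\int[mu]_y \int[mu]_x (F (x, y))%:E = \int[mu]_x \int[mu]_y (F (x, y))%:E)%E.
Proof.
move=> cF F0.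
have mF : measurable_fun setT F.
  by apply: continuous_on_measurable2; [exact: openT | move=> z _; exact: cF].
rewrite -(@fubini_tonelli1 _ _ _ _ _ mu mu (EFin \o F)).
- by rewrite (@fubini_tonelli2 _ _ _ _ _ mu mu (EFin \o F)) //; exact/measurable_EFinP.
- exact/measurable_EFinP.
- by move=> z; rewrite /= lee_fin.
Qed.

(** The coordinates of z on the hyperboloid based at a: [frame_x] and [frame_y] are
    sinh d(a, z) times the components of the unit direction from a to z, and
    [cosh_dist] is cosh d(a, z). *)
Definition frame_x a z : R := (z.1 - a.1) / z.2.
Definition frame_y a z : R := ((z.1 - a.1) ^+ 2 + z.2 ^+ 2 - a.2 ^+ 2) / (2 * a.2 * z.2).
Definition cosh_dist a z : R := ((z.1 - a.1) ^+ 2 + z.2 ^+ 2 + a.2 ^+ 2) / (2 * a.2 * z.2).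

Lemma cosh_distE a z : hplane a -> hplane z -> cosh_dist a z ^+ 2 = 1 + frame_x a z ^+ 2 + frame_y a z ^+ 2.
Proof.
rewrite /hplane /= => a0 z0; rewrite /cosh_dist /frame_x /frame_y; field.
by rewrite !gt_eqF.
Qed.

Lemma cosh_dist_gt0 a z : hplane a -> hplane z -> 0 < cosh_dist a z.
Proof.
rewrite /hplane /= => a0 z0; rewrite /cosh_dist divr_gt0 //; last by rewrite !mulr_gt0.
by rewrite ltr_wpDl ?exprn_gt0 // addr_ge0 // sqr_ge0.
Qed.

Lemma cosh_dist_sqrt a z : hplane a -> hplane z ->
  cosh_dist a z = Num.sqrt (1 + frame_x a z ^+ 2 + frame_y a z ^+ 2).
Proof.
by move=> a0 z0; rewrite -cosh_distE // sqrtr_sqr gtr0_norm // cosh_dist_gt0.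
Qed.

(** The inverse of the coordinates: a.2 * [uneta] is the height of the point. *)
Definition uneta (al be : R) : R := (Num.sqrt (1 + al ^+ 2 + be ^+ 2) - be)^-1.
Definition frame_inv a (al be : R) : R * R := (a.1 + a.2 * (al * uneta al be), a.2 * uneta al be).

Lemma sqrt_gt (al be : R) : be < Num.sqrt (1 + al ^+ 2 + be ^+ 2).
Proof.
have h : 0 <= 1 + al ^+ 2 + be ^+ 2 by rewrite addr_ge0 ?addr_ge0 ?sqr_ge0.
have h1 := sqr_sqrtr h; have h2 := sqrtr_ge0 (1 + al ^+ 2 + be ^+ 2).
have := sqr_ge0 al; nra.
Qed.

Lemma sqrt1_gt0 (al be : R) : 0 < Num.sqrt (1 + al ^+ 2 + be ^+ 2).
Proof. by rewrite sqrtr_gt0 ltr_wpDr ?sqr_ge0 // ltr_wpDr ?sqr_ge0. Qed.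

Lemma uneta_gt0 al be : 0 < uneta al be.
Proof. by rewrite invr_gt0 subr_gt0 sqrt_gt. Qed.

Lemma frame_inv_hplane a al be : hplane a -> hplane (frame_inv a al be).
Proof. by rewrite /hplane /= => a0; rewrite mulr_gt0 // uneta_gt0. Qed.

Lemma frame_inv_al a al be : hplane a -> frame_x a (frame_inv a al be) = al.
Proof.
rewrite /hplane /frame_x /= => a0; have := uneta_gt0 al be => e0; field.
by rewrite !gt_eqF.
Qed.

Lemma frame_inv_be a al be : hplane a -> frame_y a (frame_inv a al be) = be.
Proof.
rewrite /hplane /frame_y /= => a0; rewrite /uneta.
have h : 0 <= 1 + al ^+ 2 + be ^+ 2 by rewrite addr_ge0 ?addr_ge0 ?sqr_ge0.
have h1 := sqr_sqrtr h; have h2 := sqrt_gt al be.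
set s := Num.sqrt _ in h1 h2 *.
have hs : s - be != 0 by rewrite subr_eq0 gt_eqF.
have e : al ^+ 2 = s ^+ 2 - 1 - be ^+ 2 by rewrite h1; ring.
have -> : a.1 + a.2 * (al * (s - be)^-1) - a.1 = a.2 * al / (s - be) by ring.
rewrite !exprMn e; field.
by rewrite hs gt_eqF.
Qed.

Lemma frame_invK a z : hplane a -> hplane z -> frame_inv a (frame_x a z) (frame_y a z) = z.
Proof.
move=> a0 z0; rewrite /frame_inv /uneta -cosh_dist_sqrt //.
have -> : cosh_dist a z - frame_y a z = a.2 / z.2.
  rewrite /cosh_dist /frame_y; field; move: a0 z0; rewrite /hplane /= => a0 z0.
  by rewrite !gt_eqF.
move: a0 z0; rewrite /hplane /= => a0 z0.
case: z z0 => x y /= y0; rewrite /frame_x /=; congr pair; field; by rewrite !gt_eqF.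
Qed.

Lemma uneta_der al be :
  is_derive be (1:R) (fun be : R => uneta al be)
    (uneta al be / Num.sqrt (1 + al ^+ 2 + be ^+ 2)).
Proof.
have p : 0 < 1 + al ^+ 2 + be ^+ 2.
  by rewrite ltr_wpDr ?sqr_ge0 // ltr_wpDr ?sqr_ge0.
have h1 : is_derive be (1:R) (fun be : R => Num.sqrt (1 + al ^+ 2 + be ^+ 2))
    (be / Num.sqrt (1 + al ^+ 2 + be ^+ 2)).
  notypeclasses refine (deq _ _); first by der.
  by cbv beta; field; rewrite gt_eqF // sqrt1_gt0.
have h2 : Num.sqrt (1 + al ^+ 2 + be ^+ 2) - be != 0 by rewrite subr_eq0 gt_eqF // sqrt_gt.
rewrite /uneta; notypeclasses refine (deq _ _).
- notypeclasses refine (dinv _ _); first by der.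
  exact: h2.
- cbv beta; field; by rewrite h2 gt_eqF // sqrt1_gt0.
Qed.

Lemma uneta_cont (z : R * R) : {for z, continuous (fun z : R * R => uneta z.1 z.2)}.
Proof.
rewrite /uneta; cts; cbv beta.
by rewrite subr_eq0 gt_eqF // sqrt_gt.
Qed.

Lemma frame_inv_cont a (z : R * R) : {for z, continuous (fun z : R * R => frame_inv a z.1 z.2)}.
Proof.
apply: cpair; first by cts; exact: uneta_cont.
by cts; exact: uneta_cont.
Qed.

Lemma range_uneta (al : R) : range (uneta al) = [set y : R | 0 < y].
Proof.
apply/seteqP; split => [_ [be _ <-]|y /= y0]; first exact: uneta_gt0.
exists (((1 + al ^+ 2) * y - y^-1) / 2) => //.
rewrite /uneta.
have -> : 1 + al ^+ 2 + (((1 + al ^+ 2) * y - y^-1) / 2) ^+ 2 =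
  (((1 + al ^+ 2) * y + y^-1) / 2) ^+ 2 by field; rewrite gt_eqF.
rewrite sqrtr_sqr gtr0_norm.
  by rewrite -[RHS]invrK; congr (_^-1); field; rewrite gt_eqF.
rewrite divr_gt0 // addr_gt0 ?invr_gt0 // mulr_gt0 // ltr_wpDr ?sqr_ge0 //.
Qed.

(** Two one-dimensional substitutions: X = a.1 + Y al at a fixed height Y, then
    Y = a.2 * uneta al be for fixed al. *)
Lemma harea_frame a (F : R * R -> R) : hplane a ->
  (forall z, hplane z -> {for z, continuous F}) -> (forall z, hplane z -> 0 <= F z) ->
  harea_integral F =
  (\int[mu]_al \int[mu]_be (F (frame_inv a al be) / Num.sqrt (1 + al ^+ 2 + be ^+ 2))%:E)%E.
Proof.
move=> a0 cF F0; rewrite /harea_integral.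
have c1 z : hplane z -> {for z, continuous (fun z => F z / z.2 ^+ 2)}.
  move=> z0; apply: cmul; [exact: cF|cts].
  by rewrite expf_eq0 /= gt_eqF.
have p1 z : hplane z -> 0 <= F z / z.2 ^+ 2.
  by move=> z0; rewrite divr_ge0 ?F0 // sqr_ge0.
rewrite (hplane_tonelli c1 p1).
pose F1 (z : R * R) : R := F (a.1 + z.2 * z.1, z.2) / z.2.
have c2 z : hplane z -> {for z, continuous F1}.
  move=> z0; apply: cmul; last by cts; rewrite gt_eqF.
  cts; apply: (@ccomp2 _ _ F); [exact: cF|cts|cts].
have p2 z : hplane z -> 0 <= F1 z.
  by move=> z0; rewrite divr_ge0 ?F0 // ltW.
transitivity (\int[mu]_(y in [set y : R | (0 < y)%R]) \int[mu]_x (F1 (x, y))%:E)%E.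
  apply: eq_integral => y /set_mem /= y0.
  rewrite (@subst_affine _ _ y a.1).
  - apply: eq_integral => x _; congr EFin.
    rewrite /F1 /= addrC gtr0_norm //; field; by rewrite gt_eqF.
  - move=> x; cts; first by cts; apply: (@ccomp2 _ _ F); [exact: cF|cts|cts].
  - by move=> x; rewrite divr_ge0 ?F0 // sqr_ge0.
  - by rewrite gt_eqF.
rewrite (hplane_tonelli_sym c2 p2).
apply: eq_integral => al _.
have a20 : 0 < a.2 by [].
have rg : range (fun be => a.2 * uneta al be) = [set y : R | 0 < y].
  apply/seteqP; split => [_ [be _ <-]|y /= y0] /=.
    by rewrite mulr_gt0 // uneta_gt0.
  have : [set y : R | 0 < y] (y / a.2) by rewrite /= divr_gt0.
  rewrite -(range_uneta al) => -[be _ e]; exists be => //.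
  by rewrite e; field; rewrite gt_eqF.
have dF (be : R) : is_derive be (1:R) (fun be => a.2 * uneta al be)
    (a.2 * (uneta al be / Num.sqrt (1 + al ^+ 2 + be ^+ 2))).
  notypeclasses refine (deq (dmul (dcst _ _ _) (uneta_der al be)) _).
  by cbv beta; ring.
have cu : continuous (uneta al).
  by move=> be; exact: (is_derive_continuous1 (uneta_der al be)).
rewrite -rg (@subst_T _ _ _ (fun y => F1 (al, y)) dF).
- apply: eq_integral => be _; congr EFin; rewrite /F1 /frame_inv /=.
  have -> : a.2 * uneta al be * al = a.2 * (al * uneta al be) by ring.
  have := uneta_gt0 al be; have := sqrt1_gt0 al be => h1 h2.
  by field; rewrite !gt_eqF.
- move=> be; cts; [exact: cu | by rewrite gt_eqF // sqrt1_gt0].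
- by move=> be; rewrite mulr_gt0 // divr_gt0 ?uneta_gt0 ?sqrt1_gt0.
- rewrite rg => y y0.
  by cts; apply: (@ccomp2 _ _ F1); [exact: c2|cts|cts].
- by rewrite rg => y y0; exact: p2.
Qed.

(** A rotation is a product of shears, scalings and exchanges of the variables,
    so that affine substitutions and Tonelli suffice. The shears divide by n1,
    whence the separate case n1 = 0. *)
Lemma integral_rot (G : R * R -> R) (n1 n2 e1 e2 : R) :
  continuous G -> (forall z, 0 <= G z) ->
  `|e2 * n1 - e1 * n2| = 1 -> n1 ^+ 2 + n2 ^+ 2 = 1 -> n1 * e1 + n2 * e2 = 0 ->
  (\int[mu]_al \int[mu]_be (G (n1 * al + n2 * be, e1 * al + e2 * be)%R)%:E =
   \int[mu]_q \int[mu]_r (G (q, r))%:E)%E.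
Proof.
move=> cG G0 hd hn ho.
pose G1 (z : R * R) := G (n1 * z.1 + n2 * z.2, e1 * z.1 + e2 * z.2).
have cG1 : continuous G1.
  by move=> z; rewrite /G1; cts; apply: (@ccomp2 _ _ G); [exact: cG|cts|cts].
have [n10|n10] := eqVneq n1 0.
  have n20 : `|n2| = 1.
    apply/eqP; rewrite -(@eqrXn2 _ 2) // -normrX expr1n -hn n10 expr0n add0r.
    by rewrite ger0_norm // sqr_ge0.
  have n20' : n2 != 0 by rewrite -normr_eq0 n20 oner_eq0.
  have e20 : e2 = 0.
    by move: ho; rewrite n10 mul0r add0r => /eqP; rewrite mulf_eq0 (negbTE n20') /= => /eqP.
  have e10 : `|e1| = 1 by move: hd; rewrite n10 mulr0 add0r normrN normrM n20 mulr1.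
  have e10' : e1 != 0 by rewrite -normr_eq0 e10 oner_eq0.
  pose G2 (z : R * R) := G (z.1, e1 * z.2).
  have cG2 : continuous G2 by move=> z; rewrite /G2; cts; apply: (@ccomp2 _ _ G); [exact: cG|cts|cts].
  transitivity (\int[mu]_al \int[mu]_q (G2 (q, al))%:E)%E.
    apply: eq_integral => al _.
    rewrite [RHS](@subst_affine _ _ n2 0) //.
    - apply: eq_integral => be _; congr EFin.
      by rewrite /G2 /= n20 mulr1 n10 e20 !mul0r add0r !addr0.
    - by move=> q; cts; apply: (@ccomp2 _ _ G2); [exact: cG2|cts|cts].
    - by move=> q; exact: G0.
  transitivity (\int[mu]_q \int[mu]_al (G2 (q, al))%:E)%E.
    by apply: tonelli2 => // z; exact: G0.
  apply: eq_integral => q _.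
  rewrite [RHS](@subst_affine _ _ e1 0) //.
  - by apply: eq_integral => be _; congr EFin; rewrite /G2 /= e10 mulr1 addr0.
  - by move=> r; cts; apply: (@ccomp2 _ _ G); [exact: cG|cts|cts].
transitivity (\int[mu]_be \int[mu]_al (G1 (al, be))%:E)%E.
  by apply/esym/(tonelli2 cG1) => z; exact: G0.
pose D := e2 * n1 - e1 * n2.
have nn : `|n1| != 0 by rewrite normr_eq0.
pose G3 (z : R * R) := G (z.1, D / n1 * z.2 + e1 / n1 * z.1) / `|n1|.
have cG3 : continuous G3.
  by move=> z; rewrite /G3; cts; apply: (@ccomp2 _ _ G); [exact: cG|cts|cts].
have p3 z : 0 <= G3 z by rewrite divr_ge0.
transitivity (\int[mu]_be \int[mu]_q (G3 (q, be))%:E)%E.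
  apply: eq_integral => be _.
  rewrite [RHS](@subst_affine _ _ n1 (n2 * be)) //.
  - apply: eq_integral => al _; congr EFin.
    rewrite /G3 /G1 /= divfK //; congr (G (_, _)).
    by rewrite /D; field.
  - by move=> q; cts; apply: (@ccomp2 _ _ G3); [exact: cG3|cts|cts].
transitivity (\int[mu]_q \int[mu]_be (G3 (q, be))%:E)%E; first exact: tonelli2.
apply: eq_integral => q _.
rewrite [RHS](@subst_affine _ _ (D / n1) (e1 / n1 * q)) //.
- apply: eq_integral => be _; congr EFin.
  by rewrite /G3 /= normrM normrV ?unitfE // hd mul1r.
- by move=> r; cts; apply: (@ccomp2 _ _ G); [exact: cG|cts|cts].
- by rewrite mulf_neq0 ?invr_eq0 // -normr_eq0 hd oner_eq0.
Qed.

End Plane.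

(** * Real powers and the chain rule *)

Section Bernoulli.
Variable R : realType.
Implicit Types p a b : R.

Lemma powR_bernoulli p a : 1 <= p -> 0 <= a -> 1 + p * (a - 1) <= a `^ p.
Proof.
move=> p1 a0; have p0 : 0 < p by lra.
have := a0; rewrite le_eqVlt => /predU1P[<-|{}a0].
  by rewrite powR0 ?gt_eqF //; lra.
have [b0|b0] := leP (1 + p * (a - 1)) 0; first by rewrite (le_trans b0) // powR_ge0.
rewrite /powR gt_eqF // -[leLHS]lnK ?posrE // ler_expR.
set b := 1 + p * (a - 1) in b0 *.
have h1 := expR_ge1Dx (- ln a).
have h2 := expR_ge1Dx (ln b - ln a).
rewrite expRN lnK ?posrE // in h1.
rewrite expRB !lnK ?posrE // in h2.
have h3 : (p - 1) * a^-1 + b / a = p by rewrite /b; field; rewrite gt_eqF.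
have h4 : (p - 1) * (1 - ln a) <= (p - 1) * a^-1.
  by apply: ler_wpM2l h1; lra.
lra.
Qed.

(** The strict form carries the case of equality in Hoelder and hence in the
    theorem. *)
Lemma powR_bernoulli_lt p a : 1 < p -> 0 <= a -> a != 1 -> 1 + p * (a - 1) < a `^ p.
Proof.
move=> p1 a0 an1; have p0 : 0 < p by lra.
have := a0; rewrite le_eqVlt => /predU1P[<-|{}a0].
  by rewrite powR0 ?gt_eqF //; lra.
have [b0|b0] := leP (1 + p * (a - 1)) 0; first by rewrite (le_lt_trans b0) // powR_gt0.
rewrite /powR gt_eqF // -[ltLHS]lnK ?posrE // ltr_expR.
set b := 1 + p * (a - 1) in b0 *.
have lna : - ln a != 0 by rewrite oppr_eq0 ln_eq0.
have h1 := expR_gt1Dx lna.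
have h2 := expR_ge1Dx (ln b - ln a).
rewrite expRN lnK ?posrE // in h1.
rewrite expRB !lnK ?posrE // in h2.
have h3 : (p - 1) * a^-1 + b / a = p by rewrite /b; field; rewrite gt_eqF.
have h4 : (p - 1) * (1 - ln a) < (p - 1) * a^-1.
  by rewrite ltr_pM2l //; lra.
lra.
Qed.

(** Bernoulli applied to a * La. Keeping La explicit gives the optimal constant
    when La is the mass of the dual weight. *)
Lemma young p a La : 1 < p -> 0 <= a -> 0 < La ->
  a <= a `^ p * La `^ (p - 1) / p + (p - 1) / (p * La).
Proof.
move=> p1 a0 L0; have p0 : 0 < p by lra.
have := @powR_bernoulli p (a * La) (ltW p1) (mulr_ge0 a0 (ltW L0)).
rewrite powRM // ?(ltW L0) //.
have -> : La `^ p = La * La `^ (p - 1) by rewrite mulr_powRB1 // ltW.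
move=> h.
have e : a `^ p * La `^ (p - 1) / p + (p - 1) / (p * La) - a =
   (a `^ p * (La * La `^ (p - 1)) - (1 + p * (a * La - 1))) / (p * La).
  by field; rewrite !gt_eqF.
rewrite -subr_ge0 e; apply: divr_ge0; first by rewrite subr_ge0.
by rewrite mulr_ge0 // ltW.
Qed.

Lemma cpowR (T : topologicalType) (f : T -> R) (t : T) (p : R) : {for t, continuous f} ->
  0 < p -> (forall s, 0 <= f s) -> {for t, continuous (fun t => f t `^ p)}.
Proof.
move=> cf p0 f0; have := f0 t; rewrite le_eqVlt => /predU1P[ft|ft]; last first.
  have h : is_derive (f t) (1:R) (fun x : R => x `^ p) (p * f t `^ (p - 1)) by exact: is_derive1_powR.
  exact: (ccomp (is_derive_continuous1 h) cf).
apply/cvgrPdist_lt => e e0; rewrite -ft powR0 ?gt_eqF //.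
have d0 : 0 < e `^ p^-1 by rewrite powR_gt0.
near=> s.
have : `|f t - f s| < e `^ p^-1 by near: s; exact: (@cvgrPdist_lt _ _ _ _ _ _ _).1 cf _ d0.
rewrite -ft !sub0r !normrN ger0_norm ?f0 // ger0_norm ?powR_ge0 // => h.
have := gt0_ltr_powR p0 _ _ h; rewrite -powRrM mulVf ?gt_eqF // powRr1 ?(ltW e0) //.
by apply; rewrite ?nnegrE ?f0 // ltW.
Unshelve. all: by end_near. Qed.

End Bernoulli.

Section ChainC1.
Variable R : realType.
Implicit Types (z : R * R) (f : R * R -> R).

Lemma is_derive_dx f z d : is_derive z ((1, 0) : R * R) f d <->
  is_derive z.1 (1:R) (fun x : R => f (x, z.2)) d.
Proof.
rewrite is_derive_lineP [X in _ <-> X]is_derive_lineP.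
suff -> : (fun h : R => f (h *: ((1, 0) : R * R) + z)) =
   (fun h : R => f (h *: (1:R) + z.1, z.2)) by [].
apply/funext => h; congr f; case: z => x y /=.
by congr pair; rewrite /= scaler0 add0r.
Qed.

Lemma is_derive_dy f z d : is_derive z ((0, 1) : R * R) f d <->
  is_derive z.2 (1:R) (fun y : R => f (z.1, y)) d.
Proof.
rewrite is_derive_lineP [X in _ <-> X]is_derive_lineP.
suff -> : (fun h : R => f (h *: ((0, 1) : R * R) + z)) =
   (fun h : R => f (z.1, h *: (1:R) + z.2)) by [].
apply/funext => h; congr f; case: z => x y /=.
by congr pair; rewrite /= scaler0 add0r.
Qed.

Lemma mvt_abs (g dg : R -> R) (a b : R) :
  (forall x, `|x - a| <= `|b - a| -> is_derive x (1:R) g (dg x)) ->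
  exists2 c, `|c - a| <= `|b - a| & g b - g a = dg c * (b - a).
Proof.
move=> h; have [ab|ba] := leP a b.
  have h' x : x \in `[a, b]%R -> is_derive x (1:R) g (dg x).
    rewrite in_itv/= => /andP[h1 h2]; apply: h.
    by rewrite !ger0_norm ?subr_ge0 //; lra.
  have hin (x : R) : x \in `]a, b[%R -> x \in `[a, b]%R.
    by rewrite !in_itv/= => /andP[u1 u2]; rewrite !ltW.
  have cg : {within `[a, b], continuous g}.
    by apply: derivable_within_continuous => x hx; have [] := h' x hx.
  have [c hc e] := MVT_segment ab (fun x hx => h' x (hin x hx)) cg.
  exists c => //; move: hc; rewrite in_itv/= => /andP[h1 h2].
  by rewrite !ger0_norm ?subr_ge0 //; lra.
have h' x : x \in `[b, a]%R -> is_derive x (1:R) g (dg x).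
  rewrite in_itv/= => /andP[h1 h2]; apply: h.
  by rewrite !ler0_norm ?subr_le0 //; lra.
have hin (x : R) : x \in `]b, a[%R -> x \in `[b, a]%R.
  by rewrite !in_itv/= => /andP[u1 u2]; rewrite !ltW.
have cg : {within `[b, a], continuous g}.
  by apply: derivable_within_continuous => x hx; have [] := h' x hx.
have [c hc e] := MVT_segment (ltW ba) (fun x hx => h' x (hin x hx)) cg.
exists c; last by rewrite -opprB e; ring.
  move: hc; rewrite in_itv/= => /andP[h1 h2].
  by rewrite !ler0_norm ?subr_le0 //; lra.
Qed.

(** The increment of f is split into a horizontal and a vertical one, and the mean
    value theorem is applied to each. *)
Lemma chain_curve f (x y : R -> R) (t dx dy : R) :
  (forall z, hplane z -> is_derive z ((1, 0) : R * R) f (d_dx f z)) ->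
  (forall z, hplane z -> is_derive z ((0, 1) : R * R) f (d_dy f z)) ->
  (forall z, hplane z -> {for z, continuous (d_dx f)}) ->
  (forall z, hplane z -> {for z, continuous (d_dy f)}) ->
  0 < y t -> is_derive t (1:R) x dx -> is_derive t (1:R) y dy ->
  is_derive t (1:R) (fun s : R => f (x s, y s))
    (d_dx f (x t, y t) * dx + d_dy f (x t, y t) * dy).
Proof.
move=> hx hy cx cy yt0 hdx hdy.
have /is_derive1_caratheodory [gx [gxE cgx gxt]] := hdx.
have /is_derive1_caratheodory [gy [gyE cgy gyt]] := hdy.
set fx := d_dx f (x t, y t); set fy := d_dy f (x t, y t).
apply/is_derive1_caratheodory.
exists (fun s => if s == t then fx * dx + fy * dy else (f (x s, y s) - f (x t, y t)) / (s - t)).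
split; last by rewrite eqxx.
  move=> s; case: eqP => [->|/eqP st]; first by rewrite !subrr mulr0.
  by rewrite divfK // subr_eq0.
rewrite /prop_for /continuous_at eqxx.
apply/cvgrPdist_le => e e0.
pose M := `|dx| + `|dy| + 2.
have M0 : 0 < M by rewrite /M ltr_wpDl // addr_ge0.
pose e1 := e / (2 * M).
have e10 : 0 < e1 by rewrite divr_gt0 // mulr_gt0.
have zt : hplane (x t, y t) by [].
have Nx : nbhs (x t, y t) [set w | `|fx - d_dx f w| < e1].
  exact: (@cvgrPdist_lt _ _ _ _ _ _ _).1 (cx _ zt) e1 e10.
have /nbhs_ballP [r1 /= r10 h1] := Nx.
have Ny : nbhs (x t, y t) [set w | `|fy - d_dy f w| < e1].
  exact: (@cvgrPdist_lt _ _ _ _ _ _ _).1 (cy _ zt) e1 e10.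
have /nbhs_ballP [r2 /= r20 h2] := Ny.
pose r := Num.min (Num.min r1 r2) (y t).
have r0 : 0 < r by rewrite !lt_min r10 r20.
have cX : {for t, continuous x} by exact: is_derive_continuous1 hdx.
have cY : {for t, continuous y} by exact: is_derive_continuous1 hdy.
pose e2 := Num.min 1 (e / (2 * (`|fx| + `|fy| + 1))).
have ff0 : 0 < `|fx| + `|fy| + 1 by rewrite ltr_wpDl // addr_ge0.
have e20 : 0 < e2 by rewrite lt_min ltr01 divr_gt0 // mulr_gt0.
near=> s.
rewrite /=; have [est|st] := eqVneq s t; first by rewrite subrr normr0 ltW.
have s1 : `|x t - x s| < r by near: s; exact: (@cvgrPdist_lt _ _ _ _ _ _ _).1 cX r r0.
have s2 : `|y t - y s| < r by near: s; exact: (@cvgrPdist_lt _ _ _ _ _ _ _).1 cY r r0.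
have s3 : `|gx t - gx s| < e2 by near: s; exact: (@cvgrPdist_lt _ _ _ _ _ _ _).1 cgx e2 e20.
have s4 : `|gy t - gy s| < e2 by near: s; exact: (@cvgrPdist_lt _ _ _ _ _ _ _).1 cgy e2 e20.
have rr1 : r <= r1 by rewrite !ge_min lexx.
have rr2 : r <= r2 by rewrite !ge_min lexx orbT.
have rry : r <= y t by rewrite ge_min lexx orbT.
rewrite distrC in s1; rewrite distrC in s2.
have ys0 : 0 < y s.
  have := lt_le_trans s2 rry; rewrite ltr_norml => /andP[h _].
  by rewrite -(ltrD2r (- y t)) sub0r.
have [c1 hc1 E1] : exists2 c, `|c - x t| <= `|x s - x t| &
    f (x s, y s) - f (x t, y s) = d_dx f (c, y s) * (x s - x t).
  apply: (@mvt_abs (fun u => f (u, y s)) (fun u => d_dx f (u, y s))) => u _.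
  exact: (is_derive_dx f (u, y s) _).1 (hx (u, y s) ys0).
have [c2 hc2 E2] : exists2 c, `|c - y t| <= `|y s - y t| &
    f (x t, y s) - f (x t, y t) = d_dy f (x t, c) * (y s - y t).
  apply: (@mvt_abs (fun u => f (x t, u)) (fun u => d_dy f (x t, u))) => u hu.
  have u0 : 0 < u.
    have := le_lt_trans hu (lt_le_trans s2 rry); rewrite ltr_norml => /andP[h _].
    by rewrite -(ltrD2r (- y t)) sub0r.
  exact: (is_derive_dy f (x t, u) _).1 (hy (x t, u) u0).
have A : `|fx - d_dx f (c1, y s)| < e1.
  apply: h1; split; rewrite /ball /= distrC; last exact: lt_le_trans rr1.
  exact: le_lt_trans hc1 (lt_le_trans s1 rr1).
have B : `|fy - d_dy f (x t, c2)| < e1.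
  apply: h2; split; rewrite /ball /=; first by rewrite subrr normr0.
  by rewrite distrC; exact: le_lt_trans hc2 (lt_le_trans s2 rr2).
have -> : (f (x s, y s) - f (x t, y t)) / (s - t) =
    d_dx f (c1, y s) * gx s + d_dy f (x t, c2) * gy s.
  have -> : f (x s, y s) - f (x t, y t) = d_dx f (c1, y s) * (gx s * (s - t)) +
     d_dy f (x t, c2) * (gy s * (s - t)) by rewrite -gxE -gyE -E1 -E2; ring.
  by field; rewrite subr_eq0.
move: (d_dx f (c1, y s)) (d_dy f (x t, c2)) A B => A' B' A B.
rewrite -gxt -gyt.
have -> : fx * gx t + fy * gy t - (A' * gx s + B' * gy s) =
  fx * (gx t - gx s) + fy * (gy t - gy s) + ((fx - A') * gx s + (fy - B') * gy s) by ring.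
have e21 : e2 <= 1 by rewrite ge_min lexx.
have e22 : e2 <= e / (2 * (`|fx| + `|fy| + 1)) by rewrite ge_min lexx orbT.
have ngx : `|gx s| <= `|dx| + 1.
  have -> : gx s = gx t - (gx t - gx s) by ring.
  rewrite (le_trans (ler_normB _ _)) // gxt lerD2l -gxt; exact: (le_trans (ltW s3)).
have ngy : `|gy s| <= `|dy| + 1.
  have -> : gy s = gy t - (gy t - gy s) by ring.
  rewrite (le_trans (ler_normB _ _)) // gyt lerD2l -gyt; exact: (le_trans (ltW s4)).
have T1 : `|fx * (gx t - gx s) + fy * (gy t - gy s)| <= (`|fx| + `|fy|) * e2.
  rewrite (le_trans (ler_normD _ _)) // !normrM mulrDl lerD //.
    by apply: ler_wpM2l => //; exact: ltW.
  by apply: ler_wpM2l => //; exact: ltW.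
have T2 : `|(fx - A') * gx s + (fy - B') * gy s| <= e1 * (M).
  rewrite (le_trans (ler_normD _ _)) // !normrM /M.
  have -> : e1 * (`|dx| + `|dy| + 2) = e1 * (`|dx| + 1) + e1 * (`|dy| + 1) by ring.
  by rewrite lerD // ler_pM // ltW.
rewrite (le_trans (ler_normD _ _)) //.
have T3 : (`|fx| + `|fy|) * e2 <= e / 2.
  apply: (@le_trans _ _ ((`|fx| + `|fy| + 1) * (e / (2 * (`|fx| + `|fy| + 1))))).
    by apply: ler_pM => //; rewrite ?addr_ge0 ?lerDl // ltW.
  by rewrite le_eqVlt; apply/orP; left; apply/eqP; field; rewrite gt_eqF.
have T4 : e1 * M = e / 2 by rewrite /e1; field; rewrite gt_eqF.
apply: (le_trans (lerD T1 T2)); rewrite T4 [leRHS]splitr lerD2r; exact: T3.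
Unshelve. all: by end_near. Qed.

End ChainC1.

(** * Lower bound of the energy for a geodesic ball *)

Section Ray.
Variable R : realType.
Implicit Types p s La : R.

(** The dual weight of the radial problem outside a ball, in the variable t with
    sinh (distance) = s0 e^t. *)
Definition wball p s0 (t : R) : R :=
  expR ((p - 2) / (p - 1) * (ln s0 + t)) / Num.sqrt (1 + (s0 * expR t) ^+ 2).

Lemma sqrt1D_gt0 (x : R) : 0 < Num.sqrt (1 + x ^+ 2).
Proof. by rewrite sqrtr_gt0 ltr_wpDr ?sqr_ge0. Qed.

Lemma wball_cont p s0 : continuous (wball p s0).
Proof.
by move=> t; rewrite /wball; cts; rewrite gt_eqF // sqrt1D_gt0.
Qed.

(** On a ray parametrized by x the distance to the centre is arsinh (k x), so that
    e^t = k x / s0. *)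
Lemma ray_weight p s0 La (k x0 x1 : R) : 0 < s0 -> 0 < k -> k * x0 = s0 -> x0 <= x1 ->
  (forall T, 0 <= T -> sint 0 T (wball p s0) <= La) ->
  sint x0 x1 (fun x => expR ((p - 2) / (p - 1) * ln (k * x)) /
      (x * Num.sqrt (1 + (k * x) ^+ 2))) <= La.
Proof.
move=> s00 k0 kx x01 hLa.
have x00 : 0 < x0 by rewrite -(pmulr_rgt0 _ k0) kx.
have [W [dW WE]] := sint_prim (@wball_cont p s0).
have pos x : x0 <= x <= x1 -> 0 < x by move=> /andP[h _]; exact: lt_le_trans h.
set v := (fun x : R => _).
have h1 x : x0 <= x <= x1 -> {for x, continuous v}.
  move=> /pos x1p; rewrite /v; cts; first by rewrite mulr_gt0.
  by rewrite mulf_neq0 ?gt_eqF // sqrt1D_gt0.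
have h2 x : x0 <= x <= x1 -> is_derive x (1:R) (fun x : R => W (ln (k * x / s0))) (v x).
  move=> /pos xp.
  have kxs : 0 < k * x / s0 by rewrite divr_gt0 // mulr_gt0.
  notypeclasses refine (deq (dcomp (dW _) _) _).
    by der; exact: kxs.
  cbv beta; rewrite /wball /v.
  have -> : ln s0 + ln (k * x / s0) = ln (k * x).
    by rewrite -lnM ?posrE //; congr ln; field; rewrite gt_eqF.
  have -> : s0 * expR (ln (k * x / s0)) = k * x.
    by rewrite lnK ?posrE //; field; rewrite gt_eqF.
  have := sqrt1D_gt0 (k * x) => h.
  by field; rewrite !gt_eqF.
rewrite (sint_FTC x01 h1 h2).
have -> : ln (k * x0 / s0) = 0 by rewrite kx divff ?gt_eqF // ln1.
have T0 : 0 <= ln (k * x1 / s0).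
  by apply: ln_ge0; rewrite ler_pdivlMr // mul1r -kx ler_pM2l.
by rewrite -WE // hLa.
Qed.

(** The integral of - dphi is 1. Young, applied pointwise against the dual weight,
    bounds it by a multiple of the energy plus a multiple of La. *)
Lemma ray_young p s0 La (k x0 x1 : R) (A phi dphi : R -> R) :
  1 < p -> 0 < s0 -> 0 < k -> k * x0 = s0 -> x0 <= x1 -> 0 < La ->
  (forall T, 0 <= T -> sint 0 T (wball p s0) <= La) ->
  (forall x, x0 <= x <= x1 -> {for x, continuous (fun x => A x `^ p)}) ->
  (forall x, 0 <= A x) ->
  (forall x, x0 <= x <= x1 -> {for x, continuous dphi}) ->
  (forall x, x0 <= x <= x1 -> is_derive x (1:R) phi (dphi x)) ->
  (forall x, x0 <= x <= x1 -> `|dphi x| <= A x * k / Num.sqrt (1 + (k * x) ^+ 2)) ->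
  phi x0 = 1 -> phi x1 = 0 ->
  La `^ (1 - p) <= k ^+ 2 * sint x0 x1 (fun x => A x `^ p * (x / Num.sqrt (1 + (k * x) ^+ 2))).
Proof.
move=> p1 s00 k0 kx x01 La0 hLa cA A0 cdphi hphi hle e0 e1.
have x00 : 0 < x0 by rewrite -(pmulr_rgt0 _ k0) kx.
have pos x : x0 <= x <= x1 -> 0 < x by move=> /andP[h _]; exact: lt_le_trans h.
have p0 : 0 < p by lra.
have pm : 0 < p - 1 by lra.
have hw := @ray_weight p s0 La k x0 x1 s00 k0 kx x01 hLa.
set v := (fun x => _) in hw.
pose E x := A x `^ p * (x / Num.sqrt (1 + (k * x) ^+ 2)).
have cE x : x0 <= x <= x1 -> {for x, continuous E}.
  move=> hx; rewrite /E; cts; [exact: cA|by rewrite gt_eqF // sqrt1D_gt0].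
have cv x : x0 <= x <= x1 -> {for x, continuous v}.
  move=> /pos xp; rewrite /v; cts; first by rewrite mulr_gt0.
  by rewrite mulf_neq0 ?gt_eqF // sqrt1D_gt0.
have I1 : sint x0 x1 dphi = - 1.
  by rewrite (sint_FTC x01 cdphi hphi) e0 e1 sub0r.
pose c1 := La `^ (p - 1) / p * k ^+ 2; pose c2 := (p - 1) / (p * La).
have key x : x0 <= x <= x1 -> (-1) * dphi x <= c1 * E x + c2 * v x.
  move=> hx; have xp := pos _ hx.
  apply: (le_trans _ (_ : A x * k / Num.sqrt (1 + (k * x) ^+ 2) <= _)).
    apply: le_trans (hle x hx); rewrite mulN1r -normrN; exact: ler_norm.
  have kxp : 0 < k * x by rewrite mulr_gt0.
  have S0 := sqrt1D_gt0 (k * x).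
  pose b := (k * x) `^ (1 / (p - 1)).
  have b0 : 0 <= b by exact: powR_ge0.
  have Eb : expR ((p - 2) / (p - 1) * ln (k * x)) * b = k * x.
    rewrite /b /powR gt_eqF // -expRD -mulrDl.
    have -> : (p - 2) / (p - 1) + 1 / (p - 1) = 1 by field; rewrite gt_eqF.
    by rewrite mul1r lnK ?posrE.
  have Eb2 : expR ((p - 2) / (p - 1) * ln (k * x)) * b `^ p = (k * x) ^+ 2.
    rewrite /b -powRrM {1}/powR gt_eqF // -expRD -mulrDl.
    have -> : (p - 2) / (p - 1) + 1 / (p - 1) * p = 2 by field; rewrite gt_eqF.
    by rewrite mulrC -[2]/(2%:R) expRM_natr lnK ?posrE.
  have Y := @young R p (A x * b) La p1 (mulr_ge0 (A0 x) b0) La0.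
  rewrite powRM // in Y.
  have v0 : 0 <= v x by rewrite /v divr_ge0 ?expR_ge0 // mulr_ge0 ?ltW.
  have := ler_wpM2l v0 Y.
  have -> : v x * (A x * b) = A x * k / Num.sqrt (1 + (k * x) ^+ 2).
    transitivity (A x * (expR ((p - 2) / (p - 1) * ln (k * x)) * b) /
       (x * Num.sqrt (1 + (k * x) ^+ 2))); first by rewrite /v; ring.
    by rewrite Eb; field; rewrite !gt_eqF.
  move=> h; apply: (le_trans h).
  rewrite le_eqVlt; apply/orP; left; apply/eqP.
  transitivity (A x `^ p * La `^ (p - 1) / p * (expR ((p - 2) / (p - 1) * ln (k * x)) * b `^ p) /
       (x * Num.sqrt (1 + (k * x) ^+ 2)) + c2 * v x); first by rewrite /v /c2; ring.
  rewrite Eb2 /c1 /E; congr (_ + _); field; by rewrite !gt_eqF.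
have I2 : sint x0 x1 (fun x => (-1) * dphi x) <= sint x0 x1 (fun x => c1 * E x + c2 * v x).
  apply: sint_le => // x hx.
    by cts; exact: cdphi.
  by cts; [exact: cE|exact: cv].
rewrite sintZ // I1 sintD in I2; last 2 first.
  by move=> x hx; cts; exact: cE.
  by move=> x hx; cts; exact: cv.
rewrite !sintZ // in I2.
set J := sint x0 x1 E in I2.
have c20 : 0 <= c2 by rewrite divr_ge0 ?mulr_ge0 ?ltW.
have I3 : c2 * sint x0 x1 v <= c2 * La by exact: ler_wpM2l.
have e2 : c2 * La = 1 - p^-1 by rewrite /c2; field; rewrite !gt_eqF.
have I4 : p^-1 <= c1 * J by lra.
have La1 : 0 < La `^ (p - 1) by exact: powR_gt0.
have -> : La `^ (1 - p) = (La `^ (p - 1))^-1 by rewrite -powRN; congr powR; ring.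
rewrite -(ler_pM2l La1) divff ?gt_eqF //.
have -> : La `^ (p - 1) * (k ^+ 2 * J) = p * (c1 * J) by rewrite /c1; field; rewrite gt_eqF.
by rewrite -(mulVf (lt0r_neq0 p0)) mulrC ler_pM2l.
Qed.

End Ray.

Section Polar.
Variable R : realType.
Notation mu := (@lebesgue_measure R).
Implicit Types (x y m c : R).

Lemma measurable_inner (F : R * R -> R) : continuous F -> (forall z, 0 <= F z) ->
  measurable_fun setT (fun x => (\int[mu]_y (F (x, y))%:E)%E).
Proof.
move=> cF F0.
have mF : measurable_fun setT F.
  by apply: continuous_on_measurable2; [exact: openT | move=> z _; exact: cF].
apply: (@measurable_fun_fubini_tonelli_F _ _ _ _ _ mu (EFin \o F)).
- exact/measurable_EFinP.
- by move=> z; rewrite /= lee_fin.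
Qed.

(** The measure of the directions, in terms of their slopes m. *)
Lemma integral_inv1Dsqr c : 0 <= c ->
  ((2 * pi * c)%:E <= \int[mu]_m (2 * c / (1 + m ^+ 2))%:E)%E.
Proof.
move=> c0.
have d0 m : 0 < 1 + m ^+ 2 by rewrite ltr_wpDr ?sqr_ge0.
have ch : continuous (fun m : R => 2 * c / (1 + m ^+ 2)).
  by move=> m; cts; rewrite gt_eqF.
have h0 m : 0 <= 2 * c / (1 + m ^+ 2) by rewrite divr_ge0 ?mulr_ge0 // ltW.
have cv := cvg_integral_symm ch h0.
have <- := cvg_lim (@ereal_hausdorff R) cv.
have hd m : is_derive m (1:R) (fun m : R => 2 * c * atan m) (2 * c / (1 + m ^+ 2)).
  have h : is_derive m (1:R) (@atan R) (1 + m ^+ 2)^-1 by exact: is_derive1_atan.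
  notypeclasses refine (deq (dmul (dcst _ _ _) h) _); cbv beta.
  by rewrite mulr0 addr0.
have e n : (\int[mu]_(x in `[(- n.+1%:R)%R, n.+1%:R]) (2 * c / (1 + x ^+ 2))%:E)%E =
    (4 * c * atan n.+1%:R)%:E.
  rewrite sint_EFin; last by move=> x _; exact: ch.
  have n0 : - (n.+1%:R) <= n.+1%:R :> R.
    have h : (0 : R) < n.+1%:R by rewrite ltr0n.
    by lra.
  rewrite (sint_FTC n0 (fun x _ => ch x) (fun x _ => hd x)) atanN; congr EFin; ring.
have cv2 : ((4 * c * atan n.+1%:R)%:E @[n --> \oo] --> (2 * pi * c)%:E)%E.
  apply: cvg_EFin; first exact: nearW.
  have -> : 2 * pi * c = 4 * c * (pi / 2) by field.
  apply: cvgMr => /=.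
  have h := (cvg_pinftyP (@atan R) (pi / 2)).1 (@cvgy_atan R) (fun n => n.+1%:R).
  apply: h; apply/cvgryPge => A.
  near=> n; apply: (@le_trans _ _ n%:R); last by rewrite ler_nat.
  by near: n; exact: nbhs_infty_ger.
under eq_fun do rewrite e.
by rewrite (cvg_lim (@ereal_hausdorff R) cv2).
Unshelve. all: by end_near. Qed.

(** Polar coordinates with the slope m in the place of the angle, so that only
    affine substitutions are needed; a line consists of two rays, whence the
    factor 2. *)
Lemma polar_lower (G : R * R -> R) c : continuous G -> (forall z, 0 <= G z) -> 0 <= c ->
  (forall m, ((2 * c / (1 + m ^+ 2))%:E <= \int[mu]_x (G (x, m * x)%R * `|x|)%:E)%E) ->
  ((2 * pi * c)%:E <= \int[mu]_al \int[mu]_be (G (al, be))%:E)%E.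
Proof.
move=> cG G0 c0 hm.
pose G1 (z : R * R) : R := G (z.1, z.2 * z.1) * `|z.1|.
have cG1 : continuous G1.
  move=> z; rewrite /G1; cts.
    by cts; apply: (@ccomp2 _ _ G); [exact: cG|cts|cts].
  by apply: ccomp; [exact: norm_continuous|cts].
have G10 z : 0 <= G1 z by rewrite mulr_ge0.
pose G2 (z : R * R) : R := G1 (z.2, z.1).
have cG2 : continuous G2 by move=> z; cts; apply: (@ccomp2 _ _ G1); [exact: cG1|cts|cts].
apply: (@le_trans _ _ (\int[mu]_al \int[mu]_m (G1 (al, m))%:E)%E); last first.
  apply: ge0_le_integral => //.
  - by move=> x _; apply: integral_ge0 => y _; rewrite lee_fin.
  - exact: measurable_inner.
  - exact: measurable_inner.
  - move=> x _; have [->|x0] := eqVneq x 0.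
      rewrite (_ : (fun m => _) = cst 0%E) ?integral_cst ?mul0e //.
        by apply: integral_ge0 => y _; rewrite lee_fin.
      by apply/funext => m; rewrite /G1 /= normr0 mulr0.
    rewrite [leRHS](@subst_affine _ (fun y => G (x, y)) x 0) //.
      rewrite le_eqVlt; apply/orP; left; apply/eqP; apply: eq_integral => m _.
      by rewrite /G1 /= addr0 [m * x]mulrC.
    by move=> y; cts; apply: (@ccomp2 _ _ G); [exact: cG|cts|cts].
apply: (@le_trans _ _ (\int[mu]_m \int[mu]_al (G2 (m, al))%:E)%E); last first.
  rewrite le_eqVlt; apply/orP; left; apply/eqP.
  exact: (tonelli2 cG1).
apply: (le_trans (integral_inv1Dsqr c0)).
apply: ge0_le_integral => //.
- by move=> m _; rewrite lee_fin divr_ge0 ?mulr_ge0 // addr_ge0 // sqr_ge0.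
- apply/measurable_EFinP; apply: continuous_measurable_fun => m; cts.
  by rewrite gt_eqF // ltr_wpDr ?sqr_ge0.
- by apply: measurable_inner => // z; exact: G10.
Qed.

Lemma ge0_integral_two_segments (H : R -> R) (x0 x1 : R) : continuous H ->
  (forall x, 0 <= H x) -> 0 < x0 -> x0 <= x1 ->
  ((sint x0 x1 H + sint x0 x1 (fun x => H (- x)))%:E <= \int[mu]_x (H x)%:E)%E.
Proof.
move=> cH H0 x00 x01.
have cHN : continuous (fun x => H (- x)).
  by move=> x; apply: continuous_comp; [exact: opp_continuous|exact: cH].
have mH : measurable_fun setT (EFin \o H).
  by apply/measurable_EFinP; exact: continuous_measurable_fun.
have -> : sint x0 x1 (fun x => H (- x)) = sint (- x1) (- x0) H.
  apply: EFin_inj; rewrite -sint_EFin; last by move=> x _; exact: cHN.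
  rewrite -sint_EFin; last by move=> x _; exact: cH.
  by rewrite integration_by_substitution_oppr //; exact: continuous_subspaceT.
rewrite EFinD -sint_EFin; last by move=> x _; exact: cH.
rewrite -sint_EFin; last by move=> x _; exact: cH.
rewrite -ge0_integral_setU //=.
- by apply: ge0_subset_integral => //; [exact: measurableU|move=> x _; rewrite lee_fin].
- exact: measurable_funTS.
- by move=> x _; rewrite lee_fin.
- apply/disj_setPRL => x /=; rewrite !in_itv/= => /andP[h1 h2] /andP[h3 h4]; lra.
Qed.

End Polar.

Section BallLower.
Variable R : realType.
Notation mu := (@lebesgue_measure R).
Implicit Types (a : R * R).

Lemma hnorm_hgrad (f : R * R -> R) (z : R * R) : hplane z ->
  hnorm z (hgrad f z) = z.2 * Num.sqrt (d_dx f z ^+ 2 + d_dy f z ^+ 2).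
Proof.
move=> z0; have z20 : 0 < z.2 by [].
rewrite /hnorm /hmetric /hgrad /=.
have -> : (z.2 ^+ 2 * d_dx f z * (z.2 ^+ 2 * d_dx f z) +
     z.2 ^+ 2 * d_dy f z * (z.2 ^+ 2 * d_dy f z)) / z.2 ^+ 2 =
   z.2 ^+ 2 * (d_dx f z ^+ 2 + d_dy f z ^+ 2) by field; rewrite gt_eqF.
by rewrite sqrtrM ?sqr_ge0 // sqrtr_sqr gtr0_norm.
Qed.

Lemma cauchy2 (a1 a2 b1 b2 : R) :
  `|a1 * b1 + a2 * b2| <= Num.sqrt (a1 ^+ 2 + a2 ^+ 2) * Num.sqrt (b1 ^+ 2 + b2 ^+ 2).
Proof.
rewrite -sqrtrM ?addr_ge0 ?sqr_ge0 // -sqrtr_sqr ler_wsqrtr //.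
have -> : (a1 ^+ 2 + a2 ^+ 2) * (b1 ^+ 2 + b2 ^+ 2) =
  (a1 * b1 + a2 * b2) ^+ 2 + (a1 * b2 - a2 * b1) ^+ 2 by ring.
by rewrite lerDl sqr_ge0.
Qed.

(** The height, divided by a.2, of the radial geodesic from a whose coordinates
    are (n1 x, n2 x), where k is the norm of (n1, n2). *)
Definition rayU (n2 k x : R) : R := (Num.sqrt (1 + (k * x) ^+ 2) - n2 * x)^-1.
Definition rayU' (n2 k x : R) : R :=
  rayU n2 k x ^+ 2 * (n2 - k ^+ 2 * x / Num.sqrt (1 + (k * x) ^+ 2)).

Lemma uneta_ray (n1 n2 k x : R) : n1 ^+ 2 + n2 ^+ 2 = k ^+ 2 ->
  uneta (n1 * x) (n2 * x) = rayU n2 k x.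
Proof.
move=> h; rewrite /uneta /rayU; congr (Num.sqrt _ - _)^-1.
by rewrite !exprMn -h; ring.
Qed.

Lemma rayU_pos (n1 n2 k x : R) : n1 ^+ 2 + n2 ^+ 2 = k ^+ 2 ->
  0 < Num.sqrt (1 + (k * x) ^+ 2) - n2 * x.
Proof. by move=> h; rewrite -invr_gt0 -/(rayU n2 k x) -(uneta_ray _ h) uneta_gt0. Qed.

Lemma rayU_der (n1 n2 k x : R) : n1 ^+ 2 + n2 ^+ 2 = k ^+ 2 ->
  is_derive x (1:R) (fun x : R => rayU n2 k x) (rayU' n2 k x).
Proof.
move=> h; have p := rayU_pos x h.
have q : 0 < 1 + (k * x) ^+ 2 by rewrite ltr_wpDr ?sqr_ge0.
have S0 : 0 < Num.sqrt (1 + (k * x) ^+ 2) by rewrite sqrtr_gt0.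
rewrite /rayU; notypeclasses refine (deq _ _).
  der; [exact: q | by rewrite gt_eqF].
cbv beta; rewrite /rayU' /rayU; field.
by rewrite !gt_eqF.
Qed.

(** The speed of the ray is the derivative of arsinh (k x). *)
Lemma ray_speed (a2 n1 n2 k x : R) : 0 < a2 -> 0 < k -> n1 ^+ 2 + n2 ^+ 2 = k ^+ 2 ->
  Num.sqrt ((a2 * (n1 * (rayU n2 k x + x * rayU' n2 k x))) ^+ 2 + (a2 * rayU' n2 k x) ^+ 2) =
  a2 * rayU n2 k x * k / Num.sqrt (1 + (k * x) ^+ 2).
Proof.
move=> a0 k0 h; have p := rayU_pos x h.
have q : 0 <= 1 + (k * x) ^+ 2 by rewrite addr_ge0 ?sqr_ge0.
have S0 : 0 < Num.sqrt (1 + (k * x) ^+ 2) by rewrite sqrtr_gt0 ltr_wpDr ?sqr_ge0.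
have S2 := sqr_sqrtr q.
rewrite /rayU' /rayU.
set S := Num.sqrt (1 + (k * x) ^+ 2) in p S0 S2 *.
apply/eqP; rewrite -(@eqrXn2 _ 2) ?sqrtr_ge0 //; last first.
  by rewrite divr_ge0 ?(ltW S0) // mulr_ge0 ?(ltW k0) // mulr_ge0 ?(ltW a0) // invr_ge0 ltW.
rewrite sqr_sqrtr ?addr_ge0 ?sqr_ge0 //.
have en : n1 ^+ 2 = k ^+ 2 - n2 ^+ 2 by rewrite -h; ring.
have ex : (k * x) ^+ 2 = S ^+ 2 - 1 by rewrite S2; ring.
apply/eqP.
have -> : (a2 * (n1 * ((S - n2 * x)^-1 + x * ((S - n2 * x)^-1 ^+ 2 * (n2 - k ^+ 2 * x / S))))) ^+ 2 =
   a2 ^+ 2 * n1 ^+ 2 * ((S ^+ 2 - (k * x) ^+ 2) / (S * (S - n2 * x) ^+ 2)) ^+ 2.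
  by field; rewrite !gt_eqF.
rewrite ex en.
have -> : (a2 * ((S - n2 * x)^-1 ^+ 2 * (n2 - k ^+ 2 * x / S))) ^+ 2 =
   a2 ^+ 2 * (n2 ^+ 2 * S ^+ 2 - 2 * n2 * S * k ^+ 2 * x + k ^+ 2 * (k * x) ^+ 2) / (S ^+ 2 * (S - n2 * x) ^+ 4).
  by field; rewrite !gt_eqF.
rewrite ex.
have -> : (a2 * (S - n2 * x)^-1 * k / S) ^+ 2 =
   a2 ^+ 2 * (k ^+ 2 * S ^+ 2 - 2 * n2 * S * k ^+ 2 * x + n2 ^+ 2 * (k * x) ^+ 2) / (S ^+ 2 * (S - n2 * x) ^+ 4).
  by field; rewrite !gt_eqF.
rewrite ex; field.
by rewrite !gt_eqF.
Qed.

Lemma hsmooth_C1 (f : R * R -> R) : hsmooth f ->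
  [/\ forall z, hplane z -> is_derive z ((1, 0) : R * R) f (d_dx f z),
      forall z, hplane z -> is_derive z ((0, 1) : R * R) f (d_dy f z),
      forall z, hplane z -> {for z, continuous (d_dx f)}
    & forall z, hplane z -> {for z, continuous (d_dy f)}].
Proof.
move=> /(_ 1%N) /= [h1 h2 h3 h4]; split => //.
  by move=> z /h2 [h _]; exact: derivableP.
by move=> z /h2 [_ h]; exact: derivableP.
Qed.

Definition gradp (p : R) (f : R * R -> R) (z : R * R) : R :=
  hnorm z (hgrad f z) `^ p.

Lemma hnorm_ge0 (z v : R * R) : 0 <= hnorm z v.
Proof. exact: sqrtr_ge0. Qed.

Lemma gradp_cont p f z : hsmooth f -> 0 < p -> hplane z -> {for z, continuous (gradp p f)}.
Proof.
move=> sf p0 z0; have [_ _ cx cy] := hsmooth_C1 sf.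
apply: cpowR => //; last by move=> ?; exact: hnorm_ge0.
rewrite /hnorm /hmetric /hgrad /=.
have zn : z.2 ^+ 2 != 0 by rewrite expf_neq0 // gt_eqF.
have := cx _ z0; have := cy _ z0; move: (d_dx f) (d_dy f) => u v cu cv.
by ctsh.
Qed.

Lemma compact_max (T : topologicalType) (C : set T) (f : T -> R) : compact C -> C !=set0 ->
  (forall z, C z -> {for z, continuous f}) ->
  exists2 c, C c & forall z, C z -> f z <= f c.
Proof.
move=> cC C0 cf.
have [|c /set_mem Cc h] := @compact_EVT_max T R f C C0 cC.
  by apply: continuous_in_subspaceT => z /set_mem; exact: cf.
by exists c => // z Cz; apply: h; exact: mem_set.
Qed.

Lemma cosh_dist_frame_inv a al be : hplane a ->
  cosh_dist a (frame_inv a al be) = Num.sqrt (1 + al ^+ 2 + be ^+ 2).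
Proof.
by move=> a0; rewrite cosh_dist_sqrt ?frame_inv_al ?frame_inv_be //; exact: frame_inv_hplane.
Qed.

Lemma cosh_dist_cont a z : hplane a -> hplane z -> {for z, continuous (cosh_dist a)}.
Proof.
move=> a0 z0; rewrite /cosh_dist; cts.
by rewrite !mulf_neq0 // gt_eqF.
Qed.

(** By Cauchy-Schwarz the derivative of f along a ray is at most the norm of the
    gradient times the speed, as [ray_young] requires. *)
Lemma ray_bound p (s0 La : R) a (f : R * R -> R) (n1 n2 k x0 x1 : R) :
  1 < p -> 0 < s0 -> 0 < La -> hplane a ->
  (forall T, 0 <= T -> sint 0 T (wball p s0) <= La) ->
  hsmooth f -> 0 < k -> n1 ^+ 2 + n2 ^+ 2 = k ^+ 2 -> k * x0 = s0 -> x0 <= x1 ->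
  f (frame_inv a (n1 * x0) (n2 * x0)) = 1 -> f (frame_inv a (n1 * x1) (n2 * x1)) = 0 ->
  La `^ (1 - p) <= k ^+ 2 * sint x0 x1 (fun x =>
     gradp p f (frame_inv a (n1 * x) (n2 * x)) * (x / Num.sqrt (1 + (k * x) ^+ 2))).
Proof.
move=> p1 s00 La0 a0 hLa sf k0 hn kx x01 e0 e1.
have [hx hy cx cy] := hsmooth_C1 sf.
have p0 : 0 < p by lra.
have a20 : 0 < a.2 by [].
pose xc (x : R) := a.1 + a.2 * (n1 * x * rayU n2 k x).
pose yc (x : R) := a.2 * rayU n2 k x.
have cE x : frame_inv a (n1 * x) (n2 * x) = (xc x, yc x).
  by rewrite /frame_inv (uneta_ray _ hn).
have yc0 x : 0 < yc x.
  by rewrite mulr_gt0 // invr_gt0; exact: (rayU_pos x hn).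
pose dX (x : R) := a.2 * (n1 * (rayU n2 k x + x * rayU' n2 k x)).
pose dY (x : R) := a.2 * rayU' n2 k x.
have hX x : is_derive x (1:R) xc (dX x).
  have hU := rayU_der x hn.
  rewrite /xc; notypeclasses refine (deq _ _); first by der.
  by cbv beta; rewrite /dX; ring.
have hY x : is_derive x (1:R) yc (dY x).
  have hU := rayU_der x hn.
  rewrite /yc; notypeclasses refine (deq _ _); first by der.
  by cbv beta; rewrite /dY; ring.
have cU x : {for x, continuous (fun x : R => rayU n2 k x)}.
  exact: is_derive_continuous1 (rayU_der x hn).
have cU' x : {for x, continuous (fun x : R => rayU' n2 k x)}.
  rewrite /rayU'; cts; first exact: cU.
  by rewrite gt_eqF // sqrt1D_gt0.
have cxc x : {for x, continuous xc} by exact: is_derive_continuous1 (hX x).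
have cyc x : {for x, continuous yc} by exact: is_derive_continuous1 (hY x).

pose A x := hnorm (xc x, yc x) (hgrad f (xc x, yc x)).
pose dphi x := d_dx f (xc x, yc x) * dX x + d_dy f (xc x, yc x) * dY x.
have cF (F : R * R -> R) x : (forall z, hplane z -> {for z, continuous F}) ->
    {for x, continuous (fun x : R => F (xc x, yc x))}.
  by move=> h; apply: (@ccomp2 _ _ F); [apply: h; exact: yc0 | exact: cxc | exact: cyc].
have -> : sint x0 x1 (fun x => gradp p f (frame_inv a (n1 * x) (n2 * x)) *
     (x / Num.sqrt (1 + (k * x) ^+ 2))) =
   sint x0 x1 (fun x => A x `^ p * (x / Num.sqrt (1 + (k * x) ^+ 2))).
  by apply: eq_sint => x _; rewrite cE.
apply: (@ray_young _ p s0 La k x0 x1 A (fun x => f (xc x, yc x)) dphi) => //.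
- by move=> x _; apply: (cF (gradp p f)) => z; exact: gradp_cont.
- by move=> x; exact: hnorm_ge0.
- move=> x _; rewrite /dphi; cts; [exact: (cF (d_dx f)) | | exact: (cF (d_dy f)) | ].
    by rewrite /dX; cts; [exact: cU|exact: cU'].
  by rewrite /dY; cts; exact: cU'.
- by move=> x _; exact: (chain_curve hx hy cx cy (yc0 x) (hX x) (hY x)).
- move=> x _; rewrite /dphi.
  apply: (le_trans (cauchy2 _ _ _ _)).
  rewrite /dX /dY (ray_speed x a20 k0 hn) /A hnorm_hgrad; last exact: yc0.
  by rewrite /= /yc le_eqVlt; apply/orP; left; apply/eqP; ring.
- by rewrite -cE.
- by rewrite -cE.
Qed.

(** [ray_bound] on both halves of every line through a, integrated over the slopes.
    The compact support of f provides the far end points x1 of the rays. *)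
Lemma ball_lower p (s0 La : R) a (f : R * R -> R) : 1 < p -> 0 < s0 -> 0 < La -> hplane a ->
  (forall T, 0 <= T -> sint 0 T (wball p s0) <= La) ->
  hsmooth f -> hcompact_support f ->
  (forall z, hplane z -> frame_x a z ^+ 2 + frame_y a z ^+ 2 <= s0 ^+ 2 -> f z = 1) ->
  ((2 * pi * La `^ (1 - p))%:E <= harea_integral (gradp p f))%E.
Proof.
move=> p1 s00 La0 a0 hLa sf [C [cC CH fC]] f1.
have p0 : 0 < p by lra.
rewrite (@harea_frame _ a) //; last 2 first.
  by move=> z; exact: gradp_cont.
  by move=> z _; exact: powR_ge0.
pose G (z : R * R) : R := gradp p f (frame_inv a z.1 z.2) / Num.sqrt (1 + z.1 ^+ 2 + z.2 ^+ 2).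
have cG : continuous G.
  move=> z.
  have c1 : {for z, continuous (fun z : R * R => gradp p f (frame_inv a z.1 z.2))}.
    apply: (@continuous_comp _ _ _ (fun z : R * R => frame_inv a z.1 z.2) (gradp p f)).
      exact: frame_inv_cont.
    by apply: gradp_cont => //; exact: frame_inv_hplane.
  have n0 : Num.sqrt (1 + z.1 ^+ 2 + z.2 ^+ 2) != 0 by rewrite gt_eqF // sqrt1_gt0.
  by apply: (cmul _ _ _ c1); cts.
have G0 z : 0 <= G z by rewrite divr_ge0 ?powR_ge0 // ltW // sqrt1_gt0.
apply: (@polar_lower _ G) => //; first exact: powR_ge0.
have [M [M0 hM]] : exists M : R, 0 <= M /\ forall z, C z -> cosh_dist a z <= M.
  have [->|/set0P Cn0] := eqVneq C set0; first by exists 0.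
  have [w Cw hw] := compact_max cC Cn0 (fun z Cz => cosh_dist_cont a0 (CH z Cz)).
  exists (cosh_dist a w); split => //.
  by apply: ltW; apply: cosh_dist_gt0 => //; exact: CH.
move=> m; pose k := Num.sqrt (1 + m ^+ 2).
have k0 : 0 < k by exact: sqrt1D_gt0.
have k2 : k ^+ 2 = 1 + m ^+ 2 by rewrite sqr_sqrtr // addr_ge0 ?sqr_ge0.
pose x0 := s0 / k; pose x1 := x0 + M / k.
have kx0 : k * x0 = s0 by rewrite /x0; field; rewrite gt_eqF.
have kx1 : k * x1 = s0 + M by rewrite /x1 /x0; field; rewrite gt_eqF.
have x00 : 0 < x0 by rewrite divr_gt0.
have x01 : x0 <= x1 by rewrite lerDl divr_ge0 // ltW.
have ray (n1 n2 : R) : n1 ^+ 2 + n2 ^+ 2 = k ^+ 2 ->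
   La `^ (1 - p) / k ^+ 2 <= sint x0 x1 (fun x =>
     gradp p f (frame_inv a (n1 * x) (n2 * x)) * (x / Num.sqrt (1 + (k * x) ^+ 2))).
  move=> hn; rewrite ler_pdivrMr ?exprn_gt0 // mulrC.
  apply: (@ray_bound p s0 La a f n1 n2 k x0 x1) => //.
    apply: f1; first exact: frame_inv_hplane.
    rewrite frame_inv_al // frame_inv_be //.
    have -> : (n1 * x0) ^+ 2 + (n2 * x0) ^+ 2 = (n1 ^+ 2 + n2 ^+ 2) * x0 ^+ 2 by ring.
    by rewrite hn -exprMn kx0.
  apply: fC; first exact: frame_inv_hplane.
  move=> /hM; rewrite cosh_dist_frame_inv // leNgt; apply/negP; rewrite negbK.
  have -> : 1 + (n1 * x1) ^+ 2 + (n2 * x1) ^+ 2 = 1 + (s0 + M) ^+ 2.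
    have -> : (s0 + M) ^+ 2 = (n1 ^+ 2 + n2 ^+ 2) * x1 ^+ 2 by rewrite -kx1 hn; ring.
    by ring.
  have hMs : Num.sqrt (M ^+ 2) = M by rewrite sqrtr_sqr ger0_norm.
  rewrite -[ltLHS]hMs ltr_sqrt; first by nra.
  by rewrite ltr_wpDr ?sqr_ge0.
pose H (x : R) := G (x, m * x) * `|x|.
have cH : continuous H.
  move=> x; rewrite /H; cts; first by apply: (@ccomp2 _ _ G); [exact: cG|cts|cts].
  by apply: ccomp; [exact: norm_continuous|cts].
have H0 x : 0 <= H x by rewrite mulr_ge0.
apply: le_trans (ge0_integral_two_segments cH H0 x00 x01).
rewrite lee_fin -k2.
have -> : 2 * La `^ (1 - p) / k ^+ 2 = La `^ (1 - p) / k ^+ 2 + La `^ (1 - p) / k ^+ 2 by ring.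
have HE (s : R) : s ^+ 2 = 1 -> sint x0 x1 (fun x => H (s * x)) = sint x0 x1 (fun x =>
     gradp p f (frame_inv a (s * x) (s * m * x)) * (x / Num.sqrt (1 + (k * x) ^+ 2))).
  move=> s2; apply: eq_sint => x /andP[xx _].
  have x_gt0 : 0 < x by exact: lt_le_trans xx.
  have -> : H (s * x) = G (s * x, s * m * x) * x.
    rewrite /H; congr (G (_, _) * _); first by ring.
    rewrite normrM [`|x|]gtr0_norm // (_ : `|s| = 1) ?mul1r //.
    by apply/eqP; rewrite -(@eqrXn2 _ 2) // -normrX s2 normr1 expr1n.
  rewrite /G /=.
  have -> : 1 + (s * x) ^+ 2 + (s * m * x) ^+ 2 = 1 + (k * x) ^+ 2.
    by rewrite !exprMn k2 s2; ring.
  by ring.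
apply: lerD.
  have -> : sint x0 x1 H = sint x0 x1 (fun x => H (1 * x)).
    by apply: eq_sint => x _; rewrite mul1r.
  rewrite HE ?expr1n //; apply: ray.
  by rewrite k2 mul1r expr1n.
have -> : sint x0 x1 (fun x => H (- x)) = sint x0 x1 (fun x => H ((-1) * x)).
  by apply: eq_sint => x _; rewrite mulN1r.
rewrite HE ?sqrrN ?expr1n //; apply: ray.
by rewrite k2 mulN1r !sqrrN expr1n.
Qed.

End BallLower.

(** * Geodesics *)

Section Hyp.
Variable R : realType.
Implicit Types x y d : R.

Definition sh x : R := (expR x - expR (- x)) / 2.
Definition ch x : R := (expR x + expR (- x)) / 2.
Definition arsh x : R := ln (x + Num.sqrt (1 + x ^+ 2)).

Lemma ch2 x : ch x ^+ 2 = 1 + sh x ^+ 2.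
Proof.
rewrite /ch /sh expRN; have := expR_gt0 x => h; field; by rewrite gt_eqF.
Qed.

Lemma ch_gt0 x : 0 < ch x.
Proof. by rewrite /ch divr_gt0 // addr_gt0 // expR_gt0. Qed.

Lemma dsh x : is_derive x (1:R) (fun x : R => sh x) (ch x).
Proof. rewrite /sh; dert; rewrite /ch; ring. Qed.
Lemma dch x : is_derive x (1:R) (fun x : R => ch x) (sh x).
Proof. rewrite /ch; dert; rewrite /sh; ring. Qed.

Lemma arsh_arg_gt0 x : 0 < x + Num.sqrt (1 + x ^+ 2).
Proof.
have h : 0 <= 1 + x ^+ 2 by rewrite addr_ge0 ?sqr_ge0.
have h1 := sqr_sqrtr h; have h2 := sqrt1D_gt0 x.
nra.
Qed.

Lemma sh_arsh x : sh (arsh x) = x.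
Proof.
have h : 0 <= 1 + x ^+ 2 by rewrite addr_ge0 ?sqr_ge0.
have h1 := sqr_sqrtr h; have h2 := arsh_arg_gt0 x.
rewrite /sh /arsh expRN lnK ?posrE //.
set S := Num.sqrt _ in h1 h2 *.
apply: (@mulIf _ (2 * (x + S))); first by rewrite mulf_neq0 ?gt_eqF.
have -> : (x + S - (x + S)^-1) / 2 * (2 * (x + S)) = (x + S) ^+ 2 - 1.
  by field; rewrite gt_eqF.
by rewrite sqrrD h1; ring.
Qed.

Lemma sh0 : sh 0 = 0.
Proof. by rewrite /sh oppr0 subrr mul0r. Qed.

Lemma sh_lt x y : x < y -> sh x < sh y.
Proof.
move=> xy; rewrite /sh ltr_pM2r // ltrB //.
  by rewrite ltr_expR.
by rewrite ltr_expR ltrN2.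
Qed.

Lemma sh_le x y : x <= y -> sh x <= sh y.
Proof. by rewrite le_eqVlt => /predU1P[->//|/sh_lt/ltW]. Qed.

Lemma sh_inj : injective sh.
Proof.
move=> x y e; case: (ltgtP x y) => // /sh_lt; by rewrite e ltxx.
Qed.

Lemma arsh_sh x : arsh (sh x) = x.
Proof. by apply: sh_inj; rewrite sh_arsh. Qed.

Lemma arsh0 : arsh 0 = 0.
Proof. by apply: sh_inj; rewrite sh_arsh sh0. Qed.

Lemma arsh_le x y : x <= y -> arsh x <= arsh y.
Proof.
move=> xy; rewrite leNgt; apply/negP => /sh_lt; rewrite !sh_arsh; lra.
Qed.

Lemma arsh_lt x y : x < y -> arsh x < arsh y.
Proof.
move=> xy; rewrite ltNge; apply/negP => /sh_le; rewrite !sh_arsh; lra.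
Qed.

Lemma darsh x : is_derive x (1:R) (fun x : R => arsh x) (Num.sqrt (1 + x ^+ 2))^-1.
Proof.
have h : 0 < 1 + x ^+ 2 by rewrite ltr_wpDr ?sqr_ge0.
have h0 := sqrt1D_gt0 x.
rewrite /arsh; notypeclasses refine (deq _ _).
  der; [exact: arsh_arg_gt0 | exact: h].
cbv beta; field.
by rewrite !gt_eqF //; [exact: arsh_arg_gt0].
Qed.

Lemma cls1_derive1n (f : R -> R) : (forall n, cls1 setT n f) ->
  forall n t, derivable (derive1n n f) t 1.
Proof.
move=> h n; elim: n f h => [|n ih] f h t.
  by rewrite derive1n0; have [] := cls1_der (h 1%N) (I : setT t).
rewrite derive1Sn; apply: ih => m.
have -> : derive1 f = 'D_1 f by apply/funext => x; rewrite derive1E.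
by have [_ /(_ 1 erefl) []] := h m.+1.
Qed.

Lemma cls1_sh n : cls1 setT n sh.
Proof.
have cN : cls1 setT n (fun x : R => - x).
  apply: (@cls_ext _ _ _ _ _ (fun x : R => (-1) * x)); first exact: openT.
    by move=> x _; rewrite mulN1r.
  apply: cls_mul; [exact: openT|by apply: cls_cst; exact: openT|by apply: cls1_id; exact: openT].
have cEN : cls1 setT n (fun x : R => expR (- x)).
  by apply: (@cls_comp _ _ _ _ setT _ expR) => //; [exact: openT|exact: cls1_expR].
apply: (@cls_mul _ _ _ _ _ _ (fun=> 2^-1)); first exact: openT.
  apply: cls_add; [exact: openT|exact: cls1_expR|].
  apply: (@cls_ext _ _ _ _ _ (fun x : R => (-1) * expR (- x))); first exact: openT.
    by move=> x _; rewrite mulN1r.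
  by apply: cls_mul => //; [exact: openT|apply: cls_cst; exact: openT].
by apply: cls_cst; exact: openT.
Qed.

Lemma cls1_ch n : cls1 setT n ch.
Proof.
have h := cls1_sh n.+1.
have [_ /(_ 1 erefl) [_ h2]] := h.
apply: cls_ext h2; first exact: openT.
by move=> x _; have [_ ->] := dsh x.
Qed.

End Hyp.

Section Geod.
Variable R : realType.
Implicit Types (a z : R * R) (n d s t : R).

Definition geoU n2 d s : R := (ch (d * s) - n2 * sh (d * s))^-1.
Definition geoV n2 d s : R := sh (d * s) - n2 * ch (d * s).
(** The geodesic that leaves a at speed d in the direction (n1, n2). *)
Definition geod a n1 n2 d s : R * R :=
  (a.1 + a.2 * (n1 * sh (d * s) * geoU n2 d s), a.2 * geoU n2 d s).

Lemma sqrt_ch (x : R) n1 n2 : n1 ^+ 2 + n2 ^+ 2 = 1 ->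
  Num.sqrt (1 + (n1 * sh x) ^+ 2 + (n2 * sh x) ^+ 2) = ch x.
Proof.
move=> h; have -> : 1 + (n1 * sh x) ^+ 2 + (n2 * sh x) ^+ 2 = 1 + (n1 ^+ 2 + n2 ^+ 2) * sh x ^+ 2.
  by ring.
by rewrite h mul1r -ch2 sqrtr_sqr gtr0_norm // ch_gt0.
Qed.

Lemma geodE a n1 n2 d s : n1 ^+ 2 + n2 ^+ 2 = 1 ->
  geod a n1 n2 d s = frame_inv a (n1 * sh (d * s)) (n2 * sh (d * s)).
Proof. by move=> h; rewrite /geod /frame_inv /uneta sqrt_ch. Qed.

Lemma geoU_pos n1 n2 d s : n1 ^+ 2 + n2 ^+ 2 = 1 -> 0 < ch (d * s) - n2 * sh (d * s).
Proof.
move=> h; rewrite -(sqrt_ch (d * s) h) -invr_gt0; exact: uneta_gt0.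
Qed.

Lemma cls1_lin (n : nat) d : cls1 setT n (fun s : R => d * s).
Proof.
by apply: cls_mul; [exact: openT|apply: cls_cst; exact: openT|apply: cls1_id; exact: openT].
Qed.

Lemma cls1_shd (n : nat) d : cls1 setT n (fun s : R => sh (d * s)).
Proof. by apply: (@cls_comp _ _ _ _ setT _ (@sh R)) => //; [exact: openT|exact: cls1_sh|exact: cls1_lin]. Qed.

Lemma cls1_chd (n : nat) d : cls1 setT n (fun s : R => ch (d * s)).
Proof. by apply: (@cls_comp _ _ _ _ setT _ (@ch R)) => //; [exact: openT|exact: cls1_ch|exact: cls1_lin]. Qed.

Lemma cls1_geoU (n : nat) n1 n2 d : n1 ^+ 2 + n2 ^+ 2 = 1 -> cls1 setT n (fun s : R => geoU n2 d s).
Proof.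
move=> h; apply: (@cls_comp _ _ _ _ [set x : R | 0 < x] _ (fun x : R => x^-1)).
- exact: openT.
- by move=> s _; exact: (geoU_pos d s h).
- exact: cls1_inv.
- apply: cls_add; [exact: openT|exact: cls1_chd|].
  apply: (@cls_ext _ _ _ _ _ (fun s : R => (- n2) * sh (d * s))); first exact: openT.
    by move=> x _; rewrite mulNr.
  by apply: cls_mul; [exact: openT|apply: cls_cst; exact: openT|exact: cls1_shd].
Qed.

Lemma geod_smooth a n1 n2 d : hplane a -> n1 ^+ 2 + n2 ^+ 2 = 1 ->
  hsmooth_curve (geod a n1 n2 d).
Proof.
move=> a0 h; split=> [t|n t].
  by rewrite geodE //; exact: frame_inv_hplane.
have cc (c : R) m : cls1 setT m (fun _ : R => c) by apply: cls_cst; exact: openT.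
split; apply: cls1_derive1n => m.
  apply: cls_add; [exact: openT|exact: cc|].
  apply: cls_mul; [exact: openT|exact: cc|].
  apply: cls_mul; [exact: openT| |exact: cls1_geoU h].
  by apply: cls_mul; [exact: openT|exact: cc|exact: cls1_shd].
by apply: cls_mul; [exact: openT|exact: cc|exact: cls1_geoU h].
Qed.

Lemma dgeoV n2 d s : is_derive s (1:R) (fun s : R => geoV n2 d s) (d * (ch (d * s) - n2 * sh (d * s))).
Proof.
have hs : is_derive s (1:R) (fun s : R => sh (d * s)) (ch (d * s) * (d * 1 + s * 0)).
  by apply: (dcomp (dsh _)); exact: (dmul (dcst _ _ _) (did _)).
have hc : is_derive s (1:R) (fun s : R => ch (d * s)) (sh (d * s) * (d * 1 + s * 0)).
  by apply: (dcomp (dch _)); exact: (dmul (dcst _ _ _) (did _)).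
rewrite /geoV; notypeclasses refine (deq _ _); first by der.
by cbv beta; ring.
Qed.

Lemma dgeoU n1 n2 d s : n1 ^+ 2 + n2 ^+ 2 = 1 ->
  is_derive s (1:R) (fun s : R => geoU n2 d s) (- (d * geoV n2 d s * geoU n2 d s ^+ 2)).
Proof.
move=> h; have p := geoU_pos d s h.
have hs : is_derive s (1:R) (fun s : R => sh (d * s)) (ch (d * s) * (d * 1 + s * 0)).
  by apply: (dcomp (dsh _)); exact: (dmul (dcst _ _ _) (did _)).
have hc : is_derive s (1:R) (fun s : R => ch (d * s)) (sh (d * s) * (d * 1 + s * 0)).
  by apply: (dcomp (dch _)); exact: (dmul (dcst _ _ _) (did _)).
rewrite /geoU; notypeclasses refine (deq _ _); first by der; rewrite gt_eqF.
by cbv beta; rewrite /geoV; field; rewrite gt_eqF.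
Qed.

Lemma dgeod1 a n1 n2 d s : n1 ^+ 2 + n2 ^+ 2 = 1 ->
  is_derive s (1:R) (fun s : R => (geod a n1 n2 d s).1) (a.2 * n1 * d * geoU n2 d s ^+ 2).
Proof.
move=> h; have p := geoU_pos d s h.
have hs : is_derive s (1:R) (fun s : R => sh (d * s)) (ch (d * s) * (d * 1 + s * 0)).
  by apply: (dcomp (dsh _)); exact: (dmul (dcst _ _ _) (did _)).
have hU := dgeoU d s h.
rewrite /geod /=; notypeclasses refine (deq _ _); first by der.
cbv beta; rewrite /geoV /geoU.
have e := ch2 (d * s).
set C := ch (d * s) in p e *; set S := sh (d * s) in p e *.
have -> : 0 + (a.2 * (n1 * S * (- (d * (S - n2 * C) * (C - n2 * S)^-1 ^+ 2)) +
   (C - n2 * S)^-1 * (n1 * (C * (d * 1 + s * 0)) + S * 0)) + n1 * S * (C - n2 * S)^-1 * 0) =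
   a.2 * n1 * d * (C ^+ 2 - S ^+ 2) * (C - n2 * S)^-1 ^+ 2 by field; rewrite gt_eqF.
by rewrite e; ring.
Qed.

Lemma dgeod2 a n1 n2 d s : n1 ^+ 2 + n2 ^+ 2 = 1 ->
  is_derive s (1:R) (fun s : R => (geod a n1 n2 d s).2) (- (a.2 * d * geoV n2 d s * geoU n2 d s ^+ 2)).
Proof.
move=> h; have hU := dgeoU d s h.
rewrite /geod /=; notypeclasses refine (deq _ _); first by der.
by cbv beta; ring.
Qed.

Lemma derive1_geod a n1 n2 d : n1 ^+ 2 + n2 ^+ 2 = 1 ->
  derive1 (fst \o geod a n1 n2 d) = (fun s => a.2 * n1 * d * geoU n2 d s ^+ 2) /\
  derive1 (snd \o geod a n1 n2 d) = (fun s => - (a.2 * d * geoV n2 d s * geoU n2 d s ^+ 2)).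
Proof.
move=> h; split; apply/funext => s; rewrite derive1E.
  by have [_ ->] := dgeod1 a d s h.
by have [_ ->] := dgeod2 a d s h.
Qed.

Lemma geoUV n1 n2 d s : n1 ^+ 2 + n2 ^+ 2 = 1 ->
  n1 ^+ 2 + geoV n2 d s ^+ 2 = (geoU n2 d s)^-1 ^+ 2.
Proof.
move=> h; rewrite /geoU invrK /geoV.
have e := ch2 (d * s); set C := ch (d * s) in e *; set S := sh (d * s) in e *.
have n1e : n1 ^+ 2 = 1 - n2 ^+ 2 by rewrite -h; ring.
have -> : n1 ^+ 2 = (1 - n2 ^+ 2) * (C ^+ 2 - S ^+ 2) by rewrite e n1e; ring.
by ring.
Qed.

Lemma geod_geodesic a n1 n2 d : hplane a -> n1 ^+ 2 + n2 ^+ 2 = 1 ->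
  hgeodesic (geod a n1 n2 d).
Proof.
move=> a0 h; split; first exact: geod_smooth.
have a20 : 0 < a.2 by [].
move=> s; have [e1 e2] := derive1_geod a d h.
have hU := dgeoU d s h; have hV := dgeoV n2 d s.
have p := geoU_pos d s h.
have U0 : 0 < geoU n2 d s by rewrite invr_gt0.
have E := geoUV d s h.
have d1 : derive1n 2 (fst \o geod a n1 n2 d) s =
    - (2 * a.2 * n1 * d ^+ 2 * geoV n2 d s * geoU n2 d s ^+ 3).
  rewrite derive1nS derive1n1 e1 derive1E.
  suff [_ ->] : is_derive s (1:R) (fun s : R => a.2 * n1 * d * geoU n2 d s ^+ 2)
    (- (2 * a.2 * n1 * d ^+ 2 * geoV n2 d s * geoU n2 d s ^+ 3)) by [].
  notypeclasses refine (deq _ _); first by der.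
  by cbv beta => /=; ring.
have d2 : derive1n 2 (snd \o geod a n1 n2 d) s =
    - (a.2 * d ^+ 2 * (geoU n2 d s - 2 * geoV n2 d s ^+ 2 * geoU n2 d s ^+ 3)).
  rewrite derive1nS derive1n1 e2 derive1E.
  suff [_ ->] : is_derive s (1:R) (fun s : R => - (a.2 * d * geoV n2 d s * geoU n2 d s ^+ 2))
    (- (a.2 * d ^+ 2 * (geoU n2 d s - 2 * geoV n2 d s ^+ 2 * geoU n2 d s ^+ 3))) by [].
  notypeclasses refine (deq _ _); first by der.
  cbv beta => /=.
  have -> : ch (d * s) - n2 * sh (d * s) = (geoU n2 d s)^-1 by rewrite /geoU invrK.
  by field; rewrite gt_eqF.
rewrite /hacceleration /velocity /christoffel d1 d2 e1 e2 /=.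
apply/eqP; rewrite xpair_eqE; apply/andP; split; apply/eqP => /=.
  by field; rewrite !gt_eqF.
move: E; set U := geoU n2 d s in U0 *; set V := geoV n2 d s => E.
have -> : - (a.2 * d ^+ 2 * (U - 2 * V ^+ 2 * U ^+ 3)) +
  (a.2 * n1 * d * U ^+ 2 * (a.2 * n1 * d * U ^+ 2) -
   - (a.2 * d * V * U ^+ 2) * - (a.2 * d * V * U ^+ 2)) / (a.2 * U) =
  a.2 * d ^+ 2 * U ^+ 3 * ((n1 ^+ 2 + V ^+ 2) - U^-1 ^+ 2) by field; rewrite !gt_eqF.
by rewrite E subrr mulr0.
Qed.

Lemma geod_length a n1 n2 d : hplane a -> n1 ^+ 2 + n2 ^+ 2 = 1 -> 0 <= d ->
  hlength (geod a n1 n2 d) = d.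
Proof.
move=> a0 h d0; have a20 : 0 < a.2 by [].
have [e1 e2] := derive1_geod a d h.
rewrite /hlength /length_integral -/(sint 0 1 _).
rewrite (@eq_sint _ _ _ _ (fun=> d)); first by rewrite sint_cst // subr0 mulr1.
move=> s _; rewrite mul1r /hnorm /hmetric /velocity e1 e2 /=.
have p := geoU_pos d s h; have U0 : 0 < geoU n2 d s by rewrite invr_gt0.
have E := geoUV d s h.
move: E; set U := geoU n2 d s in U0 *; set V := geoV n2 d s => E.
have -> : (a.2 * n1 * d * U ^+ 2 * (a.2 * n1 * d * U ^+ 2) +
   - (a.2 * d * V * U ^+ 2) * - (a.2 * d * V * U ^+ 2)) / (a.2 * U) ^+ 2 =
   d ^+ 2 * ((n1 ^+ 2 + V ^+ 2) * U ^+ 2) by field; rewrite !gt_eqF.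
by rewrite E exprVn mulVf ?mulr1 ?sqrtr_sqr ?ger0_norm // expf_neq0 // gt_eqF.
Qed.

End Geod.

(** * Distances and convex sets *)

Section Line.
Variable R : realType.
Implicit Types (a z : R * R).

(** sinh of the signed distance to the geodesic through a orthogonal to
    (n1, n2): a linear function on the hyperboloid. *)
Definition lineq a (n1 n2 : R) z : R := n1 * frame_x a z + n2 * frame_y a z.

Lemma lineq_der (V : normedModType R) a n1 n2 (X Y : V -> R) (t v : V) (dX dY : R) :
  0 < a.2 -> Y t != 0 -> is_derive t v X dX -> is_derive t v Y dY ->
  is_derive t v (fun t => lineq a n1 n2 (X t, Y t))
    ((n1 + n2 * ((X t - a.1) / a.2)) / Y t * dX +
     (n2 * (Y t / a.2) - lineq a n1 n2 (X t, Y t)) / Y t * dY).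
Proof.
move=> a0 Y0 hX hY; rewrite /lineq /frame_x /frame_y /=.
notypeclasses refine (deq _ _).
  by der; rewrite ?mulf_neq0 // gt_eqF.
cbv beta => /=; field.
by rewrite Y0 gt_eqF.
Qed.

(** This makes arsinh of a [lineq] a function with unit gradient. *)
Lemma line_grad a n1 n2 (X Y : R) : 0 < a.2 -> Y != 0 -> n1 ^+ 2 + n2 ^+ 2 = 1 ->
  ((n1 + n2 * ((X - a.1) / a.2)) / Y) ^+ 2 +
     ((n2 * (Y / a.2) - lineq a n1 n2 (X, Y)) / Y) ^+ 2 =
  (1 + lineq a n1 n2 (X, Y) ^+ 2) / Y ^+ 2.
Proof.
move=> a0 Y0 h; rewrite /lineq /frame_x /frame_y /=.
have n1e : n1 ^+ 2 = 1 - n2 ^+ 2 by rewrite -h; ring.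
apply/eqP; rewrite -subr_eq0; apply/eqP.
rewrite [LHS](_ : _ = (n1 ^+ 2 + n2 ^+ 2 - 1) / Y ^+ 2); first by rewrite h subrr mul0r.
by field; rewrite Y0 gt_eqF.
Qed.

Lemma lineq_cont a n1 n2 z : 0 < a.2 -> 0 < z.2 -> {for z, continuous (lineq a n1 n2)}.
Proof.
move=> a0 z0; rewrite /lineq /frame_x /frame_y; cts; first by rewrite gt_eqF.
by rewrite !mulf_neq0 // gt_eqF.
Qed.

Lemma curve_der (c : R -> R * R) (t : R) : hsmooth_curve c ->
  [/\ is_derive t (1:R) (fun t : R => (c t).1) (velocity c t).1,
      is_derive t (1:R) (fun t : R => (c t).2) (velocity c t).2,
      is_derive t (1:R) (fun t : R => (velocity c t).1) (derive1n 2 (fst \o c) t),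
      is_derive t (1:R) (fun t : R => (velocity c t).2) (derive1n 2 (snd \o c) t)
    & 0 < (c t).2].
Proof.
move=> [h1 h2]; split; last exact: h1.
- have [h _] := h2 0%N t; rewrite derive1n0 in h.
  by rewrite /velocity /= derive1E; exact: derivableP.
- have [_ h] := h2 0%N t; rewrite derive1n0 in h.
  by rewrite /velocity /= derive1E; exact: derivableP.
- have [h _] := h2 1%N t; rewrite derive1n1 in h.
  by rewrite derive1nS derive1n1 derive1E; exact: derivableP.
- have [_ h] := h2 1%N t; rewrite derive1n1 in h.
  by rewrite derive1nS derive1n1 derive1E; exact: derivableP.
Qed.

Lemma curve_cont (c : R -> R * R) (t : R) : hsmooth_curve c ->
  [/\ {for t, continuous (fun t : R => (c t).1)},
      {for t, continuous (fun t : R => (c t).2)},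
      {for t, continuous (fun t : R => (velocity c t).1)}
    & {for t, continuous (fun t : R => (velocity c t).2)}].
Proof.
move=> h; have [h1 h2 h3 h4 _] := curve_der t h.
split; exact: is_derive_continuous1; eassumption.
Qed.

Lemma curve_cont2 (c : R -> R * R) (t : R) : hsmooth_curve c ->
  {for t, continuous (derive1n 2 (fst \o c))} /\ {for t, continuous (derive1n 2 (snd \o c))}.
Proof.
move=> [_ /(_ 2%N t) [h1 h2]].
by split; apply: differentiable_continuous; apply/derivable1_diffP.
Qed.

Definition speed (c : R -> R * R) (t : R) : R := hnorm (c t) (velocity c t).

Lemma speedE c t : 0 < (c t).2 ->
  speed c t = Num.sqrt ((velocity c t).1 ^+ 2 + (velocity c t).2 ^+ 2) / (c t).2.
Proof.
move=> h; rewrite /speed /hnorm /hmetric -!expr2 sqrtrM ?addr_ge0 ?sqr_ge0 //.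
by rewrite sqrtrV ?sqr_ge0 // sqrtr_sqr gtr0_norm.
Qed.

Lemma speed_cont c t : hsmooth_curve c -> {for t, continuous (speed c)}.
Proof.
move=> h; have [h1 h2 h3 h4] := curve_cont t h.
have [_ _ _ _ p] := curve_der t h.
rewrite /speed /hnorm /hmetric; move: (velocity c) h3 h4 => V h3 h4.
have n0 : (c t).2 ^+ 2 != 0 by rewrite expf_neq0 // gt_eqF.
by ctsh.
Qed.

Lemma hlengthE c : hlength c = sint 0 1 (speed c).
Proof.
by rewrite /hlength /length_integral; apply: eq_Rintegral => t _; rewrite mul1r.
Qed.

(** The signed distance to a geodesic is 1-Lipschitz. *)
Lemma line_length a n1 n2 c : 0 < a.2 -> n1 ^+ 2 + n2 ^+ 2 = 1 -> hsmooth_curve c ->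
  arsh (lineq a n1 n2 (c 1)) - arsh (lineq a n1 n2 (c 0)) <= hlength c.
Proof.
move=> a0 hn hc.
pose Q (t : R) := lineq a n1 n2 ((c t).1, (c t).2).
pose dQ (t : R) := (n1 + n2 * (((c t).1 - a.1) / a.2)) / (c t).2 * (velocity c t).1 +
     (n2 * ((c t).2 / a.2) - Q t) / (c t).2 * (velocity c t).2.
have hQ t : is_derive t (1:R) Q (dQ t).
  have [h1 h2 _ _ p] := curve_der t hc.
  by apply: lineq_der => //; rewrite gt_eqF.
have cQ t : {for t, continuous Q} by exact: is_derive_continuous1 (hQ t).
pose g t := (Num.sqrt (1 + Q t ^+ 2))^-1 * dQ t.
have hg t : is_derive t (1:R) (fun t : R => arsh (Q t)) (g t).
  exact: (dcomp (darsh _) (hQ t)).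
have cg t : {for t, continuous g}.
  have [h1 h2 h3 h4] := curve_cont t hc.
  have [_ _ _ _ p] := curve_der t hc.
  have p' : (c t).2 != 0 by rewrite gt_eqF.
  have q := cQ t; have n0 : Num.sqrt (1 + Q t ^+ 2) != 0 by rewrite gt_eqF // sqrt1D_gt0.
  rewrite /g /dQ; move: q n0; move: (Q) (velocity c) h3 h4 => Q' V h3 h4 q n0.
  by ctsh.
have cE t : c t = ((c t).1, (c t).2) by case: (c t).
have -> : arsh (lineq a n1 n2 (c 1)) - arsh (lineq a n1 n2 (c 0)) = sint 0 1 g.
  by rewrite (sint_FTC ler01 (fun t _ => cg t) (fun t _ => hg t)) /Q -!cE.
rewrite hlengthE; apply: sint_le => t _; [exact: cg|exact: speed_cont|].
have [_ _ _ _ p] := curve_der t hc.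
rewrite speedE //.
have S0 := sqrt1D_gt0 (Q t).
apply: (le_trans (ler_norm _)).
rewrite /g normrM gtr0_norm ?invr_gt0 // mulrC ler_pdivrMr //.
apply: (le_trans (cauchy2 _ _ _ _)).
rewrite line_grad //; last by rewrite gt_eqF.
rewrite sqrtrM ?addr_ge0 ?sqr_ge0 // sqrtrV ?sqr_ge0 // sqrtr_sqr gtr0_norm // -/(Q t).
by rewrite le_eqVlt; apply/orP; left; apply/eqP; ring.
Qed.

(** sinh of the distance from a to z. *)
Definition frg a z : R := Num.sqrt (frame_x a z ^+ 2 + frame_y a z ^+ 2).

Lemma frg_ge0 a z : 0 <= frg a z. Proof. exact: sqrtr_ge0. Qed.

Lemma frg_dir a z : exists n1 n2 : R,
  [/\ n1 ^+ 2 + n2 ^+ 2 = 1, frame_x a z = n1 * frg a z & frame_y a z = n2 * frg a z].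
Proof.
have [g0|g0] := eqVneq (frg a z) 0.
  exists 1, 0; rewrite g0 !mulr0 expr1n expr0n addr0; split => //.
    by move/eqP: g0; rewrite sqrtr_eq0 => h; apply/eqP; rewrite -sqrf_eq0; have := sqr_ge0 (frame_y a z); have := sqr_ge0 (frame_x a z); nra.
  by move/eqP: g0; rewrite sqrtr_eq0 => h; apply/eqP; rewrite -sqrf_eq0; have := sqr_ge0 (frame_y a z); have := sqr_ge0 (frame_x a z); nra.
have e : frg a z ^+ 2 = frame_x a z ^+ 2 + frame_y a z ^+ 2 by rewrite sqr_sqrtr // addr_ge0 ?sqr_ge0.
exists (frame_x a z / frg a z), (frame_y a z / frg a z); split; [|by rewrite divfK|by rewrite divfK].
have -> : (frame_x a z / frg a z) ^+ 2 + (frame_y a z / frg a z) ^+ 2 =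
   (frame_x a z ^+ 2 + frame_y a z ^+ 2) / frg a z ^+ 2 by field.
by rewrite -e divff // expf_neq0.
Qed.

Lemma lineq_self a n1 n2 : 0 < a.2 -> lineq a n1 n2 a = 0.
Proof. by move=> a0; rewrite /lineq /frame_x /frame_y subrr expr0n /=; field; rewrite gt_eqF. Qed.

Lemma frame_inv00 a : hplane a -> frame_inv a 0 0 = a.
Proof.
move=> a0; have a20 : 0 < a.2 by [].
rewrite -[RHS](frame_invK a0 a0); congr frame_inv.
  by rewrite /frame_x subrr mul0r.
by rewrite /frame_y subrr expr0n add0r subrr mul0r.
Qed.

(** The signed distance to the geodesic orthogonal to the direction of z bounds
    the length of every curve, and the radial geodesic attains this bound. *)
Lemma hdistE a z : hplane a -> hplane z -> hdist a z = arsh (frg a z).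
Proof.
move=> a0 z0; have a20 : 0 < a.2 by [].
have [n1 [n2 [hn e1 e2]]] := frg_dir a z.
rewrite /hdist; set S := [set hlength c | c in _].
have d0 : 0 <= arsh (frg a z) by rewrite -(arsh0 R) arsh_le // frg_ge0.
have lb : lbound S (arsh (frg a z)).
  move=> _ [c [sc c0 c1] <-].
  have := line_length a20 hn sc; rewrite c0 c1 lineq_self // arsh0 subr0.
  by rewrite /lineq e1 e2 !mulrA -!expr2 -mulrDl hn mul1r.
have mem : S (arsh (frg a z)).
  exists (geod a n1 n2 (arsh (frg a z))); last exact: geod_length.
  split; first exact: geod_smooth.
    rewrite geodE // mulr0 sh0 !mulr0.
    exact: frame_inv00.
  by rewrite geodE // mulr1 sh_arsh -e1 -e2 frame_invK.
apply/eqP; rewrite eq_le; apply/andP; split.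
  by apply: ge_inf => //; exists (arsh (frg a z)).
by apply: lb_le_inf => //; exists (arsh (frg a z)).
Qed.

Lemma hballE a r : hplane a -> 0 < r ->
  hball a r = [set z | hplane z /\ frame_x a z ^+ 2 + frame_y a z ^+ 2 <= sh r ^+ 2].
Proof.
move=> a0 r0; have shr : 0 < sh r by rewrite -(sh0 R) sh_lt.
apply/seteqP; split => z /= [z0 h]; split => //.
  rewrite hdistE // in h.
  have : frg a z <= sh r by rewrite -(sh_arsh (frg a z)) sh_le.
  move=> h'; have <- : frg a z ^+ 2 = frame_x a z ^+ 2 + frame_y a z ^+ 2 by rewrite sqr_sqrtr // addr_ge0 ?sqr_ge0.
  by rewrite ler_sqr ?nnegrE ?frg_ge0 // ltW.
rewrite hdistE // -(arsh_sh r) arsh_le // /frg.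
rewrite -[leRHS]ger0_norm ?(ltW shr) // -sqrtr_sqr ler_wsqrtr //.
Qed.

(** Geodesics are straight lines in the coordinates (x, x^2 + y^2). *)
Lemma hconvex_segment (K : set (R * R)) z1 z2 z (l : R) : hconvex K -> K `<=` hplane ->
  K z1 -> K z2 -> hplane z -> 0 <= l <= 1 ->
  z.1 = (1 - l) * z1.1 + l * z2.1 ->
  z.1 ^+ 2 + z.2 ^+ 2 = (1 - l) * (z1.1 ^+ 2 + z1.2 ^+ 2) + l * (z2.1 ^+ 2 + z2.2 ^+ 2) ->
  K z.
Proof.
move=> cK Kh K1 K2 z0 /andP[l0 l1] e1 e2.
have z10 : 0 < z1.2 by exact: (Kh z1 K1).
have z20 : 0 < z2.2 by exact: (Kh z2 K2).
have zz0 : 0 < z.2 by exact: z0.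
(* in the coordinates based at z1 the point z is m times z2 *)
pose m := l * z2.2 / z.2.
have ea : frame_x z1 z = m * frame_x z1 z2.
  by rewrite /frame_x /m e1; field; rewrite !gt_eqF.
have eb : frame_y z1 z = m * frame_y z1 z2.
  rewrite /frame_y /m.
  have -> : (z.1 - z1.1) ^+ 2 + z.2 ^+ 2 - z1.2 ^+ 2 =
     (z.1 ^+ 2 + z.2 ^+ 2) - 2 * z1.1 * z.1 + z1.1 ^+ 2 - z1.2 ^+ 2 by ring.
  by rewrite e2 e1; field; rewrite !gt_eqF.
have m0 : 0 <= m by rewrite /m divr_ge0 ?mulr_ge0 // ltW.
have m1 : m <= 1.
  rewrite /m ler_pdivrMr // mul1r.
  have h : (l * z2.2) ^+ 2 <= z.2 ^+ 2.
    have -> : z.2 ^+ 2 = l * z2.2 ^+ 2 + (1 - l) * z1.2 ^+ 2 + l * (1 - l) * (z2.1 - z1.1) ^+ 2.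
      have -> : z.2 ^+ 2 = (z.1 ^+ 2 + z.2 ^+ 2) - z.1 ^+ 2 by ring.
      by rewrite e2 e1; ring.
    have h1 : 0 <= (1 - l) * z1.2 ^+ 2 by rewrite mulr_ge0 ?sqr_ge0 // subr_ge0.
    have h2 : 0 <= l * (1 - l) * (z2.1 - z1.1) ^+ 2 by apply: mulr_ge0; [apply: mulr_ge0; rewrite ?subr_ge0 | exact: sqr_ge0].
    have h3 : (l * z2.2) ^+ 2 <= l * z2.2 ^+ 2.
      by rewrite exprMn ler_wpM2r ?sqr_ge0 // expr2 ler_piMr.
    lra.
  by rewrite -(@ler_pXn2r _ 2) // ?nnegrE ?mulr_ge0 // ltW.
have [n1 [n2 [hn g1 g2]]] := frg_dir z1 z2.
set g := frg z1 z2 in g1 g2.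
have g0 : 0 <= g by exact: frg_ge0.
pose d := arsh g.
have zE s : d * s = arsh (m * g) -> geod z1 n1 n2 d s = z.
  move=> h; rewrite geodE // h sh_arsh.
  have -> : n1 * (m * g) = frame_x z1 z by rewrite ea g1; ring.
  have -> : n2 * (m * g) = frame_y z1 z by rewrite eb g2; ring.
  by rewrite frame_invK.
have hg : hgeodesic (geod z1 n1 n2 d) by exact: geod_geodesic.
have c0 : geod z1 n1 n2 d 0 = z1.
  rewrite geodE // mulr0 sh0 !mulr0.
  exact: frame_inv00.
have c1 : geod z1 n1 n2 d 1 = z2.
  by rewrite geodE // mulr1 sh_arsh -g1 -g2 frame_invK.
have K0' : K (geod z1 n1 n2 d 0) by rewrite c0.
have K1' : K (geod z1 n1 n2 d 1) by rewrite c1.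
have key := cK _ hg K0' K1'.
have [g00|gn0] := eqVneq g 0.
  by rewrite -(zE 0) ?c0 // mulr0 g00 mulr0 arsh0.
have gp : 0 < g by rewrite lt0r gn0.
have dp : 0 < d by rewrite -(arsh0 R) arsh_lt.
rewrite -(zE (arsh (m * g) / d)); last by field; rewrite gt_eqF.
apply: key; apply/andP; split.
  by rewrite divr_ge0 ?(ltW dp) // -(arsh0 R) arsh_le // mulr_ge0.
by rewrite ler_pdivrMr // mul1r arsh_le // ler_piMl.
Qed.

Lemma hconvex_triangle (K : set (R * R)) z1 z2 z3 z (b1 b2 b3 : R) :
  hconvex K -> K `<=` hplane -> K z1 -> K z2 -> K z3 -> hplane z ->
  0 <= b1 -> 0 <= b2 -> 0 <= b3 -> b1 + b2 + b3 = 1 ->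
  z.1 = b1 * z1.1 + b2 * z2.1 + b3 * z3.1 ->
  z.1 ^+ 2 + z.2 ^+ 2 = b1 * (z1.1 ^+ 2 + z1.2 ^+ 2) + b2 * (z2.1 ^+ 2 + z2.2 ^+ 2)
     + b3 * (z3.1 ^+ 2 + z3.2 ^+ 2) -> K z.
Proof.
move=> cK Kh K1 K2 K3 z0 b10 b20 b30 b e1 e2.
have z20 : 0 < z2.2 by exact: (Kh z2 K2).
have z30 : 0 < z3.2 by exact: (Kh z3 K3).
have [s0|s0] := eqVneq (b2 + b3) 0.
  have [e3 e4] : b2 = 0 /\ b3 = 0 by lra.
  have b11 : b1 = 1 by lra.
  apply: (@hconvex_segment K z1 z1 z 0) => //; first by rewrite lexx ler01.
    by rewrite e1 e3 e4 b11; ring.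
  by rewrite e2 e3 e4 b11; ring.
have sp : 0 < b2 + b3 by rewrite lt0r s0 addr_ge0.
pose l := b3 / (b2 + b3).
have l0 : 0 <= l by rewrite divr_ge0 // ltW.
have l1 : l <= 1 by rewrite ler_pdivrMr // mul1r lerDr.
pose X := (1 - l) * z2.1 + l * z3.1.
pose W := (1 - l) * (z2.1 ^+ 2 + z2.2 ^+ 2) + l * (z3.1 ^+ 2 + z3.2 ^+ 2).
have WX : 0 < W - X ^+ 2.
  have -> : W - X ^+ 2 = l * z3.2 ^+ 2 + (1 - l) * z2.2 ^+ 2 + l * (1 - l) * (z3.1 - z2.1) ^+ 2.
    by rewrite /W /X; ring.
  have h2 : 0 <= l * (1 - l) * (z3.1 - z2.1) ^+ 2 by apply: mulr_ge0; [apply: mulr_ge0; rewrite ?subr_ge0 | exact: sqr_ge0].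
  have h3 : 0 < z3.2 ^+ 2 by rewrite exprn_gt0.
  have h4 : 0 < z2.2 ^+ 2 by rewrite exprn_gt0.
  have [l00|ln0] := eqVneq l 0; first by rewrite l00; lra.
  have lp : 0 < l by rewrite lt0r ln0.
  have h5 : 0 < l * z3.2 ^+ 2 by rewrite mulr_gt0.
  have h6 : 0 <= (1 - l) * z2.2 ^+ 2 by rewrite mulr_ge0 ?(ltW h4) // subr_ge0.
  lra.
have hw : hplane (X, Num.sqrt (W - X ^+ 2)) by rewrite /hplane /= sqrtr_gt0.
have Kw : K (X, Num.sqrt (W - X ^+ 2)).
  apply: (@hconvex_segment K z2 z3 _ l) => //=; first by rewrite l0.
  by rewrite sqr_sqrtr ?(ltW WX) // /W; ring.
apply: (@hconvex_segment K z1 (X, Num.sqrt (W - X ^+ 2)) z (b2 + b3)) => //=.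
- by rewrite (ltW sp) /=; lra.
- have b1e : b1 = 1 - (b2 + b3) by lra.
  by rewrite e1 /X /l b1e; field.
- have b1e : b1 = 1 - (b2 + b3) by lra.
  by rewrite e2 sqr_sqrtr ?(ltW WX) // /W /X /l b1e; field.
Qed.

End Line.

(** * The moving frame of the boundary *)

Section Support.
Variable R : realType.
Implicit Types (z : R * R) (K : set (R * R)) (gamma nu : R -> R * R).

(** The components of nu in the orthonormal frame at gamma t. *)
Definition nrm gamma nu (t : R) : R * R := ((nu t).1 / (gamma t).2, (nu t).2 / (gamma t).2).

Lemma nrm_facts K gamma nu (t : R) : hsmooth_curve gamma -> outward_unit_normal K gamma nu ->
  (nrm gamma nu t).1 ^+ 2 + (nrm gamma nu t).2 ^+ 2 = 1 /\
  (nrm gamma nu t).1 * (velocity gamma t).1 + (nrm gamma nu t).2 * (velocity gamma t).2 = 0.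
Proof.
move=> sg /(_ t) [h1 h2 _]; have [_ _ _ _ y0] := curve_der t sg.
have yn : (gamma t).2 != 0 by rewrite gt_eqF.
rewrite /hmetric in h1 h2; rewrite /nrm /=; split.
  by rewrite -h1; field.
have -> : (nu t).1 / (gamma t).2 * (velocity gamma t).1 + (nu t).2 / (gamma t).2 * (velocity gamma t).2 =
  ((nu t).1 * (velocity gamma t).1 + (nu t).2 * (velocity gamma t).2) / (gamma t).2 ^+ 2 * (gamma t).2 by field.
by rewrite h2 mul0r.
Qed.

Lemma sumsq0 (a b : R) : a ^+ 2 + b ^+ 2 = 0 -> a = 0 /\ b = 0.
Proof.
move=> /eqP; rewrite paddr_eq0 ?sqr_ge0 // !sqrf_eq0 => /andP[/eqP -> /eqP ->].
by [].
Qed.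

Lemma near0_gt0 (F : R -> R) : {for 0, continuous F} -> 0 < F 0 -> \forall s \near (0:R)^'+, 0 < F s.
Proof.
move=> cF F0.
near=> s.
have h : `|F 0 - F s| < F 0.
  near: s; apply: cvg_within.
  exact: (@cvgrPdist_lt _ _ _ _ _ _ _).1 cF _ F0.
by have := ler_norm (F 0 - F s); lra.
Unshelve. all: by end_near. Qed.

(** If z1 were strictly on the outer side of the tangent geodesic at gamma t, the
    point gamma t + s nu would, for small s, be inside the triangle with vertices
    z1 and the boundary points at parameters t - C s and t + C s. *)
Lemma support_line K gamma nu (t : R) z1 :
  K `<=` hplane -> hconvex K -> hsmooth_curve gamma -> (forall t, K (gamma t)) ->
  velocity gamma t != 0 -> outward_unit_normal K gamma nu -> K z1 ->
  lineq (gamma t) (nrm gamma nu t).1 (nrm gamma nu t).2 z1 <= 0.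
Proof.
move=> Kh cK sg gK vg on K1; rewrite leNgt; apply/negP => lpos.
have [hx hy _ _ y0] := curve_der t sg.
have [hn ho] := nrm_facts t sg on.
have z10 : 0 < z1.2 by exact: (Kh _ K1).
have [m1 _ [e e0 he]] := on t.
move: lpos hn ho; rewrite /nrm /=.
set x := (gamma t).1 in hx y0 *; set y := (gamma t).2 in hy y0 *.
set vx := (velocity gamma t).1 in hx *; set vy := (velocity gamma t).2 in hy *.
set N1 := (nu t).1; set N2 := (nu t).2 => lpos hn ho.
have NN : N1 ^+ 2 + N2 ^+ 2 = y ^+ 2.
  have -> : N1 ^+ 2 + N2 ^+ 2 = ((N1 / y) ^+ 2 + (N2 / y) ^+ 2) * y ^+ 2 by field; rewrite gt_eqF.
  by rewrite hn mul1r.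
have NV : N1 * vx + N2 * vy = 0.
  have -> : N1 * vx + N2 * vy = (N1 / y * vx + N2 / y * vy) * y by field; rewrite gt_eqF.
  by rewrite ho mul0r.
pose w := vx * N2 - vy * N1.
have w2 : w ^+ 2 = (vx ^+ 2 + vy ^+ 2) * y ^+ 2.
  rewrite -NN; have -> : w ^+ 2 = (vx ^+ 2 + vy ^+ 2) * (N1 ^+ 2 + N2 ^+ 2) - (N1 * vx + N2 * vy) ^+ 2.
    by rewrite /w; ring.
  by rewrite NV; ring.
have vv : 0 < vx ^+ 2 + vy ^+ 2.
  rewrite lt0r addr_ge0 ?sqr_ge0 // andbT; apply: contra vg => /eqP h.
  have [hvx hvy] := sumsq0 h.
  apply/eqP; rewrite [velocity gamma t]surjective_pairing -/vx -/vy hvx hvy //.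
have w20 : 0 < w ^+ 2 by rewrite w2 mulr_gt0 // exprn_gt0.
pose W (s : R) := (gamma s).1 ^+ 2 + (gamma s).2 ^+ 2.
have hW : is_derive t (1:R) W (2 * x * vx + 2 * y * vy).
  rewrite /W; notypeclasses refine (deq _ _); first by der.
  by cbv beta => /=; rewrite -/x -/y; ring.
have /is_derive1_caratheodory [gx [gxE cgx gxt]] := hx.
have /is_derive1_caratheodory [gw [gwE cgw gwt]] := hW.
have cgx' (c : R) : {for 0, continuous (fun s => gx (t + c * s))}.
  by apply: ccomp; [rewrite mulr0 addr0 | cts].
have cgw' (c : R) : {for 0, continuous (fun s => gw (t + c * s))}.
  by apply: ccomp; [rewrite mulr0 addr0 | cts].
pose Zx := z1.1 - x; pose Zw := z1.1 ^+ 2 + z1.2 ^+ 2 - (x ^+ 2 + y ^+ 2).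
pose NW := 2 * x * N1 + 2 * y * N2.
pose TZ := vx * Zw - (2 * x * vx + 2 * y * vy) * Zx.
pose NZ := N1 * Zw - NW * Zx.
have wTZ : 0 < w * TZ.
  set L := lineq (gamma t) (N1 / y) (N2 / y) z1 in lpos *.
  have E : TZ - w * 2 * z1.2 * L =
     vx * (Zw - 2 * x * Zx) * (1 - (N1 ^+ 2 + N2 ^+ 2) / y ^+ 2)
     - 2 * y * vy * Zx * (1 - (N1 ^+ 2 + N2 ^+ 2) / y ^+ 2)
     + (N1 * vx + N2 * vy) * ((Zw - 2 * x * Zx) * N1 / y ^+ 2 - 2 * Zx * N2 / y).
    by rewrite /TZ /w /L /lineq /frame_x /frame_y /Zw /Zx -/x -/y; field; rewrite !gt_eqF.
  have {}E : TZ = w * 2 * z1.2 * L.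
    apply/eqP; rewrite -subr_eq0 E NN NV divff ?expf_neq0 //; last by rewrite gt_eqF.
    by apply/eqP; ring.
  have -> : w * TZ = w ^+ 2 * (2 * (z1.2 * L)) by rewrite E; ring.
  by rewrite mulr_gt0 // mulr_gt0 // mulr_gt0.
(* this size of C makes the weights DA and DB of the boundary points positive at
   s = 0 *)
pose C := (`|w * NZ| + 1) / (w * TZ).
have CTZ : C * (w * TZ) = `|w * NZ| + 1 by rewrite /C divfK // gt_eqF.
have C0 : 0 < C by rewrite divr_gt0 // ltr_wpDl.
pose ax s := - C * gx (t + (- C) * s); pose aw s := - C * gw (t + (- C) * s).
pose bx s := C * gx (t + C * s); pose bw s := C * gw (t + C * s).
pose px (s : R) := N1; pose pw s := NW + s * y ^+ 2.
have cax : {for 0, continuous ax} by rewrite /ax; cts; exact: cgx'.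
have caw : {for 0, continuous aw} by rewrite /aw; cts; exact: cgw'.
have cbx : {for 0, continuous bx} by rewrite /bx; cts; exact: cgx'.
have cbw : {for 0, continuous bw} by rewrite /bw; cts; exact: cgw'.
have cpw : {for 0, continuous pw} by rewrite /pw; cts.
(* s DP / DZ, DA / DZ and DB / DZ are the barycentric coordinates of
   gamma t + s nu, computed in the coordinates (x, x^2 + y^2) *)
pose DP s := w * ((bx s - ax s) * (pw s - aw s) - (bw s - aw s) * (N1 - ax s)).
pose DZ s := w * ((bx s - ax s) * (Zw - s * aw s) - (bw s - aw s) * (Zx - s * ax s)).
pose DA s := w * ((bx s - N1) * (Zw - s * pw s) - (bw s - pw s) * (Zx - s * N1)).
pose DB s := w * ((N1 - ax s) * (Zw - s * aw s) - (pw s - aw s) * (Zx - s * ax s)).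
have a0x : ax 0 = - C * vx by rewrite /ax mulr0 addr0 gxt.
have a0w : aw 0 = - C * (2 * x * vx + 2 * y * vy) by rewrite /aw mulr0 addr0 gwt.
have b0x : bx 0 = C * vx by rewrite /bx mulr0 addr0 gxt.
have b0w : bw 0 = C * (2 * x * vx + 2 * y * vy) by rewrite /bw mulr0 addr0 gwt.
have p0w : pw 0 = NW by rewrite /pw mul0r addr0.
have DP0 : 0 < DP 0.
  rewrite /DP a0x a0w b0x b0w p0w.
  have -> : w * ((C * vx - - C * vx) * (NW - - C * (2 * x * vx + 2 * y * vy)) -
     (C * (2 * x * vx + 2 * y * vy) - - C * (2 * x * vx + 2 * y * vy)) * (N1 - - C * vx)) =
     4 * C * y * w ^+ 2 by rewrite /NW /w; ring.
  by apply: mulr_gt0 => //; apply: mulr_gt0 => //; apply: mulr_gt0.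
have DZ0 : 0 < DZ 0.
  rewrite /DZ a0x a0w b0x b0w.
  have -> : w * ((C * vx - - C * vx) * (Zw - 0 * (- C * (2 * x * vx + 2 * y * vy))) -
    (C * (2 * x * vx + 2 * y * vy) - - C * (2 * x * vx + 2 * y * vy)) * (Zx - 0 * (- C * vx))) =
    2 * C * (w * TZ) by rewrite /TZ; ring.
  by rewrite mulr_gt0 // mulr_gt0.
have absNZ := ler_norm (w * NZ); have absNZ' := ler_norm (- (w * NZ)).
rewrite normrN in absNZ'.
have DA0 : 0 < DA 0.
  rewrite /DA b0x b0w p0w.
  have -> : w * ((C * vx - N1) * (Zw - 0 * NW) - (C * (2 * x * vx + 2 * y * vy) - NW) * (Zx - 0 * N1)) =
    C * (w * TZ) - w * NZ by rewrite /TZ /NZ; ring.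
  rewrite CTZ; lra.
have DB0 : 0 < DB 0.
  rewrite /DB a0x a0w p0w.
  have -> : w * ((N1 - - C * vx) * (Zw - 0 * (- C * (2 * x * vx + 2 * y * vy))) -
     (NW - - C * (2 * x * vx + 2 * y * vy)) * (Zx - 0 * (- C * vx))) =
    C * (w * TZ) + w * NZ by rewrite /TZ /NZ; ring.
  rewrite CTZ; lra.
have cDP : {for 0, continuous DP}.
  by rewrite /DP; move: (ax) (aw) (bx) (bw) (pw) cax caw cbx cbw cpw => *; ctsh.
have cDZ : {for 0, continuous DZ}.
  by rewrite /DZ; move: (ax) (aw) (bx) (bw) (pw) cax caw cbx cbw cpw => *; ctsh.
have cDA : {for 0, continuous DA}.
  by rewrite /DA; move: (ax) (aw) (bx) (bw) (pw) cax caw cbx cbw cpw => *; ctsh.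
have cDB : {for 0, continuous DB}.
  by rewrite /DB; move: (ax) (aw) (bx) (bw) (pw) cax caw cbx cbw cpw => *; ctsh.
have n1 := near0_gt0 cDP DP0; have n2 := near0_gt0 cDZ DZ0.
have n3 := near0_gt0 cDA DA0; have n4 := near0_gt0 cDB DB0.
have n5 : \forall s \near (0:R)^'+, 0 < s < Num.min e 1.
  have m0 : 0 < Num.min e 1 by rewrite lt_min e0 ltr01.
  near=> s; apply/andP; split.
    by near: s; exact: nbhs_right_gt.
  by near: s; exact: nbhs_right_lt.
have [s [[[[/andP[s0 sm] q1] q2] q3] q4]] :=
  filter_ex (filterI (filterI (filterI (filterI n5 n1) n2) n3) n4).
move: sm; rewrite lt_min => /andP[se s1].
apply: (he s); first by rewrite s0 se.
have P0 : 0 < y + s * N2.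
  have hN : `|N2| <= y.
    rewrite -[y]ger0_norm ?(ltW y0) // -ler_sqr ?nnegrE // !real_normK ?num_real //.
    by rewrite -NN lerDr sqr_ge0.
  have := ler_norm (- N2); rewrite normrN => h; nra.
have EP : gamma t + s *: nu t = (x + s * N1, y + s * N2) by [].
rewrite EP.
have XE (r : R) : (gamma r).1 = x + gx r * (r - t) by rewrite -gxE /x; ring.
have WE (r : R) : (gamma r).1 ^+ 2 + (gamma r).2 ^+ 2 = x ^+ 2 + y ^+ 2 + gw r * (r - t).
  by rewrite -gwE /W -/x -/y; ring.
have dz : DZ s != 0 by rewrite gt_eqF.
have wn0 : w != 0 by rewrite -sqrf_eq0 gt_eqF.
apply: (@hconvex_triangle _ K z1 (gamma (t + (- C) * s)) (gamma (t + C * s)) _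
  (s * DP s / DZ s) (DA s / DZ s) (DB s / DZ s)) => //=.
- exact: divr_ge0 (mulr_ge0 (ltW s0) (ltW q1)) (ltW q2).
- exact: divr_ge0 (ltW q3) (ltW q2).
- exact: divr_ge0 (ltW q4) (ltW q2).
- rewrite -!mulrDl; apply: (canLR (mulfK dz)); rewrite mul1r /DP /DZ /DA /DB; ring.
- rewrite !XE.
  have -> : gx (t + - C * s) * (t + - C * s - t) = s * ax s by rewrite /ax; ring.
  have -> : gx (t + C * s) * (t + C * s - t) = s * bx s by rewrite /bx; ring.
  have -> : z1.1 = x + Zx by rewrite /Zx; ring.
  have -> : s * DP s / DZ s * (x + Zx) + DA s / DZ s * (x + s * ax s) + DB s / DZ s * (x + s * bx s) =
     (s * DP s * (x + Zx) + DA s * (x + s * ax s) + DB s * (x + s * bx s)) / DZ s by field.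
  apply: (canRL (mulfK dz)); rewrite /DP /DZ /DA /DB; ring.
- rewrite (WE (t + - C * s)) (WE (t + C * s)).
  have -> : gw (t + - C * s) * (t + - C * s - t) = s * aw s by rewrite /aw; ring.
  have -> : gw (t + C * s) * (t + C * s - t) = s * bw s by rewrite /bw; ring.
  have -> : z1.1 ^+ 2 + z1.2 ^+ 2 = x ^+ 2 + y ^+ 2 + Zw by rewrite /Zw; ring.
  have -> : (x + s * N1) ^+ 2 + (y + s * N2) ^+ 2 = x ^+ 2 + y ^+ 2 + s * pw s.
    have -> : (x + s * N1) ^+ 2 + (y + s * N2) ^+ 2 =
      x ^+ 2 + y ^+ 2 + s * (NW + s * (N1 ^+ 2 + N2 ^+ 2)) by rewrite /NW; ring.
    by rewrite NN.
  set G := x ^+ 2 + y ^+ 2.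
  have -> : s * DP s / DZ s * (G + Zw) + DA s / DZ s * (G + s * aw s) + DB s / DZ s * (G + s * bw s) =
     (s * DP s * (G + Zw) + DA s * (G + s * aw s) + DB s * (G + s * bw s)) / DZ s by field.
  apply: (canRL (mulfK dz)); rewrite /DP /DZ /DA /DB; ring.
Unshelve. all: by end_near. Qed.

End Support.

Definition body (R : realType) (K : set (R * R)) (gamma nu : R -> R * R) : Prop :=
  [/\ K `<=` hplane, hconvex K, compact K, K° !=set0 &
    boundary_param K gamma /\ outward_unit_normal K gamma nu].

Section Frame.
Variables (R : realType) (K : set (R * R)) (gamma nu : R -> R * R).
Variable hb : body K gamma nu.
Let Kh : K `<=` hplane. Proof. by case: hb. Qed.
Let cK : hconvex K. Proof. by case: hb. Qed.
Let ptK : compact K. Proof. by case: hb. Qed.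
Let iK : K° !=set0. Proof. by case: hb. Qed.
Let bg : boundary_param K gamma. Proof. by case: hb => _ _ _ _ []. Qed.
Let on : outward_unit_normal K gamma nu. Proof. by case: hb => _ _ _ _ []. Qed.

Definition espeed (t : R) : R := Num.sqrt ((velocity gamma t).1 ^+ 2 + (velocity gamma t).2 ^+ 2).
Definition tan1 (t : R) : R := (velocity gamma t).1 / espeed t.
Definition tan2 (t : R) : R := (velocity gamma t).2 / espeed t.
(** z in the moving frame at gamma t: [qline] along the outward normal, [rline]
    along the tangent. arsinh of [qline] is the signed distance to the tangent
    geodesic. *)
Definition qline (t : R) z : R := lineq (gamma t) (nrm gamma nu t).1 (nrm gamma nu t).2 z.
Definition rline (t : R) z : R := lineq (gamma t) (tan1 t) (tan2 t) z.

Lemma bg_smooth : hsmooth_curve gamma. Proof. by case: bg. Qed.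
Let sg := bg_smooth.

Lemma vel_neq0 t : velocity gamma t != 0. Proof. by case: bg. Qed.

Lemma gamma_gt0 t : 0 < (gamma t).2. Proof. by case: (curve_der t sg). Qed.

Lemma espeed_sqr t : espeed t ^+ 2 = (velocity gamma t).1 ^+ 2 + (velocity gamma t).2 ^+ 2.
Proof. by rewrite sqr_sqrtr // addr_ge0 ?sqr_ge0. Qed.

Lemma espeed_gt0 t : 0 < espeed t.
Proof.
rewrite sqrtr_gt0 lt0r addr_ge0 ?sqr_ge0 // andbT.
apply: contra (vel_neq0 t) => /eqP h.
by have [hx hy] := sumsq0 h; apply/eqP; rewrite [velocity gamma t]surjective_pairing hx hy.
Qed.

Lemma tan_sqr t : tan1 t ^+ 2 + tan2 t ^+ 2 = 1.
Proof.
have := espeed_gt0 t => h; rewrite /tan1 /tan2.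
have -> : ((velocity gamma t).1 / espeed t) ^+ 2 + ((velocity gamma t).2 / espeed t) ^+ 2 =
  ((velocity gamma t).1 ^+ 2 + (velocity gamma t).2 ^+ 2) / espeed t ^+ 2 by field; rewrite gt_eqF.
by rewrite espeed_sqr divff // -espeed_sqr expf_neq0 // gt_eqF.
Qed.

Lemma speed_gt0 t : 0 < speed gamma t.
Proof. by rewrite speedE ?gamma_gt0 // divr_gt0 ?gamma_gt0 // espeed_gt0. Qed.

Lemma closedK : closed K.
Proof. by apply: compact_closed ptK; exact: norm_hausdorff. Qed.

Lemma gamma_per t (n : nat) : gamma (t + n%:R) = gamma t.
Proof.
have [_ per _ _ _] := bg; elim: n => [|n IH]; first by rewrite addr0.
by rewrite -natr1 addrA per.
Qed.

Lemma gamma_red t : exists2 s, 0 <= s <= 1 & gamma t = gamma s.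
Proof.
have /andP[h1 h2] := Num.Theory.real_floor_itv (num_real t).
exists (t - (Num.floor t)%:~R); first by rewrite subr_ge0 h1 /=; rewrite intrD in h2; lra.
case: (Num.floor t) => [n|n].
  by rewrite -[in LHS](subrK n%:R t) gamma_per.
by rewrite NegzE mulrNz opprK -pmulrn gamma_per.
Qed.

Lemma gamma_frontier t : (closure K `\` K°) (gamma t).
Proof.
have [_ _ _ _ fr] := bg; have [s s01 ->] := gamma_red t.
by rewrite -fr; exists s.
Qed.

Lemma gamma_K t : K (gamma t).
Proof. by have [h _] := gamma_frontier t; exact: closedK. Qed.

Lemma qline_le0 t z : K z -> qline t z <= 0.
Proof.
move=> Kz; apply: (@support_line _ K) => //; [exact: gamma_K|exact: vel_neq0].
Qed.

Lemma nrm_sqr t : (nrm gamma nu t).1 ^+ 2 + (nrm gamma nu t).2 ^+ 2 = 1.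
Proof. by have [] := nrm_facts t sg on. Qed.

(** [qline] has no critical point, so it does not vanish at an interior point,
    where it would be maximal on K. *)
Lemma qline_lt0 t z : K° z -> qline t z < 0.
Proof.
move=> iz; have Kz : K z by exact: (interior_subset iz).
have z0 : 0 < z.2 by exact: (Kh Kz).
rewrite lt_neqAle qline_le0 // andbT; apply/negP => /eqP q0.
have a0 := gamma_gt0 t.
set n1 := (nrm gamma nu t).1 in q0 *; set n2 := (nrm gamma nu t).2 in q0 *.
(* the gradient of qline at z *)
pose g1 := (n1 + n2 * ((z.1 - (gamma t).1) / (gamma t).2)) / z.2.
pose g2 := (n2 * (z.2 / (gamma t).2) - qline t (z.1, z.2)) / z.2.
pose F (s : R) := qline t (z.1 + s * g1, z.2 + s * g2).
have hF : is_derive (0:R) (1:R) F (g1 ^+ 2 + g2 ^+ 2).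
  have hX : is_derive (0:R) (1:R) (fun s : R => z.1 + s * g1) g1.
    by notypeclasses refine (deq _ _); [der | cbv beta; ring].
  have hY : is_derive (0:R) (1:R) (fun s : R => z.2 + s * g2) g2.
    by notypeclasses refine (deq _ _); [der | cbv beta; ring].
  have Y0 : z.2 + 0 * g2 != 0 by rewrite mul0r addr0 gt_eqF.
  have := @lineq_der R R^o (gamma t) n1 n2 (fun s : R => z.1 + s * g1) (fun s : R => z.2 + s * g2) 0 1 g1 g2 a0 Y0 hX hY.
  rewrite !mul0r !addr0 => h.
  by notypeclasses refine (deq _ _); [exact: h | rewrite !expr2].
have gg : 0 < g1 ^+ 2 + g2 ^+ 2.
  rewrite /g1 /g2 line_grad ?nrm_sqr //; last by rewrite gt_eqF.
  by rewrite divr_gt0 ?exprn_gt0 // ltr_pwDl // sqr_ge0.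
have /is_derive1_caratheodory [G [GE cG G0]] := hF.
have F0 : F 0 = 0 by rewrite /F !mul0r !addr0 -surjective_pairing.
have n1' := near0_gt0 cG; rewrite G0 in n1'; have {}n1' := n1' gg.
have n2' : \forall s \near (0:R)^'+, K (z.1 + s * g1, z.2 + s * g2).
  apply: cvg_within.
  have cz : {for 0, continuous (fun s : R => (z.1 + s * g1, z.2 + s * g2))}.
    by apply: cpair; cts.
  have iz' : nbhs (z.1 + 0 * g1, z.2 + 0 * g2) K.
    by rewrite !mul0r !addr0 -surjective_pairing.
  exact: (cz K iz').
have n3' : \forall s \near (0:R)^'+, 0 < s by exact: nbhs_right_gt.
have [s [[s1 s2] s3]] := @filter_ex _ ((0:R)^'+) _ _ (filterI (filterI n1' n2') n3').
have e : F s = G s * s by have := GE s; rewrite F0 !subr0.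
by have := qline_le0 t s2; rewrite -/(F s) e leNgt mulr_gt0.
Qed.

Lemma const_sign (f : R -> R) : (forall t, {for t, continuous f}) -> (forall t, f t != 0) ->
  forall a b, 0 < f a * f b.
Proof.
move=> cf f0.
have key a b : a <= b -> 0 < f a * f b.
  move=> ab; rewrite ltNge; apply/negP => h.
  have [c _ /eqP] : exists2 c, c \in `[a, b] & f c = 0.
    apply: IVT => //; first by apply: continuous_subspaceT => x; exact: cf.
    rewrite ge_min le_max; case: (ltgtP (f a) 0) => // fa.
      by rewrite -(nmulr_rle0 _ fa) h orbT.
    by rewrite -(pmulr_rle0 _ fa) h.
  by apply/negP; exact: f0.
move=> a b; have [/key//|/ltW/key] := leP a b.
by rewrite mulrC.
Qed.

Lemma norm_der (X Y : R -> R) (t dX dY : R) : 0 < X t ^+ 2 + Y t ^+ 2 ->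
  is_derive t (1:R) X dX -> is_derive t (1:R) Y dY ->
  is_derive t (1:R) (fun t : R => Num.sqrt (X t ^+ 2 + Y t ^+ 2))
    ((X t * dX + Y t * dY) / Num.sqrt (X t ^+ 2 + Y t ^+ 2)).
Proof.
move=> h hX hY; notypeclasses refine (deq _ _); first by der.
have en : Num.sqrt (X t ^+ 2 + Y t ^+ 2) != 0 by rewrite gt_eqF // sqrtr_gt0.
by cbv beta; field.
Qed.

Lemma espeed_der t : is_derive t (1:R) espeed (((velocity gamma t).1 * derive1n 2 (fst \o gamma) t + (velocity gamma t).2 * derive1n 2 (snd \o gamma) t) / espeed t).
Proof.
have [_ _ h3 h4 _] := curve_der t sg.
by apply: (norm_der _ h3 h4); rewrite -espeed_sqr exprn_gt0 // espeed_gt0.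
Qed.

Lemma tan_der t : is_derive t (1:R) tan1 (- (((velocity gamma t).1 * derive1n 2 (snd \o gamma) t
     - (velocity gamma t).2 * derive1n 2 (fst \o gamma) t) / espeed t ^+ 2) * tan2 t) /\
  is_derive t (1:R) tan2 (((velocity gamma t).1 * derive1n 2 (snd \o gamma) t
     - (velocity gamma t).2 * derive1n 2 (fst \o gamma) t) / espeed t ^+ 2 * tan1 t).
Proof.
have [_ _ h3 h4 _] := curve_der t sg.
have e2 := espeed_sqr t; have e0 := espeed_gt0 t.
have e3 : 0 < (velocity gamma t).1 ^+ 2 + (velocity gamma t).2 ^+ 2 by rewrite -e2 exprn_gt0.
have he := espeed_der t.
have en : espeed t != 0 by rewrite gt_eqF.
split.
  rewrite /tan1; notypeclasses refine (deq _ _); first by der.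
  rewrite /tan2; cbv beta; set A1 := derive1n _ _ _; set A2 := derive1n _ _ _.
  apply/eqP; rewrite -subr_eq0; apply/eqP.
  rewrite [LHS](_ : _ = A1 * (espeed t ^+ 2 - ((velocity gamma t).1 ^+ 2 + (velocity gamma t).2 ^+ 2)) / espeed t ^+ 3); first by rewrite e2 subrr mulr0 mul0r.
  by field.
rewrite /tan2; notypeclasses refine (deq _ _); first by der.
rewrite /tan1; cbv beta; set A1 := derive1n 2 (fst \o gamma) t; set A2 := derive1n 2 (snd \o gamma) t.
apply/eqP; rewrite -subr_eq0; apply/eqP.
rewrite [LHS](_ : _ = A2 * (espeed t ^+ 2 - ((velocity gamma t).1 ^+ 2 + (velocity gamma t).2 ^+ 2)) / espeed t ^+ 3); first by rewrite e2 subrr mulr0 mul0r.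
by field.
Qed.

Lemma orth_sign (n1 n2 e1 e2 : R) : n1 ^+ 2 + n2 ^+ 2 = 1 -> e1 ^+ 2 + e2 ^+ 2 = 1 -> n1 * e1 + n2 * e2 = 0 ->
  [/\ (n2 * e1 - n1 * e2) ^+ 2 = 1, n1 = - (n2 * e1 - n1 * e2) * e2 & n2 = (n2 * e1 - n1 * e2) * e1].
Proof.
move=> hn he ho; split.
- have -> : (n2 * e1 - n1 * e2) ^+ 2 = (n1 ^+ 2 + n2 ^+ 2) * (e1 ^+ 2 + e2 ^+ 2) - (n1 * e1 + n2 * e2) ^+ 2 by ring.
  by rewrite hn he ho; ring.
- have -> : - (n2 * e1 - n1 * e2) * e2 = n1 * (e1 ^+ 2 + e2 ^+ 2) - e1 * (n1 * e1 + n2 * e2) by ring.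
  by rewrite he ho; ring.
- have -> : (n2 * e1 - n1 * e2) * e1 = n2 * (e1 ^+ 2 + e2 ^+ 2) - e2 * (n1 * e1 + n2 * e2) by ring.
  by rewrite he ho; ring.
Qed.

Lemma tan_cont t : {for t, continuous tan1} /\ {for t, continuous tan2}.
Proof. by have [h1 h2] := tan_der t; split; apply: is_derive_continuous1. Qed.

(** The normal is the tangent turned by a right angle. The sense of rotation is
    constant by continuity, because [qline] never vanishes at a fixed interior
    point. *)
Lemma normal_sign : exists ep : R, ep ^+ 2 = 1 /\
  forall t, (nrm gamma nu t).1 = - ep * tan2 t /\ (nrm gamma nu t).2 = ep * tan1 t.
Proof.
have [ep h] : exists ep : R -> R, forall t,
    [/\ ep t ^+ 2 = 1, (nrm gamma nu t).1 = - ep t * tan2 t & (nrm gamma nu t).2 = ep t * tan1 t].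
  exists (fun t => (nrm gamma nu t).2 * tan1 t - (nrm gamma nu t).1 * tan2 t) => t.
  apply: orth_sign; [exact: nrm_sqr|exact: tan_sqr|].
  have [_ h] := nrm_facts t sg on; rewrite /tan1 /tan2 !mulrA -mulrDl h.
  exact: mul0r.
have [z0 iz] := iK.
have z00 : 0 < z0.2 by exact: (Kh (interior_subset iz)).
pose Q t := lineq (gamma t) (- tan2 t) (tan1 t) z0.
have qQ t : qline t z0 = ep t * Q t.
  by have [_ e1 e2] := h t; rewrite /qline e1 e2 /Q /lineq; ring.
have cQ t : {for t, continuous Q}.
  have [h1 h2] := tan_cont t; have [c1 c2 _ _] := curve_cont t sg.
  have y0 := gamma_gt0 t.
  rewrite /Q /lineq /frame_x /frame_y; ctsh.
  by rewrite !mulf_neq0 ?pnatr_eq0 ?(lt0r_neq0 y0) ?(lt0r_neq0 z00).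
have Q0 t : Q t != 0.
  by apply/negP => /eqP e; have := qline_lt0 t iz; rewrite qQ e mulr0 ltxx.
exists (ep 0); have [e0 _ _] := h 0; split => // t.
have [et e1 e2] := h t; rewrite e1 e2.
have [e|ne] := eqVneq (ep t) (ep 0); first by rewrite e.
exfalso.
have : (ep t - ep 0) * (ep t + ep 0) = 0 by rewrite -subr_sqr et e0 subrr.
move/eqP; rewrite mulf_eq0 subr_eq0 (negbTE ne) /=.
rewrite addr_eq0 => /eqP e.
have := const_sign cQ Q0 t 0; have := qline_lt0 t iz; have := qline_lt0 0 iz.
rewrite !qQ e mulNr oppr_lt0 => a1 a2 a3.
have : 0 < ep 0 ^+ 2 * (Q t * Q 0) by rewrite e0 mul1r.
have -> : ep 0 ^+ 2 * (Q t * Q 0) = (ep 0 * Q t) * (ep 0 * Q 0) by ring.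
by rewrite (pmulr_rgt0 _ a2) ltNge (ltW a1).
Qed.

Definition sig (t : R) : R := hcurvature gamma nu t.
Definition vs (t : R) : R := speed gamma t.

(** The hyperbolic curvature is the Euclidean one, rescaled, plus the term that the
    Christoffel symbols contribute. *)
Lemma frame_all : exists ep : R, [/\ ep ^+ 2 = 1,
  forall t, (nrm gamma nu t).1 = - ep * tan2 t /\ (nrm gamma nu t).2 = ep * tan1 t
 & forall t, sig t * vs t = - ep * (((velocity gamma t).1 * derive1n 2 (snd \o gamma) t
     - (velocity gamma t).2 * derive1n 2 (fst \o gamma) t) / espeed t ^+ 2 + (velocity gamma t).1 / (gamma t).2)].
Proof.
have [ep [ep2 h]] := normal_sign; exists ep; split => // t.
have y0 := gamma_gt0 t; have e0 := espeed_gt0 t; have [h1 h2] := h t.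
have yn : (gamma t).2 != 0 by rewrite gt_eqF.
have en : espeed t != 0 by rewrite gt_eqF.
have nE1 : (nu t).1 = - ep * tan2 t * (gamma t).2 by rewrite -h1 /nrm /= divfK.
have nE2 : (nu t).2 = ep * tan1 t * (gamma t).2 by rewrite -h2 /nrm /= divfK.
have mE : hmetric (gamma t) (velocity gamma t) (velocity gamma t) = espeed t ^+ 2 / (gamma t).2 ^+ 2.
  by rewrite /hmetric espeed_sqr !expr2.
rewrite /vs speedE // -/(espeed t) /sig /hcurvature mE /hmetric /hacceleration /christoffel.
set A1 := derive1n 2 (fst \o gamma) t; set A2 := derive1n 2 (snd \o gamma) t.
rewrite /= nE1 nE2 /tan1 /tan2.
rewrite -[derive1 (fst \o gamma) t]/((velocity gamma t).1) -[derive1 (snd \o gamma) t]/((velocity gamma t).2).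
set vx := (velocity gamma t).1; set vy := (velocity gamma t).2.
have e2 : vy ^+ 2 = espeed t ^+ 2 - vx ^+ 2 by rewrite espeed_sqr; ring.
apply/eqP; rewrite -subr_eq0; apply/eqP.
rewrite [LHS](_ : _ = ep * vx * (espeed t ^+ 2 - vx ^+ 2 - vy ^+ 2) / ((gamma t).2 * espeed t ^+ 2)).
  by rewrite e2 subrr mulr0 mul0r.
by field; rewrite yn en.
Qed.

Lemma sig_cont t : {for t, continuous sig}.
Proof.
have [ep [_ _ h]] := frame_all.
have -> : sig = (fun t => (- ep * (((velocity gamma t).1 * derive1n 2 (snd \o gamma) t
     - (velocity gamma t).2 * derive1n 2 (fst \o gamma) t) / espeed t ^+ 2 + (velocity gamma t).1 / (gamma t).2)) / vs t).
  by apply/funext => s; rewrite -h mulfK // gt_eqF // speed_gt0.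
have [c1 c2 c3 c4] := curve_cont t sg; have [c5 c6] := curve_cont2 t sg.
have y0 := gamma_gt0 t; have e0 := espeed_gt0 t.
have cv : {for t, continuous vs} by exact: speed_cont.
have ce : {for t, continuous espeed} by exact: is_derive_continuous1 (espeed_der t).
clear h; move: (derive1n 2 (fst \o gamma)) (derive1n 2 (snd \o gamma)) c5 c6 => A1 A2 c5 c6.
have en : espeed t != 0 by exact: lt0r_neq0 e0.
have vn : vs t != 0 by exact: lt0r_neq0 (speed_gt0 t).
move: (espeed) (vs) ce cv en vn => e v ce cv en vn.
move: (velocity gamma) c3 c4 => V c3 c4.
ctsh => //; first exact: expf_neq0.
exact: lt0r_neq0 y0.
Qed.

(** The Frenet equations, read off in the coordinates of a fixed point z. *)
Lemma frame_der t z : hplane z ->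
  is_derive t (1:R) (fun t : R => qline t z) (sig t * vs t * rline t z) /\
  is_derive t (1:R) (fun t : R => rline t z) (- vs t * (cosh_dist (gamma t) z + sig t * qline t z)).
Proof.
move=> hz; have z0 : 0 < z.2 by [].
have [ep [ep2 h hs]] := frame_all.
have [h1 h2 _ _ y0] := curve_der t sg; have e0 := espeed_gt0 t.
have [d1 d2] := tan_der t.
have yn : (gamma t).2 != 0 by rewrite gt_eqF.
have en : espeed t != 0 by rewrite gt_eqF.
have zn : z.2 != 0 by rewrite gt_eqF.
set k := (_ / espeed t ^+ 2) in d1 d2; have hst := hs t; rewrite -/k in hst.
have ha : is_derive t (1:R) (fun t : R => frame_x (gamma t) z) ((velocity gamma t).1 / (gamma t).2 * frame_y (gamma t) z
    - cosh_dist (gamma t) z * (velocity gamma t).1 / (gamma t).2).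
  rewrite /frame_x; notypeclasses refine (deq _ _); first by der.
  by rewrite /frame_y /cosh_dist; cbv beta; field; rewrite yn.
have hbe : is_derive t (1:R) (fun t : R => frame_y (gamma t) z) (- ((velocity gamma t).1 / (gamma t).2 * frame_x (gamma t) z)
    - cosh_dist (gamma t) z * (velocity gamma t).2 / (gamma t).2).
  rewrite /frame_y; notypeclasses refine (deq _ _); first by der; rewrite !mulf_neq0.
  by rewrite /frame_x /cosh_dist; cbv beta; field; rewrite yn.
have vE : vs t = espeed t / (gamma t).2 by rewrite /vs speedE.
have vx : (velocity gamma t).1 = tan1 t * espeed t by rewrite /tan1 divfK.
have vy : (velocity gamma t).2 = tan2 t * espeed t by rewrite /tan2 divfK.
split.
  have -> : (fun t : R => qline t z) = (fun t : R => - ep * tan2 t * frame_x (gamma t) z + ep * tan1 t * frame_y (gamma t) z).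
    by apply/funext => s; have [a1 a2] := h s; rewrite /qline /lineq a1 a2.
  notypeclasses refine (deq _ _); first by der.
  by rewrite hst /rline /lineq vx vy; cbv beta; field.
have -> : (fun t : R => rline t z) = (fun t : R => tan1 t * frame_x (gamma t) z + tan2 t * frame_y (gamma t) z) by [].
notypeclasses refine (deq _ _); first by der.
have qE : qline t z = ep * (- tan2 t * frame_x (gamma t) z + tan1 t * frame_y (gamma t) z).
  by have [a1 a2] := h t; rewrite /qline /lineq a1 a2; ring.
have -> : - vs t * (cosh_dist (gamma t) z + sig t * qline t z) = - vs t * cosh_dist (gamma t) z
   + ep ^+ 2 * (k + (velocity gamma t).1 / (gamma t).2) * (- tan2 t * frame_x (gamma t) z + tan1 t * frame_y (gamma t) z).
  by rewrite qE mulrDr (_ : - vs t * (sig t * _) = - (sig t * vs t) * qline t z); [rewrite hst qE; ring | rewrite qE; ring].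
rewrite ep2 mul1r vE vx vy; cbv beta.
apply/eqP; rewrite -subr_eq0; apply/eqP.
rewrite [LHS](_ : _ = cosh_dist (gamma t) z * espeed t / (gamma t).2 * (1 - (tan1 t ^+ 2 + tan2 t ^+ 2))); first by rewrite tan_sqr subrr mulr0.
by field.
Qed.

End Frame.

Section Geo.
Variables (R : realType) (K : set (R * R)) (gamma nu : R -> R * R).
Variable hb : body K gamma nu.
Local Notation q := (qline gamma nu).
Local Notation r := (rline gamma).
Local Notation sig := (sig gamma nu).
Local Notation v := (vs gamma).

Lemma mvt_seg (f df : R -> R) (a b : R) : a < b -> (forall t, is_derive t (1:R) f (df t)) ->
  exists c, [/\ a < c, c < b & f b - f a = df c * (b - a)].
Proof.
move=> ab hf.
have cf t : {for t, continuous f} by exact: is_derive_continuous1 (hf t).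
have [c] := MVT ab (fun c _ => hf c) (continuous_subspaceT cf).
by rewrite in_itv /= => /andP[h1 h2] e; exists c.
Qed.

Lemma derive1_per (f : R -> R) t : (forall s, f (s + 1) = f s) -> (forall s, derivable f s 1) ->
  derive1 f (t + 1) = derive1 f t.
Proof.
move=> per df; rewrite !derive1E.
have h1 : is_derive (t + 1) (1:R) f ('D_1 f (t + 1)) by exact: derivableP.
have h2 : is_derive t (1:R) (fun s : R => f (s + 1)) ('D_1 f (t + 1)).
  have h3 : is_derive t (1:R) (fun s : R => s + 1) 1 by dert; ring.
  have := @dcomp R _ f (fun s : R => s + 1) t 1 _ _ h1 h3; rewrite mulr1; exact.
rewrite (_ : (fun s : R => f (s + 1)) = f) in h2; last exact/funext.
by rewrite [RHS](@derive_val _ _ _ _ _ _ _ h2).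
Qed.

Lemma velocity_per t : velocity gamma (t + 1) = velocity gamma t.
Proof.
have [[_ sg] per _ _ _] : boundary_param K gamma by case: hb => _ _ _ _ [].
rewrite /velocity; congr pair; apply: derive1_per => s /=; rewrite ?per //.
- have [h _] := sg 0%N s; rewrite derive1n0 in h; exact: h.
- have [_ h] := sg 0%N s; rewrite derive1n0 in h; exact: h.
Qed.

Lemma derive2_per t : derive1n 2 (fst \o gamma) (t + 1) = derive1n 2 (fst \o gamma) t /\
  derive1n 2 (snd \o gamma) (t + 1) = derive1n 2 (snd \o gamma) t.
Proof.
have [[_ sg] per _ _ _] : boundary_param K gamma by case: hb => _ _ _ _ [].
rewrite !derive1nS !derive1n0; split; apply: derive1_per => s.
- by have := velocity_per s; rewrite /velocity => -[].
- have [h _] := sg 1%N s; rewrite derive1n1 in h; exact: h.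
- by have := velocity_per s; rewrite /velocity => -[].
- have [_ h] := sg 1%N s; rewrite derive1n1 in h; exact: h.
Qed.

Lemma gamma_per1 t : gamma (t + 1) = gamma t.
Proof. by have [_ per _ _ _] : boundary_param K gamma by case: hb => _ _ _ _ []. Qed.

Lemma frame_per t z : [/\ q (t + 1) z = q t z, r (t + 1) z = r t z,
   sig (t + 1) * v (t + 1) = sig t * v t & v (t + 1) = v t].
Proof.
have [ep [_ h1 h2]] := frame_all hb.
have eE : espeed gamma (t + 1) = espeed gamma t by rewrite /espeed velocity_per.
have t1 : tan1 gamma (t + 1) = tan1 gamma t by rewrite /tan1 velocity_per eE.
have t2 : tan2 gamma (t + 1) = tan2 gamma t by rewrite /tan2 velocity_per eE.
have [d1 d2] := derive2_per t.
split.
- have [a1 a2] := h1 t; have [b1 b2] := h1 (t + 1).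
  by rewrite /qline a1 a2 b1 b2 t1 t2 gamma_per1.
- by rewrite /rline t1 t2 gamma_per1.
- by rewrite !h2 d1 d2 velocity_per eE gamma_per1.
- by rewrite /vs /speed velocity_per gamma_per1.
Qed.

Lemma cosh_dist_qr t z : hplane z -> cosh_dist (gamma t) z ^+ 2 = 1 + q t z ^+ 2 + r t z ^+ 2.
Proof.
move=> z0; rewrite cosh_distE //; last exact: (gamma_gt0 hb t).
have [ep [e2 h1 _]] := frame_all hb; have [a1 a2] := h1 t.
rewrite /qline /rline /lineq a1 a2.
have -> : 1 + (- ep * tan2 gamma t * frame_x (gamma t) z + ep * tan1 gamma t * frame_y (gamma t) z) ^+ 2 +
   (tan1 gamma t * frame_x (gamma t) z + tan2 gamma t * frame_y (gamma t) z) ^+ 2 =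
   1 + (tan1 gamma t * frame_x (gamma t) z + tan2 gamma t * frame_y (gamma t) z) ^+ 2 +
    ep ^+ 2 * (tan1 gamma t * frame_y (gamma t) z - tan2 gamma t * frame_x (gamma t) z) ^+ 2 by ring.
rewrite e2.
have -> : 1 + (tan1 gamma t * frame_x (gamma t) z + tan2 gamma t * frame_y (gamma t) z) ^+ 2 +
    1 * (tan1 gamma t * frame_y (gamma t) z - tan2 gamma t * frame_x (gamma t) z) ^+ 2 =
   1 + (tan1 gamma t ^+ 2 + tan2 gamma t ^+ 2) * (frame_x (gamma t) z ^+ 2 + frame_y (gamma t) z ^+ 2) by ring.
by rewrite (tan_sqr hb) mul1r addrA.
Qed.

Lemma cosh_dist_frame t z : hplane z -> cosh_dist (gamma t) z = Num.sqrt (1 + q t z ^+ 2 + r t z ^+ 2).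
Proof.
move=> z0; rewrite -cosh_dist_qr // sqrtr_sqr gtr0_norm // cosh_dist_gt0 //.
exact: (gamma_gt0 hb t).
Qed.

Lemma q_cont z t : hplane z -> {for t, continuous (fun t => q t z)}.
Proof. by move=> z0; have [h _] := frame_der hb t z0; exact: is_derive_continuous1 h. Qed.

Lemma r_cont z t : hplane z -> {for t, continuous (fun t => r t z)}.
Proof. by move=> z0; have [_ h] := frame_der hb t z0; exact: is_derive_continuous1 h. Qed.

Lemma cosh_dist_gamma_cont z t : hplane z -> {for t, continuous (fun t => cosh_dist (gamma t) z)}.
Proof.
move=> z0; have -> : (fun t => cosh_dist (gamma t) z) = (fun t => Num.sqrt (1 + q t z ^+ 2 + r t z ^+ 2)).
  by apply/funext => s; exact: cosh_dist_frame.
have h1 := @q_cont z t z0; have h2 := @r_cont z t z0.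
by ctsh.
Qed.

Lemma v_cont t : {for t, continuous v}.
Proof. exact: speed_cont (bg_smooth hb). Qed.

Lemma v_gt0 t : 0 < v t. Proof. exact: speed_gt0 hb t. Qed.

Lemma gamma_hplane t : hplane (gamma t). Proof. exact: (gamma_gt0 hb t). Qed.

Lemma cosh_dist_self (a : R * R) : hplane a -> cosh_dist a a = 1.
Proof. by rewrite /hplane /= => a0; rewrite /cosh_dist subrr; field; rewrite gt_eqF. Qed.

(** Otherwise gamma would leave K across its tangent geodesic at gamma t0. *)
Lemma sig_ge0 t0 : 0 <= sig t0.
Proof.
rewrite leNgt; apply/negP => s0.
have z0 := gamma_hplane t0; set z := gamma t0 in z0.
have q00 : q t0 z = 0 by rewrite /qline lineq_self // (gamma_gt0 hb).
have r00 : r t0 z = 0 by rewrite /rline lineq_self // (gamma_gt0 hb).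
pose D t := cosh_dist (gamma t) z + sig t * q t z.
have cq := @q_cont z t0 z0; have cc := @cosh_dist_gamma_cont z t0 z0.
have cs := @sig_cont _ _ _ _ hb t0.
have cD : {for t0, continuous D} by rewrite /D; ctsh.
have D0 : 0 < D t0 by rewrite /D q00 mulr0 addr0 cosh_dist_self.
have s0' : 0 < - sig t0 by rewrite oppr_gt0.
have n1 : \forall t \near t0, 0 < D t.
  near=> t; have : `|D t0 - D t| < D t0 by near: t; exact: (@cvgrPdist_lt _ _ _ _ _ _ _).1 cD _ D0.
  by have := ler_norm (D t0 - D t); lra.
have n2 : \forall t \near t0, sig t < 0.
  near=> t; have : `|sig t0 - sig t| < - sig t0 by near: t; exact: (@cvgrPdist_lt _ _ _ _ _ _ _).1 cs _ s0'.
  by have := ler_norm (- (sig t0 - sig t)); rewrite normrN; lra.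
have [e /= e0 he] := filterI n1 n2.
pose b := t0 + e / 2.
have inb t : t0 <= t <= b -> 0 < D t /\ sig t < 0.
  move=> /andP[h1 h2]; apply: he; rewrite /= ler0_norm; last by rewrite subr_le0.
  by rewrite /b in h2; lra.
have rneg t : t0 < t -> t <= b -> r t z < 0.
  move=> tt tb.
  have [c [c1 c2]] := mvt_seg tt (fun t => (frame_der hb t z0).2).
  have tc : t0 <= c <= b by apply/andP; split; lra.
  have [Dc _] := inb c tc.
  rewrite -/(D c) r00 subr0 => ->.
  by rewrite mulNr mulNr oppr_lt0 mulr_gt0 ?subr_gt0 // mulr_gt0 ?v_gt0.
have tb : t0 < b by rewrite /b; lra.
have [c [c1 c2]] := mvt_seg tb (fun t => (frame_der hb t z0).1).
have := rneg c c1 (ltW c2) => rc.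
have tc : t0 <= c <= b by apply/andP; split; lra.
have [_ sc] := inb c tc.
rewrite q00 subr0 => e1.
have : q b z <= 0 by apply: (qline_le0 hb); exact: (gamma_K hb).
rewrite e1 leNgt => /negP; apply; rewrite mulr_gt0 ?subr_gt0 //.
have -> : sig c * v c * r c z = (- sig c) * (v c * - r c z) by ring.
by rewrite mulr_gt0 ?oppr_gt0 // mulr_gt0 ?v_gt0 // oppr_gt0.
Unshelve. all: by end_near. Qed.

Definition total_length : R := hlength gamma.
Definition total_curv : R := sint 0 1 (fun t => sig t * v t).

Lemma length_gt0 : 0 < total_length.
Proof.
rewrite /total_length hlengthE; apply: (@sint_gt0 _ _ _ _ 0) => //.
- by move=> t _; exact: v_cont.
- by move=> t _; exact: ltW (v_gt0 t).
- by rewrite lexx ler01.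
- exact: v_gt0.
Qed.

(** If the curvature vanished, [rline] would be strictly decreasing along gamma,
    against periodicity. *)
Lemma total_curv_gt0 : 0 < total_curv.
Proof.
have [t ts] : exists t, 0 <= t <= 1 /\ 0 < sig t.
  apply: contrapT => h.
  have s0 t : 0 <= t <= 1 -> sig t = 0.
    move=> t01; apply/eqP; rewrite eq_le sig_ge0 andbT leNgt; apply/negP => s.
    by apply: h; exists t.
  have z0 := gamma_hplane 0; set z := gamma 0 in z0.
  have [c [c1 c2]] := mvt_seg ltr01 (fun t => (frame_der hb t z0).2).
  rewrite s0 ?(ltW c1) ?(ltW c2) // mul0r addr0 subr0 mulr1.
  have [_ e _ _] := frame_per 0 z; rewrite add0r in e; rewrite e subrr => /eqP.
  rewrite mulNr eq_sym oppr_eq0 mulf_eq0 !gt_eqF ?v_gt0 ?cosh_dist_gt0 //.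
  exact: gamma_hplane.
apply: (@sint_gt0 _ _ _ _ t) => //.
- by move=> s _; have h1 := @sig_cont _ _ _ _ hb s; have h2 := @v_cont s; ctsh.
- by move=> s _; rewrite mulr_ge0 ?sig_ge0 // ltW ?v_gt0.
- by case: ts.
- by case: ts => _ ts; rewrite mulr_gt0 // v_gt0.
Qed.

End Geo.

(** * An inequality of Crofton type *)

Section Crofton.
Variables (R : realType) (K : set (R * R)) (gamma nu : R -> R * R).
Variable hb : body K gamma nu.
Local Notation q := (qline gamma nu).
Local Notation r := (rline gamma).
Local Notation sig := (sig gamma nu).
Local Notation v := (vs gamma).

(** The path is on the frontier at the supremum of the parameters in K. *)
Lemma frontier_cross (P : R -> R * R) : closed K -> (forall s, {for s, continuous P}) ->
  K (P 0) -> ~ K (P 1) -> exists s, [/\ 0 <= s, s < 1 & (closure K `\` K°) (P s)].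
Proof.
move=> cK cP K0 nK1.
pose S := [set s : R | [/\ 0 <= s, s <= 1 & K (P s)]].
have S0 : S 0 by split; rewrite ?lexx ?ler01.
have hS : has_sup S by split; [exists 0 | exists 1 => s []].
pose s1 := sup S.
have s1ge s : S s -> s <= s1 by move=> Ss; exact: (ub_le_sup hS.2 Ss).
have s10 : 0 <= s1 by exact: s1ge.
have s11 : s1 <= 1 by apply: ge_sup; [exists 0 | move=> s []].
have Ks1 : K (P s1).
  apply: contrapT => nKs1.
  have op : nbhs (P s1) (~` K).
    apply: open_nbhs_nbhs; split => //; apply: closed_openC; exact: cK.
  have [e /= e0 he] := cP s1 _ op.
  have [s Ss hs] := sup_adherent e0 hS.
  have [s0 s01 Ks] := Ss.
  have /he : ball s1 e s by rewrite /ball /= ger0_norm ?subr_ge0 ?s1ge // -/s1 in hs *; lra.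
  by apply.
have s1n1 : s1 < 1.
  by rewrite lt_neqAle s11 andbT; apply/negP => /eqP e; apply: nK1; rewrite -e.
have fr : (closure K `\` K°) (P s1).
  split; first exact: subset_closure.
  move=> i1.
  have [e /= e0 he] := cP s1 _ i1.
  pose d := Num.min (e / 2) (1 - s1).
  have d0 : 0 < d by rewrite lt_min divr_gt0 //= subr_gt0.
  have de : d <= e / 2 by rewrite ge_min lexx.
  have d1 : d <= 1 - s1 by rewrite ge_min lexx orbT.
  have /he Kd : ball s1 e (s1 + d).
    by rewrite /ball /= opprD addNKr normrN gtr0_norm //; lra.
  have : s1 + d <= s1 by apply: s1ge; split => //; lra.
  by lra.
by exists s1.
Qed.

(** The segment from an interior point to z, in the coordinates (x, x^2 + y^2),
    crosses the frontier at some gamma t. Along it [qline] t is an affine function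
    up to a positive factor; being negative at the start and zero at the crossing,
    it is positive at z. *)
Lemma outside_pos z : hplane z -> ~ K z -> exists t, 0 < q t z.
Proof.
move=> hz nK.
have [Kh cK ptK [z0 iz0] [bg _]] := hb.
have K0 : K z0 by exact: interior_subset.
have h0 : 0 < z0.2 by exact: (Kh _ K0).
have h1 : 0 < z.2 by exact: hz.
pose W0 := z0.1 ^+ 2 + z0.2 ^+ 2; pose W1 := z.1 ^+ 2 + z.2 ^+ 2.
pose X (s : R) := (1 - s) * z0.1 + s * z.1; pose W (s : R) := (1 - s) * W0 + s * W1.
pose P (s : R) := (X s, Num.sqrt (W s - X s ^+ 2)).
have WX s : 0 <= s -> s <= 1 -> 0 < W s - X s ^+ 2.
  move=> s0 s1.
  have -> : W s - X s ^+ 2 = s * z.2 ^+ 2 + (1 - s) * z0.2 ^+ 2 + s * (1 - s) * (z.1 - z0.1) ^+ 2.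
    by rewrite /W /X /W0 /W1; ring.
  have a1 : 0 <= s * (1 - s) * (z.1 - z0.1) ^+ 2.
    by apply: mulr_ge0; [apply: mulr_ge0; rewrite ?subr_ge0 | exact: sqr_ge0].
  have a2 : 0 < z.2 ^+ 2 by rewrite exprn_gt0.
  have a3 : 0 < z0.2 ^+ 2 by rewrite exprn_gt0.
  have [->|sn] := eqVneq s 0; first lra.
  have sp : 0 < s by rewrite lt0r sn.
  have a4 : 0 < s * z.2 ^+ 2 by rewrite mulr_gt0.
  have a5 : 0 <= (1 - s) * z0.2 ^+ 2 by rewrite mulr_ge0 ?(ltW a3) // subr_ge0.
  lra.
have P0 : P 0 = z0.
  rewrite /P /X /W subr0 !mul1r !mul0r !addr0 /W0 [in RHS](surjective_pairing z0); congr pair.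
  by rewrite addrC addKr sqrtr_sqr gtr0_norm.
have P1 : P 1 = z.
  rewrite /P /X /W subrr !mul1r !mul0r !add0r /W1 [in RHS](surjective_pairing z); congr pair.
  by rewrite addrC addKr sqrtr_sqr gtr0_norm.
have cP s : {for s, continuous P} by rewrite /P /X /W; apply: cpair; cts.
have [s1 [s10 s1n1 fr]] : exists s, [/\ 0 <= s, s < 1 & (closure K `\` K°) (P s)].
  by apply: frontier_cross => //; rewrite ?P0 ?P1 //; exact: (closedK hb).
have s11 : s1 <= 1 by exact: ltW.
have [_ _ _ _ fE] := bg; rewrite -fE in fr.
have [t _ gt] := fr.
exists t.
have y0 := gamma_gt0 hb t.
pose n1 := (nrm gamma nu t).1; pose n2 := (nrm gamma nu t).2.
pose x := (gamma t).1; pose y := (gamma t).2.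
pose A s := n1 * (X s - x) * (2 * y) + n2 * (W s - 2 * x * X s + x ^+ 2 - y ^+ 2).
have AE s : 0 <= s -> s <= 1 -> A s = q t (P s) * (2 * y * Num.sqrt (W s - X s ^+ 2)).
  move=> s0 s01; have := WX s s0 s01 => w0.
  have sw : 0 < Num.sqrt (W s - X s ^+ 2) by rewrite sqrtr_gt0.
  have sq := sqr_sqrtr (ltW w0).
  rewrite /A /qline -/n1 -/n2; clearbody n1 n2.
  rewrite /lineq /frame_x /frame_y /P /= sq -/x -/y; field.
  by rewrite !gt_eqF.
have A0 : A 0 < 0.
  rewrite AE ?lexx ?ler01 // P0 pmulr_llt0 ?(qline_lt0 hb) //.
  by rewrite !mulr_gt0 ?sqrtr_gt0 ?WX ?lexx ?ler01.
have A1 : A s1 = 0.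
  by rewrite AE // -gt /qline lineq_self // mul0r.
have Aaff : A s1 = (1 - s1) * A 0 + s1 * A 1 by rewrite /A /X /W; ring.
have A1p : 0 < s1 * A 1.
  have := A1; rewrite Aaff => e.
  have -> : s1 * A 1 = (1 - s1) * - A 0 by lra.
  by rewrite mulr_gt0 ?subr_gt0 // oppr_gt0.
have {}A1p : 0 < A 1.
  by rewrite ltNge; apply/negP => h; have := mulr_ge0_le0 s10 h; rewrite leNgt A1p.
move: A1p; rewrite AE ?lexx ?ler01 // P1 pmulr_lgt0 //.
by rewrite !mulr_gt0 ?sqrtr_gt0 ?WX ?lexx ?ler01.
Qed.

Lemma ler_sqr_norm (x y : R) : (x ^+ 2 <= y ^+ 2) = (`|x| <= `|y|).
Proof. by rewrite -[x ^+ 2]real_normK ?num_real // -[y ^+ 2]real_normK ?num_real // ler_sqr ?nnegrE. Qed.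

Lemma sint_per (G : R -> R) (a : R) : continuous G -> (forall t, G (t + 1) = G t) ->
  sint a (a + 1) G = sint 0 1 G.
Proof.
move=> cG pG; have [F [hF sF]] := sint_prim cG.
rewrite !sF ?ler01 ?lerDl //.
pose D (x : R) := F (x + 1) - F x.
have hD x : is_derive x (1:R) D 0.
  have h3 : is_derive x (1:R) (fun s : R => s + 1) 1 by dert; ring.
  have := @dcomp R _ F (fun s : R => s + 1) x 1 _ _ (hF (x + 1)) h3; rewrite mulr1 pG => h4.
  have := hF x => h5.
  by rewrite /D; notypeclasses refine (deq _ _); [exact: (dsub h4 h5) | rewrite subrr].
have : D a = D 0.
  case: (ltgtP a 0) => [a0|a0|-> //].
    by have [c [_ _ /eqP]] := mvt_seg a0 hD; rewrite mul0r subr_eq0 => /eqP.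
  by have [c [_ _ /eqP]] := mvt_seg a0 hD; rewrite mul0r subr_eq0 => /eqP.
by rewrite /D add0r.
Qed.

Lemma last_zero (f : R -> R) (s t : R) : continuous f -> s < t -> f s <= 0 -> 0 < f t ->
  exists a, [/\ s <= a, a < t, f a = 0 & forall x, a < x -> x <= t -> 0 < f x].
Proof.
move=> cf st fs ft.
pose S := [set x : R | [/\ s <= x, x <= t & f x <= 0]].
have S0 : S s by split => //; exact: ltW.
have hS : has_sup S by split; [exists s | exists t => x []].
pose a := sup S.
have age x : S x -> x <= a by move=> Sx; exact: (ub_le_sup hS.2 Sx).
have as_ : s <= a by exact: age.
have at_ : a <= t by apply: ge_sup; [exists s | move=> x []].
have fa : f a <= 0.
  rewrite leNgt; apply/negP => fa.
  have := (@cvgrPdist_lt _ _ _ _ _ _ _).1 (cf a) _ fa.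
  move=> [e /= e0 he].
  have [x Sx hx] := sup_adherent e0 hS.
  have xa := age _ Sx; have [_ _ fx] := Sx.
  have /he : ball a e x by rewrite /ball /= ger0_norm ?subr_ge0 // -/a in hx *; lra.
  by move=> /= h; have := ler_norm (f a - f x); lra.
have at1 : a < t.
  by rewrite lt_neqAle at_ andbT; apply/negP => /eqP e; move: fa; rewrite e leNgt ft.
have pos x : a < x -> x <= t -> 0 < f x.
  move=> ax xt; rewrite ltNge; apply/negP => fx.
  have : x <= a by apply: age; split => //; lra.
  by rewrite leNgt ax.
exists a; split => //.
apply/eqP; rewrite eq_le fa /=.
rewrite leNgt; apply/negP => fan.
have fan' : 0 < - f a by rewrite oppr_gt0.
have [e /= e0 he] := (@cvgrPdist_lt _ _ _ _ _ _ _).1 (cf a) _ fan'.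
pose d := Num.min (e / 2) (t - a).
have d0 : 0 < d by rewrite lt_min divr_gt0 //= subr_gt0.
have de : d <= e / 2 by rewrite ge_min lexx.
have d1 : d <= t - a by rewrite ge_min lexx orbT.
have /he /= h : ball a e (a + d).
  by rewrite /ball /= opprD addNKr normrN gtr0_norm //; lra.
have : 0 < f (a + d) by apply: pos; lra.
by have := ler_norm (- (f a - f (a + d))); rewrite normrN; lra.
Qed.

Lemma first_zero (f : R -> R) (s t : R) : continuous f -> s < t -> 0 < f s -> f t <= 0 ->
  exists b, [/\ s < b, b <= t, f b = 0 & forall x, s <= x -> x < b -> 0 < f x].
Proof.
move=> cf st fs ft.
have cg : continuous (fun x => f (- x)).
  move=> x; have cN : {for x, continuous (fun x : R => - x)} by cts.
  exact: (ccomp (cf (- x)) cN).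
have := @last_zero (fun x => f (- x)) (- t) (- s) cg; rewrite !opprK ltrN2 => /(_ st ft fs).
move=> [a [h1 h2 h3 h4]]; exists (- a); split; [lra|lra|by []|].
by move=> x x1 x2; have := h4 (- x); rewrite opprK; apply; lra.
Qed.

(** While gamma runs along the part of the boundary that faces z, the coordinate r
    decreases. It is positive where q becomes positive and negative where q
    vanishes again, since q' = sigma v r; there |r| >= m0 by the assumption on
    the distance from z to gamma. *)
Lemma crofton_arc z (m0 : R) : hplane z -> 0 < m0 ->
  (forall t, 1 + m0 ^+ 2 <= cosh_dist (gamma t) z ^+ 2) -> (exists t, 0 < q t z) ->
  exists a b, [/\ a < b, b <= a + 1, forall t, a <= t -> t <= b -> 0 <= q t z,
     m0 <= r a z & r b z <= - m0].
Proof.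
move=> hz m00 hc [t0 qt0].
have cq : continuous (fun t => q t z) by move=> t; exact: (@q_cont _ _ _ _ hb z t hz).
have hQ t := (frame_der hb t hz).1; have hR t := (frame_der hb t hz).2.
have cpos t : 0 < cosh_dist (gamma t) z by apply: cosh_dist_gt0 => //; exact: (gamma_hplane hb).
have rdec t t' : t < t' -> (forall x, t < x -> x < t' -> 0 <= q x z) -> r t' z < r t z.
  move=> tt' h; have [c [c1 c2 e]] := mvt_seg tt' hR.
  rewrite -subr_lt0 e mulNr mulNr oppr_lt0 mulr_gt0 ?subr_gt0 // mulr_gt0 ?(v_gt0 hb) //.
  by rewrite ltr_wpDr // mulr_ge0 ?(sig_ge0 hb) // h.
(* otherwise r would be strictly decreasing and periodic *)
have [s qs] : exists s, q s z <= 0.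
  apply: contrapT => h.
  have : r 1 z < r 0 z.
    apply: rdec => // x _ _; apply: ltW; rewrite ltNge; apply/negP => hx.
    by apply: h; exists x.
  have [_ e _ _] := frame_per hb 0 z; rewrite add0r in e.
  by rewrite e ltxx.
have qper (n : nat) t : q (t + n%:R) z = q t z.
  elim: n => [|n IH]; first by rewrite addr0.
  by have [e _ _ _] := frame_per hb (t + n%:R) z; rewrite -natr1 addrA e.
(* a parameter in the period before t0 at which q is nonpositive *)
have [s' [s1 s2 qs']] : exists s', [/\ t0 - 1 <= s', s' < t0 & q s' z <= 0].
  have /andP[h1 h2] := Num.Theory.real_floor_itv (num_real (t0 - s)).
  rewrite intrD in h2.
  have e : q (s + (Num.floor (t0 - s))%:~R) z = q s z.
    case: (Num.floor (t0 - s)) => [n|n]; first exact: qper.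
    by rewrite NegzE mulrNz -pmulrn -[in RHS](subrK n.+1%:R s) qper.
  exists (s + (Num.floor (t0 - s))%:~R); rewrite e; split => //; first by lra.
  rewrite lt_neqAle; apply/andP; split; last by lra.
  by apply/negP => /eqP e'; move: qs; rewrite -e e' leNgt qt0.
have qs1 : q (s' + 1) z <= 0 by have [-> _ _ _] := frame_per hb s' z.
have st : t0 < s' + 1.
  rewrite lt_neqAle; apply/andP; split; last by lra.
  by apply/negP => /eqP e'; move: qs1; rewrite -e' leNgt qt0.
have [a [a1 a2 qa pa]] := last_zero cq s2 qs' qt0.
have [b [b1 b2 qb pb]] := first_zero cq st qt0 qs1.
have ab : a < b by lra.
have pos t : a < t -> t < b -> 0 < q t z.
  by move=> h1 h2; have [h|h] := leP t t0; [exact: pa | apply: pb => //; exact: ltW].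
have ba1 : b <= a + 1.
  have [e _ _ _] := frame_per hb a z.
  rewrite leNgt; apply/negP => h.
  by have := pos (a + 1) _ h; rewrite e qa ltxx ltrDl => h'; have := h' ltr01.
have rr t : q t z = 0 -> m0 ^+ 2 <= r t z ^+ 2.
  by move=> e; have := hc t; rewrite (cosh_dist_qr hb) // e expr0n /= addr0; lra.
have rsgn t : q t z = 0 -> (m0 <= r t z) \/ (r t z <= - m0).
  move=> /rr; rewrite ler_sqr_norm (gtr0_norm m00) ler_normr => /orP[h|h]; [left|right] => //.
  lra.
exists a, b; split => //.
- move=> t h1 h2; have [->|n1] := eqVneq t a; first by rewrite qa.
  have [->|n2] := eqVneq t b; first by rewrite qb.
  by apply: ltW; apply: pos; rewrite lt_neqAle ?h1 ?h2 ?n1 ?n2 // eq_sym n1.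
- have [//|ra] := rsgn a qa.
  have [c [c1 c2 e]] := mvt_seg a2 hQ.
  have rc : r c z < r a z by apply: rdec => // x x1 x2; apply: ltW; apply: pa => //; lra.
  have : 0 < (sig c * v c * r c z) * (t0 - a) by rewrite -e qa subr0.
  rewrite pmulr_lgt0 ?subr_gt0 // ltNge => /negP[].
  apply: mulr_ge0_le0; last by lra.
  by rewrite mulr_ge0 ?(sig_ge0 hb) // ltW // (v_gt0 hb).
- have [rb|//] := rsgn b qb.
  have [c [c1 c2 e]] := mvt_seg b1 hQ.
  have rc : r b z < r c z by apply: rdec => // x x1 x2; apply: ltW; apply: pb => //; lra.
  have : (sig c * v c * r c z) * (b - t0) < 0 by rewrite -e qb sub0r oppr_lt0.
  rewrite pmulr_llt0 ?subr_gt0 // ltNge => /negP[].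
  apply: mulr_ge0; last by lra.
  by rewrite mulr_ge0 ?(sig_ge0 hb) // ltW // (v_gt0 hb).
Qed.

(** HH is to bound an energy density as a function of q, and k is a bump of
    integral 1. The last factor is minus the derivative of r. *)
Definition crofton_density (HH k : R -> R) (t : R) (z : R * R) : R :=
  HH (q t z) * k (r t z) * ((cosh_dist (gamma t) z + sig t * q t z) * v t).

Lemma crofton_density_ge0 HH k t z : hplane z -> (forall x, 0 <= HH x) -> (forall x, 0 <= k x) ->
  (forall x, x <= 0 -> HH x = 0) -> 0 <= crofton_density HH k t z.
Proof.
move=> hz H0 k0 Hn; rewrite /crofton_density.
have [h|h] := leP (q t z) 0; first by rewrite Hn // !mul0r.
rewrite !mulr_ge0 ?(ltW (v_gt0 hb t)) // addr_ge0 //.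
  by apply: ltW; apply: cosh_dist_gt0 => //; exact: (gamma_hplane hb).
by rewrite mulr_ge0 ?(sig_ge0 hb) // ltW.
Qed.

(** On the arc of [crofton_arc] the values of r cover the support of k, so the
    factor k (r) (- r') has integral 1; and on that support q lies in the range
    where h <= HH. *)
Lemma crofton_point (HH k : R -> R) (e m0 h M : R) z :
  continuous HH -> continuous k -> (forall x, 0 <= HH x) -> (forall x, 0 <= k x) ->
  (forall x, x <= 0 -> HH x = 0) -> 0 < e -> e < m0 -> (forall x, e <= `|x| -> k x = 0) ->
  sint (- e) e k = 1 ->
  hplane z -> (forall t, 1 + m0 ^+ 2 <= cosh_dist (gamma t) z ^+ 2) -> (exists t, 0 < q t z) ->
  (forall t, q t z <= M) -> 0 <= h ->
  (forall x, 0 < x -> x <= M -> m0 ^+ 2 - e ^+ 2 <= x ^+ 2 -> h <= HH x) ->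
  h <= sint 0 1 (fun t => crofton_density HH k t z).
Proof.
move=> cH ck H0 k0 Hn e0 em ke ik hz hc hq qM h0 hH.
have m00 : 0 < m0 by lra.
have [a [b [ab ba1 qab ra rb]]] := crofton_arc hz m00 hc hq.
have cG : continuous (fun t => crofton_density HH k t z).
  move=> t; have c1 := @q_cont _ _ _ _ hb z t hz; have c2 := @r_cont _ _ _ _ hb z t hz.
  have c3 := @cosh_dist_gamma_cont _ _ _ _ hb z t hz; have c4 := @v_cont _ _ _ _ hb t.
  have c5 := @sig_cont _ _ _ _ hb t.
  have c6 : {for t, continuous (fun t => HH (q t z))} by apply: ccomp => //; exact: cH.
  have c7 : {for t, continuous (fun t => k (r t z))} by apply: ccomp => //; exact: ck.
  by rewrite /crofton_density; ctsh.
have pG t : crofton_density HH k (t + 1) z = crofton_density HH k t z.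
  have [e1 e2 e3 e4] := frame_per hb t z.
  have e5 : sig (t + 1) = sig t.
    by move: e3; rewrite e4; apply: mulIf; rewrite gt_eqF // (v_gt0 hb).
  by rewrite /crofton_density e1 e2 (gamma_per1 hb) e4 e5.
have G0 t : 0 <= crofton_density HH k t z by exact: crofton_density_ge0.
rewrite -(sint_per a cG pG) (sint_cat cG (ltW ab) ba1).
apply: ler_wpDr; first by apply: sint_ge0 => t _.
have hR t := (frame_der hb t hz).2.
have [F [hF sF]] := sint_prim ck.
have cr t : {for t, continuous (fun t => r t z)} := @r_cont _ _ _ _ hb z t hz.
pose g t := k (r t z) * ((cosh_dist (gamma t) z + sig t * q t z) * v t).
have cg : continuous g.
  move=> t; have c1 := @q_cont _ _ _ _ hb z t hz; have c2 := cr t.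
  have c3 := @cosh_dist_gamma_cont _ _ _ _ hb z t hz; have c4 := @v_cont _ _ _ _ hb t.
  have c5 := @sig_cont _ _ _ _ hb t.
  have c7 : {for t, continuous (fun t => k (r t z))} by apply: ccomp => //; exact: ck.
  by rewrite /g; ctsh.
have hg t : is_derive t (1:R) (fun t : R => - F (r t z)) (g t).
  have h1 := @dcomp R _ F (fun t : R => r t z) t 1 _ _ (hF (r t z)) (hR t).
  by notypeclasses refine (deq _ _); [exact: (dopp h1) | rewrite /g; ring].
have ig : 1 <= sint a b g.
  rewrite (sint_FTC (ltW ab) (fun t _ => cg t) (fun t _ => hg t)) opprK addrC.
  have rba : r b z <= r a z by lra.
  rewrite -sF // (@sint_cat _ (r b z) (- e) (r a z)) //; [|lra|lra].
  rewrite (@sint_cat _ (- e) e (r a z)) //; [|lra|lra].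
  rewrite ik; have s1 : 0 <= sint (r b z) (- e) k by apply: sint_ge0.
  have s2 : 0 <= sint e (r a z) k by apply: sint_ge0.
  lra.
apply: (@le_trans _ _ (h * sint a b g)); first by rewrite ler_peMr.
rewrite -sintZ; last by move=> t _; exact: cg.
apply: sint_le.
- by move=> t _; have := cg t => c; ctsh.
- by move=> t _; exact: cG.
move=> t /andP[t1 t2].
rewrite /g /crofton_density.
have cpos : 0 < cosh_dist (gamma t) z by apply: cosh_dist_gt0 => //; exact: (gamma_hplane hb).
have q0 := qab t t1 t2.
have w0 : 0 <= (cosh_dist (gamma t) z + sig t * q t z) * v t.
  rewrite mulr_ge0 ?(ltW (v_gt0 hb t)) // addr_ge0 ?(ltW cpos) //.
  by rewrite mulr_ge0 ?(sig_ge0 hb).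
have [re|re] := leP e `|r t z|; first by rewrite ke // mul0r !mulr0 mul0r.
rewrite -[leRHS]mulrA; apply: ler_wpM2r; first by rewrite mulr_ge0.
have qq : m0 ^+ 2 - e ^+ 2 <= q t z ^+ 2.
  have := hc t; rewrite (cosh_dist_qr hb) //.
  have : r t z ^+ 2 <= e ^+ 2 by rewrite ler_sqr_norm (gtr0_norm e0) ltW.
  lra.
apply: hH => //.
rewrite lt0r q0 andbT; apply/negP => /eqP q00; move: qq; rewrite q00 expr0n /=.
have : e ^+ 2 < m0 ^+ 2 by rewrite ltNge ler_sqr_norm !gtr0_norm // -ltNge.
lra.
Qed.

End Crofton.

Section Swap.
Variable R : realType.
Local Notation mu := (@lebesgue_measure R).

Lemma plane_sigma_finite : sigma_finite setT (mu \x mu)%E.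
Proof.
exists (fun n : nat => `[- n%:R, n%:R]%classic `*` `[- n%:R, n%:R]%classic).
  apply/esym/seteqP; split => // -[x y] _.
  have h (a : R) (n : nat) : `|a| <= n%:R -> [set` `[- n%:R, n%:R]%R] a.
    by move=> an; rewrite /= in_itv /= -ler_norml.
  pose n := (Num.truncn (`|x| + `|y|)).+1.
  have hn : `|x| + `|y| < n%:R by exact: truncnS_gt.
  have := normr_ge0 x; have := normr_ge0 y => y0 x0.
  by exists n => //; split; apply: h; lra.
move=> n; split; first by apply: measurableX; exact: measurable_itv.
rewrite product_measure1E; [|exact: measurable_itv|exact: measurable_itv].
have fin : (mu [set` `[- n%:R, n%:R]%R] < +oo)%E.
  by rewrite lebesgue_measure_itv /=; case: ifP => _; rewrite ?ltry.
by apply: lte_mul_pinfty => //; rewrite ge0_fin_numE.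
Qed.
Definition plane_measure : {sigma_finite_measure set _ -> \bar R} :=
  HB.pack (mu \x mu)%E (Measure_isSigmaFinite.Build _ _ _ (mu \x mu)%E plane_sigma_finite).

Lemma measurable_hplane : measurable (@hplane R).
Proof. by apply: open_measurable2; exact: open_hplane. Qed.

(** Exchange of the integrals over the half-plane and along the boundary. *)
Lemma hplane_seg_le (F : (R * R) * R -> R) (g : R * R -> R) (c : R -> R) :
  measurable_fun (hplane `*` [set: R]) F ->
  (forall z t, hplane z -> 0 <= F (z, t)) -> continuous c -> (forall t, 0 <= c t) ->
  (forall t, (\int[(mu \x mu)%E]_(z in hplane) (F (z, t))%:E <= (c t)%:E)%E) ->
  (forall z, hplane z -> {for z, continuous g}) -> (forall z, hplane z -> 0 <= g z) ->
  (forall z, hplane z -> ((g z)%:E <= \int[mu]_(t in `[0%R, 1%R]) (F (z, t))%:E)%E) ->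
  (\int[(mu \x mu)%E]_(z in hplane) (g z)%:E <= (sint 0 1 c)%:E)%E.
Proof.
move=> mF F0 cc c0 hc cg g0 gF.
pose I01 : set R := [set` `[0%R, 1%R]].
have mI : measurable I01 by exact: measurable_itv.
have mD : measurable (hplane `*` I01 : set ((R * R) * R)).
  by apply: measurableX => //; exact: measurable_hplane.
have mF' : measurable_fun (hplane `*` I01) F.
  apply: measurable_funS mF => //; first by apply: measurableX => //; exact: measurable_hplane.
  by move=> z [].
pose f := (EFin \o F) \_ (hplane `*` I01).
have mf : measurable_fun setT f.
  by apply/(measurable_restrictT _ mD); exact/measurable_EFinP.
have f0 w : (0 <= f w)%E.
  rewrite /f patchE; case: ifPn => // /set_mem [h1 _].
  by rewrite /= lee_fin; case: w h1 => z t; exact: F0.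
have mg : measurable_fun setT ((EFin \o g) \_ hplane).
  apply/(measurable_restrictT _ measurable_hplane); apply/measurable_EFinP.
  by apply: continuous_on_measurable2 => //; exact: open_hplane.
have le1 : (\int[(mu \x mu)%E]_(z in hplane) (g z)%:E <=
    \int[(mu \x mu)%E]_z \int[mu]_t f (z, t))%E.
  rewrite integral_mkcond; apply: ge0_le_integral => //.
  - by move=> z _; rewrite patchE; case: ifPn => // /set_mem hz; rewrite lee_fin g0.
  - exact: (@measurable_fun_fubini_tonelli_F _ _ _ _ _ mu f mf f0).
  move=> z _; rewrite patchE; case: ifPn => hz; last by apply: integral_ge0.
  apply: (le_trans (gF z (set_mem hz))).
  rewrite integral_mkcond le_eqVlt; apply/orP; left; apply/eqP.
  apply: eq_integral => t _; rewrite /f !patchE.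
  have -> : ((z, t) \in hplane `*` I01) = (t \in I01).
    by apply/idP/idP => /set_mem h; apply/mem_set; [case: h | split => //; exact: set_mem].
  by [].
apply: (le_trans le1).
rewrite (@fubini_tonelli _ _ _ _ R (plane_measure) mu f) // -sint_EFin; last by move=> t _; exact: cc.
rewrite [leRHS]integral_mkcond.
have mc : measurable_fun [set: R] ((EFin \o c) \_ I01).
  apply/(measurable_restrictT _ mI); apply/measurable_EFinP.
  by apply: measurable_funTS; exact: continuous_measurable_fun.
apply: ge0_le_integral => //.
- by move=> t _; exact: integral_ge0.
- exact: (@measurable_fun_fubini_tonelli_G _ _ _ _ _ (plane_measure) f mf f0).
move=> t _; rewrite patchE; case: ifPn => ht.
  apply: (le_trans _ (hc t)); rewrite [leRHS]integral_mkcond le_eqVlt; apply/orP; left; apply/eqP.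
  apply: eq_integral => z _; rewrite /f !patchE.
  have -> : ((z, t) \in hplane `*` I01) = (z \in hplane).
    by apply/idP/idP => /set_mem h; apply/mem_set; [case: h | split => //; exact: set_mem].
  by [].
rewrite integral0_eq // => z _; rewrite /f patchE ifF //.
by apply/negP => /set_mem [_ h]; case/negP: ht; exact: mem_set.
Qed.

End Swap.

Section Total.
Variables (R : realType) (K : set (R * R)) (gamma nu : R -> R * R).
Variable hb : body K gamma nu.
Local Notation mu := (@lebesgue_measure R).
Local Notation q := (qline gamma nu).
Local Notation r := (rline gamma).
Local Notation sig := (sig gamma nu).
Local Notation v := (vs gamma).

Lemma measurable_hplaneT : measurable (hplane `*` setT : set ((R * R) * R)).
Proof. by apply: measurableX => //; exact: measurable_hplane. Qed.

Lemma mfst (g : R * R -> R) : (forall z, hplane z -> {for z, continuous g}) ->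
  measurable_fun (hplane `*` [set: R]) (fun w : (R * R) * R => g w.1).
Proof.
move=> cg; have mD := measurable_hplaneT.
apply: (@measurable_comp _ _ _ _ _ _ hplane g _ fst) => //.
- exact: measurable_hplane.
- by move=> _ [w [hw _] <-].
- by apply: continuous_on_measurable2 => //; exact: open_hplane.
- by apply: measurable_funTS; exact: measurable_fst.
Qed.

Lemma msnd (h : R -> R) : continuous h ->
  measurable_fun (hplane `*` [set: R]) (fun w : (R * R) * R => h w.2).
Proof.
move=> ch; have mD := measurable_hplaneT.
apply: measurableT_comp; first exact: continuous_measurable_fun.
by apply: measurable_funTS; exact: measurable_snd.
Qed.

(** The coordinates of z in the frame at gamma t are sums of separated products,
    which gives their joint measurability in (z, t). *)
Lemma separated_measurable (g1 g2 g3 : R * R -> R) (h1 h2 h3 : R -> R) :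
  (forall z, hplane z -> {for z, continuous g1}) -> (forall z, hplane z -> {for z, continuous g2}) ->
  (forall z, hplane z -> {for z, continuous g3}) ->
  continuous h1 -> continuous h2 -> continuous h3 ->
  measurable_fun (hplane `*` [set: R])
    (fun w : (R * R) * R => g1 w.1 * h1 w.2 + g2 w.1 * h2 w.2 + g3 w.1 * h3 w.2).
Proof.
move=> c1 c2 c3 d1 d2 d3.
by apply: measurable_funD; [apply: measurable_funD|]; apply: measurable_funM; by [exact: mfst | exact: msnd].
Qed.

Lemma tan_continuous : continuous (tan1 gamma) /\ continuous (tan2 gamma).
Proof. by split => t; have [h1 h2] := @tan_cont _ _ _ _ hb t. Qed.

Lemma frame_measurable (e1 e2 : R -> R) : continuous e1 -> continuous e2 ->
  measurable_fun (hplane `*` [set: R]) (fun w : (R * R) * R => lineq (gamma w.2) (e1 w.2) (e2 w.2) w.1).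
Proof.
move=> c1 c2.
have mD : measurable (hplane `*` setT : set ((R * R) * R)).
  by apply: measurableX => //; exact: measurable_hplane.
pose g1 (z : R * R) := z.1 / z.2; pose g2 (z : R * R) := z.2^-1.
pose g3 (z : R * R) := (z.1 ^+ 2 + z.2 ^+ 2) / z.2.
pose h1 t := e1 t - e2 t * (gamma t).1 / (gamma t).2.
pose h2 t := - (e1 t * (gamma t).1) + e2 t * ((gamma t).1 ^+ 2 - (gamma t).2 ^+ 2) / (2 * (gamma t).2).
pose h3 t := e2 t / (2 * (gamma t).2).
have yn t : (gamma t).2 != 0 by rewrite gt_eqF // (gamma_gt0 hb).
have yn2 t : 2 * (gamma t).2 != 0 by rewrite mulf_neq0 ?yn // pnatr_eq0.
have E w : (hplane `*` [set: R]) w -> lineq (gamma w.2) (e1 w.2) (e2 w.2) w.1 =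
   g1 w.1 * h1 w.2 + g2 w.1 * h2 w.2 + g3 w.1 * h3 w.2.
  move=> [hz _]; have z0 : w.1.2 != 0 by rewrite gt_eqF.
  rewrite /lineq /frame_x /frame_y /g1 /g2 /g3 /h1 /h2 /h3; field.
  by rewrite z0 yn.
apply: (eq_measurable_fun _ (fun w hw => esym (E w (set_mem hw)))).
have cg t := curve_cont t (bg_smooth hb).
apply: separated_measurable.
- by move=> z hz; rewrite /g1; cts; rewrite gt_eqF.
- by move=> z hz; rewrite /g2; cts; rewrite gt_eqF.
- by move=> z hz; rewrite /g3; cts; rewrite gt_eqF.
- by move=> t; have [k1 k2 _ _] := cg t; have k3 := c1 t; have k4 := c2 t; rewrite /h1; ctsh.
- by move=> t; have [k1 k2 _ _] := cg t; have k3 := c1 t; have k4 := c2 t; rewrite /h2; ctsh.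
- by move=> t; have [k1 k2 _ _] := cg t; have k3 := c1 t; have k4 := c2 t; rewrite /h3; ctsh.
Qed.

Lemma nrm_continuous : continuous (fun t => (nrm gamma nu t).1) /\ continuous (fun t => (nrm gamma nu t).2).
Proof.
have [ep [_ h _]] := frame_all hb; have [c1 c2] := tan_continuous.
have -> : (fun t => (nrm gamma nu t).1) = (fun t => - ep * tan2 gamma t) by apply/funext => t; case: (h t).
have -> : (fun t => (nrm gamma nu t).2) = (fun t => ep * tan1 gamma t) by apply/funext => t; case: (h t).
move: (tan1 gamma) (tan2 gamma) c1 c2 => t1 t2 c1 c2.
by split => t; have k1 := c1 t; have k2 := c2 t; ctsh.
Qed.

Lemma density_measurable (HH k : R -> R) : continuous HH -> continuous k ->
  measurable_fun (hplane `*` [set: R])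
    (fun w : (R * R) * R => crofton_density gamma nu HH k w.2 w.1 / w.1.2 ^+ 2).
Proof.
move=> cH ck; have [n1 n2] := nrm_continuous; have [t1 t2] := tan_continuous.
have mq := frame_measurable n1 n2; have mr := frame_measurable t1 t2.
have yn t : (gamma t).2 != 0 by rewrite gt_eqF // (gamma_gt0 hb).
have yn2 t : 2 * (gamma t).2 != 0 by rewrite mulf_neq0 ?yn // pnatr_eq0.
have cg t := curve_cont t (bg_smooth hb).
have mD := measurable_hplaneT.
have mc : measurable_fun (hplane `*` [set: R]) (fun w : (R * R) * R => cosh_dist (gamma w.2) w.1).
  pose g1 (z : R * R) := z.1 / z.2; pose g2 (z : R * R) := z.2^-1.
  pose g3 (z : R * R) := (z.1 ^+ 2 + z.2 ^+ 2) / z.2.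
  pose h1 t := - ((gamma t).1 / (gamma t).2).
  pose h2 t := ((gamma t).1 ^+ 2 + (gamma t).2 ^+ 2) / (2 * (gamma t).2).
  pose h3 t := (2 * (gamma t).2)^-1.
  have E w : (hplane `*` [set: R]) w -> cosh_dist (gamma w.2) w.1 =
     g1 w.1 * h1 w.2 + g2 w.1 * h2 w.2 + g3 w.1 * h3 w.2.
    move=> [hz _]; have z0 : w.1.2 != 0 by rewrite gt_eqF.
    rewrite /cosh_dist /g1 /g2 /g3 /h1 /h2 /h3; field.
    by rewrite z0 yn.
  apply: (eq_measurable_fun _ (fun w hw => esym (E w (set_mem hw)))).
  apply: separated_measurable.
  - by move=> z hz; rewrite /g1; cts; rewrite gt_eqF.
  - by move=> z hz; rewrite /g2; cts; rewrite gt_eqF.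
  - by move=> z hz; rewrite /g3; cts; rewrite gt_eqF.
  - by move=> t; have [k1 k2 _ _] := cg t; rewrite /h1; ctsh.
  - by move=> t; have [k1 k2 _ _] := cg t; rewrite /h2; ctsh.
  - by move=> t; have [k1 k2 _ _] := cg t; rewrite /h3; ctsh.
have ms : measurable_fun (hplane `*` [set: R]) (fun w : (R * R) * R => sig w.2).
  by apply: msnd => t; exact: (@sig_cont _ _ _ _ hb t).
have mv : measurable_fun (hplane `*` [set: R]) (fun w : (R * R) * R => v w.2).
  by apply: msnd => t; exact: (@v_cont _ _ _ _ hb t).
apply: measurable_funM; last first.
  apply: (@mfst (fun z => (z.2 ^+ 2)^-1)) => z hz; cts.
  by rewrite expf_neq0 // gt_eqF.
rewrite /crofton_density; apply: measurable_funM; first apply: measurable_funM.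
- by apply: measurableT_comp; [exact: continuous_measurable_fun|exact: mq].
- by apply: measurableT_comp; [exact: continuous_measurable_fun|exact: mr].
apply: measurable_funM => //; apply: measurable_funD => //.
by apply: measurable_funM => //; exact: mq.
Qed.

Lemma integral_supp (f : R -> R) (a b : R) : continuous f -> (forall x, x < a -> f x = 0) ->
  (forall x, b < x -> f x = 0) -> (\int[mu]_x (f x)%:E = (sint a b f)%:E)%E.
Proof.
move=> cf fa fb; rewrite -sint_EFin; last by move=> x _; exact: cf.
rewrite [RHS]integral_mkcond; apply: eq_integral => x _; rewrite patchE; case: ifPn => // h.
have [xa|ax] := ltP x a; first by rewrite fa.
have [xb|bx] := ltP b x; first by rewrite fb.
by case/negP: h; apply/mem_set; rewrite /= in_itv /= ax bx.
Qed.

(** In the frame coordinates at gamma t the area element is dq dr / cosh d, which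
    leaves the factor 1 + sigma q / sqrt (1 + q^2 + r^2); this is at most
    1 + sigma q / sqrt (1 + q^2), and r is then integrated against k. *)
Lemma crofton_slice (HH k : R -> R) (e Q : R) t :
  continuous HH -> continuous k -> (forall x, 0 <= HH x) -> (forall x, 0 <= k x) ->
  (forall x, x <= 0 -> HH x = 0) -> (forall x, Q < x -> HH x = 0) ->
  (forall x, e <= `|x| -> k x = 0) -> sint (- e) e k = 1 ->
  (\int[(mu \x mu)%E]_(z in hplane) (crofton_density gamma nu HH k t z / z.2 ^+ 2)%:E <=
    (v t * sint 0 Q HH + sig t * v t * sint 0 Q (fun x => HH x * (x / Num.sqrt (1 + x ^+ 2))))%:E)%E.
Proof.
move=> cH ck H0 k0 Hn Hp ke ik.
have a0 := gamma_hplane hb t.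
have [ep [ep2 hN _]] := frame_all hb; have [N1 N2] := hN t.
have ts := tan_sqr hb t; have ns := nrm_sqr hb t.
have cD z : hplane z -> {for z, continuous (crofton_density gamma nu HH k t)}.
  move=> hz; have c1 : {for z, continuous (qline gamma nu t)} by exact: lineq_cont.
  have c2 : {for z, continuous (rline gamma t)} by exact: lineq_cont.
  have c3 := cosh_dist_cont a0 hz.
  have c4 : {for z, continuous (fun z => HH (q t z))} by apply: ccomp => //; exact: cH.
  have c5 : {for z, continuous (fun z => k (r t z))} by apply: ccomp => //; exact: ck.
  by rewrite /crofton_density; ctsh.
have := @harea_frame _ (gamma t) (crofton_density gamma nu HH k t) a0 cD
  (fun z hz => crofton_density_ge0 hb t hz H0 k0 Hn).
rewrite /harea_integral => ->.
pose S (x : R * R) := Num.sqrt (1 + x.1 ^+ 2 + x.2 ^+ 2).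
have S0 x : 0 < S x by exact: sqrt1_gt0.
pose G (x : R * R) := HH x.1 * k x.2 * ((1 + sig t * (x.1 / S x)) * v t).
have s0 := sig_ge0 hb t; have v0 := v_gt0 hb t.
have G0 x : 0 <= G x.
  rewrite /G; have [h|h] := leP x.1 0; first by rewrite Hn // !mul0r.
  rewrite !mulr_ge0 ?(ltW v0) // addr_ge0 // mulr_ge0 // divr_ge0 ?(ltW h) //.
  exact: ltW.
have cS : continuous S by move=> x; rewrite /S; cts.
have cG : continuous G.
  move=> x; have c1 := cS x; have n0 : S x != 0 by rewrite gt_eqF.
  have c4 : {for x, continuous (fun z : R * R => HH z.1)} by apply: ccomp; [exact: cH|exact: cfst].
  have c5 : {for x, continuous (fun z : R * R => k z.2)} by apply: ccomp; [exact: ck|exact: csnd].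
  by rewrite /G; ctsh.
have -> : (\int[mu]_al \int[mu]_be
     (crofton_density gamma nu HH k t (frame_inv (gamma t) al be) / Num.sqrt (1 + al ^+ 2 + be ^+ 2))%:E)%E =
  (\int[mu]_al \int[mu]_be (G ((nrm gamma nu t).1 * al + (nrm gamma nu t).2 * be,
      tan1 gamma t * al + tan2 gamma t * be)%R)%:E)%E.
  apply: eq_integral => al _; apply: eq_integral => be _; congr EFin.
  rewrite /crofton_density /qline /rline /lineq frame_inv_al // frame_inv_be // cosh_dist_frame_inv // N1 N2 /G /S /=.
  set x1 := - ep * tan2 gamma t * al + _; set x2 := tan1 _ _ * _ + _.
  have -> : 1 + x1 ^+ 2 + x2 ^+ 2 = 1 + al ^+ 2 + be ^+ 2.
    rewrite /x1 /x2.
    have -> : 1 + (- ep * tan2 gamma t * al + ep * tan1 gamma t * be) ^+ 2 + (tan1 gamma t * al + tan2 gamma t * be) ^+ 2 =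
      1 + ep ^+ 2 * (tan2 gamma t * al - tan1 gamma t * be) ^+ 2 + (tan1 gamma t * al + tan2 gamma t * be) ^+ 2 by ring.
    rewrite ep2.
    have -> : 1 + 1 * (tan2 gamma t * al - tan1 gamma t * be) ^+ 2 + (tan1 gamma t * al + tan2 gamma t * be) ^+ 2 =
      1 + (tan1 gamma t ^+ 2 + tan2 gamma t ^+ 2) * (al ^+ 2 + be ^+ 2) by ring.
    by rewrite ts mul1r addrA.
  have := sqrt1_gt0 al be; move: (Num.sqrt _) => w w0.
  by field; rewrite gt_eqF.
rewrite (@integral_rot _ G) //; last 2 first.
- rewrite N1 N2.
  have -> : tan2 gamma t * (- ep * tan2 gamma t) - tan1 gamma t * (ep * tan1 gamma t) =
    - ep * (tan1 gamma t ^+ 2 + tan2 gamma t ^+ 2) by ring.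
  rewrite ts mulr1 normrN.
  by apply/eqP; rewrite -(@eqrXn2 _ 2) // real_normK ?num_real // ep2 expr1n.
- by rewrite N1 N2; ring.
pose c x := HH x * (1 + sig t * (x / Num.sqrt (1 + x ^+ 2))) * v t.
have cc : continuous c.
  move=> x; have c1 := cH x; have n0 : Num.sqrt (1 + x ^+ 2) != 0 by rewrite gt_eqF // sqrt1D_gt0.
  by rewrite /c; ctsh.
have c0 x : 0 <= c x.
  rewrite /c; have [h|h] := leP x 0; first by rewrite Hn // !mul0r.
  have h1 : 0 <= x / Num.sqrt (1 + x ^+ 2) by rewrite divr_ge0 ?sqrtr_ge0 ?(ltW h).
  by apply: mulr_ge0; [apply: mulr_ge0 => //; rewrite addr_ge0 // mulr_ge0 | exact: ltW].
have -> : v t * sint 0 Q HH + sig t * v t * sint 0 Q (fun x => HH x * (x / Num.sqrt (1 + x ^+ 2))) = sint 0 Q c.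
  have cB : continuous (fun x => HH x * (x / Num.sqrt (1 + x ^+ 2))).
    move=> x; have c1 := cH x; have n0 : Num.sqrt (1 + x ^+ 2) != 0 by rewrite gt_eqF // sqrt1D_gt0.
    by ctsh.
  rewrite -!sintZ; [|by move=> x _; exact: cB|by move=> x _; exact: cH].
  rewrite -sintD; last 2 first.
    by move=> x _; have c1 := cH x; ctsh.
    by move=> x _; have c1 := cH x; have n0 : Num.sqrt (1 + x ^+ 2) != 0; [rewrite gt_eqF // sqrt1D_gt0 | ctsh].
  by apply: eq_sint => x _; rewrite /c; ring.
rewrite -(@integral_supp c 0 Q cc); last 2 first.
  by move=> x x0; rewrite /c Hn ?(ltW x0) // !mul0r.
  by move=> x x0; rewrite /c Hp // !mul0r.
have ckx x : continuous (fun y => c x * k y) by move=> y; have c1 := ck y; ctsh.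
apply: ge0_le_integral => //.
- by move=> x _; apply: integral_ge0 => y _; rewrite lee_fin.
- exact: measurable_inner.
- by apply/measurable_EFinP; exact: continuous_measurable_fun.
move=> x _.
have <- : (\int[mu]_y (c x * k y)%:E = (c x)%:E)%E.
  rewrite (@integral_supp _ (- e) e) //; last 2 first.
  - by move=> y ye; rewrite ke ?mulr0 // ler_normr; apply/orP; right; lra.
  - by move=> y ye; rewrite ke ?mulr0 // ler_normr; apply/orP; left; lra.
  by rewrite sintZ ?ik ?mulr1 // => y _; exact: ck.
have cGx : continuous (fun y => G (x, y)).
  by move=> y; apply: (@ccomp2 _ _ G); [exact: cG|cts|cts].
apply: ge0_le_integral => //.
- by move=> y _; rewrite lee_fin.
- by apply/measurable_EFinP; exact: continuous_measurable_fun.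
- by apply/measurable_EFinP; exact: continuous_measurable_fun.
move=> y _; rewrite lee_fin /G /c /=.
have [h|h] := leP x 0; first by rewrite Hn // !mul0r.
have -> : HH x * k y * ((1 + sig t * (x / S (x, y))) * v t) =
  (HH x * v t * k y) * (1 + sig t * (x / S (x, y))) by ring.
have -> : HH x * (1 + sig t * (x / Num.sqrt (1 + x ^+ 2))) * v t * k y =
  (HH x * v t * k y) * (1 + sig t * (x / Num.sqrt (1 + x ^+ 2))) by ring.
apply: ler_wpM2l; first by rewrite !mulr_ge0 // ltW.
rewrite lerD2l; apply: ler_wpM2l => //; apply: ler_wpM2l; first exact: ltW.
rewrite lef_pV2 ?posrE ?sqrt1D_gt0 ?S0 //; apply: ler_wsqrtr => /=.
by rewrite lerDl sqr_ge0.
Qed.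

(** [crofton_slice] integrated over the boundary: v yields the length, and sigma v
    the total curvature. *)
Lemma crofton_total (HH k : R -> R) (e Q : R) (F : R * R -> R) :
  continuous HH -> continuous k -> (forall x, 0 <= HH x) -> (forall x, 0 <= k x) ->
  (forall x, x <= 0 -> HH x = 0) -> (forall x, Q < x -> HH x = 0) -> 0 <= Q ->
  (forall x, e <= `|x| -> k x = 0) -> sint (- e) e k = 1 ->
  (forall z, hplane z -> {for z, continuous F}) -> (forall z, hplane z -> 0 <= F z) ->
  (forall z, hplane z -> F z <= sint 0 1 (fun t => crofton_density gamma nu HH k t z)) ->
  (harea_integral F <= (sint 0 Q (fun x => HH x *
     (total_length gamma + total_curv gamma nu * (x / Num.sqrt (1 + x ^+ 2)))))%:E)%E.
Proof.
move=> cH ck H0 k0 Hn Hp Q0 ke ik cF F0 FD.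
have cB : continuous (fun x => HH x * (x / Num.sqrt (1 + x ^+ 2))).
  move=> x; have c1 := cH x; have n0 : Num.sqrt (1 + x ^+ 2) != 0 by rewrite gt_eqF // sqrt1D_gt0.
  by ctsh.
pose A := sint 0 Q HH; pose B := sint 0 Q (fun x => HH x * (x / Num.sqrt (1 + x ^+ 2))).
have A0 : 0 <= A by apply: sint_ge0.
have B0 : 0 <= B.
  by apply: sint_ge0 => x /andP[x0 _]; apply: mulr_ge0 => //; rewrite divr_ge0 ?sqrtr_ge0.
pose c t := v t * A + sig t * v t * B.
have cv t : {for t, continuous v} := @v_cont _ _ _ _ hb t.
have cs t : {for t, continuous sig} := @sig_cont _ _ _ _ hb t.
have cc : continuous c by move=> t; have k1 := cv t; have k2 := cs t; rewrite /c; ctsh.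
have -> : sint 0 Q (fun x => HH x *
     (total_length gamma + total_curv gamma nu * (x / Num.sqrt (1 + x ^+ 2)))) = sint 0 1 c.
  have -> : sint 0 1 c = total_length gamma * A + total_curv gamma nu * B.
    rewrite /c sintD; last 2 first.
      by move=> t _; have k1 := cv t; ctsh.
      by move=> t _; have k1 := cv t; have k2 := cs t; ctsh.
    congr (_ + _).
      rewrite (@eq_sint _ _ _ _ (fun t => A * v t)); last by move=> t _; rewrite mulrC.
      rewrite sintZ; last by move=> t _; exact: cv.
      by rewrite [LHS]mulrC; congr (_ * _); rewrite /total_length hlengthE.
    rewrite (@eq_sint _ _ _ _ (fun t => B * (sig t * v t))); last by move=> t _; rewrite mulrC.
    rewrite sintZ; last by move=> t _; have k1 := cv t; have k2 := cs t; ctsh.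
    by rewrite [LHS]mulrC.
  rewrite -!sintZ; [|by move=> x _; exact: cB|by move=> x _; exact: cH].
  rewrite -sintD; last 2 first.
    by move=> x _; have c1 := cH x; ctsh.
    by move=> x _; have c1 := cH x; have n0 : Num.sqrt (1 + x ^+ 2) != 0; [rewrite gt_eqF // sqrt1D_gt0 | ctsh].
  by apply: eq_sint => x _; ring.
have cD z t : hplane z -> {for t, continuous (fun t => crofton_density gamma nu HH k t z)}.
  move=> hz; have c1 := @q_cont _ _ _ _ hb z t hz; have c2 := @r_cont _ _ _ _ hb z t hz.
  have c3 := @cosh_dist_gamma_cont _ _ _ _ hb z t hz; have c4 := cv t; have c5 := cs t.
  have c6 : {for t, continuous (fun t => HH (q t z))} by apply: ccomp => //; exact: cH.
  have c7 : {for t, continuous (fun t => k (r t z))} by apply: ccomp => //; exact: ck.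
  by rewrite /crofton_density; ctsh.
apply: (hplane_seg_le (density_measurable cH ck)) => //.
- by move=> z t hz; rewrite divr_ge0 ?sqr_ge0 //; exact: (crofton_density_ge0 hb).
- move=> t; rewrite /c addr_ge0 // mulr_ge0 ?(ltW (v_gt0 hb t)) //.
  by rewrite mulr_ge0 ?(sig_ge0 hb) // ltW // (v_gt0 hb).
- by move=> t; exact: (@crofton_slice HH k e Q t).
- move=> z hz; have c1 := cF z hz; cts; [exact: c1|].
  by rewrite expf_neq0 // gt_eqF.
- by move=> z hz; rewrite divr_ge0 ?F0 // sqr_ge0.
move=> z hz; rewrite sint_EFin; last first.
  by move=> t _; have c1 := cD z t hz; rewrite /=; ctsh.
rewrite lee_fin (@eq_sint _ _ _ _ (fun t => (z.2 ^+ 2)^-1 * crofton_density gamma nu HH k t z)); last first.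
  by move=> t _; rewrite mulrC.
rewrite sintZ; last by move=> t _; exact: cD.
rewrite mulrC ler_wpM2l ?FD // invr_ge0 sqr_ge0 //.
Qed.

End Total.

(** * The radial profile *)

Section Bump.
Variable R : realType.

(** The powers of 1/x make the family closed under differentiation. *)
Definition flat (m : nat) (x : R) : R := if 0 < x then x^-1 ^+ m * expR (- x^-1) else 0.

Lemma flat_bound m (x : R) : 0 < x -> flat m x <= (m.+2)`!%:R * x ^+ 2.
Proof.
move=> x0; rewrite /flat x0 expRN.
have y0 : 0 <= x^-1 by rewrite invr_ge0 ltW.
have := expR_ge1Dxn m.+1 y0.
have f0 : 0 < (m.+2)`!%:R :> R by rewrite ltr0n fact_gt0.
move=> h; have {}h : x^-1 ^+ m.+2 / (m.+2)`!%:R <= expR x^-1 by lra.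
rewrite ler_pdivrMr ?expR_gt0 //.
have -> : x^-1 ^+ m = x^-1 ^+ m.+2 * x ^+ 2.
  by rewrite -addn2 exprD -mulrA -exprMn mulVf ?gt_eqF // expr1n mulr1.
rewrite [leRHS]mulrAC; apply: ler_wpM2r; first exact: sqr_ge0.
by rewrite mulrC -ler_pdivrMr.
Qed.

Lemma flat_ge0 m (x : R) : 0 <= flat m x.
Proof.
rewrite /flat; case: ifPn => // x0; rewrite mulr_ge0 ?(ltW (expR_gt0 _)) //.
by rewrite exprn_ge0 // invr_ge0 ltW.
Qed.

Lemma flat_le0 m (x : R) : x <= 0 -> flat m x = 0.
Proof. by move=> x0; rewrite /flat ltNge x0. Qed.

Lemma flat_cont0 m : {for 0, continuous (flat m)}.
Proof.
apply/cvgrPdist_lt => e e0; rewrite (flat_le0 _ (lexx 0)).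
set C := ((m.+2)`!%:R : R).
have C0 : 0 < C by rewrite ltr0n fact_gt0.
have d0 : 0 < Num.min 1 (e / C) by rewrite lt_min ltr01 divr_gt0.
near=> y; rewrite sub0r normrN ger0_norm ?flat_ge0 //.
have hy : `|y| < Num.min 1 (e / C) by near: y; exists (Num.min 1 (e / C)) => // y /=; rewrite sub0r normrN.
move: hy; rewrite lt_min => /andP[y1 y2].
have [y0|y0] := leP y 0; first by rewrite flat_le0.
apply: (le_lt_trans (flat_bound m y0)); rewrite -/C.
rewrite gtr0_norm // in y1 y2.
apply: (@le_lt_trans _ _ (C * y)); last by rewrite mulrC -ltr_pdivlMr.
by rewrite ler_pM2l // expr2 ler_piMl // ltW.
Unshelve. all: by end_near. Qed.

Lemma flat_der m (x : R) : is_derive x (1:R) (flat m) (- m%:R * flat m.+1 x + flat m.+2 x).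
Proof.
case: (ltgtP x 0) => [x0|x0|->].
- rewrite !(flat_le0 _ (ltW x0)) mulr0 addr0.
  apply: (near_eq_is_derive _ (dcst 0 x (1:R))).
  near=> y; rewrite flat_le0 //.
  by near: y; exact: lt_le_nbhsl.
- have xn : x != 0 by rewrite gt_eqF.
  have hi : is_derive x (1:R) (fun x : R => x^-1) (- 1 * (x^-1 * x^-1)).
    by notypeclasses refine (deq _ _); [der | cbv beta; field].
  have h : is_derive x (1:R) (fun x : R => x^-1 ^+ m * expR (- x^-1)) (- m%:R * flat m.+1 x + flat m.+2 x).
    notypeclasses refine (deq _ _); first by der.
    rewrite /flat x0; cbv beta; move: (expR (- x^-1)) (x^-1) => E y.
    case: m => [|m] /=; first by rewrite !exprS expr0; ring.
    by rewrite !exprS; move: (y ^+ m) => Y; ring.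
  apply: (near_eq_is_derive _ h).
  have x2 : x / 2 < x by lra.
  near=> y; rewrite /flat; have -> // : 0 < y.
  have : x / 2 <= y by near: y; exact: lt_le_nbhsr.
  by lra.
rewrite !(flat_le0 _ (lexx 0)) mulr0 addr0.
apply/is_derive1_caratheodory; exists (flat m.+1); split.
- move=> z; rewrite (flat_le0 _ (lexx 0)) !subr0.
  have [z0|z0] := leP z 0; first by rewrite !flat_le0 // mul0r.
  have e : z^-1 * z = 1 by rewrite mulVf // gt_eqF.
  rewrite /flat z0 exprS; move: (z^-1 ^+ m) (expR _) => A B.
  by rewrite -[LHS]mul1r -e; ring.
- exact: flat_cont0.
- by rewrite flat_le0.
Unshelve. all: by end_near. Qed.

Lemma cls1_flat n m : cls1 setT n (flat m).
Proof.
elim: n m => [|n ih] m; first by apply: cls1_intro0 => x _; exact: flat_der.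
apply: (cls1_intro openT (fun x _ => flat_der m x)).
apply: cls_add; [exact: openT| |exact: ih].
by apply: cls_mul; [exact: openT|apply: cls_cst; exact: openT|exact: ih].
Qed.

Definition bump (x : R) : R := flat 0 x.

Lemma bumpE (x : R) : 0 < x -> bump x = expR (- x^-1).
Proof. by move=> x0; rewrite /bump /flat x0 expr0 mul1r. Qed.

Lemma bump_le1 (x : R) : bump x <= 1.
Proof.
rewrite /bump /flat; case: ifPn => // x0; rewrite expr0 mul1r -expR0 ler_expR oppr_le0.
by rewrite invr_ge0 ltW.
Qed.

End Bump.

Section Profile.
Variable R : realType.
Variables (L Th b : R).
Hypotheses (L0 : 0 < L) (Th0 : 0 < Th) (b0 : 0 < b).

(** The length of the outer parallel curve at distance s. *)
Definition ell (s : R) : R := L * ch s + Th * sh s.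
(** The derivative of the optimal radial function, up to a constant. *)
Definition Well (s : R) : R := expR (- b * ln (ell s)).

Lemma ell_gt0 s : 0 <= s -> 0 < ell s.
Proof.
move=> s0; have h1 : 0 < L * ch s by rewrite mulr_gt0 // ch_gt0.
have h2 : 0 <= Th * sh s by apply: mulr_ge0; [exact: ltW | rewrite -(sh0 R) sh_le].
by rewrite /ell ltr_pwDl.
Qed.

Lemma ell_der s : is_derive s (1:R) ell (L * sh s + Th * ch s).
Proof.
have h1 := dsh s; have h2 := dch s.
by rewrite /ell; notypeclasses refine (deq _ _); [der | cbv beta; ring].
Qed.

Lemma sh_ge0 (s : R) : 0 <= s -> 0 <= sh s.
Proof. by move=> s0; rewrite -(sh0 R) sh_le. Qed.

Lemma ell_le s s' : 0 <= s -> s <= s' -> ell s <= ell s'.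
Proof.
move=> s0; rewrite le_eqVlt => /predU1P[->//|ss].
have [c [c1 c2 e]] := mvt_seg ss ell_der.
rewrite -subr_ge0 e mulr_ge0 ?subr_ge0 ?(ltW ss) //.
have h1 : 0 <= L * sh c by apply: mulr_ge0; [exact: ltW | apply: sh_ge0; lra].
have h2 : 0 <= Th * ch c by apply: mulr_ge0; [exact: ltW | exact: ltW (ch_gt0 _)].
by rewrite addr_ge0.
Qed.

Lemma Well_gt0 s : 0 < Well s. Proof. exact: expR_gt0. Qed.

Lemma Well_le s s' : 0 <= s -> s <= s' -> Well s' <= Well s.
Proof.
move=> s0 ss; rewrite /Well ler_expR !mulNr lerN2 ler_wpM2l ?(ltW b0) //.
by rewrite ler_ln ?posrE ?ell_gt0 ?(le_trans s0) // ell_le.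
Qed.

Lemma Well_cont s : 0 <= s -> {for s, continuous Well}.
Proof.
move=> s0; have c1 := is_derive_continuous1 (ell_der s); have e0 := ell_gt0 s0.
have c2 : {for s, continuous (fun s => ln (ell s))} by apply: ccomp => //; apply: is_derive_continuous1 (dln e0).
have c3 : {for (ln (ell s)), continuous (fun x : R => expR (- b * x))} by cts.
exact: (@ccomp _ _ (fun x : R => expR (- b * x)) (fun s => ln (ell s)) s c3 c2).
Qed.

Lemma cls1_Well n : cls1 [set s : R | 0 < s] n Well.
Proof.
have o := @open_gt0 R.
have cs : cls1 [set s : R | 0 < s] n ell.
  by apply: cls_add => //; apply: cls_mul => //; try exact: cls_cst; apply: cls_sub (subsetT _) _; [exact: cls1_ch|exact: cls1_sh].
have cl : cls1 [set s : R | 0 < s] n (fun s => ln (ell s)).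
  by apply: (cls_comp o _ (cls1_ln R n) cs) => s /= s0; apply: ell_gt0; exact: ltW.
apply: (@cls_comp _ _ _ _ setT n (@expR R) (fun s => - b * ln (ell s)) o) => //; first exact: cls1_expR.
by apply: cls_mul => //; exact: cls_cst.
Qed.

(** The even extension of [Well] is continuous on the whole line, where integrals
    over adjacent segments can be added. *)
Definition Wabs (s : R) : R := Well `|s|.

Lemma Wabs_cont : continuous Wabs.
Proof.
move=> s; apply: (@ccomp _ _ Well (fun s : R => `|s|)); last exact: norm_continuous.
exact: Well_cont.
Qed.

Lemma Wabs_ge0 s : 0 <= s -> Wabs s = Well s.
Proof. by move=> s0; rewrite /Wabs ger0_norm. Qed.

Lemma sint_shift (f : R -> R) (a c d : R) : continuous f -> a <= c ->
  sint a c (fun s => f (s + d)) = sint (a + d) (c + d) f.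
Proof.
move=> cf ac; have [F [hF sF]] := sint_prim cf.
rewrite sF ?lerD2r //.
have hG s : is_derive s (1:R) (fun s : R => F (s + d)) (f (s + d)).
  have h3 : is_derive s (1:R) (fun s : R => s + d) 1 by dert; ring.
  have := @dcomp R _ F (fun s : R => s + d) s 1 _ _ (hF (s + d)) h3; rewrite mulr1; exact.
have cg s : {for s, continuous (fun s => f (s + d))}.
  have c3 : {for s, continuous (fun s : R => s + d)} by cts.
  exact: (@ccomp _ _ f (fun s : R => s + d) s (cf (s + d)) c3).
by rewrite (sint_FTC ac (fun s _ => cg s) (fun s _ => hG s)).
Qed.

(** The optimal derivative is multiplied by flat cutoffs at del and S. The loss in
    its integral is covered by the gap between j and the integral of [Wabs]. The
    shift of the argument by del makes room for the error of the soft maximum. *)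
Lemma profile S j : 0 < j -> 0 < S -> j < sint 0 S Wabs ->
  exists (del : R) (phi dphi : R -> R),
  [/\ 0 < del, forall n, cls1 setT n phi, forall s, is_derive s (1:R) phi (dphi s)
    & [/\ forall s, s <= del -> phi s = 1, forall s, S <= s -> phi s = 0,
          forall s, s <= del \/ S <= s -> dphi s = 0
        & forall s, 0 <= s -> `|dphi s| <= j^-1 * Well (s + del)]].
Proof.
move=> j0 S0 jS.
set J := sint 0 S Wabs in jS.
pose del := Num.min (S / 4) ((J - j) / (4 * Well 0)).
have W0 := Well_gt0 0.
have d0 : 0 < del.
  by rewrite lt_min !divr_gt0 ?mulr_gt0 ?ltr0n //; lra.
have d1 : del <= S / 4 by rewrite ge_min lexx.
have d2 : del * (4 * Well 0) <= J - j by rewrite -ler_pdivlMr ?mulr_gt0 ?ltr0n // ge_min lexx orbT.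
have JE : sint (3 * del) S Wabs = J - sint 0 (3 * del) Wabs.
  by rewrite /J (@sint_cat _ 0 (3 * del) S) //; [ring|exact: Wabs_cont|lra|lra].
have J3 : sint 0 (3 * del) Wabs <= Well 0 * (3 * del).
  have d3 : 0 <= 3 * del by lra.
  have <- : sint 0 (3 * del) (fun=> Well 0) = Well 0 * (3 * del) by rewrite sint_cst // subr0.
  apply: sint_le => s; [by move=> _; exact: Wabs_cont|by move=> _; exact: ccst|].
  by move=> /andP[s0 _]; rewrite (Wabs_ge0 s0); exact: Well_le (lexx 0) s0.
set J' := sint (3 * del) S Wabs in JE.
have jJ : j < J' by rewrite JE; have : 0 < Well 0 * del by [rewrite mulr_gt0]; nra.
have J'0 : 0 < J' by lra.
pose th := j / J'.
have th0 : 0 < th by rewrite divr_gt0.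
have th1 : th < 1 by rewrite ltr_pdivrMr // mul1r.
(* the product of the two cutoffs is at least th at distance del from both ends *)
pose eta := - (del / 2 * ln th).
have eta0 : 0 < eta.
  rewrite /eta -mulrN mulr_gt0 ?divr_gt0 ?ltr0n // oppr_gt0 ln_lt0 //.
  by rewrite th0 th1.
have etaE : expR (- (eta / del)) ^+ 2 = th.
  rewrite expr2 -expRD -[RHS]lnK ?posrE //; congr expR.
  by rewrite /eta; field; rewrite gt_eqF.
pose g s := bump ((s - del) / eta) * bump ((S - s) / eta) * Well (s + del).
have gneg s : s <= del -> g s = 0.
  move=> h; rewrite /g /bump flat_le0 ?mul0r //.
  by rewrite pmulr_lle0 ?invr_gt0 // subr_le0.
have gpos s : S <= s -> g s = 0.
  move=> h; rewrite /g /bump [flat 0 ((S - s) / eta)]flat_le0 ?mulr0 ?mul0r //.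
  by rewrite pmulr_lle0 ?invr_gt0 // subr_le0.
have g0 s : 0 <= g s.
  by rewrite /g mulr_ge0 ?(ltW (Well_gt0 _)) // mulr_ge0 // flat_ge0.
have gW s : g s <= Well (s + del).
  rewrite /g ler_piMl ?(ltW (Well_gt0 _)) // mulr_ile1 ?flat_ge0 ?bump_le1 //.
have cg n : cls1 setT n g.
  have o1 : open [set s : R | s < del] by exact: open_lt.
  have o2 := @open_gt0 R.
  have -> : [set: R] = [set s : R | s < del] `|` [set s : R | 0 < s].
    by apply/esym/seteqP; split => // s _; case: (ltP s del) => h; [left | right; exact: lt_le_trans h].
  apply: cls_union.
    apply: (@cls_ext _ _ _ _ _ (fun=> 0)) => //; last exact: cls_cst.
    by move=> s /= h; rewrite gneg // ltW.
  have af (c d : R) : cls1 [set s : R | 0 < s] n (fun s => c * s + d).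
    by apply: cls_add => //; [apply: cls_mul => //; [exact: cls_cst|exact: cls1_id]|exact: cls_cst].
  apply: cls_mul => //; first apply: cls_mul => //.
  - apply: (@cls_comp _ _ _ _ setT n (flat 0)) => //; first exact: cls1_flat.
    have -> : (fun s : R => (s - del) / eta) = (fun s => eta^-1 * s + - (del / eta)).
      by apply/funext => s; ring.
    exact: af.
  - apply: (@cls_comp _ _ _ _ setT n (flat 0)) => //; first exact: cls1_flat.
    have -> : (fun s : R => (S - s) / eta) = (fun s => - eta^-1 * s + S / eta).
      by apply/funext => s; ring.
    exact: af.
  apply: (@cls_comp _ _ _ _ [set s : R | 0 < s] n Well) => //.
  - by move=> s /= h; lra.
  - exact: cls1_Well.
  have -> : (fun s : R => s + del) = (fun s => 1 * s + del) by apply/funext => s; ring.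
  exact: af.
have cg0 : continuous g by move=> s; apply: (cls_cont (cg 0%N)).
have [F [hF sF]] := sint_prim cg0.
pose N0 := sint 0 S g.
have N0j : j <= N0.
  have a1 : 0 <= 2 * del by lra.
  have a2 : 2 * del <= S - del by lra.
  have a3 : S - del <= S by lra.
  have a4 : 2 * del <= S by lra.
  rewrite /N0 (sint_cat cg0 a1 a4) (sint_cat cg0 a2 a3).
  have p1 : 0 <= sint 0 (2 * del) g by apply: sint_ge0.
  have p2 : 0 <= sint (S - del) S g by apply: sint_ge0.
  have p3 : j <= sint (2 * del) (S - del) g.
    have -> : j = th * J' by rewrite /th divfK // gt_eqF.
    have -> : J' = sint (2 * del) (S - del) (fun s => Wabs (s + del)).
      rewrite sint_shift //; last exact: Wabs_cont.
      by rewrite subrK (_ : 2 * del + del = 3 * del) //; ring.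
    have cW s : {for s, continuous (fun s => Wabs (s + del))}.
      have c3 : {for s, continuous (fun s : R => s + del)} by cts.
      exact: (@ccomp _ _ Wabs (fun s : R => s + del) s (@Wabs_cont (s + del)) c3).
    rewrite -sintZ; last by move=> s _; exact: cW.
    apply: sint_le => s.
    - by move=> _; have c1 := cW s; exact: (cmul _ _ _ (ccst s th) c1).
    - by move=> _; exact: cg0.
    move=> /andP[s1 s2]; rewrite Wabs_ge0; last by lra.
    rewrite /g; apply: ler_wpM2r; first exact: ltW (Well_gt0 _).
    have bb x : del <= x -> expR (- (eta / del)) <= bump (x / eta).
      move=> dx; have x0 : 0 < x by lra.
      rewrite bumpE ?divr_gt0 // ler_expR lerN2 invf_div.
      by rewrite ler_pM2l // lef_pV2 ?posrE.
    rewrite -etaE expr2; apply: ler_pM; rewrite ?(ltW (expR_gt0 _)) //; apply: bb; lra.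
  lra.
have N00 : 0 < N0 by lra.
have NF : N0 = F S - F 0 by rewrite /N0 sF // ltW.
exists del, (fun s => 1 - (F s - F 0) / N0), (fun s => - (g s / N0)).
have hphi s : is_derive s (1:R) (fun s : R => 1 - (F s - F 0) / N0) (- (g s / N0)).
  have h := hF s.
  by notypeclasses refine (deq _ _); [der | cbv beta; ring].
split => //.
  have cd n : cls1 setT n (fun s => - (g s / N0)).
    have -> : (fun s => - (g s / N0)) = (fun s => - N0^-1 * g s) by apply/funext => s; ring.
    by apply: cls_mul; [exact: openT|apply: cls_cst; exact: openT|exact: cg].
  case=> [|n]; first by apply: (@cls1_intro0 _ _ _ (fun s => - (g s / N0))) => s _.
  by apply: (@cls1_intro _ _ _ _ (fun s => - (g s / N0))) => //; exact: openT.
split.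
- move=> s sd; suff -> : F s = F 0 by rewrite subrr mul0r subr0.
  apply/eqP; case: (ltgtP s 0) => [h|h|-> //].
    have [c [c1 c2 e]] := mvt_seg h hF.
    by rewrite eq_sym -subr_eq0 e gneg ?mul0r //; lra.
  have [c [c1 c2 e]] := mvt_seg h hF.
  by rewrite -subr_eq0 e gneg ?mul0r //; lra.
- move=> s; rewrite le_eqVlt => /predU1P[<-|h]; first by rewrite NF divff ?subrr // -NF gt_eqF.
  have [c [c1 c2 e]] := mvt_seg h hF.
  have -> : F s = F S by apply/eqP; rewrite -subr_eq0 e gpos ?mul0r // ltW.
  by rewrite NF divff ?subrr // -NF gt_eqF.
- move=> s h; have -> : g s = 0 by case: h => h; [exact: gneg|exact: gpos].
  by rewrite mul0r oppr0.
move=> s s0; rewrite normrN ger0_norm ?divr_ge0 ?(ltW N00) // mulrC.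
apply: ler_pM; [by rewrite invr_ge0 ltW|exact: g0| |exact: gW].
by rewrite lef_pV2 ?posrE.
Qed.

End Profile.

(** * A smooth substitute for the distance to K *)

Section Smooth.
Variable R : realType.
Implicit Types (z v a : R * R).

Lemma dfst z v : is_derive z v (fun z : R * R => z.1) v.1.
Proof.
apply/is_derive_lineP => /=.
have -> : (fun h : R => h * v.1 + z.1) = (fun h : R => v.1 * h + z.1) by apply/funext => h; ring.
by notypeclasses refine (deq _ _); [der | cbv beta; ring].
Qed.

Lemma dsnd z v : is_derive z v (fun z : R * R => z.2) v.2.
Proof.
apply/is_derive_lineP => /=.
have -> : (fun h : R => h * v.2 + z.2) = (fun h : R => v.2 * h + z.2) by apply/funext => h; ring.
by notypeclasses refine (deq _ _); [der | cbv beta; ring].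
Qed.

Lemma cls_fst n : cls (@hdirs R) (@hplane R) n (fun z : R * R => z.1).
Proof.
case: n => [|n]; first by split=> [z _|]; [exact: cfst|].
apply: (@cls_intro _ _ _ _ _ _ (fun v _ => v.1)); first exact: open_hplane.
- by move=> z _; exact: cfst.
- by move=> z v _ _; exact: dfst.
- by move=> v _; apply: cls_cst; exact: open_hplane.
Qed.

Lemma cls_snd n : cls (@hdirs R) (@hplane R) n (fun z : R * R => z.2).
Proof.
case: n => [|n]; first by split=> [z _|]; [exact: csnd|].
apply: (@cls_intro _ _ _ _ _ _ (fun v _ => v.2)); first exact: open_hplane.
- by move=> z _; exact: csnd.
- by move=> z v _ _; exact: dsnd.
- by move=> v _; apply: cls_cst; exact: open_hplane.
Qed.

Lemma cls_sqr (n : nat) (f : R * R -> R) : cls (@hdirs R) (@hplane R) n f -> cls (@hdirs R) (@hplane R) n (fun z => f z ^+ 2).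
Proof. by move=> h; apply: (cls_mul (@open_hplane R) h h). Qed.

Lemma cls_invsnd n : cls (@hdirs R) (@hplane R) n (fun z : R * R => z.2^-1).
Proof.
apply: (@cls_comp _ _ _ _ [set x : R | 0 < x] n (@GRing.inv R) (fun z : R * R => z.2)) => //.
- exact: open_hplane.
- exact: cls1_inv.
- exact: cls_snd.
Qed.

Lemma cls_lineq n a n1 n2 : cls (@hdirs R) (@hplane R) n (lineq a n1 n2).
Proof.
have o := @open_hplane R.
have c (k : R) : cls (@hdirs R) (@hplane R) n (fun=> k) by exact: cls_cst.
have hx : cls (@hdirs R) (@hplane R) n (fun z : R * R => z.1 + - a.1) by apply: cls_add => //; exact: cls_fst.
have hy := cls_snd n; have hi := cls_invsnd n.
rewrite /lineq /frame_x /frame_y.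
have -> : (fun z : R * R => n1 * ((z.1 - a.1) / z.2) + n2 * (((z.1 - a.1) ^+ 2 + z.2 ^+ 2 - a.2 ^+ 2) / (2 * a.2 * z.2))) =
  (fun z : R * R => n1 * ((z.1 + - a.1) * z.2^-1) + (n2 * (2 * a.2)^-1) * (((z.1 + - a.1) ^+ 2 + z.2 ^+ 2 + - a.2 ^+ 2) * z.2^-1)).
  by apply/funext => z; rewrite invfM; ring.
apply: cls_add => //; apply: cls_mul => //; apply: cls_mul => //.
by apply: cls_add => //; apply: cls_add => //; exact: cls_sqr.
Qed.

Lemma cls_cosh_dist n a : cls (@hdirs R) (@hplane R) n (cosh_dist a).
Proof.
have o := @open_hplane R.
have c (k : R) : cls (@hdirs R) (@hplane R) n (fun=> k) by exact: cls_cst.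
have hx : cls (@hdirs R) (@hplane R) n (fun z : R * R => z.1 + - a.1) by apply: cls_add => //; exact: cls_fst.
have hy := cls_snd n; have hi := cls_invsnd n.
rewrite /cosh_dist.
have -> : (fun z : R * R => ((z.1 - a.1) ^+ 2 + z.2 ^+ 2 + a.2 ^+ 2) / (2 * a.2 * z.2)) =
  (fun z : R * R => (2 * a.2)^-1 * (((z.1 + - a.1) ^+ 2 + z.2 ^+ 2 + a.2 ^+ 2) * z.2^-1)).
  by apply/funext => z; rewrite invfM; ring.
apply: cls_mul => //; apply: cls_mul => //.
by apply: cls_add => //; apply: cls_add => //; exact: cls_sqr.
Qed.

Lemma cls1_arsh n : cls1 setT n (@arsh R).
Proof.
case: n => [|n]; first by apply: cls1_intro0 => x _; exact: darsh.
apply: (cls1_intro openT (fun x _ => darsh x)).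
have p (x : R) : 0 < 1 + x ^+ 2 by rewrite ltr_wpDr ?sqr_ge0.
have -> : (fun x : R => (Num.sqrt (1 + x ^+ 2))^-1) = (fun x => expR (- 2^-1 * ln (1 + x * x))).
  apply/funext => x; rewrite mulNr expRN; congr (_^-1).
  apply/eqP; rewrite -(@eqrXn2 _ 2) ?sqrtr_ge0 ?(ltW (expR_gt0 _)) // sqr_sqrtr ?(ltW (p x)) //.
  rewrite [X in _ == X]expr2 -expRD -mulrDl (_ : 2^-1 + 2^-1 = 1 :> R); last by field.
  by rewrite mul1r lnK ?posrE -?expr2 //.
apply: (@cls_comp _ _ _ _ setT n (@expR R)) => //; [exact: openT|exact: cls1_expR|].
apply: cls_mul; [exact: openT|apply: cls_cst; exact: openT|].
apply: (@cls_comp _ _ _ _ [set x : R | 0 < x] n (@ln R)) => //; first exact: openT.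
- by move=> x _ /=; rewrite -expr2.
- exact: cls1_ln.
apply: cls_add; [exact: openT|apply: cls_cst; exact: openT|].
by apply: cls_mul; [exact: openT| |]; apply: cls1_id; exact: openT.
Qed.

(** The gradient of f has hyperbolic length at most 1. *)
Definition grad_le1 (f : R * R -> R) : Prop :=
  forall z, hplane z -> d_dx f z ^+ 2 + d_dy f z ^+ 2 <= (z.2 ^+ 2)^-1.

Lemma is_derive_d (f : R * R -> R) z v d : is_derive z v f d -> 'D_v f z = d.
Proof. by move=> h; exact: derive_val. Qed.

Lemma grad_arsh a n1 n2 : 0 < a.2 -> n1 ^+ 2 + n2 ^+ 2 = 1 ->
  (forall n, cls (@hdirs R) hplane n (fun z => arsh (lineq a n1 n2 z))) /\
  grad_le1 (fun z => arsh (lineq a n1 n2 z)).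
Proof.
move=> a0 hn; split.
  move=> n; apply: (@cls_comp _ _ _ _ setT n (@arsh R)) => //; first exact: open_hplane.
    exact: cls1_arsh.
  exact: cls_lineq.
move=> z hz; have z0 : z.2 != 0 by rewrite gt_eqF.
set s := Num.sqrt (1 + lineq a n1 n2 z ^+ 2).
have s0 : 0 < s by exact: sqrt1D_gt0.
have s2 : s ^+ 2 = 1 + lineq a n1 n2 z ^+ 2 by rewrite sqr_sqrtr // addr_ge0 ?sqr_ge0.
pose A := (n1 + n2 * ((z.1 - a.1) / a.2)) / z.2.
pose B := (n2 * (z.2 / a.2) - lineq a n1 n2 (z.1, z.2)) / z.2.
have eL : (fun z : R * R => lineq a n1 n2 (z.1, z.2)) = lineq a n1 n2 by apply/funext => -[].
have D v : is_derive z v (fun z => arsh (lineq a n1 n2 z)) (s^-1 * (A * v.1 + B * v.2)).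
  have := @lineq_der R _ a n1 n2 fst snd z v v.1 v.2 a0 z0 (dfst z v) (dsnd z v).
  rewrite eL => h.
  exact: (@dcomp _ _ (@arsh R) (lineq a n1 n2) z v _ _ (darsh _) h).
rewrite /d_dx /d_dy (is_derive_d (D (1, 0))) (is_derive_d (D (0, 1))) /= !mulr1 !mulr0 addr0 add0r.
have -> : (s^-1 * A) ^+ 2 + (s^-1 * B) ^+ 2 = (s^-1) ^+ 2 * (A ^+ 2 + B ^+ 2) by ring.
rewrite /A /B (line_grad _ a0 z0 hn) -surjective_pairing -s2 exprVn.
by rewrite mulrA mulVf ?mul1r // expf_neq0 // gt_eqF.
Qed.

(** This function, the logarithm of cosh of the distance to a up to a constant, is
    at most 0 on K for suitable M, and tends to infinity at infinity; it makes the
    support of the test functions compact. *)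
Lemma grad_lncosh_dist a M : 0 < a.2 -> 0 < M ->
  (forall n, cls (@hdirs R) hplane n (fun z => ln (cosh_dist a z / M))) /\
  grad_le1 (fun z => ln (cosh_dist a z / M)).
Proof.
move=> a0 M0; have ha : hplane a by [].
have p z : hplane z -> 0 < cosh_dist a z / M by move=> hz; rewrite divr_gt0 // cosh_dist_gt0.
split.
  move=> n; apply: (@cls_comp _ _ _ _ [set x : R | 0 < x] n (@ln R)) => //; first exact: open_hplane.
    exact: cls1_ln.
  apply: cls_mul; [exact: open_hplane|exact: cls_cosh_dist|apply: cls_cst; exact: open_hplane].
move=> z hz; have z0 : z.2 != 0 by rewrite gt_eqF.
have an : a.2 != 0 by rewrite gt_eqF.
have r0 := cosh_dist_gt0 ha hz.
pose A := (z.1 - a.1) / (a.2 * z.2); pose B := (z.2 / a.2 - cosh_dist a z) / z.2.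
have D v : is_derive z v (fun z => ln (cosh_dist a z / M)) ((cosh_dist a z)^-1 * (A * v.1 + B * v.2)).
  have h1 := dfst z v; have h2 := dsnd z v.
  have h : is_derive z v (cosh_dist a) (A * v.1 + B * v.2).
    rewrite /cosh_dist; notypeclasses refine (deq _ _); first by der; rewrite !mulf_neq0.
    by rewrite /A /B /cosh_dist; cbv beta; field; rewrite z0.
  notypeclasses refine (deq _ _); first by der; exact: p.
  by cbv beta; field; rewrite !gt_eqF.
rewrite /d_dx /d_dy (is_derive_d (D (1, 0))) (is_derive_d (D (0, 1))) /= !mulr1 !mulr0 addr0 add0r.
have -> : ((cosh_dist a z)^-1 * A) ^+ 2 + ((cosh_dist a z)^-1 * B) ^+ 2 = (cosh_dist a z)^-1 ^+ 2 * (A ^+ 2 + B ^+ 2) by ring.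
have -> : A ^+ 2 + B ^+ 2 = (cosh_dist a z ^+ 2 - 1) / z.2 ^+ 2.
  by rewrite /A /B /cosh_dist; field; rewrite z0.
rewrite mulrA -[leRHS]mul1r; apply: ler_wpM2r; first by rewrite invr_ge0 sqr_ge0.
by rewrite exprVn mulrBr mulVf ?expf_neq0 ?gt_eqF // gerBl mulr1 invr_ge0 sqr_ge0.
Qed.

Section Softmax.
Variables (n : nat) (V : 'I_n.+1 -> R * R -> R) (k : R).
Hypotheses (k0 : 0 < k) (sV : forall i m, cls (@hdirs R) (@hplane R) m (V i)) (gV : forall i, grad_le1 (V i)).

(** Within k^-1 ln (n + 1) of the maximum of the V i, and smooth. Its gradient is a
    convex combination of theirs. *)
Definition softmax (z : R * R) : R := k^-1 * ln (\sum_i expR (k * V i z)).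

Lemma softsum_gt0 z : 0 < \sum_i expR (k * V i z).
Proof.
by rewrite (bigD1 ord0) //= ltr_pwDl ?expR_gt0 // sumr_ge0 // => i _.
Qed.

Lemma softmax_ge i z : V i z <= softmax z.
Proof.
rewrite /softmax mulrC ler_pdivlMr // mulrC -[leLHS]expRK ler_ln ?posrE ?expR_gt0 ?softsum_gt0 //.
by rewrite (bigD1 i) //= lerDl sumr_ge0 // => j _.
Qed.

Lemma softmax_le z : (forall i, V i z <= 0) -> softmax z <= k^-1 * ln n.+1%:R.
Proof.
move=> h; rewrite /softmax ler_wpM2l ?invr_ge0 ?(ltW k0) //.
rewrite ler_ln ?posrE ?softsum_gt0 ?ltr0n //.
have -> : n.+1%:R = \sum_(i < n.+1) (1:R) by rewrite sumr_const card_ord.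
apply: ler_sum => i _; rewrite -expR0 ler_expR.
by rewrite pmulr_rle0.
Qed.

Lemma cls_softmax m : cls (@hdirs R) (@hplane R) m softmax.
Proof.
have o := @open_hplane R.
apply: cls_mul => //; first exact: cls_cst.
apply: (@cls_comp _ _ _ _ [set x : R | 0 < x] m (@ln R)) => //.
- by move=> z _; exact: softsum_gt0.
- exact: cls1_ln.
apply: cls_sum => // i.
apply: (@cls_comp _ _ _ _ setT m (@expR R)) => //; first exact: cls1_expR.
by apply: cls_mul => //; exact: cls_cst.
Qed.

Lemma grad_softmax : grad_le1 softmax.
Proof.
move=> z hz; have z0 : 0 < z.2 by [].
pose s := \sum_i expR (k * V i z); have s0 : 0 < s by exact: softsum_gt0.
pose w i := expR (k * V i z) / s.
have w0 i : 0 <= w i by rewrite divr_ge0 ?(ltW s0) // ltW // expR_gt0.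
have w1 : \sum_i w i = 1 by rewrite -mulr_suml divff // gt_eqF.
have D v : @hdirs R v -> is_derive z v softmax (\sum_i w i * 'D_v (V i) z).
  move=> hv; have h i : is_derive z v (V i) ('D_v (V i) z) by exact: (cls_der (sV i 1%N) hv hz).
  have h2 : is_derive z v (fun z => \sum_i expR (k * V i z)) (\sum_i expR (k * V i z) * (k * 'D_v (V i) z)).
    apply: dsum => i; have hi := h i.
    by notypeclasses refine (deq _ _); [der | cbv beta; ring].
  have h3 := @dcomp _ _ (@ln R) (fun z => \sum_i expR (k * V i z)) z v _ _ (dln (softsum_gt0 z)) h2.
  rewrite /softmax; notypeclasses refine (deq _ _); first exact: (dmul (dcst k^-1 z v) h3).
  cbv beta; rewrite -/s mulr0 addr0 !mulr_sumr; apply: eq_bigr => i _.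
  by rewrite /w; field; rewrite !gt_eqF.
pose a i := 'D_((1, 0) : R * R) (V i) z; pose b i := 'D_((0, 1) : R * R) (V i) z.
rewrite /d_dx /d_dy (is_derive_d (D (1, 0) (or_introl erefl))) (is_derive_d (D (0, 1) (or_intror erefl))).
set A := \sum_i _; set B := \sum_i _.
set g := Num.sqrt (A ^+ 2 + B ^+ 2).
have g2 : g ^+ 2 = A ^+ 2 + B ^+ 2 by rewrite sqr_sqrtr // addr_ge0 ?sqr_ge0.
have g0 : 0 <= g by exact: sqrtr_ge0.
have key : g ^+ 2 <= z.2^-1 * g.
  have -> : g ^+ 2 = \sum_i w i * (a i * A + b i * B).
    rewrite g2 !expr2 {1}/A {2}/B -/A -/B !mulr_suml -big_split /=.
    by apply: eq_bigr => i _; rewrite /a /b; ring.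
  have -> : z.2^-1 * g = \sum_i w i * (z.2^-1 * g) by rewrite -mulr_suml w1 mul1r.
  apply: ler_sum => i _; apply: ler_wpM2l => //.
  apply: (le_trans (ler_norm _)); apply: (le_trans (cauchy2 _ _ _ _)).
  rewrite -/g; apply: ler_wpM2r => //.
  have -> : z.2^-1 = Num.sqrt ((z.2 ^+ 2)^-1) by rewrite -exprVn sqrtr_sqr gtr0_norm ?invr_gt0.
  by apply: ler_wsqrtr; exact: gV.
rewrite -g2 -exprVn ler_sqr ?nnegrE ?invr_ge0 ?(ltW z0) //.
have [->|gn] := eqVneq g 0; first by rewrite invr_ge0 ltW.
by move: key; rewrite expr2 ler_pM2r // lt0r gn.
Qed.

End Softmax.

Lemma grad_comp (phi dphi : R -> R) (u : R * R -> R) z : hplane z ->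
  (forall s, is_derive s (1:R) phi (dphi s)) -> cls (@hdirs R) (@hplane R) 1 u -> grad_le1 u ->
  hnorm z (hgrad (fun z => phi (u z)) z) <= `|dphi (u z)|.
Proof.
move=> hz hphi cu gu; have z0 : 0 < z.2 by [].
have D v : @hdirs R v -> is_derive z v (fun z => phi (u z)) (dphi (u z) * 'D_v u z).
  by move=> hv; exact: (@dcomp _ _ phi u z v _ _ (hphi (u z)) (cls_der cu hv hz)).
rewrite hnorm_hgrad // /d_dx /d_dy (is_derive_d (D (1, 0) (or_introl erefl))) (is_derive_d (D (0, 1) (or_intror erefl))).
rewrite !exprMn -mulrDr sqrtrM ?sqr_ge0 // sqrtr_sqr mulrCA ler_piMr //.
have := gu z hz; rewrite /d_dx /d_dy => h.
rewrite -ler_pdivlMl // mulr1.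
have -> : z.2^-1 = Num.sqrt ((z.2 ^+ 2)^-1) by rewrite -exprVn sqrtr_sqr gtr0_norm ?invr_gt0.
exact: ler_wsqrtr.
Qed.

End Smooth.

Section Aux.
Variable R : realType.

Lemma max0_cont (T : topologicalType) (f : T -> R) (t : T) : {for t, continuous f} ->
  {for t, continuous (fun t => Num.max 0 (f t))}.
Proof. by move=> cf; apply: (@continuous_max _ _ (fun=> 0) f t (ccst t 0) cf). Qed.

Lemma min1_cont (T : topologicalType) (f : T -> R) (t : T) : {for t, continuous f} ->
  {for t, continuous (fun t => Num.min 1 (f t))}.
Proof. by move=> cf; apply: (@continuous_min _ _ (fun=> 1) f t (ccst t 1) cf). Qed.

Lemma tent_ex (e : R) : 0 < e -> exists k : R -> R,
  [/\ continuous k, forall x, 0 <= k x, forall x, e <= `|x| -> k x = 0 & sint (- e) e k = 1].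
Proof.
move=> e0; pose k0 (x : R) := Num.max 0 (e - `|x|).
have ck0 : continuous k0.
  move=> x; have c1 : {for x, continuous (fun x : R => `|x|)} by exact: norm_continuous.
  have c2 : {for x, continuous (fun x : R => e - `|x|)} by ctsh.
  exact: (@max0_cont _ (fun x : R => e - `|x|) x c2).
have N0 : 0 < sint (- e) e k0.
  apply: (@sint_gt0 _ _ _ _ 0) => //; [lra|by move=> x _; exact: ck0| |by rewrite oppr_le0 ltW|].
    by move=> x _; rewrite le_max lexx.
  by rewrite /k0 normr0 subr0 lt_max e0 orbT.
exists (fun x => (sint (- e) e k0)^-1 * k0 x); split.
- by move=> x; have c1 := ck0 x; exact: (cmul _ _ _ (ccst x _) c1).
- by move=> x; rewrite mulr_ge0 ?invr_ge0 ?(ltW N0) // le_max lexx.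
- move=> x ex; rewrite /k0 max_l ?mulr0 // subr_le0 //.
by rewrite sintZ ?mulVf ?gt_eqF // => x _; exact: ck0.
Qed.

Lemma polar_compact (a : R * R) (A : R) : hplane a -> exists C : set (R * R),
  [/\ compact C, C `<=` hplane & forall z, hplane z -> cosh_dist a z <= A -> C z].
Proof.
move=> ha.
exists ((fun z : R * R => frame_inv a z.1 z.2) @` ([set` `[- A, A]] `*` [set` `[- A, A]])); split.
- apply: continuous_compact.
    by apply: continuous_subspaceT => z; exact: frame_inv_cont.
  by apply: compact_setX; exact: segment_compact.
- by move=> _ [z _ <-]; exact: frame_inv_hplane.
move=> z hz hA; exists (frame_x a z, frame_y a z); last exact: frame_invK.
have A0 : 0 < A by apply: lt_le_trans hA; exact: cosh_dist_gt0.
have h : cosh_dist a z ^+ 2 <= A ^+ 2 by rewrite ler_sqr ?nnegrE ?(ltW A0) // ltW // cosh_dist_gt0.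
rewrite cosh_distE // in h.
have q1 := sqr_ge0 (frame_x a z); have q2 := sqr_ge0 (frame_y a z).
split => /=; rewrite in_itv /= -ler_norml -[A]gtr0_norm // -ler_sqr_norm; lra.
Qed.

Lemma cosh_dist_ge1 (a z : R * R) : hplane a -> hplane z -> 1 <= cosh_dist a z.
Proof.
move=> ha hz; have c0 := cosh_dist_gt0 ha hz; have := cosh_distE ha hz.
have := sqr_ge0 (frame_x a z); have := sqr_ge0 (frame_y a z); nra.
Qed.

Lemma cosh_dist_eq1 (a z : R * R) : hplane a -> hplane z -> cosh_dist a z = 1 -> z = a.
Proof.
move=> ha hz e; have := cosh_distE ha hz; rewrite e expr1n => h.
have [e1 e2] : frame_x a z = 0 /\ frame_y a z = 0 by apply: sumsq0; lra.
by rewrite -(frame_invK ha hz) e1 e2 frame_inv00.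
Qed.

Lemma ch_arsh (x : R) : ch (arsh x) = Num.sqrt (1 + x ^+ 2).
Proof.
apply/eqP; rewrite -(@eqrXn2 _ 2) ?sqrtr_ge0 ?(ltW (ch_gt0 _)) // sqr_sqrtr ?addr_ge0 ?sqr_ge0 //.
by rewrite ch2 sh_arsh.
Qed.

(** With x = sinh s the factor L + Th x / sqrt (1 + x^2) is ell s / cosh s, and
    W^p ell = W for W = ell^(-1/(p-1)). *)
Lemma weight_total (L Th p La P : R) (HH : R -> R) (j : R) : 0 < L -> 0 < Th -> 1 < p -> 0 < j -> 0 <= P ->
  continuous HH ->
  (forall x, 0 <= x -> HH x <= (j^-1 * Wabs L Th (p - 1)^-1 (arsh x)) `^ p) ->
  (forall T, 0 <= T -> sint 0 T (Wabs L Th (p - 1)^-1) <= La) ->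
  sint 0 P (fun x => HH x * (L + Th * (x / Num.sqrt (1 + x ^+ 2)))) <= j^-1 `^ p * La.
Proof.
move=> L0 Th0 p1 j0 P0 cH hH hLa.
set b := (p - 1)^-1 in hH hLa.
have b0 : 0 < b by rewrite invr_gt0 subr_gt0.
have cW : continuous (Wabs L Th b) by move=> x; exact: Wabs_cont.
have sx (x : R) : 0 < Num.sqrt (1 + x ^+ 2) by exact: sqrt1D_gt0.
have j0' : 0 <= j^-1 by rewrite invr_ge0 ltW.
have cA x : {for x, continuous (@arsh R)} by exact: is_derive_continuous1 (darsh x).
have cg x : {for x, continuous (fun x => Wabs L Th b (arsh x) * (Num.sqrt (1 + x ^+ 2))^-1)}.
  have c1 : {for x, continuous (fun x => Wabs L Th b (arsh x))}.
    exact: (@ccomp _ _ (Wabs L Th b) (@arsh R) x (cW (arsh x)) (cA x)).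
  have n0 : Num.sqrt (1 + x ^+ 2) != 0 by rewrite gt_eqF.
  by apply: (cmul _ _ _ c1); cts.
apply: (@le_trans _ _ (sint 0 P (fun x => j^-1 `^ p * (Wabs L Th b (arsh x) * (Num.sqrt (1 + x ^+ 2))^-1)))).
  apply: sint_le => x.
  - move=> _; have c1 := cH x; have n0 : Num.sqrt (1 + x ^+ 2) != 0 by rewrite gt_eqF.
    by apply: (cmul _ _ _ c1); cts.
  - by move=> _; have c1 := cg x; exact: (cmul _ _ _ (ccst x _) c1).
  move=> /andP[x0 _].
  have a0 : 0 <= arsh x by rewrite -(arsh0 R) arsh_le.
  have e0 : 0 < ell L Th (arsh x) by exact: ell_gt0.
  have eE : L + Th * (x / Num.sqrt (1 + x ^+ 2)) = ell L Th (arsh x) / Num.sqrt (1 + x ^+ 2).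
    by rewrite /ell ch_arsh sh_arsh; field; rewrite gt_eqF.
  rewrite eE !mulrA; apply: ler_wpM2r; first by rewrite invr_ge0 ltW.
  apply: (@le_trans _ _ ((j^-1 * Wabs L Th b (arsh x)) `^ p * ell L Th (arsh x))).
    by apply: ler_wpM2r; [exact: ltW | exact: hH].
  rewrite Wabs_ge0 // powRM ?(ltW (Well_gt0 L Th b _)) // -mulrA.
  rewrite ler_wpM2l ?powR_ge0 // /Well.
  have -> : expR (- b * ln (ell L Th (arsh x))) `^ p = expR (p * (- b * ln (ell L Th (arsh x)))).
    by rewrite /powR gt_eqF ?expR_gt0 // expRK.
  rewrite -[X in _ * X](lnK (x := ell L Th (arsh x))) ?posrE // -expRD.
  rewrite le_eqVlt; apply/orP; left; apply/eqP; congr expR.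
  rewrite /b; field; rewrite subr_eq0 gt_eqF //.
rewrite sintZ; last by move=> x _; exact: cg.
apply: ler_wpM2l; first exact: powR_ge0.
have [F [hF sF]] := sint_prim cW.
have hG x : is_derive x (1:R) (fun x : R => F (arsh x)) (Wabs L Th b (arsh x) * (Num.sqrt (1 + x ^+ 2))^-1).
  exact: (@dcomp R _ F (@arsh R) x 1 _ _ (hF (arsh x)) (darsh x)).
rewrite (sint_FTC P0 (fun x _ => cg x) (fun x _ => hG x)) arsh0 -sF; last by rewrite -(arsh0 R) arsh_le.
by apply: hLa; rewrite -(arsh0 R) arsh_le.
Qed.

End Aux.

Section Net.
Variables (R : realType) (K : set (R * R)) (gamma nu : R -> R * R).
Variable hb : body K gamma nu.
Local Notation q := (qline gamma nu).
Local Notation r := (rline gamma).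
Local Notation sig := (sig gamma nu).
Local Notation v := (vs gamma).

Lemma q_red t : exists s, [/\ 0 <= s, s < 1 & forall z, q t z = q s z].
Proof.
have qper (n : nat) s z : q (s + n%:R) z = q s z.
  elim: n => [|n IH]; first by rewrite addr0.
  by have [e _ _ _] := frame_per hb (s + n%:R) z; rewrite -natr1 addrA e.
have /andP[h1 h2] := Num.Theory.real_floor_itv (num_real t).
rewrite intrD in h2.
exists (t - (Num.floor t)%:~R); split; [by rewrite subr_ge0|by lra|move=> z].
case: (Num.floor t) => [n|n].
  by rewrite -[in LHS](subrK n%:R t) qper.
by rewrite NegzE mulrNz opprK -pmulrn qper.
Qed.

Lemma cosh_dist_joint_cont (w : (R * R) * R) : hplane w.1 ->
  {for w, continuous (fun w : (R * R) * R => cosh_dist (gamma w.2) w.1)}.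
Proof.
move=> hw; have [c1 c2 _ _] := curve_cont w.2 (bg_smooth hb).
have y0 := gamma_gt0 hb w.2.
have k2 : {for w, continuous (fun w : (R * R) * R => w.2)} by exact: cvg_snd.
have k1 : {for w, continuous (fun w : (R * R) * R => w.1)} by exact: cvg_fst.
have d1 : {for w, continuous (fun w : (R * R) * R => (gamma w.2).1)}.
  exact: (@ccomp _ _ (fun t => (gamma t).1) (fun w : (R * R) * R => w.2) w c1 k2).
have d2 : {for w, continuous (fun w : (R * R) * R => (gamma w.2).2)}.
  exact: (@ccomp _ _ (fun t => (gamma t).2) (fun w : (R * R) * R => w.2) w c2 k2).
have d3 : {for w, continuous (fun w : (R * R) * R => w.1.1)}.
  exact: (continuous_comp k1 (cfst w.1)).
have d4 : {for w, continuous (fun w : (R * R) * R => w.1.2)}.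
  exact: (continuous_comp k1 (csnd w.1)).
rewrite /cosh_dist; ctsh.
by rewrite !mulf_neq0 ?pnatr_eq0 // gt_eqF.
Qed.

(** On a compact set arsinh (q t z) is Lipschitz in t, with a constant that does not
    depend on z, because |r| <= cosh d. *)
Lemma net (C : set (R * R)) (del : R) : compact C -> C !=set0 -> C `<=` hplane -> 0 < del ->
  exists N : nat, forall z, C z -> forall t, exists2 i : 'I_N.+1,
    True & arsh (q t z) <= arsh (q (i%:R / N.+1%:R) z) + del.
Proof.
move=> cC [z0 Cz0] Ch d0.
pose I01 : set R := [set` `[0, 1]].
have cI : compact I01 by exact: segment_compact.
have I0 : I01 !=set0 by exists 0; rewrite /I01 /= in_itv /= lexx ler01.
have [t1 _ h1] := compact_max cI I0 (fun t _ => @v_cont _ _ _ _ hb t).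
have [t2 _ h2] := compact_max cI I0 (fun t _ => @sig_cont _ _ _ _ hb t).
have cCI : compact (C `*` I01) by exact: compact_setX.
have CI0 : C `*` I01 !=set0 by have [s Is] := I0; exists (z0, s).
have [w Cw h3] := compact_max cCI CI0 (fun w Cw => cosh_dist_joint_cont (Ch _ Cw.1)).
set M := sig t2 * v t1 * cosh_dist (gamma w.2) w.1 in h3 *.
have s0 := sig_ge0 hb t2; have v0 := v_gt0 hb t1.
have f0 := cosh_dist_gt0 (gamma_hplane hb w.2) (Ch _ Cw.1).
have M0 : 0 <= M by exact: (mulr_ge0 (mulr_ge0 s0 (ltW v0)) (ltW f0)).
pose N := Num.truncn (M / del).
have hN : M / del < N.+1%:R by exact: truncnS_gt.
have N0 : 0 < N.+1%:R :> R by rewrite ltr0n.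
exists N => z Cz t; have hz := Ch _ Cz.
have [s [s0' s1 qs]] := q_red t.
have sN0 : 0 <= s * N.+1%:R by rewrite mulr_ge0 // ltW.
have /andP[a1 a2] := truncn_itv sN0.
have iN : (Num.truncn (s * N.+1%:R) < N.+1)%N.
  rewrite -(ltr_nat R); apply: (le_lt_trans a1).
  by rewrite gtr_pMl.
exists (Ordinal iN) => //=; rewrite qs.
set i := Num.truncn _ in a1 a2 iN *.
have ti : i%:R / N.+1%:R <= s by rewrite ler_pdivrMr.
have ts : s - i%:R / N.+1%:R <= N.+1%:R^-1.
  have a3 : s * N.+1%:R < i%:R + 1 by rewrite natr1.
  by rewrite lerBlDr -[X in _ <= X + _]mul1r -mulrDl ler_pdivlMr // addrC ltW.
move: ti; rewrite le_eqVlt => /predU1P[->|ti]; first by rewrite lerDl ltW.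
have i0 : 0 <= i%:R / N.+1%:R :> R by rewrite divr_ge0 ?ler0n.
have hD x : is_derive x (1:R) (fun x : R => arsh (q x z)) ((Num.sqrt (1 + q x z ^+ 2))^-1 * (sig x * v x * r x z)).
  exact: (@dcomp R _ (@arsh R) (fun x : R => q x z) x 1 _ _ (darsh _) (frame_der hb x hz).1).
have [c [c1 c2 e]] := mvt_seg ti hD.
rewrite -lerBlDl e.
have c01 : I01 c by rewrite /I01 /= in_itv /= (ltW (le_lt_trans i0 c1)) (ltW (lt_trans c2 s1)).
have key : (Num.sqrt (1 + q c z ^+ 2))^-1 * (sig c * v c * r c z) <= M.
  have k1 : r c z <= cosh_dist (gamma w.2) w.1.
    apply: (@le_trans _ _ (cosh_dist (gamma c) z)); last exact: (h3 (z, c)).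
    apply: (le_trans (ler_norm _)).
    rewrite -[leRHS]gtr0_norm; last exact: (cosh_dist_gt0 (gamma_hplane hb c) hz).
    rewrite -ler_sqr_norm (cosh_dist_qr hb) //; have := sqr_ge0 (q c z); lra.
  have k2 : (Num.sqrt (1 + q c z ^+ 2))^-1 <= 1.
    rewrite invf_le1 ?sqrt1D_gt0 // -[leLHS]sqrtr1 ler_wsqrtr // lerDl sqr_ge0 //.
  have sv : 0 <= sig c * v c by rewrite mulr_ge0 ?(sig_ge0 hb) // ltW // (v_gt0 hb).
  have sM : sig c * v c <= sig t2 * v t1.
    by apply: ler_pM; rewrite ?(sig_ge0 hb) ?(ltW (v_gt0 hb _)) //; [exact: h2|exact: h1].
  have [rn|rp] := leP (r c z) 0.
    apply: le_trans M0; apply: mulr_ge0_le0; first by rewrite invr_ge0 sqrtr_ge0.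
    exact: mulr_ge0_le0.
  apply: (@le_trans _ _ (1 * (sig c * v c * r c z))).
    by apply: ler_wpM2r => //; apply: mulr_ge0 => //; exact: ltW.
  by rewrite mul1r /M; apply: ler_pM => //; exact: ltW.
apply: (@le_trans _ _ (M * N.+1%:R^-1)).
  apply: (@le_trans _ _ (M * (s - i%:R / N.+1%:R))); last by apply: ler_wpM2l.
  by apply: ler_wpM2r => //; rewrite subr_ge0 ltW.
by rewrite ler_pdivrMr // mulrC -ler_pdivrMr // ltW.
Qed.

End Net.

(** * Upper bound of the capacity *)

Section Upper.
Variables (R : realType) (K : set (R * R)) (gamma nu : R -> R * R).
Variable hb : body K gamma nu.
Local Notation q := (qline gamma nu).
Local Notation L := (total_length gamma).
Local Notation Th := (total_curv gamma nu).

(** The function minimized below vanishes at no point: cosh d(gamma t, z) = 1 only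
    if z is the point gamma t of K, and then u z < del. *)
Lemma cosh_dist_gap (C : set (R * R)) (u : R * R -> R) (del : R) : compact C -> C !=set0 -> C `<=` hplane ->
  (forall z, C z -> {for z, continuous u}) -> (forall z, K z -> u z < del) ->
  exists2 m : R, 0 < m & forall z, C z -> del <= u z -> forall t, 1 + m <= cosh_dist (gamma t) z.
Proof.
move=> cC [z0 Cz0] Ch cu uK.
pose I01 : set R := [set` `[0, 1]].
have cCI : compact (C `*` I01) by apply: compact_setX => //; exact: segment_compact.
have CI0 : C `*` I01 !=set0 by exists (z0, 0); split => //=; rewrite /I01 /= in_itv /= lexx ler01.
(* minus the function to be minimized, which equals cosh d - 1 where del <= u *)
pose g (w : (R * R) * R) := - (cosh_dist (gamma w.2) w.1 - 1 + Num.max 0 (del - u w.1)).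
have cg w : (C `*` I01) w -> {for w, continuous g}.
  move=> [Cw _]; have c1 := @cosh_dist_joint_cont _ _ _ _ hb w (Ch _ Cw).
  have k1 : {for w, continuous (fun w : (R * R) * R => w.1)} by exact: cvg_fst.
  have c2 : {for w, continuous (fun w : (R * R) * R => u w.1)} by exact: (continuous_comp k1 (cu _ Cw)).
  have c3 : {for w, continuous (fun w : (R * R) * R => del - u w.1)} by ctsh.
  have c4 := @max0_cont _ _ (fun w : (R * R) * R => del - u w.1) w c3.
  by rewrite /g; ctsh.
have [w [Cw _] hw] := compact_max cCI CI0 cg.
have f1 := cosh_dist_ge1 (gamma_hplane hb w.2) (Ch _ Cw).
have mx : 0 <= Num.max 0 (del - u w.1) by rewrite le_max lexx.
exists (- g w); rewrite /g opprK.
  have [f2|f2] := eqVneq (cosh_dist (gamma w.2) w.1) 1.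
    have e := cosh_dist_eq1 (gamma_hplane hb w.2) (Ch _ Cw) f2.
    rewrite f2 subrr add0r lt_max; apply/orP; right; rewrite subr_gt0; apply: uK.
    by rewrite e; exact: (gamma_K hb).
  have : 1 < cosh_dist (gamma w.2) w.1 by rewrite lt_neqAle eq_sym f2.
  lra.
move=> z Cz dz t.
have [s s01 ->] := gamma_red hb t.
have := hw (z, s); rewrite /g /= max_l ?subr_le0 // addr0.
have h0 : (C `*` I01) (z, s) by split => //=; rewrite /I01 /= in_itv.
by move=> /(_ h0); lra.
Qed.

Lemma powR_le_base (x y z : R) : 0 < x -> 0 <= y -> y <= z -> y `^ x <= z `^ x.
Proof.
move=> x0 y0 yz; apply: ge0_ler_powR; rewrite ?nnegrE //; first exact: ltW.
exact: le_trans yz.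
Qed.

(** The test function is phi (u), with phi from [profile] and u the soft maximum of
    finitely many signed distances to tangent geodesics and of [ln (cosh_dist a0 z / M)].
    Where del < u < S, its gradient is at most j^-1 Well (u + del), while
    arsinh (q t) <= u + del for all t; as [Well] decreases, the energy density is
    bounded as [crofton_point] requires. *)
Lemma energy_upper (p S j La : R) : 1 < p -> 0 < S -> 0 < j ->
  j < sint 0 S (Wabs L Th (p - 1)^-1) ->
  (forall T, 0 <= T -> sint 0 T (Wabs L Th (p - 1)^-1) <= La) ->
  (hcap p K <= (j^-1 `^ p * La)%:E)%E.
Proof.
move=> p1 S0 j0 jS hLa.
have L0 := length_gt0 hb; have Th0 := total_curv_gt0 hb.
have [Kh cK ptK [zi izi] _] := hb.
have Kzi : K zi by exact: interior_subset.
set b := (p - 1)^-1 in jS hLa *.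
have b0 : 0 < b by rewrite invr_gt0 subr_gt0.
have p0 : 0 < p by lra.
have j0' : 0 <= j^-1 by rewrite invr_ge0 ltW.
have [del [phi [dphi [d0 sphi hphi [phi1 phi0 dphi0 dphile]]]]] := profile L0 Th0 b0 j0 S0 jS.
pose a0 := gamma 0; have ha0 : hplane a0 by exact: (gamma_hplane hb).
have [zM KzM hM] := compact_max ptK (ex_intro _ zi Kzi) (fun z Kz => cosh_dist_cont ha0 (Kh z Kz)).
set M := cosh_dist a0 zM in hM.
have M0 : 0 < M by apply: cosh_dist_gt0 => //; exact: Kh.
have [C [cC Ch hC]] := polar_compact (M * expR S) ha0.
have M1 : 1 <= M by apply: cosh_dist_ge1 => //; exact: Kh.
have eS1 : 1 <= expR S by rewrite -expR0 ler_expR ltW.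
have KC : K `<=` C.
  move=> z Kz; apply: hC; first exact: Kh.
  by apply: (le_trans (hM z Kz)); rewrite ler_peMr // ltW.
have C0 : C !=set0 by exists zi; exact: KC.
have [N hN] := net hb cC C0 Ch d0.
pose V (i : 'I_N.+2) (z : R * R) : R :=
  if (i < N.+1)%N then arsh (q (i%:R / N.+1%:R) z) else ln (cosh_dist a0 z / M).
have VP i : (forall n, cls (@hdirs R) hplane n (V i)) /\ grad_le1 (V i).
  have [iN|iN] := boolP (i < N.+1)%N.
    have -> : V i = (fun z => arsh (q (i%:R / N.+1%:R) z)) by apply/funext => z; rewrite /V iN.
    by apply: grad_arsh; [exact: (gamma_gt0 hb)|exact: (nrm_sqr hb)].
  have -> : V i = (fun z => ln (cosh_dist a0 z / M)) by apply/funext => z; rewrite /V (negbTE iN).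
  exact: grad_lncosh_dist.
have lnN : 0 <= ln (N.+2%:R : R) by rewrite ln_ge0 // ler1n.
(* with this k the soft maximum is below del on K *)
pose k := (ln (N.+2%:R : R) + 1) / del.
have k0 : 0 < k by rewrite divr_gt0 // ltr_wpDl.
pose u := softmax V k.
have su n : cls (@hdirs R) hplane n u by apply: cls_softmax => i m; exact: (VP i).1.
have gu : grad_le1 u by apply: grad_softmax => [|i m|i]; [exact: k0|exact: (VP i).1|exact: (VP i).2].
have cu z : hplane z -> {for z, continuous u} by move=> hz; exact: (cls_cont (su 0%N)).
have uV i z : V i z <= u z by exact: softmax_ge.
have uK z : K z -> u z < del.
  move=> Kz; apply: (@le_lt_trans _ _ (k^-1 * ln N.+2%:R)).
    apply: softmax_le => // i; rewrite /V; case: ifP => _.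
      by rewrite -(arsh0 R) arsh_le // (qline_le0 hb).
    by rewrite ln_le0 // ler_pdivrMr // mul1r hM.
  rewrite /k invf_div mulrAC ltr_pdivrMr; last by lra.
  by rewrite ltr_pM2l //; lra.
have uq z t : C z -> arsh (q t z) <= u z + del.
  move=> Cz; have [i _ hi] := hN z Cz t.
  apply: (le_trans hi); rewrite lerD2r.
  have := uV (widen_ord (leqnSn _) i) z; rewrite /V /=.
  by rewrite ltn_ord.
have uC z : hplane z -> u z <= S -> C z.
  move=> hz uS; apply: hC => //.
  have := uV ord_max z; rewrite /V /= ltnn => h.
  have f0 := cosh_dist_gt0 ha0 hz.
  have : ln (cosh_dist a0 z / M) <= S by lra.
  have e : expR (ln (cosh_dist a0 z / M)) = cosh_dist a0 z / M by rewrite lnK // posrE divr_gt0.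
  by rewrite -ler_expR e ler_pdivrMr // mulrC.
pose f z := phi (u z).
have sf n : cls (@hdirs R) hplane n f.
  apply: (@cls_comp _ _ _ _ setT n phi u) => //; exact: open_hplane.
have hf : hsmooth f by move=> n; apply/hclassE.
have [m m0 hm] := @cosh_dist_gap C u del cC C0 Ch (fun z Cz => cu z (Ch z Cz)) uK.
have m20 : 0 < m / 2 by rewrite divr_gt0.
have [kk [ckk kk0 kke ikk]] := tent_ex m20.
pose Q := sh (S + del).
have Q0 : 0 < Q by rewrite /Q -(sh0 R) sh_lt // addr_gt0.
pose W := Wabs L Th b.
have cW : continuous W by move=> x; exact: Wabs_cont.
have W0 x : 0 < W x by exact: Well_gt0.
pose P x := (j^-1 * W (arsh x)) `^ p.
(* equal to 1 on [m / 2, Q], where the values of q that matter lie *)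
pose chi x := Num.min 1 (Num.max 0 (x / (m / 2))) * Num.min 1 (Num.max 0 (Q + 1 - x)).
have chi0 x : 0 <= chi x by rewrite mulr_ge0 // le_min ler01 le_max lexx.
have chi1 x : chi x <= 1.
  by rewrite /chi mulr_ile1 ?ge_min ?lexx // le_min ler01 le_max lexx.
pose HH x := chi x * P x.
have P0 x : 0 <= P x by exact: powR_ge0.
have cP : continuous P.
  move=> x.
  have cA : {for x, continuous (@arsh R)} by exact: is_derive_continuous1 (darsh x).
  have c1 : {for x, continuous (fun x => W (arsh x))}.
    exact: (@ccomp _ _ W (@arsh R) x (cW (arsh x)) cA).
  have c2 : {for x, continuous (fun x => j^-1 * W (arsh x))} by exact: (cmul _ _ _ (ccst x _) c1).
  have c3 s : 0 <= j^-1 * W (arsh s) by rewrite mulr_ge0 // ltW.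
  exact: (cpowR c2 p0 c3).
have cchi : continuous chi.
  move=> x.
  have c1 : {for x, continuous (fun x : R => x / (m / 2))} by cts; rewrite gt_eqF.
  have c2 : {for x, continuous (fun x : R => Q + 1 - x)} by cts.
  have c3 := @min1_cont _ _ _ _ (@max0_cont _ _ _ _ c1).
  have c4 := @min1_cont _ _ _ _ (@max0_cont _ _ _ _ c2).
  exact: (cmul _ _ _ c3 c4).
have cHH : continuous HH by move=> x; exact: (cmul _ _ _ (cchi x) (cP x)).
have HH0 x : 0 <= HH x by rewrite mulr_ge0.
have HHn x : x <= 0 -> HH x = 0.
  move=> x0; have e : Num.max 0 (x / (m / 2)) = 0.
    by rewrite max_l // pmulr_lle0 // invr_gt0.
  have e1 : Num.min 1 0 = 0 :> R by rewrite min_r // ler01.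
  by rewrite /HH /chi e e1 !mul0r.
have HHp x : Q + 1 < x -> HH x = 0.
  move=> x0; have e : Num.max 0 (Q + 1 - x) = 0.
    by rewrite max_l // subr_le0 ltW.
  have e1 : Num.min 1 0 = 0 :> R by rewrite min_r // ler01.
  by rewrite /HH /chi e e1 mulr0 mul0r.
have Q1 : 0 <= Q + 1 by lra.
have fsupp : hcompact_support f.
  exists C; split => // z hz nC; apply: phi0; rewrite leNgt; apply/negP => h.
  by apply: nC; apply: uC => //; exact: ltW.
have fK z : K z -> f z = 1 by move=> Kz; apply: phi1; exact: ltW (uK z Kz).
have gF z : hplane z -> gradp p f z <= sint 0 1 (fun t => crofton_density gamma nu HH kk t z).
  move=> hz; have h1 : hnorm z (hgrad f z) <= `|dphi (u z)|.
    exact: (grad_comp hz hphi (su 1%N) gu).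
  have h2 : gradp p f z <= `|dphi (u z)| `^ p.
    exact: (powR_le_base p0 (hnorm_ge0 _ _) h1).
  apply: (le_trans h2).
  have triv : `|dphi (u z)| = 0 -> `|dphi (u z)| `^ p <= sint 0 1 (fun t => crofton_density gamma nu HH kk t z).
    move=> ->; rewrite powR0 ?gt_eqF //; apply: sint_ge0 => t _.
    exact: (crofton_density_ge0 hb).
  have [ud|ud] := leP (u z) del; first by apply: triv; rewrite dphi0 ?normr0 //; left.
  have [uS|uS] := leP S (u z); first by apply: triv; rewrite dphi0 ?normr0 //; right.
  have Cz : C z by apply: uC => //; exact: ltW.
  have u0 : 0 <= u z by lra.
  have qM t : q t z <= sh (u z + del) by rewrite -[q t z]sh_arsh sh_le // uq.
  apply: (@le_trans _ _ ((j^-1 * Well L Th b (u z + del)) `^ p)).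
    exact: (powR_le_base p0 (normr_ge0 _) (dphile _ u0)).
  have nKz : ~ K z by move=> Kz; have := uK z Kz; lra.
  have hc t : 1 + m ^+ 2 <= cosh_dist (gamma t) z ^+ 2.
    by have := hm z Cz (ltW ud) t => h; have := sqr_ge0 m; nra.
  have hq := outside_pos hb hz nKz.
  have W1 : 0 <= j^-1 * Well L Th b (u z + del) by apply: mulr_ge0 => //; exact: ltW (Well_gt0 _ _ _ _).
  have mm : m / 2 < m by lra.
  apply: (crofton_point hb cHH ckk HH0 kk0 HHn m20 mm kke ikk hz hc hq qM (powR_ge0 _ _)).
  move=> x x0 xM mx.
  have xm : m / 2 <= x.
    rewrite -[m / 2]gtr0_norm // -[x]gtr0_norm // -ler_sqr_norm.
    have e1 : (m / 2) ^+ 2 = m ^+ 2 / 4 by field.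
    rewrite e1 in mx *; have := sqr_ge0 m; lra.
  have sQ : sh (u z + del) <= Q by apply: sh_le; rewrite lerD2r ltW.
  have xQ : x <= Q by exact: le_trans xM sQ.
  have -> : HH x = P x.
    rewrite /HH /chi.
    have -> : Num.min 1 (Num.max 0 (x / (m / 2))) = 1.
      by rewrite min_l // le_max; apply/orP; right; rewrite ler_pdivlMr // mul1r.
    have -> : Num.min 1 (Num.max 0 (Q + 1 - x)) = 1.
      by rewrite min_l // le_max; apply/orP; right; rewrite addrAC lerDr subr_ge0.
    by rewrite !mul1r.
  have ax : 0 <= arsh x by rewrite -(arsh0 R) arsh_le // ltW.
  have W2 : 0 <= j^-1 * W (arsh x) by apply: mulr_ge0 => //; exact: ltW (W0 _).
  have xd : arsh x <= u z + del by rewrite -(arsh_sh (u z + del)) arsh_le.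
  have Wx : Well L Th b (u z + del) <= W (arsh x).
    by rewrite /W (Wabs_ge0 _ _ _ ax); exact: (Well_le L0 Th0 b0 ax xd).
  exact: (powR_le_base p0 W1 (ler_wpM2l j0' Wx)).
have E := crofton_total hb cHH ckk HH0 kk0 HHn HHp Q1 kke ikk
  (fun z hz => gradp_cont hf p0 hz) (fun z hz => powR_ge0 _ _) gF.
have : (hcap p K <= harea_integral (gradp p f))%E.
  by apply: ereal_inf_lbound; exists f.
move=> /le_trans; apply; apply: (le_trans E); rewrite lee_fin.
apply: weight_total => // x x0.
rewrite /HH -[leRHS]mul1r; apply: ler_wpM2r => //.
Qed.

End Upper.

(** * Comparison of the integrals *)

Section Weight.
Variables (R : realType) (p L Th : R).
Hypotheses (p1 : 1 < p) (L0 : 0 < L) (Th0 : 0 < Th).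
Local Notation mu := (@lebesgue_measure R).

(** The integrand of the theorem, as a function of the term
    Y = (L^(p-2) T)^(2/(p-1)). *)
Definition wcap (Y t : R) : R := expR ((p - 2) / (p - 1) * t) * L `^ ((p - 2) / (p - 1))
        * (expR (2 * t) * L ^+ 2 + Y - L ^+ 2) `^ (- 2^-1).
Definition Icap (Y : R) : R := \int[mu]_(t in `[0, +oo[) wcap Y t.

Lemma wcap_base Y t : 0 <= t -> Y <= expR (2 * t) * L ^+ 2 + Y - L ^+ 2.
Proof.
move=> t0; have : 1 <= expR (2 * t) by rewrite -expR0 ler_expR mulr_ge0.
have := sqr_ge0 L; nra.
Qed.

Lemma wcap_gt0 Y t : 0 < Y -> 0 <= t -> 0 < wcap Y t.
Proof.
move=> Y0 t0; have := wcap_base Y t0 => h.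
by rewrite /wcap mulr_gt0 ?powR_gt0 ?mulr_gt0 ?expR_gt0 ?powR_gt0 //; lra.
Qed.

Lemma wcap_cont Y t : 0 < Y -> 0 <= t -> {for t, continuous (wcap Y)}.
Proof.
move=> Y0 t0; have := wcap_base Y t0 => h.
have b0 : 0 < expR (2 * t) * L ^+ 2 + Y - L ^+ 2 by lra.
have c1 : {for t, continuous (fun t : R => expR (2 * t) * L ^+ 2 + Y - L ^+ 2)} by cts.
have c2 : {for (expR (2 * t) * L ^+ 2 + Y - L ^+ 2), continuous (fun x : R => x `^ (- 2^-1))}.
  by apply: is_derive_continuous1; exact: is_derive1_powR.
have c3 := @ccomp _ _ (fun x : R => x `^ (- 2^-1)) (fun t : R => expR (2 * t) * L ^+ 2 + Y - L ^+ 2) t c2 c1.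
have c4 : {for t, continuous (fun t : R => expR ((p - 2) / (p - 1) * t) * L `^ ((p - 2) / (p - 1)))} by cts.
exact: (cmul _ _ _ c4 c3).
Qed.

Lemma wcap_lt Y Y' t : 0 < Y -> Y < Y' -> 0 <= t -> wcap Y' t < wcap Y t.
Proof.
move=> Y0 YY t0; have h := wcap_base Y t0; have h' := wcap_base Y' t0.
rewrite /wcap ltr_pM2l ?mulr_gt0 ?expR_gt0 ?powR_gt0 //.
rewrite !powRN ltf_pV2 ?posrE ?powR_gt0 //; [|lra|lra].
apply: gt0_ltr_powR; rewrite ?nnegrE ?invr_gt0 //; lra.
Qed.

(** The substitution e^t = ell s / L, based on ell'^2 = ell^2 + Th^2 - L^2. *)
Lemma wcap_par S : 0 <= S ->
  sint 0 (ln (ell L Th S / L)) (wcap (Th ^+ 2)) = sint 0 S (Wabs L Th (p - 1)^-1).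
Proof.
move=> S0; set T := ln _.
have eS := ell_gt0 L0 Th0 S0.
have Y0 : 0 < Th ^+ 2 by rewrite exprn_gt0.
have p10 : p - 1 != 0 by rewrite subr_eq0 gt_eqF.
have ell0 : ell L Th 0 = L by rewrite /ell sh0 /ch oppr0 expR0; field.
have lr s : 0 <= s -> 1 <= ell L Th s / L.
  by move=> s0; rewrite ler_pdivlMr // mul1r -{1}ell0 ell_le.
have T0 : 0 <= T by rewrite ln_ge0 // lr.
pose we (t : R) := wcap (Th ^+ 2) `|t|.
have cwe : continuous we.
  move=> t; apply: (@ccomp _ _ (wcap (Th ^+ 2)) (fun t : R => `|t|)); last exact: norm_continuous.
  exact: wcap_cont.
have -> : sint 0 T (wcap (Th ^+ 2)) = sint 0 T we.
  by apply: eq_sint => t /andP[t0 _]; rewrite /we ger0_norm.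
have [F [hF sF]] := sint_prim cwe.
rewrite sF //.
pose dl s := (L * sh s + Th * ch s) / ell L Th s.
have hl (s : R) : 0 <= s -> is_derive s (1:R) (fun s : R => ln (ell L Th s / L)) (dl s).
  move=> s0; have e0 := ell_gt0 L0 Th0 s0; have h := ell_der L Th s.
  have hp : 0 < ell L Th s / L by rewrite divr_gt0.
  by notypeclasses refine (deq _ _); [der; exact: hp | rewrite /dl; cbv beta; field; rewrite !gt_eqF].
have hG (s : R) : 0 <= s -> is_derive s (1:R) (fun s : R => F (ln (ell L Th s / L))) (we (ln (ell L Th s / L)) * dl s).
  by move=> s0; exact: (@dcomp R _ F (fun s : R => ln (ell L Th s / L)) s 1 _ _ (hF _) (hl s s0)).
have key (s : R) : 0 <= s -> we (ln (ell L Th s / L)) * dl s = Wabs L Th (p - 1)^-1 s.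
  move=> s0; have e0 := ell_gt0 L0 Th0 s0.
  have hp : 0 < ell L Th s / L by rewrite divr_gt0.
  have t0 : 0 <= ln (ell L Th s / L) by rewrite ln_ge0 // lr.
  rewrite /we ger0_norm // Wabs_ge0 // /wcap /Well /dl.
  have eE : expR (2 * ln (ell L Th s / L)) = (ell L Th s / L) ^+ 2.
    by rewrite mulrC -[2]/(2%:R) expRM_natr lnK ?posrE.
  have -> : expR (2 * ln (ell L Th s / L)) * L ^+ 2 + Th ^+ 2 - L ^+ 2 = (L * sh s + Th * ch s) ^+ 2.
    rewrite eE; have -> : (ell L Th s / L) ^+ 2 * L ^+ 2 = ell L Th s ^+ 2 by field; rewrite gt_eqF.
    have c2 : ch s ^+ 2 = 1 + sh s ^+ 2 := ch2 s.
    have -> : ell L Th s ^+ 2 = L ^+ 2 * ch s ^+ 2 + 2 * L * Th * ch s * sh s + Th ^+ 2 * sh s ^+ 2 by rewrite /ell; ring.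
    have -> : (L * sh s + Th * ch s) ^+ 2 = L ^+ 2 * sh s ^+ 2 + 2 * L * Th * ch s * sh s + Th ^+ 2 * ch s ^+ 2 by ring.
    by rewrite c2; ring.
  have d0 : 0 < L * sh s + Th * ch s.
    have h1 : 0 <= L * sh s by apply: mulr_ge0; [exact: ltW | exact: sh_ge0].
    have h2 : 0 < Th * ch s by rewrite mulr_gt0 // ch_gt0.
    by rewrite ltr_wpDl.
  rewrite powRN powR12_sqrt ?sqr_ge0 // sqrtr_sqr gtr0_norm //.
  have -> : expR ((p - 2) / (p - 1) * ln (ell L Th s / L)) * L `^ ((p - 2) / (p - 1)) =
     expR ((p - 2) / (p - 1) * ln (ell L Th s)).
    rewrite /powR gt_eqF // -expRD -mulrDr ln_div ?posrE //; congr expR; congr (_ * _); lra.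
  have -> : expR (- (p - 1)^-1 * ln (ell L Th s)) = expR ((p - 2) / (p - 1) * ln (ell L Th s)) / ell L Th s.
    rewrite -[X in _ = _ / X](lnK (x := ell L Th s)) ?posrE // -expRN -expRD; congr expR.
    by field.
  by field; rewrite !gt_eqF.
have cW : continuous (Wabs L Th (p - 1)^-1).
  by move=> s; apply: Wabs_cont => //; rewrite invr_gt0 subr_gt0.
have hG' (s : R) : 0 <= s <= S -> is_derive s (1:R) (fun s : R => F (ln (ell L Th s / L))) (Wabs L Th (p - 1)^-1 s).
  by move=> /andP[s0 _]; have := hG s s0; rewrite key.
by rewrite (sint_FTC S0 (fun s _ => cW s) hG') ell0 divff ?gt_eqF // ln1.
Qed.

(** ell s is at least (L / 2) e^s. *)
Lemma Wabs_total : exists M : R, forall S, 0 <= S -> sint 0 S (Wabs L Th (p - 1)^-1) <= M.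
Proof.
set b := (p - 1)^-1; have b0 : 0 < b by rewrite invr_gt0 subr_gt0.
pose c := expR (- b * ln (L / 2)).
have L20 : 0 < L / 2 by rewrite divr_gt0.
exists (c / b) => S S0.
have hF (s : R) : is_derive s (1:R) (fun s : R => - (c / b * expR (- b * s))) (c * expR (- b * s)).
  by notypeclasses refine (deq _ _); [der | cbv beta; field; rewrite gt_eqF].
have cf (s : R) : {for s, continuous (fun s : R => c * expR (- b * s))} by cts.
apply: (@le_trans _ _ (sint 0 S (fun s => c * expR (- b * s)))); last first.
  rewrite (sint_FTC S0 (fun s _ => cf s) (fun s _ => hF s)) mulr0 expR0 mulr1 opprK.
  rewrite gerDr oppr_le0 mulr_ge0 ?(ltW (expR_gt0 _)) // divr_ge0 ?(ltW b0) //.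
  exact: ltW (expR_gt0 _).
apply: sint_le => s; [by move=> _; exact: Wabs_cont|by move=> _; exact: cf|].
move=> /andP[s0 _]; rewrite Wabs_ge0 // /Well /c -expRD -mulrDr ler_expR !mulNr lerN2.
rewrite ler_pM2l //.
have e0 := ell_gt0 L0 Th0 s0.
rewrite -[X in _ + X](expRK s) -lnM ?posrE ?expR_gt0 // ler_ln ?posrE ?mulr_gt0 ?expR_gt0 //.
have h1 : 0 <= Th * sh s by apply: mulr_ge0; [exact: ltW | exact: sh_ge0].
have h2 : L / 2 * expR s <= L * ch s.
  rewrite /ch -mulrA ler_pM2l // mulrC ler_pM2r ?invr_gt0 // lerDl.
  exact: ltW (expR_gt0 _).
by rewrite /ell; lra.
Qed.

(** [wcap_par] in the limit of large S. *)
Lemma Icap_par : 0 < Icap (Th ^+ 2) /\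
  (forall S, 0 <= S -> sint 0 S (Wabs L Th (p - 1)^-1) <= Icap (Th ^+ 2)) /\
  (forall x, x < Icap (Th ^+ 2) -> exists2 S, 0 < S & x < sint 0 S (Wabs L Th (p - 1)^-1)) /\
  (forall T, 0 <= T -> sint 0 T (wcap (Th ^+ 2)) <= Icap (Th ^+ 2)).
Proof.
have Y0 : 0 < Th ^+ 2 by rewrite exprn_gt0.
have [M hM] := Wabs_total.
have b0 : 0 < (p - 1)^-1 by rewrite invr_gt0 subr_gt0.
have ell0 : ell L Th 0 = L by rewrite /ell sh0 /ch oppr0 expR0; field.
have wc (t : R) : 0 <= t -> {for t, continuous (wcap (Th ^+ 2))} by exact: wcap_cont.
have w0 t : 0 <= t -> 0 <= wcap (Th ^+ 2) t by move=> t0; exact: ltW (wcap_gt0 Y0 t0).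
have cW : continuous (Wabs L Th (p - 1)^-1) by move=> s; apply: Wabs_cont.
(* every T is reached by the logarithm of the length *)
have par T : 0 <= T -> exists2 S, 0 <= S & T <= ln (ell L Th S / L).
  move=> T0; exists (T + ln 2); first by rewrite addr_ge0 // ln_ge0 // ler1n.
  have S0 : 0 <= T + ln 2 :> R by rewrite addr_ge0 // ln_ge0 // ler1n.
  have e0 := ell_gt0 L0 Th0 S0.
  rewrite -[leLHS]expRK ler_ln ?posrE ?expR_gt0 ?divr_gt0 // ler_pdivlMr //.
  have h1 : 0 <= Th * sh (T + ln 2) by apply: mulr_ge0; [exact: ltW | exact: sh_ge0].
  have h2 : L * expR T <= L * ch (T + ln 2).
    rewrite ler_pM2l // /ch ler_pdivlMr // expRD lnK ?posrE // lerDl.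
    exact: ltW (expR_gt0 _).
  by rewrite /ell; lra.
have mono a b (a0 : 0 <= a) := sint_mono wc w0 a0 (b := b).
have wM T : 0 <= T -> sint 0 T (wcap (Th ^+ 2)) <= M.
  move=> T0; have [S S0 hS] := par T T0.
  by apply: (le_trans (mono _ _ T0 hS)); rewrite wcap_par // hM.
have [h1 h2] := sint_y wc w0 wM.
rewrite -/(Icap (Th ^+ 2)) in h1 h2.
split; last split; last split => //.
- apply: lt_le_trans (h1 1 ler01).
  apply: (@sint_gt0 _ _ _ _ 0) => //; last exact: wcap_gt0.
  + by move=> t /andP[t0 _]; exact: wc.
  + by move=> t /andP[t0 _]; exact: w0.
  + by rewrite lexx ler01.
- move=> S S0; rewrite -wcap_par //; apply: h1; rewrite ln_ge0 //.
  by rewrite ler_pdivlMr // mul1r -{1}ell0 ell_le.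
move=> x hx; have e0 : 0 < Icap (Th ^+ 2) - x by rewrite subr_gt0.
have [T T0 hT] := h2 _ e0.
have [S S0 hS] := par T T0.
exists (S + 1); first by lra.
apply: (@lt_le_trans _ _ (sint 0 T (wcap (Th ^+ 2)))); first by lra.
apply: (le_trans (mono _ _ T0 hS)); rewrite wcap_par //.
have S1 : S <= S + 1 by lra.
rewrite (sint_cat cW S0 S1) lerDl; apply: sint_ge0 => s _.
exact: ltW (Well_gt0 _ _ _ _).
Qed.

Lemma Icap_lt Y : Th ^+ 2 < Y -> 0 < Icap Y < Icap (Th ^+ 2).
Proof.
move=> YY; have Y0 : 0 < Th ^+ 2 by rewrite exprn_gt0.
have Yp : 0 < Y by exact: lt_trans YY.
have [_ [_ [_ hT]]] := Icap_par.
apply: (@sint_y_lt _ (wcap Y) (wcap (Th ^+ 2))) => // x x0.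
- exact: wcap_cont.
- exact: wcap_cont.
- exact: wcap_gt0.
- exact: wcap_lt.
Qed.

End Weight.

Section Compare.
Variables (R : realType) (K : set (R * R)) (gamma nu : R -> R * R).
Variable hb : body K gamma nu.
Local Notation sig := (sig gamma nu).
Local Notation v := (vs gamma).
Local Notation L := (total_length gamma).
Local Notation Th := (total_curv gamma nu).
Variable p : R.
Hypothesis p3 : 3 <= p.
Local Notation CE := (curvature_energy p gamma nu).

(** [energy_upper] as j tends to the total integral. *)
Lemma upper_limit : (hcap p K <= (Icap p L (Th ^+ 2) `^ (1 - p))%:E)%E.
Proof.
have L0 := length_gt0 hb; have Th0 := total_curv_gt0 hb.
have p1 : 1 < p by have := p3; lra.
have [I0 [I1 [I2 _]]] := Icap_par p1 L0 Th0.
set I := Icap p L (Th ^+ 2) in I0 I1 I2 *.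
apply/lee_addgt0Pr => e e0; rewrite -EFinD.
have B0 : 0 < I `^ (1 - p) by rewrite powR_gt0.
pose rho := (I `^ (1 - p) + e) / I `^ (1 - p).
have rho1 : 1 < rho by rewrite ltr_pdivlMr // mul1r; lra.
have rho0 : 0 < rho by lra.
pose c := rho `^ p^-1.
have c1 : 1 < c.
  have -> : 1 = (1:R) `^ p^-1 by rewrite powR1.
  by apply: gt0_ltr_powR; rewrite ?nnegrE ?invr_gt0 //; lra.
have c0 : 0 < c by lra.
have cp : c `^ p = rho by rewrite -powRrM mulVf ?powRr1 ?(ltW rho0) // gt_eqF //; lra.
pose j := I / c.
have j0 : 0 < j by rewrite divr_gt0.
have jI : j < I by rewrite ltr_pdivrMr // ltr_pMr.
have [S S0 hS] := I2 j jI.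
apply: (le_trans (energy_upper hb p1 S0 j0 hS I1)); rewrite lee_fin.
have -> : j^-1 `^ p * I = rho * I `^ (1 - p).
  rewrite /j invf_div powRM ?invr_ge0 ?(ltW c0) ?(ltW I0) // cp -mulrA; congr (_ * _).
  rewrite powRD; last by rewrite (gt_eqF I0) implybT.
  by rewrite powRr1 ?(ltW I0) // mulrC -powR_inv1 ?(ltW I0) // -powRrM mulN1r.
by rewrite /rho divfK // gt_eqF.
Qed.

Lemma sig_per t : sig (t + 1) = sig t.
Proof.
have [_ _ e3 e4] := frame_per hb t (gamma 0).
by move: e3; rewrite e4; apply: mulIf; rewrite gt_eqF // (v_gt0 hb).
Qed.

(** Hoelder against the constant 1, obtained by integrating Bernoulli for the ratio
    of the curvature to its mean Th / L; the strict case needs a strict inequality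
    at one point only, by continuity. *)
Lemma energy_bernoulli :
  (Th / L) `^ (p - 1) * L <= CE /\
  ((exists2 t, 0 <= t <= 1 & sig t != Th / L) -> (Th / L) `^ (p - 1) * L < CE) /\
  ((forall t, sig t = Th / L) -> CE = (Th / L) `^ (p - 1) * L).
Proof.
have L0 := length_gt0 hb; have Th0 := total_curv_gt0 hb.
set m := Th / L; have m0 : 0 < m by rewrite divr_gt0.
have p1 : 1 < p - 1 by have := p3; lra.
have cv (t : R) : {for t, continuous v} := @v_cont _ _ _ _ hb t.
have cs (t : R) : {for t, continuous sig} := @sig_cont _ _ _ _ hb t.
have s0 t : 0 <= sig t by exact: (sig_ge0 hb).
have LE : L = sint 0 1 v by rewrite /total_length hlengthE.
have CEE : CE = sint 0 1 (fun t => sig t `^ (p - 1) * v t) by [].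
pose A := m `^ (p - 1); have A0 : 0 < A by rewrite powR_gt0.
(* the tangent line of the power function at m, whose integral is explicit *)
pose f t := A * (1 + (p - 1) * (sig t / m - 1)) * v t.
have cp t : {for t, continuous (fun t => sig t `^ (p - 1) * v t)}.
  have c1 := cpowR (cs t) (lt_trans ltr01 p1) s0.
  exact: (cmul _ _ _ c1 (cv t)).
have cf (t : R) : {for t, continuous f}.
  have k1 := cs t; have k2 := cv t; have mn : m != 0 by rewrite gt_eqF.
  by rewrite /f; ctsh.
have fE : sint 0 1 f = A * L.
  have -> : sint 0 1 f = A * (1 - (p - 1)) * L + A * (p - 1) / m * Th.
    rewrite LE /total_curv -!sintZ; last 2 first.
    - by move=> t _; have k1 := cs t; have k2 := cv t; ctsh.
    - by move=> t _; exact: cv.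
    rewrite -sintD; last 2 first.
    - by move=> t _; have k2 := cv t; ctsh.
    - by move=> t _; have k1 := cs t; have k2 := cv t; ctsh.
    by apply: eq_sint => t _; rewrite /f; field; rewrite gt_eqF.
  by rewrite /m; field; rewrite !gt_eqF.
have sp t : sig t `^ (p - 1) = A * (sig t / m) `^ (p - 1).
  rewrite /A -powRM ?(ltW m0) //; last by rewrite divr_ge0 ?s0 ?(ltW m0).
  by rewrite mulrC divfK // gt_eqF.
have le t : f t <= sig t `^ (p - 1) * v t.
  rewrite /f sp; apply: ler_wpM2r; first exact: ltW (v_gt0 hb t).
  rewrite ler_pM2l //; apply: powR_bernoulli; first exact: ltW.
  by rewrite divr_ge0 ?s0 ?(ltW m0).
split; last split.
- rewrite -/A -fE CEE; apply: sint_le => t _; [exact: cf|exact: cp|exact: le].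
- move=> [t t01 st]; rewrite -/A -fE CEE -subr_gt0.
  have -> : sint 0 1 (fun t => sig t `^ (p - 1) * v t) - sint 0 1 f =
     sint 0 1 (fun t => sig t `^ (p - 1) * v t + -1 * f t).
    rewrite sintD; last 2 first.
    - by move=> x _; exact: cp.
    - by move=> x _; exact: (cmul _ _ _ (ccst x (-1)) (cf x)).
    by rewrite sintZ ?mulN1r // => x _; exact: cf.
  apply: (@sint_gt0 _ _ _ _ t) => //.
  + by move=> x _; exact: (cadd _ _ _ (cp x) (cmul _ _ _ (ccst x (-1)) (cf x))).
  + by move=> x _; rewrite mulN1r subr_ge0.
  rewrite mulN1r subr_gt0 /f sp ltr_pM2r ?(v_gt0 hb) // ltr_pM2l //.
  apply: powR_bernoulli_lt => //; first by rewrite divr_ge0 ?s0 ?(ltW m0).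
  apply: contra st => /eqP e; apply/eqP.
  have mn : m != 0 by rewrite gt_eqF.
  by rewrite -[LHS](divfK mn) e mul1r.
move=> h; rewrite -/A -fE CEE; apply: eq_sint => t _.
by rewrite /f h divff ?gt_eqF // subrr mulr0 addr0 mulr1.
Qed.

Lemma Y_compare : let Y := (L `^ (p - 2) * CE) `^ (2 / (p - 1)) in
  [/\ Th ^+ 2 <= Y, Y = Th ^+ 2 -> forall t, sig t = Th / L
    & (forall t, sig t = Th / L) -> Y = Th ^+ 2].
Proof.
move=> Y.
have L0 := length_gt0 hb; have Th0 := total_curv_gt0 hb.
have [h1 [h2 h3]] := energy_bernoulli.
have p1 : 1 < p by have := p3; lra.
have X0 : L `^ (p - 2) * ((Th / L) `^ (p - 1) * L) = Th `^ (p - 1).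
  have -> : L `^ (p - 2) * ((Th / L) `^ (p - 1) * L) = (Th / L) `^ (p - 1) * (L `^ (p - 2) * L) by ring.
  have -> : L `^ (p - 2) * L = L `^ (p - 1).
    rewrite -{2}[L]powRr1 ?(ltW L0) // -powRD; last by rewrite (gt_eqF L0) implybT.
    by congr (_ `^ _); ring.
  by rewrite -powRM ?divfK ?gt_eqF // ?divr_ge0 // ltW.
have ThY : (Th `^ (p - 1)) `^ (2 / (p - 1)) = Th ^+ 2.
  rewrite -powRrM mulrC divfK ?powR_mulrn ?(ltW Th0) //.
  by rewrite subr_eq0 gt_eqF.
have e0 : 0 < 2 / (p - 1) by rewrite divr_gt0 // subr_gt0.
have Lp : 0 < L `^ (p - 2) by rewrite powR_gt0.
have T0 : 0 < Th `^ (p - 1) by rewrite powR_gt0.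
split.
- rewrite -ThY -X0 /Y; apply: ge0_ler_powR; rewrite ?nnegrE.
  + exact: ltW.
  + by rewrite X0 ltW.
  + by apply: (le_trans (ltW T0)); rewrite -X0 (ler_pM2l Lp); exact: h1.
  + by rewrite (ler_pM2l Lp); exact: h1.
- move=> YE.
  have all01 t : 0 <= t <= 1 -> sig t = Th / L.
    move=> t01; apply/eqP/negPn/negP => st.
    have h := h2 (ex_intro2 _ _ t t01 st).
    have : Th ^+ 2 < Y.
      rewrite -ThY -X0 /Y; apply: gt0_ltr_powR; rewrite ?nnegrE //.
      * by rewrite X0 ltW.
      * by apply: (le_trans (ltW T0)); rewrite -X0 (ler_pM2l Lp); exact: h1.
      * by rewrite (ltr_pM2l Lp); exact: h.
    by rewrite YE ltxx.
  have per (n : nat) s : sig (s + n%:R) = sig s.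
    elim: n => [|n IH]; first by rewrite addr0.
    by rewrite -natr1 addrA sig_per.
  move=> t.
  have /andP[f1 f2] := Num.Theory.real_floor_itv (num_real t).
  rewrite intrD in f2.
  have f3 : 0 <= t - (Num.floor t)%:~R <= 1 by rewrite subr_ge0 f1 lerBlDl ltW.
  rewrite -(all01 _ f3).
  case: (Num.floor t) => [n|n].
    by rewrite -[in LHS](subrK n%:R t) per.
  by rewrite NegzE mulrNz opprK -pmulrn per.
by move=> h; rewrite /Y (h3 h) X0 ThY.
Qed.

Lemma upper_bound : let Y := (L `^ (p - 2) * CE) `^ (2 / (p - 1)) in
  (hcap p K <= (Icap p L Y `^ (1 - p))%:E)%E /\
  (hcap p K = (Icap p L Y `^ (1 - p))%:E -> forall t, sig t = Th / L).
Proof.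
move=> Y.
have L0 := length_gt0 hb; have Th0 := total_curv_gt0 hb.
have p1 : 1 < p by have := p3; lra.
have [h1 h2 h3] := Y_compare; rewrite -/Y in h1 h2 h3.
have U := upper_limit.
move: h1; rewrite le_eqVlt => /predU1P[e|h1].
  by rewrite -e; split => // _; apply: h2; rewrite e.
have /andP[I0 I1] := Icap_lt p1 L0 Th0 h1.
have anti (a c : R) : 0 < a -> a < c -> c `^ (1 - p) < a `^ (1 - p).
  move=> a0 ac; have c0 : 0 < c by exact: lt_trans ac.
  have e : 1 - p = - (p - 1) by ring.
  rewrite e !powRN ltf_pV2 ?posrE ?powR_gt0 //.
  by apply: gt0_ltr_powR; rewrite ?nnegrE ?subr_gt0 // ltW.
have lt := anti _ _ I0 I1.
split.
  by apply: (le_trans U); rewrite lee_fin; exact: ltW lt.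
move=> e; exfalso; move: U; rewrite e lee_fin leNgt => /negP; apply; exact: lt.
Qed.

End Compare.

(** * Constant boundary curvature *)

Section Rigid.
Variables (R : realType) (K : set (R * R)) (gamma nu : R -> R * R).
Variable hb : body K gamma nu.
Local Notation sig := (sig gamma nu).
Local Notation v := (vs gamma).

(** The derivative of the normal is the velocity times the Euclidean curvature. *)
Lemma nrm_der t :
  is_derive t (1:R) (fun t : R => (nrm gamma nu t).1)
     ((sig t + (nrm gamma nu t).2) / (gamma t).2 * (velocity gamma t).1) /\
  is_derive t (1:R) (fun t : R => (nrm gamma nu t).2)
     ((sig t + (nrm gamma nu t).2) / (gamma t).2 * (velocity gamma t).2).
Proof.
have [ep [ep2 h hs]] := frame_all hb; have [N1 N2] := h t.
have y0 := gamma_gt0 hb t; have e0 := espeed_gt0 hb t.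
have yn : (gamma t).2 != 0 by rewrite gt_eqF.
have en : espeed gamma t != 0 by rewrite gt_eqF.
have [d1 d2] := tan_der hb t; have hst := hs t.
set k := (_ / espeed gamma t ^+ 2) in d1 d2 hst.
have vE : v t = espeed gamma t / (gamma t).2 by rewrite /vs speedE.
have vx : (velocity gamma t).1 = tan1 gamma t * espeed gamma t by rewrite /tan1 divfK.
have vy : (velocity gamma t).2 = tan2 gamma t * espeed gamma t by rewrite /tan2 divfK.
have kE : - ep * k = sig t * v t + ep * tan1 gamma t * v t.
  by rewrite hst vE vx; field.
have kE' : - ep * k = (sig t + ep * tan1 gamma t) / (gamma t).2 * espeed gamma t.
  by rewrite kE vE; field.
rewrite N2; split.
  have -> : (fun t => (nrm gamma nu t).1) = (fun t => - ep * tan2 gamma t) by apply/funext => s; case: (h s).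
  notypeclasses refine (deq _ _); first by der.
  cbv beta; rewrite vx.
  have -> : (sig t + ep * tan1 gamma t) / (gamma t).2 * (tan1 gamma t * espeed gamma t) =
    ((sig t + ep * tan1 gamma t) / (gamma t).2 * espeed gamma t) * tan1 gamma t by ring.
  by rewrite -kE'; ring.
have -> : (fun t => (nrm gamma nu t).2) = (fun t => ep * tan1 gamma t) by apply/funext => s; case: (h s).
notypeclasses refine (deq _ _); first by der.
cbv beta; rewrite vy.
have -> : (sig t + ep * tan1 gamma t) / (gamma t).2 * (tan2 gamma t * espeed gamma t) =
    ((sig t + ep * tan1 gamma t) / (gamma t).2 * espeed gamma t) * tan2 gamma t by ring.
by rewrite -kE'; ring.
Qed.

Lemma der0_const (f : R -> R) : (forall t, is_derive t (1:R) f 0) -> forall s t, f s = f t.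
Proof.
move=> h s t; apply/eqP; case: (ltgtP s t) => [st|ts|->//].
  by have [c [_ _ e]] := mvt_seg st h; rewrite eq_sym -subr_eq0 e mul0r.
by have [c [_ _ e]] := mvt_seg ts h; rewrite -subr_eq0 e mul0r.
Qed.

(** c is the Euclidean curvature (m + N_2) / y, whose derivative vanishes, so that
    the centre gamma - N / c is constant. If c were 0 then gamma would run along a
    line and could not close up. *)
Lemma const_curv_circle m : (forall t, sig t = m) -> exists c P1 P2 : R,
  c != 0 /\ forall t, ((gamma t).1 - P1) ^+ 2 + ((gamma t).2 - P2) ^+ 2 = (c ^-1) ^+ 2.
Proof.
move=> hm.
pose N1 t := (nrm gamma nu t).1; pose N2 t := (nrm gamma nu t).2.
pose ke t := (m + N2 t) / (gamma t).2.
have yn t : (gamma t).2 != 0 by rewrite gt_eqF // (gamma_gt0 hb).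
have d1 t : is_derive t (1:R) N1 (ke t * (velocity gamma t).1).
  by have [h _] := nrm_der t; rewrite hm in h.
have d2 t : is_derive t (1:R) N2 (ke t * (velocity gamma t).2).
  by have [_ h] := nrm_der t; rewrite hm in h.
have ke0 t : is_derive t (1:R) ke 0.
  have [_ hy _ _ _] := curve_der t (bg_smooth hb); have h2 := d2 t; have y := yn t.
  rewrite /ke; notypeclasses refine (deq _ _); first by der.
  by rewrite /ke; cbv beta; field.
have kc t : ke t = ke 0 by exact: der0_const.
have nn t : N1 t ^+ 2 + N2 t ^+ 2 = 1 by exact: (nrm_sqr hb).
set c := ke 0 in kc.
have hx t := let: And5 h _ _ _ _ := curve_der t (bg_smooth hb) in h.
have hy t := let: And5 _ h _ _ _ := curve_der t (bg_smooth hb) in h.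
have c0 : c != 0.
  apply/negP => /eqP c0.
  have e1 t : is_derive t (1:R) N1 0 by have h := d1 t; rewrite kc c0 mul0r in h.
  have e2 t : is_derive t (1:R) N2 0 by have h := d2 t; rewrite kc c0 mul0r in h.
  pose g t := - N2 0 * (gamma t).1 + N1 0 * (gamma t).2.
  have hg t : is_derive t (1:R) g (- N2 0 * (velocity gamma t).1 + N1 0 * (velocity gamma t).2).
    have h1 := hx t; have h2 := hy t.
    by rewrite /g; notypeclasses refine (deq _ _); [der | cbv beta; ring].
  have [s [_ _ e]] := mvt_seg (@ltr01 R) hg.
  have per : g 1 = g 0 by rewrite /g -[1]add0r (gamma_per1 hb).
  move: e; rewrite per subrr subr0 mulr1 => /esym e.
  have [ep [ep2 h _]] := frame_all hb; have [E1 E2] := h s.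
  have en := espeed_gt0 hb s.
  have F1 : N1 0 = - ep * tan2 gamma s by rewrite -E1; exact: der0_const e1 _ _.
  have F2 : N2 0 = ep * tan1 gamma s by rewrite -E2; exact: der0_const e2 _ _.
  have vx : (velocity gamma s).1 = tan1 gamma s * espeed gamma s by rewrite /tan1 divfK // gt_eqF.
  have vy : (velocity gamma s).2 = tan2 gamma s * espeed gamma s by rewrite /tan2 divfK // gt_eqF.
  have : - ep * espeed gamma s * (tan1 gamma s ^+ 2 + tan2 gamma s ^+ 2) = 0.
    by rewrite -e F1 F2 vx vy; ring.
  rewrite (tan_sqr hb) mulr1 => /eqP; rewrite mulf_eq0 oppr_eq0 (gt_eqF en) orbF => /eqP ep0.
  by move: ep2; rewrite ep0 expr0n /= => /eqP; rewrite eq_sym oner_eq0.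
have P1c t : (gamma t).1 - N1 t / c = (gamma 0).1 - N1 0 / c.
  apply: (@der0_const (fun t => (gamma t).1 - N1 t / c)) => s.
  have h1 := hx s; have h2 := d1 s.
  notypeclasses refine (deq _ _); first by der.
  by cbv beta; rewrite kc; field.
have P2c t : (gamma t).2 - N2 t / c = (gamma 0).2 - N2 0 / c.
  apply: (@der0_const (fun t => (gamma t).2 - N2 t / c)) => s.
  have h1 := hy s; have h2 := d2 s.
  notypeclasses refine (deq _ _); first by der.
  by cbv beta; rewrite kc; field.
exists c, ((gamma 0).1 - N1 0 / c), ((gamma 0).2 - N2 0 / c); split => // t.
rewrite -(P1c t) -(P2c t).
have -> : ((gamma t).1 - ((gamma t).1 - N1 t / c)) ^+ 2 + ((gamma t).2 - ((gamma t).2 - N2 t / c)) ^+ 2 =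
  (N1 t ^+ 2 + N2 t ^+ 2) * c^-1 ^+ 2 by ring.
by rewrite nn mul1r.
Qed.

(** A straight path from K to a point not in K meets the circle. Applied to rays
    away from the centre, to segments from an interior point and to radii, this
    excludes points of K outside the disc and points of the disc outside K. *)
Lemma disc_of_frontier (P1 P2 rho : R) : 0 < rho ->
  (forall z, (closure K `\` K°) z -> (z.1 - P1) ^+ 2 + (z.2 - P2) ^+ 2 = rho ^+ 2) ->
  forall z, K z <-> (z.1 - P1) ^+ 2 + (z.2 - P2) ^+ 2 <= rho ^+ 2.
Proof.
move=> r0 hf.
have [Kh cK ptK [zi izi] _] := hb.
have Kzi : K zi by exact: interior_subset.
have clK := closedK hb.
pose d (z : R * R) := (z.1 - P1) ^+ 2 + (z.2 - P2) ^+ 2.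
have cd z : {for z, continuous d} by rewrite /d; cts.
have [zM _ hM] := compact_max ptK (ex_intro _ zi Kzi) (fun z _ => cd z).
pose seg (z w : R * R) (s : R) := (z.1 + s * (w.1 - z.1), z.2 + s * (w.2 - z.2)).
have cseg z w s : {for s, continuous (seg z w)} by rewrite /seg; apply: cpair; cts.
have seg0 z w : seg z w 0 = z by rewrite /seg !mul0r !addr0 -surjective_pairing.
have seg1 z w : seg z w 1 = w by rewrite /seg !mul1r !subrKC -surjective_pairing.
(* the exterior of the circle is reached by rays that leave K *)
have ext w : K w -> d w <= rho ^+ 2.
  move=> Kw; rewrite leNgt; apply/negP => dw.
  have dw0 : 0 < d w by apply: lt_trans dw; rewrite exprn_gt0.
  pose T := d zM / d w + 1.
  have T0 : 0 <= T by rewrite addr_ge0 // divr_ge0 ?(ltW dw0) // /d addr_ge0 ?sqr_ge0.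
  pose w' : R * R := (w.1 + T * (w.1 - P1), w.2 + T * (w.2 - P2)).
  have dE s : d (seg w w' s) = (1 + s * T) ^+ 2 * d w by rewrite /d /seg /w' /=; ring.
  have nK : ~ K (seg w w' 1).
    move=> h; have := hM _ h; rewrite dE mul1r leNgt => /negP; apply.
    have e : d zM = (T - 1) * d w by rewrite /T addrK divfK // gt_eqF.
    rewrite e ltr_pM2r //; nra.
  have K0 : K (seg w w' 0) by rewrite seg0.
  have [s [s0 s1 fr]] := frontier_cross clK (cseg w w') K0 nK.
  have := hf _ fr; rewrite -/(d (seg w w' s)) dE => e.
  have : 1 <= (1 + s * T) ^+ 2 by have := mulr_ge0 s0 T0; nra.
  have := exprn_gt0 2 r0; nra.
have inn : d zi < rho ^+ 2.
  rewrite lt_neqAle ext // andbT; apply/negP => /eqP e.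
  pose w : R * R := (zi.1 + (zi.1 - P1), zi.2 + (zi.2 - P2)).
  have op : nbhs (seg zi w 0) K by rewrite seg0.
  have [e1 /= e10 he] := cseg zi w 0 K op.
  have /he Ks : ball (0:R) e1 (e1 / 2).
    by rewrite /ball /= sub0r normrN gtr0_norm; lra.
  have := ext _ Ks.
  have -> : d (seg zi w (e1 / 2)) = (1 + e1 / 2) ^+ 2 * d zi by rewrite /d /seg /w /=; ring.
  by rewrite e; have := exprn_gt0 2 r0; nra.
have dseg (z w : R * R) (s : R) : d (seg z w s) =
    (1 - s) * d z + s * d w - s * (1 - s) * ((z.1 - w.1) ^+ 2 + (z.2 - w.2) ^+ 2).
  by rewrite /d /seg /=; ring.
have disc w : d w < rho ^+ 2 -> K w.
  move=> dw; apply: contrapT => nK.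
  have Kz0 : K (seg zi w 0) by rewrite seg0.
  have nK1 : ~ K (seg zi w 1) by rewrite seg1.
  have [s [s0 s1 fr]] := frontier_cross clK (cseg zi w) Kz0 nK1.
  have := hf _ fr; rewrite -/(d (seg zi w s)) dseg => e.
  have h1 : 0 <= s * (1 - s) * ((zi.1 - w.1) ^+ 2 + (zi.2 - w.2) ^+ 2).
    apply: mulr_ge0; first by apply: mulr_ge0 => //; rewrite subr_ge0 ltW.
    by rewrite addr_ge0 ?sqr_ge0.
  have h2 : 0 < (1 - s) * (rho ^+ 2 - d zi) by rewrite mulr_gt0 // subr_gt0.
  have h3 : 0 <= s * (rho ^+ 2 - d w) by rewrite mulr_ge0 // subr_ge0 ltW.
  by lra.
have circ w : d w = rho ^+ 2 -> K w.
  move=> dw; apply: contrapT => nK.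
  have KP : K (P1, P2) by apply: disc; rewrite /d /= !subrr !expr0n /= addr0 exprn_gt0.
  have Kz0 : K (seg (P1, P2) w 0) by rewrite seg0.
  have nK1 : ~ K (seg (P1, P2) w 1) by rewrite seg1.
  have [s [s0 s1 fr]] := frontier_cross clK (cseg (P1, P2) w) Kz0 nK1.
  have := hf _ fr; rewrite -/(d (seg (P1, P2) w s)).
  have -> : d (seg (P1, P2) w s) = s ^+ 2 * d w by rewrite /d /seg /=; ring.
  rewrite dw => e; have : 0 < (1 - s) * ((1 + s) * rho ^+ 2) by rewrite !mulr_gt0 ?exprn_gt0 ?subr_gt0 //; lra.
  by lra.
move=> z; split; first exact: ext.
by rewrite le_eqVlt => /orP[/eqP|]; [exact: circ | exact: disc].
Qed.

(** The hyperbolic centre of the Euclidean disc with centre (P1, P2) and radius rho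
    has height sqrt (P2^2 - rho^2). *)
Lemma const_curv_ball m : (forall t, sig t = m) -> geodesic_ball K.
Proof.
move=> hm; have [Kh _ _ _ [[_ _ _ _ fr] _]] := hb.
have [c [P1 [P2 [c0 hc]]]] := const_curv_circle hm.
pose rho := `|c^-1|.
have rho0 : 0 < rho by rewrite normr_gt0 invr_neq0.
have rho2 : rho ^+ 2 = c^-1 ^+ 2 by rewrite /rho real_normK // num_real.
have hf z : (closure K `\` K°) z -> (z.1 - P1) ^+ 2 + (z.2 - P2) ^+ 2 = rho ^+ 2.
  by rewrite -fr rho2 => -[t _ <-].
have KE := disc_of_frontier rho0 hf.
(* the lowest point of the disc lies in the half-plane *)
have low : rho < P2.
  have : K (P1, P2 - rho) by apply/KE; rewrite /= subrr expr0n add0r (_ : P2 - rho - P2 = - rho) ?sqrrN //; ring.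
  by move/Kh; rewrite /hplane /= subr_gt0.
have D0 : 0 < P2 ^+ 2 - rho ^+ 2 by nra.
pose a2 := Num.sqrt (P2 ^+ 2 - rho ^+ 2).
have a20 : 0 < a2 by rewrite sqrtr_gt0.
have a2E : a2 ^+ 2 = P2 ^+ 2 - rho ^+ 2 by rewrite sqr_sqrtr // ltW.
have P20 : 0 < P2 by lra.
exists (P1, a2), (arsh (rho / a2)).
have ra : 0 < rho / a2 by rewrite divr_gt0.
have r0 : 0 < arsh (rho / a2) by rewrite -(arsh0 R) arsh_lt.
split => //; rewrite hballE //; apply/seteqP; split => z.
  move=> Kz; have z0 := Kh _ Kz; split => //.
  have z20 : 0 < z.2 by exact: z0.
  have /KE h := Kz.
  have hc0 := @cosh_distE R (P1, a2) z a20 z0.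
  have e : cosh_dist (P1, a2) z <= P2 / a2.
    rewrite /cosh_dist /= ler_pdivrMr; last by rewrite !mulr_gt0.
    have -> : P2 / a2 * (2 * a2 * z.2) = 2 * P2 * z.2 by field; rewrite gt_eqF.
    by nra.
  have c1 : 0 < cosh_dist (P1, a2) z by exact: cosh_dist_gt0.
  have : cosh_dist (P1, a2) z ^+ 2 <= (P2 / a2) ^+ 2 by rewrite ler_sqr ?nnegrE ?(ltW c1) ?(ltW (divr_gt0 P20 a20)).
  rewrite hc0 sh_arsh !expr_div_n.
  have -> : P2 ^+ 2 / a2 ^+ 2 = 1 + rho ^+ 2 / a2 ^+ 2.
    by rewrite (_ : P2 ^+ 2 = a2 ^+ 2 + rho ^+ 2); [field; rewrite gt_eqF | rewrite a2E; ring].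
  by lra.
move=> [z0]; rewrite sh_arsh => h; apply/KE.
have z20 : 0 < z.2 by exact: z0.
have hc0 := @cosh_distE R (P1, a2) z a20 z0.
have c1 : 0 < cosh_dist (P1, a2) z by exact: cosh_dist_gt0.
have : cosh_dist (P1, a2) z ^+ 2 <= (P2 / a2) ^+ 2.
  rewrite hc0 [leRHS]expr_div_n.
  have -> : P2 ^+ 2 / a2 ^+ 2 = 1 + (rho / a2) ^+ 2.
    by rewrite expr_div_n (_ : P2 ^+ 2 = a2 ^+ 2 + rho ^+ 2); [field; rewrite gt_eqF | rewrite a2E; ring].
  by lra.
rewrite ler_sqr ?nnegrE ?(ltW c1) //; last by rewrite ltW // divr_gt0.
rewrite /cosh_dist /= ler_pdivrMr; last by rewrite !mulr_gt0.
have -> : P2 / a2 * (2 * a2 * z.2) = 2 * P2 * z.2 by field; rewrite gt_eqF.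
by nra.
Qed.

End Rigid.

(** * Geodesic balls *)

Section BallCase.
Variables (R : realType) (K : set (R * R)) (gamma nu : R -> R * R).
Variable hb : body K gamma nu.
Local Notation q := (qline gamma nu).
Local Notation r := (rline gamma).
Local Notation sig := (sig gamma nu).
Local Notation v := (vs gamma).
Variables (a : R * R) (s : R).
Hypotheses (a0 : hplane a) (s0 : 0 < s) (KE : K = hball a s).
Local Notation rho := (sh s).
Local Notation mu := (@lebesgue_measure R).

Lemma rho_gt0 : 0 < rho.
Proof. by rewrite -(sh0 R) sh_lt. Qed.

Lemma ball_cosh_distE z : K z <-> hplane z /\ cosh_dist a z <= ch s.
Proof.
have c0 := ch_gt0 s; rewrite KE hballE //; split => -[z0] h; split => //.
  rewrite -ler_sqr ?nnegrE ?(ltW c0) ?(ltW (cosh_dist_gt0 a0 z0)) // cosh_distE // ch2; lra.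
have : cosh_dist a z ^+ 2 <= ch s ^+ 2 by rewrite ler_sqr ?nnegrE ?(ltW c0) ?(ltW (cosh_dist_gt0 a0 z0)).
by rewrite cosh_distE // ch2; lra.
Qed.

Lemma ball_interior z : hplane z -> cosh_dist a z < ch s -> K° z.
Proof.
move=> z0 h.
have n1 : \forall w \near z, hplane w by apply: open_nbhs_nbhs; split => //; exact: open_hplane.
have n2 : \forall w \near z, cosh_dist a w < ch s by exact: (cvgr_lt _ (cosh_dist_cont a0 z0)).
rewrite /interior /=; near=> w; apply/ball_cosh_distE; split; first by near: w.
by apply: ltW; near: w.
Unshelve. all: by end_near. Qed.

Lemma cosh_distC (b z : R * R) : hplane b -> hplane z -> cosh_dist b z = cosh_dist z b.
Proof.
move=> b0 z0; have b20 : 0 < b.2 by []. have z20 : 0 < z.2 by [].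
by rewrite /cosh_dist; field; rewrite !gt_eqF.
Qed.

Lemma gamma_cosh_dist t : cosh_dist a (gamma t) = ch s.
Proof.
have g0 : hplane (gamma t) := gamma_hplane hb t.
have [_ ni] := gamma_frontier hb t.
have [_ h] : hplane (gamma t) /\ cosh_dist a (gamma t) <= ch s by apply/ball_cosh_distE; exact: gamma_K hb t.
apply/eqP; rewrite eq_le h leNgt; apply/negP => lt; apply: ni; exact: ball_interior.
Qed.

Lemma der_cst_eq (f : R -> R) t d : (forall u w, f u = f w) -> is_derive t (1:R) f d -> d = 0.
Proof.
move=> hf h; have e : f = cst (f 0) by apply/funext => u; exact: hf.
rewrite -(@derive_val _ _ _ _ _ _ _ h) e.
exact: (@derive_val _ _ _ _ _ _ _ (is_derive_cst (f 0) t (1:R))).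
Qed.

(** The distance from the centre to gamma is constant, so that the Frenet equations
    for z = a determine q, r and the curvature. *)
Lemma ball_frame t : [/\ q t a = - rho, r t a = 0 & sig t = ch s / rho].
Proof.
have c0 := ch_gt0 s; have r0 := rho_gt0.
have cE u : cosh_dist (gamma u) a = ch s by rewrite cosh_distC ?gamma_cosh_dist //; exact: gamma_hplane hb u.
have qr u : q u a ^+ 2 + r u a ^+ 2 = rho ^+ 2.
  by have := cosh_dist_qr hb u a0; rewrite cE ch2; lra.
have rz u : r u a = 0.
  have [d1 d2] := frame_der hb u a0.
  have h : is_derive u (1:R) (fun u : R => q u a ^+ 2 + r u a ^+ 2) (- (2 * v u * ch s) * r u a).
    notypeclasses refine (deq _ _); first by der.
    by cbv beta; rewrite cE; ring.
  have m0 : 0 < 2 * v u * ch s by apply: mulr_gt0 => //; apply: mulr_gt0 => //; exact: v_gt0 hb u.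
  have := der_cst_eq (fun u w => etrans (qr u) (esym (qr w))) h => /eqP.
  by rewrite mulf_eq0 oppr_eq0 (gt_eqF m0) /= => /eqP.
have qE : q t a = - rho.
  have iK : K° a by apply: ball_interior => //; rewrite cosh_dist_self // -(ltr_sqr (x:=1)) ?nnegrE ?(ltW c0) // ch2 expr1n; have := exprn_gt0 2 r0; lra.
  have q0 := qline_lt0 hb t iK.
  have e := qr t; rewrite rz expr0n addr0 /= in e.
  have : (q t a - rho) * (q t a + rho) = 0 by rewrite -subr_sqr e subrr.
  by move/eqP; rewrite mulf_eq0 => /orP[] /eqP h; lra.
split => //.
have [_ d2] := frame_der hb t a0.
have := der_cst_eq (fun u w => etrans (rz u) (esym (rz w))) d2 => /eqP.
rewrite mulf_eq0 oppr_eq0 (gt_eqF (v_gt0 hb t)) /= cE qE => /eqP e.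
by apply: (mulIf (lt0r_neq0 r0)); rewrite divfK ?gt_eqF //; lra.
Qed.

Lemma cosh_dist_frame_y (b z : R * R) : b.2 != 0 -> z.2 != 0 -> cosh_dist b z - frame_y b z = b.2 / z.2.
Proof. by case: b z => b1 b2 [z1 z2] /= h1 h2; rewrite /cosh_dist /frame_y /=; field; rewrite h1 h2. Qed.

Local Notation al t := (frame_x a (gamma t)).
Local Notation be t := (frame_y a (gamma t)).

(** In the coordinates based at a the boundary runs on the Euclidean circle of
    radius sinh s with angular velocity v / sinh s; ep is its orientation. *)
Lemma ball_angle : exists ep : R, ep ^+ 2 = 1 /\ forall t,
  is_derive t (1:R) (fun t : R => al t) (- ep * be t * (v t / rho)) /\
  is_derive t (1:R) (fun t : R => be t) (ep * al t * (v t / rho)).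
Proof.
have [ep [ep2 h _]] := frame_all hb; exists (- ep); rewrite sqrrN; split => // t.
have r0 := rho_gt0; have c2 := ch2 s.
have [hx hy _ _ y0] := curve_der t (bg_smooth hb); have e0 := espeed_gt0 hb t.
have a20 : 0 < a.2 by [].
have yn : (gamma t).2 != 0 by rewrite gt_eqF.
have an : a.2 != 0 by rewrite gt_eqF.
have rn : rho != 0 by rewrite gt_eqF.
have vE : v t = espeed gamma t / (gamma t).2 by rewrite /vs speedE.
have vx : (velocity gamma t).1 = tan1 gamma t * espeed gamma t by rewrite /tan1 divfK // gt_eqF.
have vy : (velocity gamma t).2 = tan2 gamma t * espeed gamma t by rewrite /tan2 divfK // gt_eqF.
have [qE rE _] := ball_frame t; have [n1 n2] := h t.
have cE := gamma_cosh_dist t.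
have T2 := tan_sqr hb t.
have cE' : cosh_dist (gamma t) a = ch s by rewrite cosh_distC //; exact: gamma_hplane hb t.
rewrite /qline /lineq n1 n2 in qE; rewrite /rline /lineq in rE.
set t1 := tan1 gamma t in vx qE rE T2; set t2 := tan2 gamma t in vy qE rE T2.
have f1 : frame_x (gamma t) a = ep * t2 * rho.
  have -> : frame_x (gamma t) a = ep ^+ 2 * ((t1 ^+ 2 + t2 ^+ 2) * frame_x (gamma t) a) by rewrite ep2 T2 !mul1r.
  have -> : ep ^+ 2 * ((t1 ^+ 2 + t2 ^+ 2) * frame_x (gamma t) a) =
    ep ^+ 2 * t1 * (t1 * frame_x (gamma t) a + t2 * frame_y (gamma t) a)
    - ep * t2 * (- ep * t2 * frame_x (gamma t) a + ep * t1 * frame_y (gamma t) a) by ring.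
  by rewrite rE qE; ring.
have f2 : frame_y (gamma t) a = - ep * t1 * rho.
  have -> : frame_y (gamma t) a = ep ^+ 2 * ((t1 ^+ 2 + t2 ^+ 2) * frame_y (gamma t) a) by rewrite ep2 T2 !mul1r.
  have -> : ep ^+ 2 * ((t1 ^+ 2 + t2 ^+ 2) * frame_y (gamma t) a) =
    ep ^+ 2 * t2 * (t1 * frame_x (gamma t) a + t2 * frame_y (gamma t) a)
    + ep * t1 * (- ep * t2 * frame_x (gamma t) a + ep * t1 * frame_y (gamma t) a) by ring.
  by rewrite rE qE; ring.
have xE : (gamma t).1 = a.1 - ep * t2 * rho * a.2.
  by rewrite -f1 /frame_x; field.
have yE : (gamma t).2 = a.2 * (ch s + ep * t1 * rho).
  have -> : ep * t1 * rho = - frame_y (gamma t) a by rewrite f2; ring.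
  by rewrite -cE' cosh_dist_frame_y // mulrC divfK.
have alE : al t * (gamma t).2 = - ep * t2 * rho * a.2 by rewrite /frame_x divfK // xE; ring.
have beE : be t * (gamma t).2 = ch s * (gamma t).2 - a.2.
  have h1 : ch s - be t = a.2 / (gamma t).2 by rewrite -cE cosh_dist_frame_y.
  have -> : be t = ch s - (ch s - be t) by ring.
  by rewrite h1 mulrBl divfK.
split.
  have : is_derive t (1:R) (fun t : R => al t) (((velocity gamma t).1 - al t * (velocity gamma t).2) / (gamma t).2).
    rewrite /frame_x; notypeclasses refine (deq _ _); first by der.
    by cbv beta; field; rewrite ?yn ?an ?rn.
  congr (is_derive _ _ _ _).
  apply: (mulIf yn); apply: (mulIf yn); rewrite divfK // vE vx vy.
  have -> : (t1 * espeed gamma t - al t * (t2 * espeed gamma t)) * (gamma t).2 =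
    espeed gamma t * (t1 * (gamma t).2 - t2 * (al t * (gamma t).2)) by ring.
  have -> : - - ep * be t * (espeed gamma t / (gamma t).2 / rho) * (gamma t).2 * (gamma t).2 =
     espeed gamma t * (ep * (be t * (gamma t).2) / rho) by field; rewrite ?yn ?an ?rn.
  rewrite alE beE; congr (_ * _); apply: (mulIf rn); rewrite divfK // yE.
  apply/eqP; rewrite -subr_eq0; apply/eqP.
  rewrite [LHS](_ : _ = a.2 * ep * (rho ^+ 2 * (t1 ^+ 2 + t2 ^+ 2) - ch s ^+ 2 + 1)
      + a.2 * t1 * ch s * rho * (1 - ep ^+ 2)); last by ring.
  by rewrite T2 ep2 c2; ring.
have : is_derive t (1:R) (fun t : R => be t) (((gamma t).1 - a.1) * (velocity gamma t).1 / (a.2 * (gamma t).2)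
   + (velocity gamma t).2 / a.2 - be t * (velocity gamma t).2 / (gamma t).2).
  rewrite /frame_y; notypeclasses refine (deq _ _); first by der; rewrite !mulf_neq0.
  by cbv beta; field; rewrite ?yn ?an ?rn.
congr (is_derive _ _ _ _).
apply: (mulIf yn); apply: (mulIf yn); rewrite vE vx vy.
have -> : - ep * al t * (espeed gamma t / (gamma t).2 / rho) * (gamma t).2 * (gamma t).2 =
     espeed gamma t * (- ep * (al t * (gamma t).2) / rho) by field; rewrite ?yn ?an ?rn.
have -> : (((gamma t).1 - a.1) * (t1 * espeed gamma t) / (a.2 * (gamma t).2) + t2 * espeed gamma t / a.2
     - be t * (t2 * espeed gamma t) / (gamma t).2) * (gamma t).2 * (gamma t).2 =
   espeed gamma t * (((gamma t).1 - a.1) * t1 * (gamma t).2 / a.2 + t2 * (gamma t).2 ^+ 2 / a.2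
     - t2 * (be t * (gamma t).2)) by field; rewrite ?yn ?an ?rn.
rewrite alE beE; congr (_ * _); rewrite xE yE.
have -> : - ep * (- ep * t2 * rho * a.2) / rho = ep ^+ 2 * t2 * a.2 by field; rewrite ?yn ?an ?rn.
apply/eqP; rewrite -subr_eq0; apply/eqP.
rewrite [LHS](_ : _ = a.2 * t2 * (1 - ep ^+ 2)); last by field; rewrite ?yn ?an ?rn.
by rewrite ep2; ring.
Qed.

(** If the length exceeded 2 pi sinh s, the angle would reach 2 pi at some time
    before 1, and gamma would return to its starting point too early. *)
Lemma ball_length_le : total_length gamma <= 2 * pi * rho.
Proof.
have r0 := rho_gt0.
rewrite leNgt; apply/negP => lt.
have [ep [ep2 hd]] := ball_angle.
pose om (t : R) := v t / rho.
have com : continuous om by move=> t; have cv := @v_cont _ _ _ _ hb t; rewrite /om; cts.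
have [F [dF sF]] := sint_prim com.
pose T (t : R) := F t - F 0.
have dT (t : R) : is_derive t (1:R) T (om t).
  by have h := dF t; rewrite /T; notypeclasses refine (deq _ _); [der | cbv beta; ring].
have T0 : T 0 = 0 by rewrite /T subrr.
have T1 : 2 * pi < T 1.
  rewrite /T -sF //.
  have -> : sint 0 1 om = total_length gamma / rho.
    rewrite /total_length hlengthE mulrC -sintZ; last by move=> t _; exact: (@v_cont _ _ _ _ hb t).
    by apply: eq_sint => t _; rewrite /om mulrC.
  by rewrite ltr_pdivlMr.
have [t1 /andP[t10 t11] Te] : exists2 t1, 0 <= t1 <= 1 & T t1 = 2 * pi.
  have [||c ce Tc] := @IVT _ T 0 1 (2 * pi) ler01.
  - by apply: continuous_subspaceT => x; exact: is_derive_continuous1 (dT x).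
  - rewrite T0 ge_min le_max; have := @pi_gt0 R => p0.
    by apply/andP; split; apply/orP; [left | right]; lra.
  - by exists c => //; move: ce; rewrite in_itv.
have p0 := @pi_gt0 R.
have t1p : 0 < t1 by rewrite lt_neqAle t10 andbT; apply/negP => /eqP e; move: Te; rewrite -e T0; lra.
have t1n : t1 < 1 by rewrite lt_neqAle t11 andbT; apply/negP => /eqP e; move: Te; rewrite e; lra.
(* the frame coordinates, turned back by the angle, are constant *)
pose A (t : R) := al t * cos (T t) + ep * be t * sin (T t).
pose B (t : R) := be t * cos (T t) - ep * al t * sin (T t).
have dA (t : R) : is_derive t (1:R) A 0.
  have [ha hbe] := hd t; have hT := dT t.
  have hc := @dcomp R _ (fun x : R => cos x) T t 1 _ _ (is_derive_cos (T t)) hT.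
  have hs := @dcomp R _ (fun x : R => sin x) T t 1 _ _ (is_derive_sin (T t)) hT.
  rewrite /A; notypeclasses refine (deq _ _); first by der.
  cbv beta; rewrite -/(om t).
  by rewrite [LHS](_ : _ = al t * om t * sin (T t) * (ep ^+ 2 - 1)); [rewrite ep2 subrr mulr0 | rewrite -/(om t); ring].
have dB (t : R) : is_derive t (1:R) B 0.
  have [ha hbe] := hd t; have hT := dT t.
  have hc := @dcomp R _ (fun x : R => cos x) T t 1 _ _ (is_derive_cos (T t)) hT.
  have hs := @dcomp R _ (fun x : R => sin x) T t 1 _ _ (is_derive_sin (T t)) hT.
  rewrite /B; notypeclasses refine (deq _ _); first by der.
  cbv beta; rewrite -/(om t).
  by rewrite [LHS](_ : _ = be t * om t * sin (T t) * (ep ^+ 2 - 1)); [rewrite ep2 subrr mulr0 | rewrite -/(om t); ring].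
have eA : A t1 = A 0.
  by have [c [_ _ e]] := mvt_seg t1p dA; apply/eqP; rewrite -subr_eq0 e mul0r.
have eB : B t1 = B 0.
  by have [c [_ _ e]] := mvt_seg t1p dB; apply/eqP; rewrite -subr_eq0 e mul0r.
move: eA eB; rewrite /A /B Te T0 cos0 sin0 mulr_natl cos2pi sin2pi !mulr1 !mulr0 !addr0 !subr0 => eA eB.
have eg : gamma t1 = gamma 0.
  by rewrite -(frame_invK a0 (gamma_hplane hb t1)) -(frame_invK a0 (gamma_hplane hb 0)) eA eB.
have [_ _ _ _ [[_ _ _ inj _] _]] := hb.
have : t1 = 0 by apply: inj => //; rewrite in_itv /= ?lexx ?ltr01 ?t10 ?t1n.
by lra.
Qed.

Variable p : R.
Hypothesis p3 : 3 <= p.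
Local Notation L := (total_length gamma).
Local Notation Th := (total_curv gamma nu).

Lemma ball_total_curv : Th = ch s / rho * L.
Proof.
rewrite /total_curv /total_length hlengthE -sintZ; last by move=> t _; exact: (@v_cont _ _ _ _ hb t).
by apply: eq_sint => t _; have [_ _ ->] := ball_frame t.
Qed.

(** By [ball_total_curv], Th^2 - L^2 = (L / sinh s)^2. *)
Lemma wball_wcap t : wball p rho t = (L / rho) `^ (p - 1)^-1 * wcap p L (Th ^+ 2) t.
Proof.
have r0 := rho_gt0; have L0 := length_gt0 hb; have rn : rho != 0 by rewrite gt_eqF.
have Ln : L != 0 by rewrite gt_eqF.
have k0 : 0 < L / rho by rewrite divr_gt0.
have pn : p - 1 != 0 by have := p3 => h3; rewrite subr_eq0 gt_eqF //; lra.
rewrite /wball /wcap ball_total_curv; move: (total_length gamma) L0 Ln k0 => l L0 Ln k0.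
have c2 := ch2 s; set c := ch s in c2 *.
move: (sh s) r0 rn k0 c2 => rh r0 rn k0 c2.
have -> : expR (2 * t) * l ^+ 2 + (c / rh * l) ^+ 2 - l ^+ 2 = (l / rh) ^+ 2 * (1 + (rh * expR t) ^+ 2).
  have -> : expR (2 * t) = expR t ^+ 2 by rewrite mulrC -[2]/(2%:R) expRM_natr.
  by rewrite (_ : (c / rh * l) ^+ 2 = c ^+ 2 * (l / rh) ^+ 2); [rewrite c2; field | field].
have D0 := sqrt1D_gt0 (rh * expR t).
rewrite powRN powR12_sqrt; last by rewrite mulr_ge0 ?sqr_ge0 // addr_ge0 ?sqr_ge0.
rewrite sqrtrM ?sqr_ge0 // sqrtr_sqr gtr0_norm // invfM.
rewrite mulrDr expRD.
have e1 : expR ((p - 2) / (p - 1) * ln rh) = rh `^ ((p - 2) / (p - 1)) by rewrite /powR gt_eqF.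
have e2 : (l / rh) `^ (p - 1)^-1 * l `^ ((p - 2) / (p - 1)) = rh `^ ((p - 2) / (p - 1)) * (l / rh).
  rewrite /powR !gt_eqF // ln_div ?posrE // -expRD -[X in _ = _ * (X / _)](lnK (x := l)) ?posrE //.
  rewrite -[X in _ = _ * (_ / X)](lnK (x := rh)) ?posrE // -expRN -!expRD; congr expR.
  by field.
rewrite e1.
rewrite [RHS](_ : _ = ((l / rh) `^ (p - 1)^-1 * l `^ ((p - 2) / (p - 1))) * (l / rh)^-1
    * expR ((p - 2) / (p - 1) * t) / Num.sqrt (1 + (rh * expR t) ^+ 2)); last first.
  by field; rewrite Ln rn gt_eqF.
by rewrite e2; field; rewrite Ln rn gt_eqF.
Qed.

(** With k = L / sinh s, the bound of [ball_lower] is 2 pi / k times the left-hand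
    side, and k <= 2 pi. *)
Lemma ball_hcap_ge : ((Icap p L (Th ^+ 2) `^ (1 - p))%:E <= hcap p K)%E.
Proof.
have r0 := rho_gt0; have L0 := length_gt0 hb; have Th0 := total_curv_gt0 hb.
have p1 : 1 < p by have := p3; lra.
have [I0 [_ [_ hI]]] := Icap_par p1 L0 Th0.
have WE := wball_wcap; have Lle := ball_length_le.
have cw (t : R) : 0 <= t -> {for t, continuous (wcap p L (Th ^+ 2))}.
  by move=> t0; apply: wcap_cont => //; rewrite exprn_gt0.
move: (Icap p L (Th ^+ 2)) I0 hI => I I0 hI.
move: (wcap p L (Th ^+ 2)) hI WE cw => w hI WE cw.
move: L L0 WE Lle => l L0 WE Lle.
pose k := l / rho; have k0 : 0 < k by rewrite divr_gt0.
have k2 : k <= 2 * pi by rewrite ler_pdivrMr.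
have kb : 0 < k `^ (p - 1)^-1 by rewrite powR_gt0.
have hLa T : 0 <= T -> sint 0 T (wball p rho) <= k `^ (p - 1)^-1 * I.
  move=> T0; have -> : sint 0 T (wball p rho) = sint 0 T (fun t => k `^ (p - 1)^-1 * w t).
    by apply: eq_sint => t _; exact: WE.
  by rewrite sintZ ?ler_pM2l // ?hI // => t /andP[t0 _]; exact: cw.
apply: le_ereal_inf_tmp => _ [f [sf cf f1] <-].
have La0 : 0 < k `^ (p - 1)^-1 * I by rewrite mulr_gt0.
apply: le_trans (ball_lower p1 r0 La0 a0 hLa sf cf _); last first.
  by move=> z z0 hz; apply: f1; rewrite KE hballE.
rewrite lee_fin powRM ?(ltW kb) ?(ltW I0) // -powRrM.
have -> : (p - 1)^-1 * (1 - p) = -1 by field; rewrite subr_eq0 gt_eqF.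
rewrite powR_inv1 ?(ltW k0) // mulrA ler_peMl ?powR_ge0 //.
by rewrite ler_pdivlMr // mul1r.
Qed.

End BallCase.

Theorem theorem2 (R : realType) (p : R) (K : set (R * R))
    (gamma nu : R -> R * R)
    (p_ge3 : 3 <= p)
    (K_hplane : K `<=` hplane)
    (K_compact : compact K)
    (K_convex : hconvex K)
    (K_interior : K° !=set0)
    (K_boundary : boundary_param K gamma)
    (nu_outward : outward_unit_normal K gamma nu) :
  let L := hlength gamma in
  let T := curvature_energy p gamma nu in
  let B :=
    (\int[@lebesgue_measure R]_(t in `[0, +oo[)
       (expR ((p - 2) / (p - 1) * t) * L `^ ((p - 2) / (p - 1))
        * (expR (2 * t) * L ^+ 2 + (L `^ (p - 2) * T) `^ (2 / (p - 1)) - L ^+ 2)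
            `^ (- 2^-1))) `^ (1 - p) in
  (hcap p K <= B%:E)%E /\ (hcap p K = B%:E <-> geodesic_ball K).
Proof.
move=> L T B.
have hb : body K gamma nu by [].
have [le eq] := upper_bound hb p_ge3.
split; first exact: le.
split => [e|[a [r [a0 r0 KE]]]]; first exact: (const_curv_ball hb (eq e)).
apply/eqP; rewrite eq_le; apply/andP; split; first exact: le.
have sc t : sig gamma nu t = total_curv gamma nu / total_length gamma.
  have L0 := length_gt0 hb; have [_ _ ->] := ball_frame hb a0 r0 KE t.
  by rewrite (ball_total_curv hb a0 r0 KE) mulfK // gt_eqF.
have [_ _ hY] := Y_compare hb p_ge3.
have := ball_hcap_ge hb a0 r0 KE p_ge3; rewrite -(hY sc).
exact: id.
Qed.
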